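(* For every $s\geq 1$ there is a constant $c(s)>0$ depending only on $s$ such that the following holds. Let $\mu$ be an isotropic log-concave probability measure on $\mathbb{R}^n$, let $x_1,\ldots,x_N$ be independent random points distributed according to $\mu$, and let $K_N=\mathrm{conv}\{\pm x_1,\ldots,\pm x_N\}$. If $\exp(\sqrt{n})\leq N\leq\exp(n)$, then with probability greater than $1-N^{-s}$, $$Q_k(K_N)\leq c(s)\sqrt{\log N}\,(\log\log N)^2\qquad\text{for all }1\leq k<n.$$
   Context: A log-concave probability measure on $\mathbb{R}^n$ is isotropic if its center of mass is the origin and its covariance matrix is the identity. For a convex body $K$ in $\mathbb{R}^n$ and $1\leq k\leq n$, the normalized quermassintegral is $$Q_k(K)=\left(\frac{1}{\omega_k}\int_{G_{n,k}}|P_F(K)|\,d\nu_{n,k}(F)\right)^{1/k},$$ where $G_{n,k}$ is the Grassmannian of $k$-dimensional subspaces of $\mathbb{R}^n$ with its Haar probability measure $\nu_{n,k}$, $P_F$ is the orthogonal projection onto $F$, $|\cdot|$ is ($k$-dimensional) volume and $\omega_k$ is the volume of the Euclidean unit ball in $\mathbb{R}^k$. *)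

(* Defs.v *)
From HB Require Import structures.
From mathcomp Require Export all_boot all_order all_algebra.
From mathcomp Require Export all_classical all_reals all_analysis.
Export numFieldNormedType.Exports.

Set Implicit Arguments.
Unset Strict Implicit.
Unset Printing Implicit Defensive.

Import Order.TTheory GRing.Theory Num.Theory.

Local Open Scope classical_set_scope.
Local Open Scope ring_scope.

(** Points of R^n are row vectors ['rV[R]_n]; R^n carries the Borel
    sigma-algebra of its usual topology. *)
Notation borel_rV R n := (g_sigma_algebraType (@open 'rV[R]_n)).

Definition dot (R : realType) (n : nat) (u v : 'rV[R]_n) : R :=
  \sum_(i < n) u 0 i * v 0 i.

Definition euclidean_unit_ball (R : realType) (n : nat) : set 'rV[R]_n :=
  [set x | dot x x <= 1].
Arguments euclidean_unit_ball : clear implicits.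

(** Lebesgue outer measure on R^k, defined by countable covers by boxes.  It
    coincides with k-dimensional volume on every Lebesgue measurable set; it is
    only applied to compact sets below. *)
Section lebesgue_volume.
Context (R : realType) (k : nat).

Definition box (a b : 'rV[R]_k) : set 'rV[R]_k :=
  [set x | forall i, a 0 i <= x 0 i <= b 0 i].

Definition box_cover (S : set 'rV[R]_k) (ab : nat -> 'rV[R]_k * 'rV[R]_k) :=
  (forall j i, (ab j).1 0 i <= (ab j).2 0 i) /\
  S `<=` \bigcup_j box (ab j).1 (ab j).2.

Definition volume (S : set 'rV[R]_k) : \bar R :=
  ereal_inf [set (\sum_(0 <= j <oo)
                   (\prod_(i < k) ((ab j).2 0 i - (ab j).1 0 i))%:E)%E
            | ab in box_cover S].

End lebesgue_volume.

Definition omega (R : realType) (k : nat) : \bar R :=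
  volume (euclidean_unit_ball R k).

Section subspaces.
Context (R : realType) (n : nat).
Implicit Types (F : {vspace 'rV[R]_n}) (x : 'rV[R]_n).

Definition orth_proj F x : 'rV[R]_n :=
  xget 0 [set y | y \in F /\ forall z, z \in F -> dot (x - y) z = 0].

(** Since there are [\dim F] of them, orthonormal rows lying in [F] form a
    basis of [F]. *)
Definition orthonormal_basis F : 'M[R]_(\dim F, n) :=
  xget 0 [set B : 'M[R]_(\dim F, n) |
    B *m B^T = 1%:M /\ forall i, row i B \in F].

(** [\dim F]-dimensional volume of [S `&` F], computed in orthonormal
    coordinates of [F] (it does not depend on the basis). *)
Definition subspace_volume F (S : set 'rV[R]_n) : \bar R :=
  volume [set y : 'rV[R]_(\dim F) | S (y *m orthonormal_basis F)].

HB.instance Definition _ := isPointed.Build {vspace 'rV[R]_n} 0%VS.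

(** The topology of the Grassmannians is the one induced by [F |-> P_F]; the
    following sets generate its Borel sigma-algebra. *)
Definition subspace_generators : set (set {vspace 'rV[R]_n}) :=
  [set A | exists x (U : set 'rV[R]_n),
    open U /\ A = [set F | U (orth_proj F x)]].

Definition grassmannian (k : nat) : set {vspace 'rV[R]_n} :=
  [set F | \dim F = k].

Definition rotate (U : 'M[R]_n) F : {vspace 'rV[R]_n} :=
  (linfun (mulmxr U) @: F)%VS.

End subspaces.

(** The Grassmannians [G_{n,k}], 0 <= k <= n, are the measurable subsets
    [grassmannian k] of the space of all linear subspaces of R^n. *)
Notation subspaces R n := (g_sigma_algebraType (@subspace_generators R n)).

(** [nu] is the Haar probability measure of [G_{n,k}]: the unique probability
    measure on [G_{n,k}] that is invariant under the orthogonal group. *)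
Definition haar_grassmannian (R : realType) (n k : nat)
    (nu : probability (subspaces R n) R) : Prop :=
  nu (grassmannian k) = 1%E /\
  forall U : 'M[R]_n, U *m U^T = 1%:M ->
  forall A : set (subspaces R n), measurable A ->
    nu (rotate U @^-1` A) = nu A.

(** Extended-real valued, so that a divergent integral would give [+oo]. *)
Definition quermassintegral (R : realType) (n k : nat)
    (nu : probability (subspaces R n) R) (K : set 'rV[R]_n) : \bar R :=
  (((omega R k)^-1 *
    \int[nu]_(F in grassmannian k) subspace_volume F (orth_proj F @` K))
   `^ (k%:R^-1))%E.

Section measures.
Context (R : realType) (n : nat) (mu : probability (borel_rV R n) R).

(** Compact test sets, so that [l A + (1 - l) B] is compact, hence Borel. *)
Definition log_concave : Prop :=
  forall (A B : set 'rV[R]_n) (l : R), compact A -> compact B -> 0 < l < 1 ->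
  (mu A `^ l * mu B `^ (1 - l) <=
   mu [set (l *: a + (1 - l) *: b)%R | a in A & b in B])%E.

Definition isotropic : Prop :=
  (forall i : 'I_n, ('E_mu[fun x : 'rV[R]_n => x 0%R i] = 0)%E) /\
  (forall i j : 'I_n,
     covariance mu (fun x : 'rV[R]_n => x 0 i) (fun x : 'rV[R]_n => x 0 j)
     = (1%:M i j : R)%:E).

End measures.

Definition independent_RVs (R : realType) d (T : measurableType d)
    (P : probability T R) d' (T' : measurableType d') (I : finType)
    (X : I -> {RV P >-> T'}) : Prop :=
  forall (J : {set I}) (A : I -> set T'), (forall i, measurable (A i)) ->
  P (\bigcap_(i in [set` J]) X i @^-1` A i) =
  (\prod_(i in J) P (X i @^-1` A i))%E.

Definition has_law (R : realType) d (T : measurableType d)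
    (P : probability T R) d' (T' : measurableType d')
    (X : {RV P >-> T'}) (mu : probability T' R) : Prop :=
  forall A, measurable A -> distribution P X A = mu A.

Definition convex_hull (R : realType) (n : nat) (S : set 'rV[R]_n) :
  set 'rV[R]_n := smallest (@convex_set R 'rV[R]_n) S.

Definition symmetric_polytope (R : realType) (n N : nat)
    (x : 'I_N -> 'rV[R]_n) : set 'rV[R]_n :=
  convex_hull [set y | exists i, y = x i \/ y = - x i].

(* Main.v *)
(** The quermassintegrals of a symmetric body are controlled by its mean width
    [l] in a Gaussian direction, up to [1 / sqrt n]: a covering argument bounds
    the volume of a projection by its mean width, and averaging over products of
    a random sign matrix with rotations and signed shifts, together with
    concentration of convex functions on the cube, bounds the [k]-th moment of
    the mean width of a random [k]-dimensional projection. For the random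
    polytope, [l] is the mean over [g] of [max_i |<x_i, g>|], which a union bound
    compares with the mean of the [p]-th marginal norm
    [h_p g = (E |<x, g>|^p)^(1/p)], where [p] is about [log N]. Finally
    [E h_p g <= C sqrt (p n) (log p)^2], because the bodies generated by the
    [p]-th marginals of a log-concave measure are covered by few balls in every
    dimension at most [p], and the K-convexity of the cube (with constant
    [log p]) dualizes this into an upper bound for a Gaussian average. All
    Gaussian vectors are replaced by normalized sums of random signs. *)

Require Import Defs.
From mathcomp Require Import ring lra zify measurable_realfun perm.

Set Implicit Arguments.
Unset Strict Implicit.
Unset Printing Implicit Defensive.

Import Order.TTheory GRing.Theory Num.Theory.
Local Open Scope ring_scope.

(** * Averages over signs *)

(** Each logarithm in [(log p)^2] has its own source. One is the total mass of the coefficients that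
    recover a linear Walsh part; about [log p] nodes are taken so that the remaining error offsets a
    crude bound of order [p] on support vectors. The other is a harmonic sum: in every
    [k]-dimensional subspace there is a unit vector on which the matrix of linear parts has norm of
    order [p / k], and these bounds add up along an orthonormal basis built one vector at a time.
    Such a vector exists because sign sums that expand every direction of the subspace cannot stay
    near [exp(10 k)] centres. Sign sums are not rotation invariant. Three devices make up for this:
    [domination] compares weighted sums with sums of repeated vectors, random lines drawn from
    [nu 1] supply uniform directions, and averages over signed shifts turn a matrix into a scalar. A
    last obstacle is that the event must be measurable, while volume is an outer measure and the
    volume of the projection is never shown measurable in the subspace. Monotonicity and
    semicontinuity of lower integrals settle this. *)

Section Mean.
Variable R : realType.

Definition mean (T : finType) (F : T -> R) : R := #|T|%:R^-1 * \sum_t F t.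

Lemma eq_mean (T : finType) (F G : T -> R) : F =1 G -> mean F = mean G.
Proof. by move=> FG; rewrite /mean (eq_bigr G). Qed.

Lemma mean_cst (T : finType) (c : R) : (0 < #|T|)%N -> mean (fun _ : T => c) = c.
Proof.
move=> T0; rewrite /mean sumr_const -[c *+ _]mulr_natl mulrA mulVf ?mul1r//.
by rewrite pnatr_eq0 -lt0n.
Qed.

Lemma meanD (T : finType) (F G : T -> R) :
  mean (fun t => F t + G t) = mean F + mean G.
Proof. by rewrite /mean big_split/= mulrDr. Qed.

Lemma meanZ (T : finType) (c : R) (F : T -> R) :
  mean (fun t => c * F t) = c * mean F.
Proof. by rewrite /mean -mulr_sumr mulrCA. Qed.

Lemma meanN (T : finType) (F : T -> R) : mean (fun t => - F t) = - mean F.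
Proof. by rewrite /mean sumrN mulrN. Qed.

Lemma mean_sum (T : finType) (I : Type) (r : seq I) (P : pred I) (F : I -> T -> R) :
  mean (fun t => \sum_(i <- r | P i) F i t) = \sum_(i <- r | P i) mean (F i).
Proof. by rewrite /mean exchange_big mulr_sumr. Qed.

Lemma ler_mean (T : finType) (F G : T -> R) :
  (forall t, F t <= G t) -> mean F <= mean G.
Proof.
by move=> FG; rewrite /mean ler_wpM2l ?invr_ge0// ler_sum.
Qed.

Lemma mean_ge0 (T : finType) (F : T -> R) : (forall t, 0 <= F t) -> 0 <= mean F.
Proof. by move=> F0; rewrite /mean mulr_ge0 ?invr_ge0// sumr_ge0. Qed.

Lemma mean_exchange (T U : finType) (F : T -> U -> R) :
  mean (fun t => mean (F t)) = mean (fun u => mean (fun t => F t u)).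
Proof.
rewrite /mean -!mulr_sumr exchange_big/= !mulrA; congr (_ * _).
by rewrite mulrC.
Qed.

Lemma mean_reindex (T U : finType) (f : U -> T) (F : T -> R) :
  bijective f -> mean F = mean (fun u => F (f u)).
Proof.
move=> bf; rewrite /mean (bij_eq_card bf); congr (_ * _).
by rewrite (reindex f)//; exact: onW_bij.
Qed.

Lemma mean_pair (T U : finType) (F : T * U -> R) :
  mean F = mean (fun t => mean (fun u => F (t, u))).
Proof.
rewrite /mean card_prod natrM invfM -mulr_sumr mulrA; congr (_ * _).
by rewrite pair_bigA/=; apply: eq_bigr => -[].
Qed.

Lemma exists_ge_mean (T : finType) (F : T -> R) : (0 < #|T|)%N ->
  exists t, mean F <= F t.
Proof.
move=> T0; apply: contrapT => /forallNP H.
suff : mean F < mean (fun _ : T => mean F) by rewrite mean_cst// ltxx.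
have H' t : F t < mean F by rewrite ltNge; apply/negP.
rewrite [X in X < _]/mean [X in _ < X]/mean ltr_pM2l ?invr_gt0 ?ltr0n//.
move/card_gt0P: (T0) => [t0 _].
rewrite (bigD1 t0)//= [ltRHS](bigD1 t0)//=.
by rewrite ltr_leD// ler_sum// => i _; exact: ltW.
Qed.

(* Jensen for [expR], through the tangent line at the mean. *)
Lemma expR_mean_le (T : finType) (F : T -> R) : (0 < #|T|)%N ->
  expR (mean F) <= mean (fun t => expR (F t)).
Proof.
move=> T0; set m := mean F.
have -> : expR m = mean (fun t => expR m * (1 + (F t - m))).
  rewrite meanZ meanD meanD mean_cst// mean_cst// -/m; ring.
apply: ler_mean => t.
have -> : expR (F t) = expR m * expR (F t - m) by rewrite -expRD addrC subrK.
by rewrite ler_wpM2l ?expR_ge0// expR_ge1Dx.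
Qed.

End Mean.

Notation signs I := {ffun I -> bool}.

Section Signs.
Variable R : realType.
Local Notation mean := (@mean R).

Definition sgb (b : bool) : R := (-1) ^+ b.

Lemma sgb_sqr b : sgb b * sgb b = 1.
Proof. by rewrite /sgb -signr_addb addbb. Qed.

Lemma norm_sgb b : `|sgb b| = 1.
Proof. by rewrite /sgb normr_sign. Qed.

Lemma sgb_addb a b : sgb (a (+) b) = sgb a * sgb b.
Proof. by rewrite /sgb signr_addb. Qed.

Lemma card_signs_gt0 (I : finType) : (0 < #|{: signs I}|)%N.
Proof. by rewrite card_ffun card_bool expn_gt0. Qed.

Definition flip (I : finType) (e f : signs I) : signs I := [ffun i => e i (+) f i].

Lemma flip_bij (I : finType) (e : signs I) : bijective (flip e).
Proof.
by exists (flip e) => f; apply/ffunP => i; rewrite !ffunE addKb.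
Qed.

Lemma mean_flip (I : finType) (e : signs I) (F : signs I -> R) :
  mean (fun f => F (flip e f)) = mean F.
Proof. by rewrite [RHS](mean_reindex _ (flip_bij e)). Qed.

Lemma mean_prod (I : finType) (phi : I -> bool -> R) :
  mean (fun e : signs I => \prod_i phi i (e i)) =
  \prod_i ((phi i true + phi i false) / 2).
Proof.
rewrite /mean card_ffun card_bool.
have E i : true -> phi i true + phi i false = \sum_(b : bool) phi i b.
  by rewrite big_bool.
rewrite big_split/= (eq_bigr _ E) bigA_distr_bigA/= prodr_const mulrC.
by rewrite natrX exprVn.
Qed.

Definition walsh (I : finType) (S : {set I}) (e : signs I) : R :=
  \prod_(i in S) sgb (e i).

Lemma walsh1 (I : finType) (i : I) e : walsh [set i] e = sgb (e i).
Proof. by rewrite /walsh big_set1. Qed.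

Lemma walshE (I : finType) (S : {set I}) e :
  walsh S e = \prod_i (if i \in S then sgb (e i) else 1).
Proof. by rewrite /walsh big_mkcond. Qed.

Lemma walsh_flip (I : finType) (S : {set I}) e f :
  walsh S (flip e f) = walsh S e * walsh S f.
Proof.
by rewrite /walsh -big_split/=; apply: eq_bigr => i _; rewrite ffunE sgb_addb.
Qed.

Lemma walsh_orth (I : finType) (S T : {set I}) :
  mean (fun e => walsh S e * walsh T e) = (S == T)%:R.
Proof.
under eq_mean do rewrite !walshE -big_split/=.
rewrite (mean_prod (fun i b => (if i \in S then sgb b else 1) *
                               (if i \in T then sgb b else 1))).
have [->|ST] := eqVneq S T.
  apply: big1 => i _; rewrite /sgb; case: ifP => _; rewrite /= ?expr0 ?expr1; lra.
have [i iST] : exists i, (i \in S) != (i \in T).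
  apply: contrapT => /forallNP H; move/eqP: ST; apply; apply/setP => i.
  by apply/eqP/negPn/negP; exact: H.
rewrite (bigD1 i)//= /sgb !expr0 !expr1.
by move: iST; case: (i \in S); case: (i \in T) => //= _;
  rewrite (_ : (_ + _) / 2 = 0) ?mul0r//; lra.
Qed.

Lemma mean_sgb2 (I : finType) (i j : I) :
  mean (fun e : signs I => sgb (e i) * sgb (e j)) = (i == j)%:R.
Proof.
under eq_mean do rewrite -!walsh1.
by rewrite walsh_orth (inj_eq set1_inj).
Qed.

Lemma mean_sgb (I : finType) (i : I) : mean (fun e : signs I => sgb (e i)) = 0.
Proof.
have := walsh_orth [set i] finset.set0.
rewrite (negbTE (_ : [set i] != finset.set0)); last first.
  by apply/finset.set0Pn; exists i; rewrite inE.
by under eq_mean do rewrite walsh1 /walsh big_set0 mulr1.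
Qed.

(** The law of independent signs with means [r i], a probability weight when every [|r i| <= 1]. Its
    expansion [wtE] as a Riesz product is what makes such averages diagonal on Walsh functions. *)
Definition wt (I : finType) (r : I -> R) (e : signs I) : R :=
  \prod_i ((1 + r i * sgb (e i)) / 2).

Lemma wt_ge0 (I : finType) (r : I -> R) e : (forall i, `|r i| <= 1) -> 0 <= wt r e.
Proof.
move=> r1; apply: prodr_ge0 => i _; rewrite divr_ge0//.
have : `|r i * sgb (e i)| <= 1 by rewrite normrM norm_sgb mulr1.
by rewrite ler_norml; lra.
Qed.

Lemma wtE (I : finType) (r : I -> R) e :
  wt r e = #|{: signs I}|%:R^-1 * \sum_(S : {set I}) (\prod_(i in S) r i) * walsh S e.
Proof.
rewrite /wt big_split/= card_ffun card_bool prodr_const natrX exprVn mulrC.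
congr (_ * _).
under eq_bigr => i _ do rewrite addrC.
rewrite (_ : \prod_i _ = \prod_i \sum_(b : bool)
  (if b then r i * sgb (e i) else 1)); last first.
  by apply: eq_bigr => i _; rewrite big_bool.
rewrite bigA_distr_bigA/= (reindex (fun S : {set I} => [ffun i => i \in S]))/=.
  apply: eq_bigr => S _; rewrite /walsh -big_split/= [RHS]big_mkcond/=.
  by apply: eq_bigr => i _; rewrite ffunE.
exists (fun f : {ffun I -> bool} => [set i | f i]) => [S _|f _].
  by apply/setP => i; rewrite inE ffunE.
by apply/ffunP => i; rewrite ffunE inE.
Qed.

Lemma sum_wt_walsh (I : finType) (r : I -> R) (S : {set I}) :
  \sum_(e : signs I) wt r e * walsh S e = \prod_(i in S) r i.
Proof.
under [LHS]eq_bigr => e _ do rewrite wtE -mulrA mulr_suml.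
rewrite -mulr_sumr exchange_big/= mulr_sumr (bigD1 S)//= [X in _ + X]big1 ?addr0.
  transitivity (mean (fun e => (\prod_(i in S) r i) * (walsh S e * walsh S e))).
    rewrite /mean; congr (_ * _); apply: eq_bigr => e _; ring.
  by rewrite meanZ walsh_orth eqxx mulr1.
move=> T TS.
transitivity (mean (fun e => (\prod_(i in T) r i) * (walsh S e * walsh T e))).
  rewrite /mean; congr (_ * _); apply: eq_bigr => e _; ring.
by rewrite meanZ walsh_orth eq_sym (negbTE TS) mulr0.
Qed.

Lemma sum_wt (I : finType) (r : I -> R) : \sum_(e : signs I) wt r e = 1.
Proof.
have := sum_wt_walsh r finset.set0; rewrite big_set0 => <-.
by apply: eq_bigr => e _; rewrite /walsh big_set0 mulr1.
Qed.

Lemma sum_wt_sgb (I : finType) (r : I -> R) i :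
  \sum_(e : signs I) wt r e * sgb (e i) = r i.
Proof.
have := sum_wt_walsh r [set i]; rewrite big_set1 => <-.
by apply: eq_bigr => e _; rewrite walsh1.
Qed.

End Signs.

(** * Euclidean norms and sign sums of seminorms *)

Section Dot.
Variable R : realType.
Implicit Types n m : nat.

Lemma dotE n (u v : 'rV[R]_n) : dot u v = (u *m v^T) 0 0.
Proof. by rewrite mxE; apply: eq_bigr => i _; rewrite mxE. Qed.

Lemma dotC n (u v : 'rV[R]_n) : dot u v = dot v u.
Proof. by apply: eq_bigr => i _; rewrite mulrC. Qed.

Lemma dotDl n (u v w : 'rV[R]_n) : dot (u + v) w = dot u w + dot v w.
Proof. by rewrite !dotE mulmxDl mxE. Qed.

Lemma dotNl n (u w : 'rV[R]_n) : dot (- u) w = - dot u w.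
Proof. by rewrite !dotE mulNmx mxE. Qed.

Lemma dotZl n a (u w : 'rV[R]_n) : dot (a *: u) w = a * dot u w.
Proof. by rewrite !dotE -scalemxAl mxE. Qed.

Lemma dotDr n (u v w : 'rV[R]_n) : dot w (u + v) = dot w u + dot w v.
Proof. by rewrite dotC dotDl !(dotC w). Qed.

Lemma dotNr n (u w : 'rV[R]_n) : dot w (- u) = - dot w u.
Proof. by rewrite dotC dotNl (dotC w). Qed.

Lemma dotZr n a (u w : 'rV[R]_n) : dot w (a *: u) = a * dot w u.
Proof. by rewrite dotC dotZl (dotC w). Qed.

Lemma dotBl n (u v w : 'rV[R]_n) : dot (u - v) w = dot u w - dot v w.
Proof. by rewrite dotDl dotNl. Qed.

Lemma dotBr n (u v w : 'rV[R]_n) : dot w (u - v) = dot w u - dot w v.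
Proof. by rewrite dotDr dotNr. Qed.

Lemma dot0l n (w : 'rV[R]_n) : dot 0 w = 0.
Proof. by rewrite dotE mul0mx mxE. Qed.

Lemma dot0r n (w : 'rV[R]_n) : dot w 0 = 0.
Proof. by rewrite dotC dot0l. Qed.

Lemma dot_suml n (I : Type) (r : seq I) (P : pred I) (F : I -> 'rV[R]_n) w :
  dot (\sum_(i <- r | P i) F i) w = \sum_(i <- r | P i) dot (F i) w.
Proof. by rewrite dotE mulmx_suml summxE; apply: eq_bigr => i _; rewrite dotE. Qed.

Lemma dot_sumr n (I : Type) (r : seq I) (P : pred I) (F : I -> 'rV[R]_n) w :
  dot w (\sum_(i <- r | P i) F i) = \sum_(i <- r | P i) dot w (F i).
Proof. by rewrite dotC dot_suml; apply: eq_bigr => i _; rewrite dotC. Qed.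

Lemma dot_ge0 n (u : 'rV[R]_n) : 0 <= dot u u.
Proof. by apply: sumr_ge0 => i _; rewrite -expr2 sqr_ge0. Qed.

Lemma dot_eq0 n (u : 'rV[R]_n) : (dot u u == 0) = (u == 0).
Proof.
apply/eqP/eqP => [u0|->]; last by rewrite dot0l.
apply/rowP => i; rewrite mxE; apply/eqP; rewrite -sqrf_eq0 expr2; apply/eqP.
by apply: (psumr_eq0P _ u0) => // j _; rewrite -expr2 sqr_ge0.
Qed.

Lemma dot_mulmx n m (u : 'rV[R]_n) (A : 'M[R]_(n, m)) v :
  dot (u *m A) v = dot u (v *m A^T).
Proof. by rewrite !dotE trmx_mul trmxK mulmxA. Qed.

Lemma dot_CS n (u v : 'rV[R]_n) : dot u v ^+ 2 <= dot u u * dot v v.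
Proof.
have [->|v0] := eqVneq v 0.
  by rewrite !dot0r expr0n/= mulr0.
have vv : 0 < dot v v by rewrite lt_def dot_eq0 v0 dot_ge0.
have := dot_ge0 (u - (dot u v / dot v v) *: v).
have -> : dot (u - (dot u v / dot v v) *: v) (u - (dot u v / dot v v) *: v) =
   (dot u u * dot v v - dot u v ^+ 2) / dot v v.
  by rewrite !(dotBl, dotBr, dotZl, dotZr) (dotC v u); field; rewrite gt_eqF.
by rewrite pmulr_lge0 ?invr_gt0// subr_ge0.
Qed.

Definition nrm n (u : 'rV[R]_n) : R := Num.sqrt (dot u u).

Lemma nrm_ge0 n (u : 'rV[R]_n) : 0 <= nrm u.
Proof. exact: sqrtr_ge0. Qed.

Lemma nrm2 n (u : 'rV[R]_n) : nrm u ^+ 2 = dot u u.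
Proof. by rewrite sqr_sqrtr// dot_ge0. Qed.

Lemma dot_le_nrm n (u v : 'rV[R]_n) : `|dot u v| <= nrm u * nrm v.
Proof.
rewrite -[leRHS]ger0_norm ?mulr_ge0 ?nrm_ge0//.
by rewrite -ler_sqr ?nnegrE// !real_normK ?num_real// exprMn !nrm2 dot_CS.
Qed.

Lemma nrmD n (u v : 'rV[R]_n) : nrm (u + v) <= nrm u + nrm v.
Proof.
rewrite -ler_sqr ?nnegrE ?addr_ge0 ?nrm_ge0// nrm2 sqrrD !nrm2.
rewrite !(dotDl, dotDr) (dotC v u) -mulr_natl.
have := ler_norm (dot u v); have := dot_le_nrm u v; lra.
Qed.

Lemma nrmZ n a (u : 'rV[R]_n) : nrm (a *: u) = `|a| * nrm u.
Proof. by rewrite /nrm dotZl dotZr mulrA -expr2 sqrtrM ?sqr_ge0// sqrtr_sqr. Qed.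

Lemma nrmN n (u : 'rV[R]_n) : nrm (- u) = nrm u.
Proof. by rewrite -scaleN1r nrmZ normrN normr1 mul1r. Qed.

Lemma nrm0 n : nrm (0 : 'rV[R]_n) = 0.
Proof. by rewrite /nrm dot0l sqrtr0. Qed.

Lemma nrm_eq0 n (u : 'rV[R]_n) : (nrm u == 0) = (u == 0).
Proof. by rewrite -sqrf_eq0 nrm2 dot_eq0. Qed.

Lemma coord_le_nrm n (u : 'rV[R]_n) i : `|u 0 i| <= nrm u.
Proof.
rewrite -ler_sqr ?nnegrE ?nrm_ge0// real_normK ?num_real// nrm2 /dot (bigD1 i)//=.
by rewrite -expr2 lerDl sumr_ge0// => j _; rewrite -expr2 sqr_ge0.
Qed.

End Dot.

Section Seminorm.
Variables (R : realType) (V : lmodType R).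

Definition seminorm (h : V -> R) : Prop :=
  (forall u v, h (u + v) <= h u + h v) /\
  (forall a u, h (a *: u) = `|a| * h u).

Variables (h : V -> R) (hS : seminorm h).

Lemma seminorm0 : h 0 = 0.
Proof. by rewrite -[X in h X](scale0r 0) hS.2 normr0 mul0r. Qed.

Lemma seminormN u : h (- u) = h u.
Proof. by rewrite -scaleN1r hS.2 normrN normr1 mul1r. Qed.

Lemma seminorm_ge0 u : 0 <= h u.
Proof.
by have := hS.1 u (- u); rewrite subrr seminorm0 seminormN; lra.
Qed.

Lemma seminorm_sum (I : Type) (r : seq I) (P : pred I) (F : I -> V) :
  h (\sum_(i <- r | P i) F i) <= \sum_(i <- r | P i) h (F i).
Proof.
elim/big_rec2 : _ => [|i x y _ xy]; first by rewrite seminorm0.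
by apply: (le_trans (hS.1 _ _)); rewrite lerD2l.
Qed.

Lemma seminorm_mean (T : finType) (F : T -> V) :
  h (#|T|%:R^-1 *: \sum_t F t) <= mean (fun t => h (F t)).
Proof.
by rewrite hS.2 ger0_norm ?invr_ge0// /mean ler_wpM2l ?invr_ge0// seminorm_sum.
Qed.

(** Contraction principle. Writing [a = r b] with [|r| <= 1], the number [r i] is the mean of a
    random sign under [wt r]; convexity moves this average out of [h], and flipping [e] by the
    random signs leaves the mean over [e] unchanged. *)
Lemma seminorm_contraction (I : finType) (a b : I -> R) (v : I -> V) :
  (forall i, `|a i| <= b i) ->
  mean (fun e : signs I => h (\sum_i (sgb R (e i) * a i) *: v i)) <=
  mean (fun e : signs I => h (\sum_i (sgb R (e i) * b i) *: v i)).
Proof.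
(* If [b i = 0] then [a i = 0] as well, so the convention [x / 0 = 0] still yields
   [a i = r i * b i]. *)
move=> ab; pose r i := a i / b i.
have rE i : a i = r i * b i.
  have [b0|b0] := eqVneq (b i) 0; last by rewrite /r divfK.
  by move: (ab i); rewrite b0 mulr0 normr_le0 => /eqP.
have r1 i : `|r i| <= 1.
  have [b0|b0] := eqVneq (b i) 0; first by rewrite /r b0 invr0 mulr0 normr0.
  have bi : 0 < b i by rewrite lt_def b0 (le_trans _ (ab i)).
  by rewrite /r normrM normfV (gtr0_norm bi) ler_pdivrMr ?mul1r.
apply: (@le_trans _ _ (mean (fun e : signs I => \sum_(f : signs I) wt r f *
    h (\sum_i (sgb R (flip f e i) * b i) *: v i)))).
  apply: ler_mean => e.
  have -> : \sum_i (sgb R (e i) * a i) *: v i =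
     \sum_(f : signs I) wt r f *: (\sum_i (sgb R (flip f e i) * b i) *: v i).
    under [RHS]eq_bigr => f _ do rewrite scaler_sumr.
    rewrite exchange_big/=; apply: eq_bigr => i _.
    rewrite rE -(sum_wt_sgb r i) mulr_suml mulr_sumr scaler_suml.
    apply: eq_bigr => f _; rewrite scalerA; congr (_ *: _).
    by rewrite ffunE sgb_addb; ring.
  apply: (le_trans (seminorm_sum _ _ _)); apply: ler_sum => f _.
  by rewrite hS.2 ger0_norm// wt_ge0.
rewrite mean_sum.
under eq_bigr => f _ do
  rewrite meanZ (mean_flip f (fun e => h (\sum_i (sgb R (e i) * b i) *: v i))).
by rewrite -mulr_suml sum_wt mul1r.
Qed.

End Seminorm.

Section Khinchine.
Variable R : realType.
Local Notation mean := (@mean R).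
Local Notation sgb := (@sgb R).

Lemma sum_delta (J : finType) (P : pred J) (i : J) (F : J -> R) : P i ->
  \sum_(j | P j) (i == j)%:R * F j = F i.
Proof.
move=> Pi; rewrite (bigD1 i)//= eqxx mul1r big1 ?addr0// => j /andP[_ ji].
by rewrite eq_sym (negbTE ji) mul0r.
Qed.

(** Only products whose indices pair off survive. The right side counts the three pairings, several
    times when all four indices agree, and sums easily to [3 m^2]. *)
Lemma mean_sgb4_le (J : finType) (i j k l : J) :
  mean (fun e : signs J => sgb (e i) * sgb (e j) * (sgb (e k) * sgb (e l))) <=
  (i == j)%:R * (k == l)%:R + (i == k)%:R * (j == l)%:R + (i == l)%:R * (j == k)%:R.
Proof.
have ge0 (a b c d : bool) : 0 <= a%:R * b%:R + c%:R * d%:R :> R.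
  by rewrite addr_ge0// mulr_ge0.
have [<-|ij] := eqVneq i j.
  under eq_mean do rewrite sgb_sqr mul1r.
  by rewrite mean_sgb2 mul1r -addrA lerDl.
have [<-|kl] := eqVneq k l.
  under eq_mean do rewrite sgb_sqr mulr1.
  by rewrite mean_sgb2 (negbTE ij) mul0r add0r.
have W a b : a != b -> forall e : signs J, sgb (e a) * sgb (e b) = walsh R (a |: [set b]) e.
  by move=> ab e; rewrite /walsh big_setU1 ?inE//= big_set1.
under eq_mean do rewrite (W _ _ ij) (W _ _ kl).
rewrite walsh_orth mul0r add0r.
case: eqP => [E|_]; last exact: ge0.
have : i \in k |: [set l] by rewrite -E !inE eqxx.
rewrite !inE => /orP[/eqP ik|/eqP il].
  have : j \in k |: [set l] by rewrite -E !inE eqxx orbT.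
  rewrite !inE -ik eq_sym (negbTE ij)/= => /eqP ->.
  by rewrite !eqxx !mulr1 lerDl mulr_ge0.
have : j \in k |: [set l] by rewrite -E !inE eqxx orbT.
rewrite !inE -il orbC eq_sym (negbTE ij)/= => /eqP ->.
by rewrite !eqxx !mulr1 lerDr mulr_ge0.
Qed.

(** The second moment [m] is played against a fourth moment of at most [3 m^2], through a pointwise
    lower bound of [|S|] by [S^2] and [S^4]. The constant is [3/4 - 1/4]. *)
Lemma khinchine (J : finType) (P : pred J) :
  Num.sqrt (#|P|%:R) / 2 <= mean (fun w : signs J => `|\sum_(b | P b) sgb (w b)|).
Proof.
set m : R := #|P|%:R; set s := Num.sqrt m.
have [m0|m0] := eqVneq m 0.
  by rewrite /s m0 sqrtr0 mul0r mean_ge0.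
have m_gt0 : 0 < m by rewrite lt_def m0 /m ler0n.
have s_gt0 : 0 < s by rewrite sqrtr_gt0.
have s2 : s ^+ 2 = m by rewrite sqr_sqrtr// ltW.
pose S (w : signs J) := \sum_(b | P b) sgb (w b).
have S2 : mean (fun w : signs J => S w ^+ 2) = m.
  have -> : mean (fun w : signs J => S w ^+ 2) =
      \sum_(i | P i) \sum_(j | P j) mean (fun w : signs J => sgb (w i) * sgb (w j)).
    under [RHS]eq_bigr do rewrite -mean_sum.
    rewrite -mean_sum; apply: eq_mean => w; rewrite /S expr2 mulr_suml.
    by apply: eq_bigr => i _; rewrite mulr_sumr.
  transitivity (\sum_(i | P i) (1 : R)); last by rewrite sumr_const.
  apply: eq_bigr => i Pi; transitivity (\sum_(j | P j) (i == j)%:R * 1 : R).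
    by apply: eq_bigr => j _; rewrite mean_sgb2 mulr1.
  by rewrite (sum_delta (fun=> 1)).
have S4 : mean (fun w : signs J => S w ^+ 4) <= 3 * m ^+ 2.
  have -> : mean (fun w : signs J => S w ^+ 4) =
      \sum_(i | P i) \sum_(j | P j) \sum_(k | P k) \sum_(l | P l)
         mean (fun w : signs J => sgb (w i) * sgb (w j) * (sgb (w k) * sgb (w l))).
    under [RHS]eq_bigr do under eq_bigr do under eq_bigr do rewrite -mean_sum.
    under [RHS]eq_bigr do under eq_bigr do rewrite -mean_sum.
    under [RHS]eq_bigr do rewrite -mean_sum.
    rewrite -mean_sum; apply: eq_mean => w.
    rewrite (_ : S w ^+ 4 = (S w * S w) * (S w * S w)); last by ring.
    rewrite -mulrA {1}/S mulr_suml; apply: eq_bigr => i _.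
    rewrite {1}/S mulr_suml mulr_sumr; apply: eq_bigr => j _.
    rewrite {1}/S mulr_suml !mulr_sumr; apply: eq_bigr => k _.
    rewrite /S !mulr_sumr; apply: eq_bigr => l _; ring.
  apply: (@le_trans _ _ (\sum_(i | P i) \sum_(j | P j) \sum_(k | P k) \sum_(l | P l)
    ((i == j)%:R * (k == l)%:R + (i == k)%:R * (j == l)%:R +
     (i == l)%:R * (j == k)%:R))).
    by do 4 (apply: ler_sum => ? _); exact: mean_sgb4_le.
  have D1 i (a : R) : P i -> \sum_(j | P j) (i == j)%:R * a = a.
    by move=> Pi; rewrite (sum_delta (fun=> a) Pi).
  have cst (a : R) : \sum_(i | P i) a = m * a by rewrite sumr_const /m mulr_natl.
  have in2 i j : P i -> P j -> \sum_(k | P k) \sum_(l | P l)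
      ((i == j)%:R * (k == l)%:R + (i == k)%:R * (j == l)%:R +
       (i == l)%:R * (j == k)%:R) = (i == j)%:R * m + 2 :> R.
    move=> Pi Pj.
    have E k : P k -> \sum_(l | P l)
      ((i == j)%:R * (k == l)%:R + (i == k)%:R * (j == l)%:R +
       (i == l)%:R * (j == k)%:R) = (i == j)%:R + (i == k)%:R * 1 + (j == k)%:R * 1 :> R.
      move=> Pk; rewrite !big_split/=; congr (_ + _ + _).
        by under eq_bigr do rewrite mulrC; rewrite D1.
        by under eq_bigr do rewrite mulrC; rewrite D1// mulr1.
      by rewrite D1// mulr1.
    by rewrite (eq_bigr _ E) !big_split/= cst D1// D1//; lra.
  rewrite (eq_bigr (fun=> m + m * 2)); last first.
    move=> i Pi; rewrite (eq_bigr _ (fun j Pj => in2 i j Pi Pj)) big_split/=.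
    by rewrite D1// cst.
  by rewrite cst expr2; lra.
(* In the variable [t = |S| / sqrt m] the claim is [3/4 t^2 - t^4 / 12 <= t]. The cubic
   [t^3 - 9 t + 12] is smallest at [sqrt 3], close to [7/4], so a square vanishing at [7/4]
   certifies its positivity. *)
have pt (w : signs J) : 3 / 4 * S w ^+ 2 / s - S w ^+ 4 / (12 * m * s) <= `|S w|.
  set x := `|S w|; have x0 : 0 <= x by exact: normr_ge0.
  have -> : S w ^+ 2 = x ^+ 2 by rewrite real_normK ?num_real.
  have -> : S w ^+ 4 = x ^+ 4.
    by rewrite -[4%N]/(2 * 2)%N !exprM real_normK ?num_real.
  have [t t0 ->] : exists2 t, 0 <= t & x = t * s.
    by exists (x / s); rewrite ?divr_ge0 ?(ltW s_gt0)// divfK// gt_eqF.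
  rewrite -s2.
  have -> : 3 / 4 * (t * s) ^+ 2 / s - (t * s) ^+ 4 / (12 * s ^+ 2 * s) =
     (3 / 4 * t ^+ 2 - t ^+ 4 / 12) * s by field; rewrite gt_eqF.
  rewrite ler_pM2r//.
  have : 0 <= (t - 7 / 4) ^+ 2 * (t + 7 / 2) * t.
    by rewrite mulr_ge0// mulr_ge0 ?sqr_ge0//; lra.
  have t2 : 0 <= t ^+ 2 by exact: sqr_ge0.
  nra.
apply: (le_trans _ (ler_mean pt)).
rewrite meanD meanN.
have -> : mean (fun w : signs J => 3 / 4 * S w ^+ 2 / s) = 3 / 4 / s * m.
  by rewrite -S2 -meanZ; apply: eq_mean => w; ring.
have -> : mean (fun w : signs J => S w ^+ 4 / (12 * m * s)) = (12 * m * s)^-1 * mean (fun w : signs J => S w ^+ 4).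
  by rewrite -meanZ; apply: eq_mean => w; ring.
apply: (@le_trans _ _ (3 / 4 / s * m - (12 * m * s)^-1 * (3 * m ^+ 2))).
  rewrite -s2; have s0 : s != 0 by rewrite gt_eqF.
  by rewrite le_eqVlt; apply/orP; left; apply/eqP; field.
by rewrite lerD2l lerN2 ler_wpM2l// invr_ge0 !mulr_ge0// ltW.
Qed.

(** By Khinchine [|c i|] is at most twice the mean of [|S i|], where [S i] sums the signs of the
    copies of [i]. Contraction and convexity bring in [|S i|] itself, and a random sign times
    [|S i|] has the law of [S i]. The lemma trades unequal weights for repetitions of the same
    vector. *)
Lemma domination (V : lmodType R) (h : V -> R) (hS : seminorm h)
    (I J : finType) (o : J -> I) (c : I -> R) (v : I -> V) :
  (forall i, `|c i| <= Num.sqrt #|[pred b | o b == i]|%:R) ->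
  mean (fun e : signs I => h (\sum_i (sgb (e i) * c i) *: v i)) <=
  2 * mean (fun w : signs J => h (\sum_b sgb (w b) *: v (o b))).
Proof.
move=> cS; pose S i (w : signs J) := \sum_(b | o b == i) sgb (w b).
pose A i := mean (fun w : signs J => `|S i w|).
have cA i : `|c i| <= 2 * A i.
  apply: (le_trans (cS i)); have := khinchine [pred b | o b == i].
  by rewrite -/(A i); lra.
apply: (le_trans (seminorm_contraction hS _ cA)).
apply: (@le_trans _ _ (2 * mean (fun e : signs I => mean (fun w : signs J =>
    h (\sum_i (sgb (e i) * `|S i w|) *: v i))))).
  rewrite -meanZ; apply: ler_mean => e.
  rewrite (_ : \sum_i _ = 2 *: (#|{: signs J}|%:R^-1 *: \sum_w
      \sum_i (sgb (e i) * `|S i w|) *: v i)).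
    by rewrite hS.2 normr_nat ler_wpM2l// seminorm_mean.
  rewrite exchange_big/= !scaler_sumr; apply: eq_bigr => i _.
  rewrite -scaler_suml !scalerA; congr (_ *: _).
  by rewrite /A /mean -mulr_sumr; ring.
rewrite ler_wpM2l// mean_exchange le_eqVlt; apply/orP; left; apply/eqP.
transitivity (mean (fun w : signs J => mean (fun e : signs I =>
    h (\sum_i (sgb (e i) * S i w) *: v i)))).
  (* Flipping [e] by the signs of the [S i w] turns [|S i w|] into [S i w] at no cost. *)
  apply: eq_mean => w; pose s : signs I := [ffun i => S i w < 0].
  rewrite -(mean_flip s); apply: eq_mean => e; congr h; apply: eq_bigr => i _.
  rewrite ffunE sgb_addb; congr (_ *: _).
  rewrite ffunE /sgb [in RHS](numEsign (S i w)); ring.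
rewrite mean_exchange -[RHS](mean_cst _ (card_signs_gt0 I)); apply: eq_mean => e.
rewrite -(mean_flip [ffun b => e (o b)]); apply: eq_mean => w; congr h.
rewrite (partition_big o xpredT)//=; apply: eq_bigr => i _.
rewrite mulr_sumr scaler_suml; apply: eq_bigr => b /eqP <-.
by rewrite !ffunE sgb_addb mulrA sgb_sqr mul1r.
Qed.

End Khinchine.

(** * Linear parts of functions on the discrete cube *)

Section KConvexity.
Variables (R : realType) (I : finType) (d : nat).
Local Notation mean := (@mean R).
Local Notation sgb := (@sgb R).
Local Notation walsh := (@walsh R I).
Implicit Types (f : signs I -> 'rV[R]_d) (e : signs I).

Definition wcoef f (S : {set I}) : 'rV[R]_d :=
  #|{: signs I}|%:R^-1 *: \sum_g walsh S g *: f g.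

(** The noise operator: an average of translates of [f] when [|r| <= 1], and multiplication by
    [r ^+ #|S|] on the Walsh coefficient at [S] ([noiseE]). *)
Definition noise (r : R) f e : 'rV[R]_d :=
  \sum_(g : signs I) wt (fun=> r) g *: f (flip e g).

Lemma noiseE r f e :
  noise r f e = \sum_(S : {set I}) (r ^+ #|S| * walsh S e) *: wcoef f S.
Proof.
rewrite /noise (reindex (flip e))/=; last exact/onW_bij/flip_bij.
transitivity (\sum_g \sum_(S : {set I}) (#|{: signs I}|%:R^-1 * (r ^+ #|S| * walsh S e) *
    walsh S g) *: f g).
  apply: eq_bigr => g _; rewrite -scaler_suml.
  have -> : flip e (flip e g) = g by apply/ffunP => i; rewrite !ffunE addKb.
  congr (_ *: _); rewrite wtE mulr_sumr; apply: eq_bigr => S _.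
  by rewrite walsh_flip prodr_const; ring.
rewrite exchange_big/=; apply: eq_bigr => S _.
rewrite /wcoef scalerA scaler_sumr; apply: eq_bigr => g _.
by rewrite scalerA; congr (_ *: _); ring.
Qed.

Lemma parseval (a : {set I} -> R) (c : {set I} -> 'rV[R]_d) :
  mean (fun e => dot (\sum_(S : {set I}) (a S * walsh S e) *: c S)
                     (\sum_(S : {set I}) (a S * walsh S e) *: c S)) =
  \sum_(S : {set I}) a S ^+ 2 * dot (c S) (c S).
Proof.
transitivity (\sum_(S : {set I}) \sum_(T : {set I}) mean (fun e =>
    (a S * a T * dot (c S) (c T)) * (walsh S e * walsh T e))).
  under [RHS]eq_bigr do rewrite -mean_sum.
  rewrite -mean_sum; apply: eq_mean => e; rewrite dot_suml.
  apply: eq_bigr => S _; rewrite dot_sumr; apply: eq_bigr => T _.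
  by rewrite dotZl dotZr; set x := dot _ _; ring.
apply: eq_bigr => S _; rewrite (bigD1 S)//= big1 ?addr0 => [|T TS].
  by rewrite meanZ walsh_orth eqxx mulr1 -expr2.
by rewrite meanZ walsh_orth eq_sym (negbTE TS) mulr0.
Qed.

Lemma bessel f : \sum_(S : {set I}) dot (wcoef f S) (wcoef f S) <= mean (fun e => dot (f e) (f e)).
Proof.
pose g e := \sum_(S : {set I}) (1 * walsh S e) *: wcoef f S.
have gg : mean (fun e => dot (g e) (g e)) = \sum_(S : {set I}) dot (wcoef f S) (wcoef f S).
  by rewrite /g (parseval (fun=> 1)); apply: eq_bigr => S _; rewrite expr1n mul1r.
have fg : mean (fun e => dot (f e) (g e)) = \sum_(S : {set I}) dot (wcoef f S) (wcoef f S).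
  transitivity (\sum_(S : {set I}) mean (fun e => walsh S e * dot (f e) (wcoef f S))).
    rewrite -mean_sum; apply: eq_mean => e; rewrite /g dot_sumr.
    by apply: eq_bigr => S _; rewrite dotZr mul1r.
  apply: eq_bigr => S _; rewrite {2}/wcoef dotZl dot_suml /mean.
  by congr (_ * _); apply: eq_bigr => e _; rewrite dotZl.
have : 0 <= mean (fun e => dot (f e - g e) (f e - g e)).
  by apply: mean_ge0 => e; exact: dot_ge0.
rewrite (_ : mean _ = mean (fun e => dot (f e) (f e)) - 2 * mean (fun e => dot (f e) (g e))
   + mean (fun e => dot (g e) (g e))).
  by rewrite gg fg; lra.
rewrite -meanZ -meanN -!meanD; apply: eq_mean => e.
by rewrite !(dotBl, dotBr) (dotC (g e)); ring.
Qed.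

(* Pisier's argument: a combination of noise operators reproduces the linear
   Walsh part up to an [L^2]-small error, and noise operators average [f]. *)
Lemma linear_part_approx (J : finType) (c r : J -> R) (delta : R) f :
  (forall j, `|r j| <= 1) -> 0 <= delta -> \sum_j c j * r j = 1 ->
  (forall k, (0 < k)%N -> `|\sum_j c j * r j ^+ k.*2.+1| <= delta) ->
  exists z err : signs I -> 'rV[R]_d,
  [/\ forall e, \sum_i sgb (e i) *: wcoef f [set i] = z e - err e,
      forall xi H, (forall e, `|dot xi (f e)| <= H) ->
        forall e, `|dot xi (z e)| <= (\sum_j `|c j|) * H
    & mean (fun e => dot (err e) (err e)) <=
      delta ^+ 2 * mean (fun e => dot (f e) (f e))].
Proof.
move=> r1 delta0 cr1 crk.
(* Taking the odd part in [r j] kills the even Walsh levels, so that only the odd powers of the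
   nodes have to be controlled. *)
pose z e := \sum_j (c j / 2) *: (noise (r j) f e - noise (- r j) f e).
pose lin e := \sum_i sgb (e i) *: wcoef f [set i].
pose q k := \sum_j c j * ((r j ^+ k - (- r j) ^+ k) / 2).
have zE e : z e = \sum_(S : {set I}) (q #|S| * walsh S e) *: wcoef f S.
  transitivity (\sum_j \sum_(S : {set I}) (c j * ((r j ^+ #|S| - (- r j) ^+ #|S|) / 2) *
      walsh S e) *: wcoef f S).
    apply: eq_bigr => j _; rewrite !noiseE -sumrB scaler_sumr.
    by apply: eq_bigr => S _; rewrite -scalerBl scalerA; congr (_ *: _); ring.
  rewrite exchange_big/=; apply: eq_bigr => S _.
  by rewrite -scaler_suml -mulr_suml.
have linE e : lin e = \sum_(S : {set I}) ((#|S| == 1%N)%:R * walsh S e) *: wcoef f S.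
  rewrite (bigID (fun S : {set I} => #|S| == 1%N))/= [X in _ = _ + X]big1 ?addr0; last first.
    by move=> S /negbTE ->; rewrite mul0r scale0r.
  rewrite (eq_bigr (fun S => walsh S e *: wcoef f S)); last first.
    by move=> S ->; rewrite mul1r.
  rewrite big_cards1/=.
  by apply: eq_bigr => i _; rewrite walsh1.
have half2 (x : R) : (x + x) / 2 = x by lra.
have qk k : `|q k - (k == 1%N)%:R| <= delta.
  rewrite /q; have [/eqP ok|ok] := boolP (odd k == false).
    rewrite big1 => [|j _]; last by rewrite exprNn -signr_odd ok expr0 mul1r subrr mul0r mulr0.
    rewrite (_ : (k == 1)%N = false) ?subrr ?normr0//.
    by apply/eqP => k1; rewrite k1 in ok.
  have {}ok : odd k by move: ok; case: (odd k).
  under eq_bigr do rewrite exprNn -signr_odd ok expr1 mulN1r opprK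
    half2.
  rewrite -(odd_double_half k) ok add1n.
  have [->|k0] := posnP k./2.
    by rewrite double0 eqxx; under eq_bigr do rewrite expr1; rewrite cr1 subrr normr0.
  rewrite (_ : (_ == 1)%N = false) ?subr0 ?crk//.
  by apply/negbTE; rewrite eqSS double_eq0 -lt0n.
exists z, (fun e => z e - lin e); split => [e|xi H fH e|].
- by rewrite opprB addrC subrK.
- have H0 : 0 <= H by apply: le_trans (fH e).
  have nH s : `|s| <= 1 -> `|dot xi (noise s f e)| <= H.
    move=> s1; rewrite /noise dot_sumr; apply: (le_trans (ler_norm_sum _ _ _)).
    rewrite -[leRHS]mul1r -(sum_wt (fun _ : I => s)) mulr_suml; apply: ler_sum => g _.
    rewrite dotZr normrM ger0_norm ?wt_ge0// ler_wpM2l// wt_ge0//.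
  rewrite /z dot_sumr mulr_suml; apply: (le_trans (ler_norm_sum _ _ _)).
  apply: ler_sum => j _; rewrite dotZr normrM normf_div (gtr0_norm (_ : 0 < 2))//.
  rewrite -mulrA ler_wpM2l// dotBr.
  have := nH _ (r1 j); have := nH (- r j); rewrite normrN => /(_ (r1 j)).
  have := ler_normB (dot xi (noise (r j) f e)) (dot xi (noise (- r j) f e)); lra.
- pose a (S : {set I}) := q #|S| - (#|S| == 1%N)%:R.
  have -> : mean (fun e => dot (z e - lin e) (z e - lin e)) =
      \sum_(S : {set I}) a S ^+ 2 * dot (wcoef f S) (wcoef f S).
    rewrite -parseval; apply: eq_mean => e; rewrite zE linE -sumrB.
    by congr dot; apply: eq_bigr => S _; rewrite -scalerBl mulrBl.
  apply: (@le_trans _ _ (delta ^+ 2 * \sum_(S : {set I}) dot (wcoef f S) (wcoef f S))).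
    rewrite mulr_sumr; apply: ler_sum => S _; rewrite ler_wpM2r ?dot_ge0//.
    by rewrite -[a S ^+ 2]real_normK ?num_real// ler_sqr ?nnegrE// qk.
  by rewrite ler_wpM2l ?sqr_ge0// bessel.
Qed.

End KConvexity.

(** * Interpolation coefficients *)

Section Coefficients.
Variable R : realType.

(** The difference [P] between [X^k] and its Lagrange interpolant has size at most [m] and [m]
    distinct roots, so it vanishes; the claim is [P.[0] = 0]. *)
Lemma lagrange_at0 (m : nat) (u : 'I_m -> R) (k : nat) : injective u -> (k < m)%N ->
  \sum_j u j ^+ k * \prod_(l | l != j) (u l / (u l - u j)) = (k == 0)%:R.
Proof.
move=> uI km.
pose L j := \prod_(l | l != j) ('X - (u l)%:P).
pose P := \sum_j (u j ^+ k / \prod_(l | l != j) (u j - u l)) *: L j - 'X^k.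
have LE j x : (L j).[x] = \prod_(l | l != j) (x - u l).
  by rewrite /L horner_prod; apply: eq_bigr => l _; rewrite hornerXsubC.
have nz j : \prod_(l | l != j) (u j - u l) != 0.
  apply/prodf_neq0 => l lj; rewrite subr_eq0; apply: contra lj => /eqP/uI ->.
  exact: eqxx.
have sP : (size P <= m)%N.
  rewrite (leq_trans (size_polyD _ _))// geq_max size_polyN size_polyXn km andbT.
  apply: (leq_trans (size_sum _ _ _)); apply/bigmax_leqP => j _.
  apply: (leq_trans (size_scale_leq _ _)).
  rewrite /L -big_filter size_prod_XsubC size_filter -sum1_count sum1_card.
  by rewrite cardC1 card_ord prednK// (leq_ltn_trans _ km).
have P0 : P = 0.
  apply: contraTeq sP => P0; rewrite -ltnNge.
  rewrite -(card_ord m) cardE -(size_map u); apply: max_poly_roots => //.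
    apply/allP => x /mapP[i _ ->]; rewrite /root /P hornerD hornerN hornerXn.
    rewrite horner_sum (bigD1 i)//= hornerZ LE divfK//.
    rewrite [\sum_(j | _) _]big1 ?addr0 ?subrr// => j ji.
    have ij : i != j by rewrite eq_sym.
    by rewrite hornerZ LE [X in _ * X](bigD1 i ij)/= subrr mul0r mulr0.
  by rewrite map_inj_uniq ?enum_uniq.
have : P.[0] = 0 by rewrite P0 horner0.
rewrite /P hornerD hornerN hornerXn => /eqP; rewrite subr_eq0 => /eqP.
rewrite expr0n horner_sum => <-; apply: eq_bigr => j _.
rewrite hornerZ LE -mulrA; congr (_ * _).
rewrite mulrC -prodf_div; apply: eq_bigr => l lj.
rewrite sub0r -(opprB (u l)) invrN mulNr mulrN opprK//.
Qed.

Lemma prod_dist (m : nat) (j : 'I_m) :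
  \prod_(l < m | l != j) `|(l%:R - j%:R : R)| = (j`! * (m.-1 - j)`!)%:R.
Proof.
have jm := ltn_ord j.
have low i : \prod_(0 <= l < i) `|(l%:R - i%:R : R)| = i`!%:R.
  elim: i => [|i IH]; first by rewrite big_nil.
  rewrite big_nat_recl// factS natrM sub0r normrN normr_nat -IH; congr (_ * _).
  by apply: eq_bigr => l _; congr `|_|; rewrite -!natr1; ring.
have high t : \prod_(0 <= l < t) `|((l + j.+1)%:R - j%:R : R)| = t`!%:R.
  elim: t => [|t IH]; first by rewrite big_nil.
  rewrite big_nat_recr//= IH factS natrM mulrC; congr (_ * _).
  have -> : (t + j.+1)%:R - j%:R = t.+1%:R :> R by rewrite natrD -!natr1; ring.
  by rewrite normr_nat.
rewrite -(big_mkord (fun l => l != j :> nat) (fun l => `|(l%:R - j%:R : R)|)).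
rewrite (@big_cat_nat _ _ _ j)//=; last exact: ltnW.
rewrite natrM -low -high; congr (_ * _).
  rewrite big_nat_cond [RHS]big_nat_cond; apply: eq_bigl => l.
  by rewrite andbT; case: ltngtP; rewrite ?andbF.
rewrite big_ltn_cond// eqxx/= -{1}(add0n j.+1) big_addn.
rewrite (_ : (m.-1 - j = m - j.+1)%N); last by lia.
rewrite big_nat_cond [RHS]big_nat_cond; apply: eq_bigl => l.
by rewrite andbT; case: eqP => //; lia.
Qed.

(** A product of two factorials with fixed sum of arguments is least when the arguments are
    balanced. This makes the bound of [lweight_le] independent of the other nodes. *)
Lemma fact_unimodal (n j : nat) : (j <= n)%N ->
  (n`! * n.+1`! <= (n - j)`! * (n.+1 + j)`!)%N.
Proof.
elim: j => [|j IH] jn; first by rewrite subn0 addn0.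
apply: (leq_trans (IH (ltnW jn))).
rewrite -subnSK// factS addnS [in X in (_ <= X)%N]factS.
rewrite -mulnA [X in (_ <= X)%N]mulnCA leq_mul2r; apply/orP; right.
lia.
Qed.

(** Odd multiples of a common step, scaled below [1/2]: the odd powers of order beyond [m], which
    the interpolation does not cancel, then decay geometrically in [m]. *)
Definition node (m : nat) (j : 'I_m) : R := j.*2.+1%:R / (4 * m%:R).

Definition lweight (m : nat) (j : 'I_m) : R :=
  \prod_(l < m | l != j) (node l ^+ 2 / (node l ^+ 2 - node j ^+ 2)).

(** A Wallis-type bound. The correction [m^-1] is there for the induction: with the bare constant 2
    the step would need [(2 m + 1)^2 <= 4 m (m + 1)], which fails. *)
Lemma odd_sqr_prod m : (0 < m)%N ->
  \prod_(l < m) (l.*2.+1%:R ^+ 2 : R) <=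
  (2 - m%:R^-1) * 4 ^+ m.-1 * (m.-1`! * m`!)%:R.
Proof.
case: m => // m _; elim: m => [|m IH].
  by rewrite big_ord1 expr1n/= expr0 !mulr1 invr1; lra.
rewrite big_ord_recr/=; apply: (le_trans (ler_wpM2r (sqr_ge0 _) IH)).
rewrite /= [4 ^+ m.+1]exprS !factS !natrM.
have f0 : 0 < m`!%:R :> R by rewrite ltr0n fact_gt0.
have e0 : 0 < (4 : R) ^+ m by rewrite exprn_gt0.
set a := m`!%:R; set e := 4 ^+ m; have -> : m.+1.*2.+1%:R = 2 * m.+1%:R + 1 :> R.
  by rewrite -natr1 -muln2 natrM mulrC.
have -> : m.+2%:R = m.+1%:R + 1 :> R by rewrite natr1.
set x : R := m.+1%:R; have x1 : 1 <= x by rewrite ler1n.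
have -> : (2 - x^-1) * e * (a * (x * a)) * (2 * x + 1) ^+ 2 =
   (e * a ^+ 2) * ((2 - x^-1) * x * (2 * x + 1) ^+ 2) by ring.
have -> : (2 - (x + 1)^-1) * (4 * e) * (x * a * ((x + 1) * (x * a))) =
   (e * a ^+ 2) * (4 * x ^+ 2 * ((2 - (x + 1)^-1) * (x + 1))) by ring.
rewrite ler_pM2l ?mulr_gt0 ?exprn_gt0//.
have -> : (2 - x^-1) * x = 2 * x - 1 by field; lra.
have -> : (2 - (x + 1)^-1) * (x + 1) = 2 * x + 1 by field; lra.
nra.
Qed.

(** The factorization [(2l+1)^2 - (2j+1)^2 = 4 (l-j) (l+j+1)] turns the weight into a quotient of
    factorials, which [odd_sqr_prod] and [fact_unimodal] bound. *)
Lemma lweight_le m (j : 'I_m) : `|lweight j| <= 2 / j.*2.+1%:R.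
Proof.
have m0 : (0 < m)%N by apply: leq_ltn_trans (ltn_ord j).
have mR : 0 < m%:R :> R by rewrite ltr0n.
have xj : 0 < j.*2.+1%:R :> R by rewrite ltr0n.
have sE (l : 'I_m) : node l ^+ 2 / (node l ^+ 2 - node j ^+ 2) =
    l.*2.+1%:R ^+ 2 / (4 * (l%:R - j%:R) * (l + j).+1%:R).
  have K0 : (4 * m%:R : R) ^+ 2 != 0 by rewrite expf_neq0// mulf_neq0// gt_eqF.
  rewrite /node !expr_div_n -mulrBl; move: K0; set K := (4 * m%:R) ^+ 2 => K0.
  rewrite [(_ / K)^-1]invfM invrK mulrACA mulVf ?mulr1//.
  congr (_ / _).
  have E (i : nat) : i.*2.+1%:R = 2 * i%:R + 1 :> R by rewrite -natr1 -muln2 natrM mulrC.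
  by rewrite !E -[(l + j).+1%:R]natr1 natrD; ring.
rewrite /lweight (eq_bigr _ (fun l _ => sE l)) normr_prod.
have nE (l : 'I_m) : `|l.*2.+1%:R ^+ 2 / (4 * (l%:R - j%:R) * (l + j).+1%:R) : R| =
    l.*2.+1%:R ^+ 2 / (4 * `|l%:R - j%:R| * (l + j).+1%:R).
  by rewrite normf_div normrX normr_nat; congr (_ / _); rewrite !normrM !normr_nat.
rewrite (eq_bigr _ (fun l _ => nE l)) prodf_div.
rewrite [X in _ / X <= _]big_split/= [X in _ / (X * _) <= _]big_split/= prod_dist.
rewrite prodr_const cardC1 card_ord.
set P := \prod_(i < m | i != j) _ ^+ 2; set Q := \prod_(i < m | i != j) _%:R.
have PE : P * j.*2.+1%:R ^+ 2 <= 2 * 4 ^+ m.-1 * (m.-1`! * m`!)%:R.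
  have -> : P * j.*2.+1%:R ^+ 2 = \prod_(l < m) (l.*2.+1%:R ^+ 2 : R).
    by rewrite [RHS](bigD1 j)//= mulrC.
  apply: (le_trans (odd_sqr_prod m0)).
  by rewrite ler_wpM2r// ler_wpM2r ?exprn_ge0// lerBlDr lerDl invr_ge0.
have QE : Q * j.*2.+1%:R * j`!%:R = (m + j)`!%:R.
  have -> : Q * j.*2.+1%:R = \prod_(l < m) (l + j).+1%:R.
    by rewrite [RHS](bigD1 j)//= addnn mulrC.
  move: (nat_of_ord j) => i; elim: (m) => [|k IH]; first by rewrite big_ord0 mul1r.
  by rewrite big_ord_recr/= addSn factS natrM -IH; ring.
have j0 : 0 < j`!%:R :> R by rewrite ltr0n fact_gt0.
have Q0 : 0 < Q by apply: prodr_gt0 => l _; rewrite ltr0n.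
have t0 : 0 < (m.-1 - j)`!%:R :> R by rewrite ltr0n fact_gt0.
have e0 : 0 < (4 : R) ^+ m.-1 by rewrite exprn_gt0.
rewrite natrM ler_pdivrMr ?mulr_gt0// mulrAC ler_pdivlMr//.
rewrite -(ler_pM2r xj) -mulrA -expr2; apply: (le_trans PE).
have -> : 2 * (4 ^+ m.-1 * (j`!%:R * (m.-1 - j)`!%:R) * Q) * j.*2.+1%:R =
  2 * 4 ^+ m.-1 * ((m.-1 - j)`! * (m + j)`!)%:R by rewrite natrM -QE; ring.
rewrite ler_pM2l ?mulr_gt0// ler_nat.
have := @fact_unimodal m.-1 j; rewrite prednK//; apply.
by rewrite -ltnS prednK.
Qed.

Lemma sum_inv_odd_sqr m : (0 < m)%N -> \sum_(j < m) (j.*2.+1%:R ^- 2 : R) <= 2 - m%:R^-1.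
Proof.
case: m => // m _; elim: m => [|m IH].
  by rewrite big_ord1 expr1n invr1; lra.
rewrite big_ord_recr/=; apply: (le_trans (lerD IH (lexx _))).
have -> : m.+1.*2.+1%:R = 2 * m.+1%:R + 1 :> R.
  by rewrite -natr1 -muln2 natrM mulrC.
have -> : m.+2%:R = m.+1%:R + 1 :> R by rewrite natr1.
set x : R := m.+1%:R; have x1 : 1 <= x by rewrite ler1n.
rewrite -subr_ge0.
have -> : 2 - (x + 1)^-1 - (2 - x^-1 + (2 * x + 1) ^- 2) =
   ((2 * x + 1) ^+ 2 - x * (x + 1)) / (x * (x + 1) * (2 * x + 1) ^+ 2).
  by field; rewrite ?gt_eqF//; nra.
rewrite divr_ge0// ?mulr_ge0 ?sqr_ge0//; nra.
Qed.

(* The weights extrapolate to [0] the polynomial [r |-> sum_k a_k r^{2k}] from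
   the nodes; dividing by the node turns this into reading off the linear
   coefficient of an odd polynomial, and half-integer nodes keep the total
   mass linear in [m]. *)
Lemma interpolation_coefs m : (0 < m)%N ->
  exists c r : 'I_m -> R, [/\ forall j, 0 <= r j <= 1 / 2,
    \sum_j c j * r j = 1,
    forall k, (0 < k < m)%N -> \sum_j c j * r j ^+ k.*2.+1 = 0
    & \sum_j `|c j| <= 16 * m%:R].
Proof.
move=> m0; have mR : 0 < m%:R :> R by rewrite ltr0n.
have n0 (j : 'I_m) : 0 < node j by rewrite divr_gt0// mulr_gt0.
exists (fun j => lweight j / node j), (@node m).
have L k : (k < m)%N -> \sum_(j < m) lweight j / node j * node j ^+ k.*2.+1 = (k == 0)%:R.
  move=> km; have inj : injective (fun j : 'I_m => node j ^+ 2).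
    move=> i j /eqP; rewrite eqrXn2 ?ltW// => /eqP.
    rewrite /node => /(mulIf (_ : (4 * m%:R)^-1 != 0)) H.
    apply/val_inj/double_inj/succn_inj/eqP; rewrite -(eqr_nat R); apply/eqP/H.
    by rewrite invr_neq0// mulf_neq0// gt_eqF.
  rewrite -(lagrange_at0 inj km); apply: eq_bigr => j _.
  by rewrite exprS mulrA divfK ?gt_eqF// -muln2 mulnC exprM mulrC.
split.
- move=> j; rewrite (ltW (n0 j))/= /node ler_pdivrMr ?mulr_gt0//.
  have : (j.*2.+1 <= 2 * m)%N by have := ltn_ord j; lia.
  by rewrite -(ler_nat R) natrM; lra.
- by have := L 0 m0; under eq_bigr do rewrite expr1.
- by move=> k /andP[k0 km]; rewrite L// eqn0Ngt k0.
(* Dividing [2 / (2j+1)] by the node [(2j+1) / (4m)] gives [8 m / (2j+1)^2], and the inverse squares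
   of the odd numbers sum to at most 2. *)
- apply: (@le_trans _ _ (\sum_(j < m) 8 * m%:R * (j.*2.+1%:R ^- 2))).
    apply: ler_sum => j _; rewrite normrM normfV (gtr0_norm (n0 j)) ler_pdivrMr//.
    apply: (le_trans (lweight_le j)); rewrite /node le_eqVlt; apply/orP; left; apply/eqP.
    by field; rewrite gt_eqF//= pnatr_eq0.
  rewrite -mulr_sumr; have := sum_inv_odd_sqr m0.
  have : 0 <= m%:R^-1 :> R by rewrite invr_ge0 ltW.
  nra.
Qed.

End Coefficients.

(** * Inequalities for cosine, hyperbolic cosine and the exponential *)

Section ElementaryBounds.
Local Open Scope classical_set_scope.
Variable R : realType.
Implicit Types x : R.

Lemma sin_MVT x : 0 <= x -> exists2 c, 0 <= c <= x & sin x = cos c * x.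
Proof.
move=> x0.
have cs : {within `[0, x], continuous (@sin R)}.
  by apply: continuous_subspaceT => y; exact: continuous_sin.
have [c] := MVT_segment x0 (fun y _ => is_derive_sin y) cs.
by rewrite in_itv/= sin0 !subr0 => cx ->; exists c.
Qed.

Lemma normr_sin_le x : `|sin x| <= `|x|.
Proof.
have pos (y : R) : 0 <= y -> `|sin y| <= y.
  move=> y0; have [c _ ->] := sin_MVT y0.
  by rewrite normrM (ger0_norm y0) ler_piMl// cos_max.
have [x0|x0] := lerP 0 x; first by rewrite (ger0_norm x0) pos.
by rewrite -normrN -sinN -[`|x|]normrN (@ger0_norm _ (- x)) ?pos// oppr_ge0 ltW.
Qed.

Lemma cosE_half x : cos x = 1 - 2 * sin (x / 2) ^+ 2.
Proof.
have {1}-> : x = (x / 2) *+ 2 by rewrite mulr2n; field.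
by rewrite cos_mulr2n cos2sin2 mulr2n; ring.
Qed.

Lemma cos_ge x : 1 - x ^+ 2 / 2 <= cos x.
Proof.
have : sin (x / 2) ^+ 2 <= (x / 2) ^+ 2.
  by rewrite -real_normK ?num_real// -[leRHS]real_normK ?num_real// lerXn2r ?nnegrE// normr_sin_le.
by rewrite cosE_half; lra.
Qed.

Lemma cos_le x : `|x| <= 1 -> `|cos x| <= expR (- (x ^+ 2 / 4)).
Proof.
move=> x1; rewrite -[cos x]cos_norm -[x ^+ 2]real_normK ?num_real//.
move: x1 (normr_ge0 x); move: `|x| => {}x x1 x0.
have x2 : x ^+ 2 <= 1 by rewrite expr_le1.
have x20 : 0 <= x ^+ 2 by exact: sqr_ge0.
have c0 : 0 <= cos x by have := cos_ge x; lra.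
rewrite ger0_norm//; apply: le_trans (expR_ge1Dx _).
have [c /andP[c_ge0 cx] sc] := @sin_MVT (x / 2) ltac:(lra).
have c2 : c ^+ 2 <= (1 / 2) ^+ 2 by rewrite lerXn2r ?nnegrE//; lra.
have h : 7 / 8 <= cos c by have := cos_ge c; lra.
have h2 : (7 / 8) ^+ 2 <= cos c ^+ 2 by rewrite lerXn2r ?nnegrE//; lra.
rewrite cosE_half sc exprMn.
have : (7 / 8) ^+ 2 * (x / 2) ^+ 2 <= cos c ^+ 2 * (x / 2) ^+ 2.
  by rewrite ler_wpM2r// sqr_ge0.
set y := cos c ^+ 2 * _; lra.
Qed.

Lemma expRN_le_cos x : `|x| <= 1 -> expR (- x ^+ 2) <= cos x.
Proof.
move=> x1; apply: le_trans (cos_ge x).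
have x2 : x ^+ 2 <= 1 by rewrite -real_normK ?num_real// expr_le1.
have x20 : 0 <= x ^+ 2 by exact: sqr_ge0.
rewrite expRN -[leLHS]mul1r ler_pdivrMr ?expR_gt0//.
have h := expR_ge1Dx (x ^+ 2).
have h1 : (1 - x ^+ 2 / 2) * (1 + x ^+ 2) <= (1 - x ^+ 2 / 2) * expR (x ^+ 2).
  by rewrite ler_wpM2l//; lra.
apply: le_trans h1; have : x ^+ 2 * x ^+ 2 <= x ^+ 2 by rewrite ler_piMl.
lra.
Qed.

Lemma expR_le_inv_sqr (x : R) : x < 2 -> expR x <= ((1 - x / 2) ^+ 2)^-1.
Proof.
move=> x2; have := expR_ge1Dx (- (x / 2)) => h.
have -> : expR x = (expR (- (x / 2)) ^+ 2)^-1.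
  by rewrite -expRM_natl -expRN; congr expR; field.
have h0 : 0 < 1 - x / 2 by lra.
by rewrite lef_pV2 ?posrE ?exprn_gt0 ?expR_gt0// lerXn2r ?nnegrE ?expR_ge0// ltW.
Qed.

Lemma invr1B_le (u : R) : 0 <= u <= 1 / 3 -> (1 - u)^-1 <= expR (3 / 2 * u).
Proof.
move=> /andP[u0 u1]; apply: le_trans (expR_ge1Dx _).
rewrite -[leLHS]mul1r ler_pdivrMr; last by lra.
have : u * u <= u * (1 / 3) by rewrite ler_wpM2l.
lra.
Qed.

Lemma cosh_le x : (expR x + expR (- x)) / 2 <= expR (x ^+ 2).
Proof.
have [x1|x1] := lerP `|x| 1.
  have := x1; rewrite ler_norml => /andP[xl xr].
  pose u := x ^+ 2 / 4.
  have x2 : x ^+ 2 <= 1 by rewrite -real_normK ?num_real// expr_le1.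
  have u0 : 0 <= u by rewrite divr_ge0// sqr_ge0.
  have u1 : u <= 1 / 3 by rewrite /u; lra.
  have hp := @expR_le_inv_sqr x ltac:(lra).
  have hm := @expR_le_inv_sqr (- x) ltac:(lra).
  apply: (@le_trans _ _ ((1 + u) * ((1 - u)^-1 * (1 - u)^-1))).
    apply: (@le_trans _ _ ((((1 - x / 2) ^+ 2)^-1 + ((1 - (- x) / 2) ^+ 2)^-1) / 2)).
      by rewrite ler_pM2r// lerD.
    rewrite le_eqVlt; apply/orP; left; apply/eqP.
    have p0 : 2 - x != 0 by lra.
    have q0 : 2 + x != 0 by lra.
    have -> : 1 - u = (2 - x) * (2 + x) / 4 by rewrite /u; field.
    have -> : 1 - x / 2 = (2 - x) / 2 by field.
    have -> : 1 - (- x) / 2 = (2 + x) / 2 by field.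
    rewrite /u; field; by rewrite p0 q0.
  apply: (@le_trans _ _ (expR u * (expR (3 / 2 * u) * expR (3 / 2 * u)))).
    have hu : (1 - u)^-1 <= expR (3 / 2 * u) by apply: invr1B_le; rewrite u0.
    have iu : 0 <= (1 - u)^-1 by rewrite invr_ge0; lra.
    apply: ler_pM; rewrite ?expR_ge1Dx//; [lra|exact: mulr_ge0|exact: ler_pM].
  by rewrite -!expRD ler_expR /u; lra.
have h (y : R) : `|y| = `|x| -> expR y <= expR (x ^+ 2).
  move=> yx; rewrite ler_expR (le_trans (ler_norm y))// yx -[x ^+ 2]real_normK ?num_real//.
  by rewrite expr2 ler_peMl// ltW.
by have := h x erefl; have := h (- x) (normrN x); lra.
Qed.

End ElementaryBounds.

(** * Small balls *)

Section SignSums.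
Variable R : realType.
Local Notation mean := (@mean R).
Local Notation sgb := (@sgb R).

Definition single (I : finType) (i : I) : signs I := [ffun j => j == i].

Lemma sgb_true : sgb true = -1. Proof. by rewrite /sgb expr1. Qed.
Lemma sgb_false : sgb false = 1. Proof. by rewrite /sgb expr0. Qed.

Lemma mean_halfflip (I : finType) (i : I) (F : signs I -> R) :
  mean F = mean (fun e => (F e + F (flip (single i) e)) / 2).
Proof.
under [RHS]eq_mean do rewrite mulrC.
by rewrite meanZ meanD mean_flip; field.
Qed.

Definition ssum (I : finType) (s : seq I) (a : I -> R) (e : signs I) : R :=
  \sum_(i <- s) sgb (e i) * a i.

Lemma ssum_flip (I : finType) (i : I) s (a : I -> R) e :
  i \notin s -> ssum s a (flip (single i) e) = ssum s a e.
Proof.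
move=> si; apply: eq_big_seq => j js; rewrite !ffunE.
by case: eqP => [ji|//]; rewrite -ji js in si.
Qed.

Lemma ssum_cons (I : finType) (i : I) s (a : I -> R) (F : R -> R) : i \notin s ->
  mean (fun e => F (ssum (i :: s) a e)) =
  mean (fun e => (F (ssum s a e + a i) + F (ssum s a e - a i)) / 2).
Proof.
move=> si; rewrite (mean_halfflip i); apply: eq_mean => e.
have E f : ssum (i :: s) a f = sgb (f i) * a i + ssum s a f.
  by rewrite /ssum big_cons.
rewrite !E ssum_flip// ffunE sgb_addb ffunE eqxx sgb_true.
case: (e i); rewrite ?sgb_true ?sgb_false ?mulN1r ?opprK ?mul1r.
  by rewrite [_ + F _]addrC [- _ + _]addrC [a i + _]addrC.
by rewrite [- _ + _]addrC [a i + _]addrC.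
Qed.

Lemma mean_cos (I : finType) (a : I -> R) phi :
  mean (fun e : signs I => cos (phi + \sum_i sgb (e i) * a i)) =
  cos phi * \prod_i cos (a i).
Proof.
suff H s : uniq s -> forall phi, mean (fun e : signs I => cos (phi + ssum s a e)) =
    cos phi * \prod_(i <- s) cos (a i).
  by have := H _ (index_enum_uniq I) phi.
elim: s => [_|i s IH /= /andP[si us]] {}phi.
  rewrite big_nil mulr1 -[RHS](mean_cst _ (card_signs_gt0 I)).
  by apply: eq_mean => e; rewrite /ssum big_nil addr0.
rewrite big_cons (ssum_cons _ (fun x => cos (phi + x)) si).
rewrite mulrCA -(IH us) -meanZ; apply: eq_mean => e.
by rewrite !addrA; set y := phi + _; rewrite cosB cosD; field.
Qed.

(** A discrete analogue of the Gaussian formula [(1 + 2 b m)^(-1/2)], with exponent [1/8] so that it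
    can be proved one sign at a time, uniformly in a shift [x] of the sum. *)
Lemma mean_expRN_sqr (m : nat) (b : R) : 0 <= b <= 1 / 8 ->
  mean (fun e : signs 'I_m => expR (- (b * (\sum_i sgb (e i)) ^+ 2))) ^+ 8 <=
  (1 + 8 * b * m%:R)^-1.
Proof.
suff H (s : seq 'I_m) : uniq s -> forall b, 0 <= b <= 1 / 8 -> exists C : R,
   [/\ 0 <= C, C ^+ 8 <= (1 + 8 * b * (size s)%:R)^-1 & forall x,
     mean (fun e : signs 'I_m => expR (- (b * (x + ssum s (fun=> 1) e) ^+ 2))) <= C].
  move=> b01; have [C [C0 C8 HC]] := H _ (index_enum_uniq _) b b01.
  have sz : size (index_enum (ordinal m : finType)) = m by rewrite -[RHS](card_ord m) cardT enumT.
  rewrite sz in C8; apply: le_trans C8.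
  have eqe : mean (fun e : signs 'I_m => expR (- (b * (\sum_i sgb (e i)) ^+ 2))) <= C.
    apply: le_trans (HC 0); rewrite le_eqVlt; apply/orP; left; apply/eqP.
    by apply: eq_mean => e; rewrite add0r /ssum; under [in RHS]eq_bigr do rewrite mulr1.
  by rewrite lerXn2r ?nnegrE// mean_ge0// => e; exact: expR_ge0.
elim: s => [_|i s IH /= /andP[si us]] {}b b01.
  exists 1; split => //=; first by rewrite expr1n mulr0 addr0 invr1.
  move=> x; rewrite -[leRHS](mean_cst _ (card_signs_gt0 'I_m)); apply: ler_mean => e.
  by rewrite -expR0 ler_expR oppr_le0 mulr_ge0 ?sqr_ge0//; case/andP: b01.
case/andP: b01 => b0 b1.
have d0 : 0 < 1 + 8 * b by lra.
(* Averaging over one sign gains [exp(- b)] and lowers [b] to at least [b (1 - 4 b)] by [cosh_le].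
   The value [b'] is below that exactly because [b <= 1/8], and it satisfies
   [(1 + 8 b) (1 + 8 b' m) = 1 + 8 b (m + 1)], which closes the induction. *)
pose b' := b / (1 + 8 * b).
have b'0 : 0 <= b' by rewrite divr_ge0// ltW.
have b'b : b' <= b by rewrite ler_pdivrMr//; nra.
have b'l : b' <= b * (1 - 4 * b) by rewrite ler_pdivrMr//; nra.
have [|C [C0 C8 HC]] := IH us b'; first by rewrite b'0 (le_trans b'b).
exists (expR (- b) * C); split => [||x]; first by rewrite mulr_ge0 ?expR_ge0.
  rewrite exprMn -expRM_natl.
  apply: (@le_trans _ _ ((1 + 8 * b)^-1 * (1 + 8 * b' * (size s)%:R)^-1)).
    apply: ler_pM => //; rewrite ?expR_ge0 ?exprn_ge0//.
    rewrite mulrN expRN lef_pV2 ?posrE ?expR_gt0//.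
    exact: expR_ge1Dx.
  have h1 : 0 < 1 + 8 * b * (size s).+1%:R by rewrite ltr_wpDr// mulr_ge0// mulr_ge0.
  have E : (1 + 8 * b) * (1 + 8 * b' * (size s)%:R) = 1 + 8 * b * (size s).+1%:R.
    by rewrite /b' -natr1; field; rewrite gt_eqF.
  by rewrite -invfM E.
rewrite (ssum_cons _ (fun y => expR (- (b * (x + y) ^+ 2))) si).
apply: (@le_trans _ _ (expR (- b) * mean (fun e : signs 'I_m =>
    expR (- (b' * (x + ssum s (fun=> 1) e) ^+ 2))))); last first.
  by rewrite ler_wpM2l ?expR_ge0.
rewrite -meanZ; apply: ler_mean => e; set y := ssum _ _ _.
have -> : (expR (- (b * (x + (y + 1)) ^+ 2)) + expR (- (b * (x + (y - 1)) ^+ 2))) / 2 =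
   expR (- b - b * (x + y) ^+ 2) *
   ((expR (2 * b * (x + y)) + expR (- (2 * b * (x + y)))) / 2).
  rewrite mulrA mulrDr -!expRD addrC.
  by congr ((expR _ + expR _) / _); ring.
apply: (le_trans (ler_wpM2l (expR_ge0 _) (cosh_le _))).
rewrite -!expRD ler_expR.
have : 0 <= (x + y) ^+ 2 by exact: sqr_ge0.
by rewrite exprMn; nra.
Qed.

Lemma mean_curry (I J : finType) (F : signs (I * J)%type -> R) :
  mean F = mean (fun f : {ffun I -> signs J} => F [ffun p => f p.1 p.2]).
Proof.
apply: (mean_reindex _ (f := fun f : {ffun I -> signs J} => [ffun p => f p.1 p.2])).
exists (fun e : signs (I * J)%type => [ffun i => [ffun j => e (i, j)]]) => f.
  by apply/ffunP => i; apply/ffunP => j; rewrite !ffunE.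
by apply/ffunP => -[i j]; rewrite !ffunE.
Qed.

Lemma mean_prod_rows (I J : finType) (phi : I -> signs J -> R) :
  mean (fun f : {ffun I -> signs J} => \prod_i phi i (f i)) = \prod_i mean (phi i).
Proof.
rewrite /mean big_split/= bigA_distr_bigA/= prodr_const exprVn.
by rewrite card_ffun natrX.
Qed.

(* The kernel [prod_i cos (t v_i)^mm] is nonnegative, of order one on the ball
   of radius [rho sqrt k], and is an average of characters, which makes its
   expectation over sign sums explicit. *)
Lemma small_ball (J : finType) (k mm : nat) (a : J -> 'rV[R]_k) (y : 'rV[R]_k) (rho s : R) :
  0 < rho -> 0 <= s -> (k <= mm)%N -> (0 < mm)%N -> ~~ odd mm ->
  2 * s ^+ 2 <= rho ^+ 2 * mm%:R ->
  (forall j, nrm (a j) * k%:R * mm%:R <= rho * Num.sqrt mm%:R) ->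
  (forall eta, s ^+ 2 * dot eta eta <= \sum_j dot (a j) eta ^+ 2) ->
  mean (fun w : signs J => (dot (\sum_j sgb (w j) *: a j - y)
     (\sum_j sgb (w j) *: a j - y) <= rho ^+ 2 * k%:R)%R%:R) ^+ 8 <=
  expR (8 * k%:R) * ((1 + 2 * s ^+ 2 / rho ^+ 2) ^+ k)^-1.
Proof.
move=> rho0 s0 kmm mm0 emm smm small asp.
have mR : 0 < mm%:R :> R by rewrite ltr0n.
pose q := Num.sqrt mm%:R : R.
have q0 : 0 < q by rewrite sqrtr_gt0.
have q2 : q ^+ 2 = mm%:R by rewrite sqr_sqrtr// ltW.
pose t := (rho * q)^-1.
have t0 : 0 < t by rewrite invr_gt0 mulr_gt0.
have t2 : t ^+ 2 = (rho ^+ 2 * mm%:R)^-1 by rewrite exprVn exprMn q2.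
pose S (w : signs J) := \sum_j sgb (w j) *: a j.
pose kap (v : 'rV[R]_k) := \prod_(i < k) cos (t * v 0 i) ^+ mm.
pose H (e : signs ('I_k * 'I_mm)%type) : 'rV[R]_k := \row_i \sum_b sgb (e (i, b)).
have kap_ge0 v : 0 <= kap v by apply: prodr_ge0 => i _; rewrite exprn_even_ge0.
(* Each factor [cos(t v_i)^mm] is the characteristic function of a sum of [mm] signs, so [kap]
   averages characters with random integer frequencies [H e], of coordinates at most [mm]. *)
have kapE v : kap v = mean (fun e => cos (t * dot v (H e))).
  transitivity (mean (fun e : signs ('I_k * 'I_mm)%type =>
      cos (0 + \sum_p sgb (e p) * (t * v 0 p.1)))).
    rewrite mean_cos cos0 mul1r -(pair_bigA _ (fun i _ => cos (t * v 0 i)))/=.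
    by apply: eq_bigr => i _; rewrite prodr_const card_ord.
  apply: eq_mean => e; rewrite add0r; congr cos.
  transitivity (\sum_i \sum_b sgb (e (i, b)) * (t * v 0 i)).
    by rewrite pair_bigA/=; apply: eq_bigr => -[].
  by rewrite /dot mulr_sumr; apply: eq_bigr => i _; rewrite mxE -mulr_suml; ring.
have kap_ball v : dot v v <= rho ^+ 2 * k%:R -> expR (- k%:R) <= kap v.
  move=> vk.
  have tv : t ^+ 2 * mm%:R * dot v v <= k%:R.
    have -> : t ^+ 2 * mm%:R * dot v v = dot v v / rho ^+ 2.
      by rewrite t2; field; rewrite !gt_eqF.
    by rewrite ler_pdivrMr ?exprn_gt0// mulrC.
  have tv1 i : `|t * v 0 i| <= 1.
    rewrite -(@expr_le1 _ 2)// real_normK ?num_real// exprMn.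
    have vi : v 0 i ^+ 2 <= dot v v.
      by rewrite -nrm2 -real_normK ?num_real// lerXn2r ?nnegrE ?nrm_ge0// coord_le_nrm.
    have h1 : t ^+ 2 * v 0 i ^+ 2 <= t ^+ 2 * dot v v by rewrite ler_wpM2l// sqr_ge0.
    apply: (le_trans h1).
    rewrite -(ler_pM2r mR) mul1r mulrAC (le_trans tv)// ler_nat//.
  apply: (@le_trans _ _ (\prod_(i < k) expR (- (t * v 0 i) ^+ 2) ^+ mm)).
    under [in leRHS]eq_bigr do rewrite -expRM_natl.
    rewrite -expR_sum ler_expR -mulr_sumr sumrN mulrN lerN2.
    apply: le_trans tv; rewrite le_eqVlt; apply/orP; left; apply/eqP.
    rewrite /dot mulr_sumr mulr_sumr; apply: eq_bigr => i _; ring.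
  by apply: ler_prod => i _; rewrite exprn_ge0 ?expR_ge0//= lerXn2r ?nnegrE ?expR_ge0//
    ?(le_trans (expR_ge0 _) (expRN_le_cos (tv1 i))) ?expRN_le_cos.
have Hcoord e i : `|H e 0 i| <= mm%:R.
  rewrite mxE; apply: (le_trans (ler_norm_sum _ _ _)).
  under eq_bigr do rewrite norm_sgb.
  by rewrite sumr_const card_ord.
(* The decay [cos_le] of the cosine needs arguments in [[-1, 1]]; this is why the vectors [a j] have
   to be short. *)
have aH e j : `|t * dot (a j) (H e)| <= 1.
  rewrite normrM (gtr0_norm t0) mulrC ler_pdivrMr ?mulr_gt0// mul1r.
  apply: le_trans (small j); rewrite /dot.
  apply: (le_trans (ler_norm_sum _ _ _)).
  apply: (@le_trans _ _ (\sum_(i < k) nrm (a j) * mm%:R)).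
    by apply: ler_sum => i _; rewrite normrM ler_pM// coord_le_nrm.
  by rewrite sumr_const card_ord -[_ *+ k]mulr_natr mulrAC.
pose b := t ^+ 2 * s ^+ 2 / 4.
have b01 : 0 <= b <= 1 / 8.
  have bE : b = (rho ^+ 2 * mm%:R)^-1 * s ^+ 2 / 4 by rewrite /b t2.
  have : (rho ^+ 2 * mm%:R)^-1 * s ^+ 2 <= 1 / 2.
    by rewrite ler_pdivrMl ?mulr_gt0 ?exprn_gt0//; lra.
  have : 0 <= (rho ^+ 2 * mm%:R)^-1 * s ^+ 2.
    by rewrite mulr_ge0 ?sqr_ge0// invr_ge0 mulr_ge0 ?sqr_ge0.
  by rewrite bE => h1 h2; apply/andP; split; lra.
(* The mean over [w] factors into a product of cosines. The phase due to [y] costs nothing, and the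
   lower bound on [\sum_j dot (a j) eta ^+ 2] at [eta = H e] gives Gaussian decay in the
   frequency. *)
have step e : mean (fun w => cos (t * dot (S w - y) (H e))) <=
    expR (- (b * dot (H e) (H e))).
  under eq_mean => w.
    rewrite (_ : t * _ = - (t * dot y (H e)) + \sum_j sgb (w j) * (t * dot (a j) (H e))); last first.
      rewrite dotBl dot_suml mulrBr addrC; congr (_ + _).
      by rewrite mulr_sumr; apply: eq_bigr => j _; rewrite dotZl; ring.
    over.
  rewrite mean_cos; apply: (le_trans (ler_norm _)); rewrite normrM normr_prod.
  apply: (@le_trans _ _ (\prod_j `|cos (t * dot (a j) (H e))|)).
    by rewrite ler_piMl ?cos_max// prodr_ge0.
  apply: (@le_trans _ _ (\prod_j expR (- ((t * dot (a j) (H e)) ^+ 2 / 4)))).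
    by apply: ler_prod => j _; rewrite normr_ge0/= cos_le.
  rewrite -expR_sum ler_expR sumrN lerN2.
  have := asp (H e); move=> /(ler_wpM2l (_ : 0 <= t ^+ 2 / 4)).
  move=> /(_ ltac:(by rewrite divr_ge0 ?sqr_ge0)) h.
  rewrite /b (le_trans _ (le_trans h _))//; first by rewrite le_eqVlt; apply/orP; left; apply/eqP; field.
  rewrite mulr_sumr le_eqVlt; apply/orP; left; apply/eqP.
  by apply: eq_bigr => j _; field.
pose M1 := mean (fun e : signs 'I_mm => expR (- (b * (\sum_i sgb (e i)) ^+ 2))).
have M1_8 : M1 ^+ 8 <= (1 + 2 * s ^+ 2 / rho ^+ 2)^-1.
  apply: (le_trans (mean_expRN_sqr mm b01)).
  rewrite le_eqVlt; apply/orP; left; apply/eqP; congr (_ ^-1); rewrite /b t2.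
  by field; rewrite !gt_eqF.
set ind := fun w : signs J => _.
have main : expR (- k%:R) * mean ind <= M1 ^+ k.
  rewrite -meanZ; apply: (@le_trans _ _ (mean (fun w => kap (S w - y)))).
    apply: ler_mean => w; rewrite /ind; case: (leP (dot _ _)) => [h|_].
      by rewrite mulr1 kap_ball.
    by rewrite mulr0.
  under eq_mean do rewrite kapE.
  rewrite mean_exchange; apply: (le_trans (ler_mean step)).
  rewrite mean_curry.
  under eq_mean => f.
    rewrite (_ : expR _ = \prod_(i < k) expR (- (b * (\sum_l sgb (f i l)) ^+ 2))); last first.
      rewrite -expR_sum sumrN -mulr_sumr; congr (expR (- (_ * _))).
      apply: eq_bigr => i _; rewrite !mxE expr2.
      by congr (_ * _); apply: eq_bigr => l _; rewrite ffunE.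
    over.
  rewrite (mean_prod_rows (fun _ f => expR (- (b * (\sum_l sgb (f l)) ^+ 2)))).
  by rewrite prodr_const card_ord.
have M10 : 0 <= M1 by apply: mean_ge0 => e; exact: expR_ge0.
have ind0 : 0 <= mean ind by apply: mean_ge0 => w; rewrite /ind.
have : (expR (- k%:R) * mean ind) ^+ 8 <= (M1 ^+ k) ^+ 8.
  by rewrite lerXn2r ?nnegrE ?(mulr_ge0 (expR_ge0 _) ind0) ?(exprn_ge0 _ M10).
rewrite exprMn -expRM_natl mulrN expRN ler_pdivrMl ?expR_gt0// => h.
apply: (le_trans h); rewrite ler_wpM2l ?expR_ge0// exprAC -exprVn lerXn2r ?nnegrE//.
  by rewrite exprn_ge0.
by rewrite invr_ge0 addr_ge0// divr_ge0 ?sqr_ge0// mulr_ge0 ?sqr_ge0.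
Qed.

End SignSums.

(** * Concentration of convex functions on the cube *)

Section SplitHead.
Local Open Scope classical_set_scope.
Variable R : realType.
Local Notation mean := (@mean R).

Definition fcons (T : Type) (n : nat) (b : T) (e : {ffun 'I_n -> T}) : {ffun 'I_n.+1 -> T} :=
  [ffun i => oapp e b (unlift ord0 i)].

Lemma fcons0 (T : Type) n (b : T) (e : {ffun 'I_n -> T}) : fcons b e ord0 = b.
Proof. by rewrite ffunE unlift_none. Qed.

Lemma fconsS (T : Type) n (b : T) (e : {ffun 'I_n -> T}) i : fcons b e (lift ord0 i) = e i.
Proof. by rewrite ffunE liftK. Qed.

Lemma fcons_bij (T : finType) n :
  bijective (fun p : T * {ffun 'I_n -> T} => fcons p.1 p.2).
Proof.
exists (fun f : {ffun 'I_n.+1 -> T} => (f ord0, [ffun i => f (lift ord0 i)])).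
  by move=> [b e] /=; rewrite fcons0; congr (_, _); apply/ffunP => i; rewrite ffunE fconsS.
move=> f; apply/ffunP => i /=.
by case: (unliftP ord0 i) => [j ->|->]; rewrite ?fcons0// fconsS ffunE.
Qed.

Lemma mean_fcons n (F : signs 'I_n.+1 -> R) :
  mean F = (mean (fun e => F (fcons true e)) + mean (fun e => F (fcons false e))) / 2.
Proof.
rewrite (mean_reindex _ (fcons_bij bool n)) mean_pair.
by rewrite {1}/mean card_bool big_bool mulrC.
Qed.

End SplitHead.

Section Concentration.
Local Open Scope classical_set_scope.
Variable R : realType.
Local Notation mean := (@mean R).
Local Notation sgb := (@sgb R).

Definition cvx n (F : 'rV[R]_n -> R) : Prop := forall t x y, 0 <= t <= 1 ->
  F ((1 - t) *: x + t *: y) <= (1 - t) * F x + t * F y.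

Definition signvec n (e : signs 'I_n) : 'rV[R]_n := \row_i sgb (e i).

Definition rcons1 n (a : R) (x : 'rV[R]_n) : 'rV[R]_n.+1 :=
  \row_i oapp (fun j => x 0 j) a (unlift ord0 i).

Lemma dot_rcons1 n a b (x y : 'rV[R]_n) :
  dot (rcons1 a x) (rcons1 b y) = a * b + dot x y.
Proof.
rewrite /dot big_ord_recl !mxE unlift_none/=; congr (_ + _).
by apply: eq_bigr => i _; rewrite !mxE liftK.
Qed.

Lemma rcons1_lin n a b s t (x y : 'rV[R]_n) :
  s *: rcons1 a x + t *: rcons1 b y = rcons1 (s * a + t * b) (s *: x + t *: y).
Proof.
by apply/rowP => i; rewrite !mxE; case: unliftP => [j _|_]; rewrite /= ?mxE.
Qed.

Lemma signvec_fcons n b (e : signs 'I_n) :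
  signvec (fcons b e) = rcons1 (sgb b) (signvec e).
Proof.
by apply/rowP => i; rewrite !mxE ffunE; case: unliftP => [j _|_]; rewrite //= mxE.
Qed.

Lemma expR_conv (t a b : R) : 0 <= t <= 1 ->
  expR ((1 - t) * a + t * b) <= (1 - t) * expR a + t * expR b.
Proof.
move=> /andP[t0 t1]; set m := _ + _ * b.
have ge x : expR m * (1 + (x - m)) <= expR x.
  have -> : expR x = expR m * expR (x - m) by rewrite -expRD addrC subrK.
  by rewrite ler_wpM2l ?expR_ge0// expR_ge1Dx.
apply: (@le_trans _ _ ((1 - t) * (expR m * (1 + (a - m))) + t * (expR m * (1 + (b - m))))).
  by rewrite le_eqVlt /m; apply/orP; left; apply/eqP; ring.
by apply: lerD; rewrite ler_wpM2l// subr_ge0.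
Qed.

(** Hoelder's inequality in logarithmic form: after normalizing both exponential means to 1 it is
    the pointwise convexity of the exponential. *)
Lemma mean_expR_holder (T : finType) (A B : T -> R) (t u v : R) : (0 < #|T|)%N ->
  0 <= t <= 1 -> mean (fun x => expR (A x)) <= expR u ->
  mean (fun x => expR (B x)) <= expR v ->
  mean (fun x => expR ((1 - t) * A x + t * B x)) <= expR ((1 - t) * u + t * v).
Proof.
move=> T0 t01 Au Bv; have /andP[t0 t1] := t01.
set w := (1 - t) * u + t * v.
apply: (@le_trans _ _ (mean (fun x => expR w *
    ((1 - t) * (expR (- u) * expR (A x)) + t * (expR (- v) * expR (B x)))))).
  apply: ler_mean => x.
  have -> : (1 - t) * A x + t * B x =
      w + ((1 - t) * (- u + A x) + t * (- v + B x)) by rewrite /w; ring.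
  by rewrite expRD ler_wpM2l ?expR_ge0// -!expRD expR_conv.
rewrite meanZ meanD !meanZ -[leRHS]mulr1 ler_wpM2l ?expR_ge0//.
have h1 : expR (- u) * mean (fun x => expR (A x)) <= 1.
  by rewrite expRN ler_pdivrMl ?expR_gt0// mulr1.
have h2 : expR (- v) * mean (fun x => expR (B x)) <= 1.
  by rewrite expRN ler_pdivrMl ?expR_gt0// mulr1.
have := ler_wpM2l t0 h2; have t1' : 0 <= 1 - t by rewrite subr_ge0.
by have := ler_wpM2l t1' h1; lra.
Qed.

(** The one-coordinate step of [property_tau]. Moving a fraction [t] towards the other face of the
    cube costs [(2 t)^2 / 32 = t^2 / 8] and replaces [u] by a mean of [u] and [v]. *)
Lemma two_point (u v : R) : v <= u -> exists2 t, 0 <= t <= 1 &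
  (expR ((1 - t) * u + t * v + t ^+ 2 / 8) + expR v) * (expR (- u) + expR (- v)) <= 4.
Proof.
move=> vu; pose d := u - v; have d0 : 0 <= d by rewrite subr_ge0.
have E t : (expR ((1 - t) * u + t * v + t ^+ 2 / 8) + expR v) * (expR (- u) + expR (- v)) =
   expR (- (t * d - t ^+ 2 / 8)) * (1 + expR d) + expR (- d) + 1.
  rewrite mulrDl !mulrDr -!expRD addrA; congr (_ + _ + _ + _).
  - by rewrite mulr1; congr expR; rewrite /d; ring.
  - by congr expR; rewrite /d; ring.
  - by rewrite /d opprB addrC.
  - by rewrite subrr expR0.
have [d1|d1] := leP d (1 / 2).
  (* The fraction is taken proportional to the gap [d] while that stays within [[0, 1]]; for a
     larger gap the whole way is taken. *)
  exists (2 * d); first by lra.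
  rewrite E.
  have -> : 2 * d * d - (2 * d) ^+ 2 / 8 = 3 / 2 * d ^+ 2 by field.
  have d2 : 0 <= d ^+ 2 by exact: sqr_ge0.
  have h1 : expR (- (3 / 2 * d ^+ 2)) <= (1 + 3 / 2 * d ^+ 2)^-1.
    by rewrite expRN lef_pV2 ?posrE ?expR_gt0 ?expR_ge1Dx//; lra.
  have h2 : expR d <= 1 + d + 2 * d ^+ 2.
    have := expR_ge1Dx (- d) => h; have p : 0 < 1 - d by lra.
    apply: (@le_trans _ _ (1 - d)^-1).
      by rewrite -[expR d]invrK -expRN lef_pV2 ?posrE ?expR_gt0.
    rewrite -[leLHS]mul1r ler_pdivrMr//.
    have : 0 <= d ^+ 2 * (1 - 2 * d) by rewrite mulr_ge0//; lra.
    have -> : (1 + d + 2 * d ^+ 2) * (1 - d) = 1 + d ^+ 2 * (1 - 2 * d) by ring.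
    lra.
  have h3 : expR (- d) <= 1 - d + d ^+ 2.
    rewrite expRN -[leLHS]mul1r ler_pdivrMr ?expR_gt0//.
    have p : 0 <= 1 - d + d ^+ 2 by lra.
    apply: le_trans (ler_wpM2l p (expR_ge1Dx d)).
    have : 0 <= d ^+ 2 * d by rewrite mulr_ge0.
    have -> : (1 - d + d ^+ 2) * (1 + d) = 1 + d ^+ 2 * d by ring.
    lra.
  have p : 0 < 1 + 3 / 2 * d ^+ 2 by lra.
  have e1 : 0 <= 1 + expR d by rewrite addr_ge0// expR_ge0.
  have i0 : 0 <= (1 + 3 / 2 * d ^+ 2)^-1 by rewrite invr_ge0 ltW.
  have h4 : expR (- (3 / 2 * d ^+ 2)) * (1 + expR d) <= 2 + d - d ^+ 2.
    apply: (le_trans (ler_wpM2r e1 h1)).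
    rewrite mulrC ler_pdivrMr//; apply: (@le_trans _ _ (2 + d + 2 * d ^+ 2)); first lra.
    have : 0 <= d ^+ 2 * (d * (1 - d)) by rewrite mulr_ge0// mulr_ge0//; lra.
    have -> : (2 + d - d ^+ 2) * (1 + 3 / 2 * d ^+ 2) =
       2 + d + 2 * d ^+ 2 + 3 / 2 * (d ^+ 2 * (d * (1 - d))) by field.
    lra.
  lra.
exists 1; first by rewrite ler01 lexx.
rewrite E (_ : 1 * d - 1 ^+ 2 / 8 = d - 1 / 8); last by field.
have -> : expR (- (d - 1 / 8)) * (1 + expR d) = expR (1 / 8) * (1 + expR (- d)).
  by rewrite !mulrDr -!expRD !mulr1 addrC; congr (expR _ + expR _); ring.
have h1 : expR (1 / 8) <= 8 / 7 :> R.
  rewrite -[expR _]invrK -expRN -[leRHS]invrK lef_pV2 ?posrE ?expR_gt0 ?invr_gt0 ?divr_gt0//.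
  by have := expR_ge1Dx (- (1 / 8) : R); lra.
have h2 : expR (- d) <= 2 / 3.
  rewrite expRN -[leRHS]invrK lef_pV2 ?posrE ?expR_gt0 ?invr_gt0 ?divr_gt0//.
  by have := expR_ge1Dx d; lra.
have e0 := expR_ge0 (- d).
have : expR (1 / 8) * (1 + expR (- d)) <= 8 / 7 * (1 + expR (- d)).
  by rewrite ler_wpM2r// addr_ge0.
lra.
Qed.

Lemma dot_conv n t (p q : 'rV[R]_n) :
  dot ((1 - t) *: p + t *: q) ((1 - t) *: p + t *: q) =
  (1 - t) * dot p p + t * dot q q - t * (1 - t) * dot (p - q) (p - q).
Proof.
by rewrite !(dotBl, dotBr, dotDl, dotDr, dotZl, dotZr) (dotC q p); ring.
Qed.

(* Maurey's property (tau) for convex functions on the discrete cube. *)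
Lemma property_tau n (F G : 'rV[R]_n -> R) :
  cvx F -> (forall x, 0 <= F x) ->
  (forall x y, G x <= F y + dot (x - y) (x - y) / 32) ->
  mean (fun e => expR (G (signvec e))) * mean (fun e => expR (- F (signvec e))) <= 1.
Proof.
elim: n F G => [|n IH] F G cF F0 GF.
  have E (f : 'rV[R]_0 -> R) : mean (fun e => f (signvec e)) = f 0.
    rewrite -[RHS](mean_cst _ (card_signs_gt0 'I_0)); apply: eq_mean => e.
    by congr f; apply/rowP => -[].
  rewrite (E (fun x => expR (G x))) (E (fun x => expR (- F x))) -expRD.
  by rewrite -expR0 ler_expR; have := GF 0 0; rewrite subrr dot0l; lra.
pose Fb b x := F (rcons1 (sgb b) x).
pose Gb b x := G (rcons1 (sgb b) x).
have cFb b : cvx (Fb b).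
  move=> t x y t01; rewrite /Fb; apply: le_trans (cF t _ _ t01).
  by rewrite rcons1_lin -mulrDl subrK mul1r.
pose Qs b x := [set Fb b y + dot (x - y) (x - y) / 32 | y in [set: 'rV[R]_n]]%classic.
(* [Q b] is the infimal convolution of [F] on the face [b] with the quadratic cost; the induction
   hypothesis applies to it, and convexity of [F] bounds [G] by a mixture of the two faces. *)
pose Q b x := inf (Qs b x).
have Q0 b x y : 0 <= Fb b y + dot (x - y) (x - y) / 32.
  by rewrite addr_ge0 ?F0// divr_ge0 ?dot_ge0.
have QF b x y : Q b x <= Fb b y + dot (x - y) (x - y) / 32.
  apply: ge_inf; last by exists y.
  by exists 0 => _ [z _ <-].
have leQ b x (k c a : R) : 0 <= k ->
    (forall y, a <= k * (Fb b y + dot (x - y) (x - y) / 32) + c) -> a <= k * Q b x + c.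
  move=> k0; have [->|kn0] := eqVneq k 0 => H.
    by have := H 0; rewrite !mul0r.
  have {}k0 : 0 < k by rewrite lt_def kn0.
  rewrite -lerBlDr -ler_pdivrMl//; apply: lb_le_inf; first by exists (Fb b 0 + dot (x - 0) (x - 0) / 32), 0.
  by move=> _ [y _ <-]; rewrite ler_pdivrMl// lerBlDr.
pose u b := - ln (mean (fun e => expR (- Fb b (signvec e)))).
have uE b : mean (fun e => expR (- Fb b (signvec e))) = expR (- u b).
  rewrite opprK lnK// posrE /mean mulr_gt0 ?invr_gt0 ?ltr0n ?card_signs_gt0//.
  have /card_gt0P[e0 _] := card_signs_gt0 'I_n.
  rewrite (bigD1 e0)//= ltr_wpDr ?expR_gt0// sumr_ge0// => e _; exact: expR_ge0.
have IHQ b : mean (fun e => expR (Q b (signvec e))) <= expR (u b).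
  have := IH (Fb b) (Q b) (cFb b) (fun x => F0 _) (QF b).
  by rewrite uE expRN ler_pdivrMr ?expR_gt0// mul1r.
have Gt b t x : 0 <= t <= 1 ->
    Gb b x <= (1 - t) * Q b x + t * Q (~~ b) x + t ^+ 2 / 8.
  move=> t01; have /andP[t0 t1] := t01.
  have s0 : 0 <= 1 - t by rewrite subr_ge0.
  have key y z : Gb b x <= (1 - t) * (Fb b y + dot (x - y) (x - y) / 32) +
      (t * (Fb (~~ b) z + dot (x - z) (x - z) / 32) + t ^+ 2 / 8).
    pose w := (1 - t) *: rcons1 (sgb b) y + t *: rcons1 (sgb (~~ b)) z.
    apply: (le_trans (GF _ w)).
    have := cF t (rcons1 (sgb b) y) (rcons1 (sgb (~~ b)) z) t01.
    rewrite -/w -/(Fb b y) -/(Fb (~~ b) z) => Fw.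
    have sN : sgb (~~ b) = - sgb b.
      by case: (b) => /=; rewrite ?sgb_true ?sgb_false ?opprK.
    have -> : rcons1 (sgb b) x - w =
        rcons1 (2 * t * sgb b) ((1 - t) *: (x - y) + t *: (x - z)).
      rewrite /w rcons1_lin -scaleN1r -[rcons1 _ x]scale1r rcons1_lin sN.
      congr rcons1; first by ring.
      by apply/rowP => i; rewrite !mxE; ring.
    rewrite dot_rcons1.
    have -> : 2 * t * sgb b * (2 * t * sgb b) = 4 * t ^+ 2 * (sgb b * sgb b) by ring.
    rewrite sgb_sqr mulr1.
    have : 0 <= t * (1 - t) * dot ((x - y) - (x - z)) ((x - y) - (x - z)).
      by rewrite mulr_ge0 ?dot_ge0 ?mulr_ge0.
    by rewrite dot_conv; lra.
  have key2 z : Gb b x <= t * (Fb (~~ b) z + dot (x - z) (x - z) / 32) +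
      ((1 - t) * Q b x + t ^+ 2 / 8).
    by have := leQ b x _ _ _ s0 (fun y => key y z); lra.
  by have := leQ (~~ b) x _ _ _ t0 key2; lra.
have Gh b t : 0 <= t <= 1 -> mean (fun e => expR (Gb b (signvec e))) <=
    expR ((1 - t) * u b + t * u (~~ b) + t ^+ 2 / 8).
  move=> t01; rewrite expRD mulrC.
  apply: (@le_trans _ _ (expR (t ^+ 2 / 8) * mean (fun e =>
      expR ((1 - t) * Q b (signvec e) + t * Q (~~ b) (signvec e))))).
    rewrite -meanZ; apply: ler_mean => e; rewrite -expRD ler_expR addrC.
    exact: Gt.
  rewrite ler_wpM2l ?expR_ge0//; apply: mean_expR_holder => //; exact: card_signs_gt0.
have G1 b : mean (fun e => expR (Gb b (signvec e))) <= expR (u b).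
  have := Gh b 0; rewrite lexx ler01 => /(_ isT); rewrite subr0 mul1r mul0r expr0n/=.
  by rewrite mul0r !addr0.
rewrite !mean_fcons.
have EF b : mean (fun e => expR (- F (signvec (fcons b e)))) = expR (- u b).
  by rewrite -uE; apply: eq_mean => e; rewrite signvec_fcons.
pose g b := mean (fun e => expR (Gb b (signvec e))).
have EG b : mean (fun e => expR (G (signvec (fcons b e)))) = g b.
  by apply: eq_mean => e; rewrite signvec_fcons.
rewrite (EF true) (EF false) (EG true) (EG false).
suff : (g true + g false) * (expR (- u true) + expR (- u false)) <= 4.
  by move: (g true) (g false) (expR (- u true)) (expR (- u false)) => a b c d' h; lra.
have p0 : 0 <= expR (- u true) + expR (- u false) by rewrite addr_ge0 ?expR_ge0.
have [uu|/ltW uu] := leP (u false) (u true).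
  have [t t01 h] := two_point uu; apply: le_trans h; rewrite ler_wpM2r//.
  by apply: lerD; [exact: (Gh true)|exact: G1].
have [t t01 h] := two_point uu; apply: le_trans h; rewrite [X in _ <= _ * X]addrC.
by rewrite ler_wpM2r// addrC; apply: lerD; [exact: (Gh false)|exact: G1].
Qed.

(** The maximum of [a r - r^2 / 32] is [8 a^2], attained at [r = 16 a], so [F - 8 a^2] is admissible
    for [property_tau]. Jensen's inequality bounds the mean of [exp(- F)] below. *)
Lemma concentration n (F : 'rV[R]_n -> R) (a : R) :
  cvx F -> (forall x, 0 <= F x) ->
  (forall x y, F x - F y <= a * nrm (x - y)) ->
  mean (fun e => expR (F (signvec e))) <=
  expR (8 * a ^+ 2 + mean (fun e => F (signvec e))).
Proof.
move=> cF F0 aF.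
have := @property_tau n F (fun x => F x - 8 * a ^+ 2) cF F0.
have GF x y : F x - 8 * a ^+ 2 <= F y + dot (x - y) (x - y) / 32.
  rewrite -nrm2; have := aF x y; set r := nrm _.
  have : 0 <= (r - 16 * a) ^+ 2 by exact: sqr_ge0.
  by rewrite sqrrB; lra.
move=> /(_ GF).
under eq_mean do rewrite expRD mulrC.
rewrite meanZ; set A := mean (fun e => expR (F _)); set m := mean (fun e => F _) => h.
have A0 : 0 <= A by apply: mean_ge0 => e; exact: expR_ge0.
have mF : expR (- m) <= mean (fun e => expR (- F (signvec e))).
  by rewrite -meanN; exact: expR_mean_le (card_signs_gt0 _).
rewrite -(ler_pM2l (expR_gt0 (- (8 * a ^+ 2 + m)))) -expRD addNr expR0.
apply: le_trans h; rewrite opprD expRD mulrAC ler_wpM2l// mulr_ge0 ?expR_ge0//.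
Qed.

(** With [l = k / D], the bound [y^k <= k^k exp(y)] at [y = l F] reduces moments to [concentration],
    whose exponent is at most [8 k + k]. *)
Lemma moment_concentration n (F : 'rV[R]_n -> R) (a D : R) (k : nat) :
  cvx F -> (forall x, 0 <= F x) -> 0 <= a ->
  (forall x y, F x - F y <= a * nrm (x - y)) -> 0 < D -> (0 < k)%N ->
  mean (fun e => F (signvec e)) <= D -> a * Num.sqrt k%:R <= D ->
  mean (fun e => F (signvec e) ^+ k) <= (expR 9 * D) ^+ k.
Proof.
move=> cF F0 a0 aF D0 k0 mD aD.
have kR : 0 < k%:R :> R by rewrite ltr0n.
pose l := k%:R / D; have l0 : 0 < l by rewrite divr_gt0.
have clF : cvx (fun x => l * F x).
  by move=> t x y t01; have := ler_wpM2l (ltW l0) (cF t x y t01); lra.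
have := @concentration n (fun x => l * F x) (l * a) clF.
have h1 x : 0 <= l * F x by rewrite mulr_ge0// ltW.
have h2 x y : l * F x - l * F y <= l * a * nrm (x - y).
  by rewrite -mulrBr -mulrA ler_wpM2l// ltW.
move=> /(_ h1 h2); rewrite meanZ => cc.
have lk : l * D = k%:R by rewrite /l divfK// gt_eqF.
have h3 : 8 * (l * a) ^+ 2 + l * mean (fun e => F (signvec e)) <= 9 * k%:R.
  have : l * mean (fun e => F (signvec e)) <= k%:R by rewrite -lk ler_wpM2l// ltW.
  have : (l * a * Num.sqrt k%:R) ^+ 2 <= k%:R ^+ 2.
    have p1 : l * a * Num.sqrt k%:R <= k%:R by rewrite -[leRHS]lk -mulrA ler_wpM2l// ltW.
    have p2 : 0 <= l * a * Num.sqrt k%:R by apply: mulr_ge0 (sqrtr_ge0 _); apply: mulr_ge0 (ltW l0) a0.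
    by rewrite lerXn2r ?nnegrE.
  rewrite exprMn sqr_sqrtr// expr2 [k%:R ^+ 2]expr2 ler_pM2r//.
  by rewrite -expr2; lra.
have kk (y : R) : 0 <= y -> y ^+ k <= k%:R ^+ k * expR y.
  move=> y0; have := expR_ge1Dxn k.-1 y0; rewrite prednK// => h.
  have f0 : 0 < k`!%:R :> R by rewrite ltr0n fact_gt0.
  have : y ^+ k / k`!%:R <= expR y by lra.
  rewrite ler_pdivrMr// => h'; apply: (le_trans h'); rewrite mulrC ler_wpM2r ?expR_ge0//.
  rewrite -natrX ler_nat; elim: (k) => // j IHj.
  rewrite factS expnS leq_mul//; apply: (leq_trans IHj).
  by case: (j) => // i; rewrite leq_exp2r.
apply: (@le_trans _ _ (mean (fun e => D ^+ k * expR (l * F (signvec e))))).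
  apply: ler_mean => e; rewrite -(ler_pM2l (exprn_gt0 k l0)) mulrA -!exprMn lk.
  exact: kk (h1 _).
rewrite meanZ exprMn mulrC ler_wpM2r ?exprn_ge0 ?(ltW D0)//.
by rewrite -expRM_natr; apply: (le_trans cc); rewrite ler_expR.
Qed.

End Concentration.

(** * Lattice points and mean width *)

Section Counting.
Variable R : realType.
Local Notation mean := (@mean R).
Local Notation sgb := (@sgb R).

Lemma expRN1_le : 2 * expR (-1) <= 1 :> R.
Proof.
rewrite expRN ler_pdivrMr ?expR_gt0// mul1r.
by have := expR_ge1Dx (1 : R); lra.
Qed.

Lemma sum_expRN_abs (M : nat) (x : R) : \sum_(t < M) expR (- `|t%:R - x|) <= 4.
Proof.
have e1 (y : R) : 2 * expR (y - 1) <= expR y.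
  rewrite expRD mulrCA -[leRHS]mulr1 ler_wpM2l ?expR_ge0//; exact: expRN1_le.
have low m : m%:R - 1 <= x -> \sum_(t < m) expR (- `|t%:R - x|) <= 2 * expR (m%:R - 1 - x).
  elim: m => [|m IH] mx; first by rewrite big_ord0 mulr_ge0 ?expR_ge0.
  rewrite big_ord_recr/= -[m.+1%:R]natr1 addrK; rewrite -[m.+1%:R]natr1 addrK in mx.
  apply: (le_trans (lerD (IH _) (lexx _))); first by lra.
  rewrite ler0_norm ?subr_le0// opprK.
  by have := e1 (m%:R - x); rewrite addrAC; lra.
have high m : x <= m%:R -> \sum_(t < m) expR (- `|t%:R - x|) <= 4 - 2 * expR (x - m%:R).
  elim: m => [|m IH] mx.
    rewrite big_ord0; have : expR (x - 0%:R) <= 1 by rewrite -[leRHS]expR0 ler_expR; lra.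
    lra.
  have [xm|xm] := leP x m%:R.
    rewrite big_ord_recr/=; apply: (le_trans (lerD (IH xm) (lexx _))).
    rewrite ger0_norm ?subr_ge0// opprB -[m.+1%:R]natr1.
    by have := e1 (x - m%:R); rewrite -addrA -opprD; lra.
  apply: (le_trans (low _ _)); first by rewrite -[m.+1%:R]natr1; lra.
  have : expR (x - m.+1%:R) <= 1 by rewrite -[leRHS]expR0 ler_expR; lra.
  have : expR (m.+1%:R - 1 - x) <= 1 by rewrite -[leRHS]expR0 ler_expR -[m.+1%:R]natr1; lra.
  lra.
have [xM|xM] := leP x M%:R.
  by apply: (le_trans (high _ xM)); have := expR_ge0 (x - M%:R); lra.
apply: (le_trans (low _ _)); first by lra.
by have : expR (M%:R - 1 - x) <= 1 by [rewrite -[leRHS]expR0 ler_expR; lra]; lra.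
Qed.

(* A set of lattice points is no larger than the exponential of its mean width:
   slicing along one coordinate, the two signs bound the slice at height [t] by
   [exp (A - t)] and [exp (B + t)], whose minimum is summable. *)
Lemma card_le_expR_mean (k M : nat) (S : {set {ffun 'I_k -> 'I_M}}) (H : signs 'I_k -> R) :
  (forall (e : signs 'I_k) a, a \in S -> \sum_j sgb (e j) * (a j)%:R <= H e) ->
  #|S|%:R <= 4 ^+ k * expR (mean H).
Proof.
elim: k S H => [|k IH] S H SH.
  rewrite expr0 mul1r; have : (#|S| <= 1)%N.
    by rewrite (leq_trans (max_card _))// card_ffun !card_ord expn0.
  rewrite leq_eqVlt ltnS leqn0 => /orP[/eqP S1|/eqP ->]; last exact: expR_ge0.
  have /cards1P[a Sa] : #|S| == 1%N by rewrite S1.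
  rewrite S1 -expR0 ler_expR -(mean_cst 0 (card_signs_gt0 'I_0)); apply: ler_mean => e.
  by have := SH e a; rewrite Sa inE eqxx big_ord0 => /(_ isT).
pose St (t : 'I_M) := [set a | fcons t a \in S].
have cS : #|S|%:R = \sum_t #|St t|%:R :> R.
  rewrite -natr_sum; congr (_%:R); rewrite -sum1_card.
  rewrite (reindex (fun p : 'I_M * {ffun 'I_k -> 'I_M} => fcons p.1 p.2))/=; last exact/onW_bij/fcons_bij.
  under [RHS]eq_bigr do rewrite -sum1_card.
  by rewrite pair_big_dep/=; apply: eq_bigl => -[t a]; rewrite inE.
pose Hb b e := H (fcons b e).
have bnd b t : #|St t|%:R <= 4 ^+ k * expR (mean (Hb b) - sgb b * t%:R).
  have -> : mean (Hb b) - sgb b * t%:R = mean (fun e => Hb b e + - (sgb b * t%:R)).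
    by rewrite meanD mean_cst// card_signs_gt0.
  apply: IH => e a; rewrite inE => aS; have := SH (fcons b e) _ aS.
  rewrite big_ord_recl !fcons0 => h; rewrite lerBrDl; apply: le_trans h.
  by rewrite lerD2l; apply: ler_sum => j _; rewrite !fconsS.
rewrite cS mean_fcons -/(Hb true) -/(Hb false).
set A := mean (Hb false); set B := mean (Hb true).
apply: (@le_trans _ _ (\sum_(t < M) 4 ^+ k * expR ((A + B) / 2) * expR (- `|t%:R - (A - B) / 2|))).
  apply: ler_sum => t _; rewrite -mulrA -expRD.
  have h1 := bnd false t; have h2 := bnd true t; rewrite sgb_false sgb_true in h1 h2.
  have [tx|tx] := leP ((A - B) / 2) t%:R.
    apply: (le_trans h1); rewrite ler_wpM2l ?exprn_ge0// ler_expR.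
    by rewrite ger0_norm ?subr_ge0// -/A; lra.
  apply: (le_trans h2); rewrite ler_wpM2l ?exprn_ge0// ler_expR.
  by rewrite ltr0_norm ?subr_lt0// -/B; lra.
rewrite -mulr_sumr exprS [B + A]addrC [4 * _]mulrC [leRHS]mulrAC.
by rewrite ler_wpM2l ?sum_expRN_abs// mulr_ge0 ?exprn_ge0 ?expR_ge0.
Qed.

(** Counting with the weight [exp(- |a - x|^2)] factors over the coordinates. In each of them
    [u^2 >= |u| - 1/4], and the factor 2 comes from [4 exp(1/4) <= exp 2]. *)
Lemma card_ball_le (k M : nat) (x : 'I_k -> R) (t : R) (S : {set {ffun 'I_k -> 'I_M}}) :
  (forall a, a \in S -> \sum_j ((a j)%:R - x j) ^+ 2 <= t * k%:R) ->
  #|S|%:R <= expR ((t + 2) * k%:R).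
Proof.
move=> St; have e2 : 4 * expR (1 / 4) <= expR 2 :> R.
  have h : 4 <= expR (4 * (7 / 16)) :> R.
    rewrite (_ : expR (4 * _) = expR (7 / 16) ^+ 4); last by rewrite -expRM_natl.
    apply: (@le_trans _ _ ((23 / 16) ^+ 4)); first lra.
    by rewrite lerXn2r ?nnegrE ?expR_ge0//; have := expR_ge1Dx (7 / 16 : R); lra.
  have -> : expR 2 = expR (4 * (7 / 16)) * expR (1 / 4) :> R.
    by rewrite -expRD; congr expR; field.
  by rewrite ler_wpM2r ?expR_ge0.
apply: (@le_trans _ _ (\sum_(a in S) expR (t * k%:R) * expR (- \sum_j ((a j)%:R - x j) ^+ 2))).
  rewrite -sum1_card natr_sum; apply: ler_sum => a aS.
  by rewrite -expRD -[leLHS]expR0 ler_expR subr_ge0 St.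
rewrite -mulr_sumr mulrDl expRD ler_wpM2l ?expR_ge0//.
apply: (@le_trans _ _ (\sum_(a : {ffun 'I_k -> 'I_M}) \prod_j (expR (1 / 4) * expR (- `|(a j)%:R - x j|)))).
  rewrite [leLHS]big_mkcond; apply: ler_sum => a _.
  case: ifP => _; last by apply: prodr_ge0 => j _; rewrite mulr_ge0 ?expR_ge0.
  rewrite -sumrN expR_sum; apply: ler_prod => j _; rewrite expR_ge0/= -expRD ler_expR.
  set u := _ - x j; have : 0 <= (`|u| - 1 / 2) ^+ 2 by exact: sqr_ge0.
  by rewrite sqrrB real_normK ?num_real//; lra.
rewrite -(bigA_distr_bigA (fun j (i : 'I_M) => expR (1 / 4) * expR (- `|i%:R - x j|))).
rewrite expRM_natr.
apply: (@le_trans _ _ (\prod_(j < k) expR 2)); last by rewrite prodr_const card_ord.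
apply: ler_prod => j _; rewrite sumr_ge0/=; last by move=> i _; rewrite mulr_ge0 ?expR_ge0.
rewrite -mulr_sumr; apply: le_trans e2; rewrite mulrC ler_wpM2r ?expR_ge0//.
exact: sum_expRN_abs.
Qed.

End Counting.

Local Open Scope classical_set_scope.

(** * Closed and compact sets of row vectors *)

Section Topology.
Variable R : realType.

Lemma continuous_bigsum (T : topologicalType) (I : Type) (r : seq I) (F : I -> T -> R) :
  (forall i, continuous (F i)) -> continuous (fun x => \sum_(i <- r) F i x).
Proof.
move=> cF; elim: r => [|i r IH] x.
  by under eq_fun do rewrite big_nil; exact: cvg_cst.
under eq_fun do rewrite big_cons.
by apply: cvgD; [exact: cF|exact: IH].
Qed.

Lemma continuous_mul (T : topologicalType) (f g : T -> R) :
  continuous f -> continuous g -> continuous (fun x => f x * g x).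
Proof. by move=> cf cg x; apply: cvgM; [exact: cf|exact: cg]. Qed.

Lemma continuous_add (T : topologicalType) (f g : T -> R) :
  continuous f -> continuous g -> continuous (fun x => f x + g x).
Proof. by move=> cf cg x; apply: cvgD; [exact: cf|exact: cg]. Qed.

Lemma continuous_coord n (j : 'I_n) : continuous (fun x : 'rV[R]_n => x 0 j).
Proof. exact: coord_continuous. Qed.

Lemma continuous_lincoord n m (L : 'M[R]_(n, m)) (j : 'I_m) :
  continuous (fun x : 'rV[R]_n => (x *m L) 0 j).
Proof.
rewrite (_ : (fun x => _) = (fun x : 'rV[R]_n => \sum_i x 0 i * L i j)).
  apply: (continuous_bigsum (F := fun i (x : 'rV[R]_n) => x 0 i * L i j)) => i.
  by apply: continuous_mul; [exact: coord_continuous|exact: cst_continuous].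
by apply/funext => x; rewrite mxE.
Qed.

Lemma continuous_dot n (v : 'rV[R]_n) : continuous (fun x : 'rV[R]_n => dot v x).
Proof.
apply: (continuous_bigsum (F := fun i (x : 'rV[R]_n) => v 0 i * x 0 i)) => i.
by apply: continuous_mul; [exact: cst_continuous|exact: coord_continuous].
Qed.

Lemma continuous_dist2 n m (L : 'M[R]_(n, m)) (z : 'rV[R]_m) :
  continuous (fun x : 'rV[R]_n => dot (x *m L - z) (x *m L - z)).
Proof.
apply: (continuous_bigsum (F := fun i (x : 'rV[R]_n) => (x *m L - z) 0 i * (x *m L - z) 0 i)).
have cz i : continuous (fun x : 'rV[R]_n => (x *m L - z) 0 i).
  rewrite (_ : (fun x => _) = (fun x : 'rV[R]_n => (x *m L) 0 i - z 0 i)).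
    by apply: continuous_add; [exact: continuous_lincoord|exact: cst_continuous].
  by apply/funext => x; rewrite !mxE.
by move=> i; apply: continuous_mul; exact: cz.
Qed.

Lemma open_measurable_rV n (U : set 'rV[R]_n) : open U ->
  measurable (U : set (borel_rV R n)).
Proof. by move=> oU; exact: sub_sigma_algebra. Qed.

Lemma closed_measurable_rV n (A : set 'rV[R]_n) : closed A ->
  measurable (A : set (borel_rV R n)).
Proof.
move=> cA; rewrite -(setCK A); apply: measurableC; apply: open_measurable_rV.
exact: closed_openC.
Qed.

Lemma continuous_measurable_rV n (f : 'rV[R]_n -> R) : continuous f ->
  measurable_fun setT (f : borel_rV R n -> R).
Proof.
move=> /continuousP cf; apply: (measurability _ (measurable_realfun.RGenOpens.measurableE R)).
move=> _ [_ [a [b ->] <-]]; rewrite setTI; apply: open_measurable_rV.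
exact/cf/interval_open.
Qed.

Lemma closed_le (T : topologicalType) (f : T -> R) (a : R) : continuous f ->
  closed [set x | f x <= a].
Proof.
move=> cf; rewrite (_ : [set x | _] = f @^-1` [set y | y <= a])//.
by apply: closed_comp; [move=> x _; exact: cf|exact: closed_le].
Qed.

Lemma closed_ge (T : topologicalType) (f : T -> R) (a : R) : continuous f ->
  closed [set x | a <= f x].
Proof.
move=> cf; rewrite (_ : [set x | _] = f @^-1` [set y | a <= y])//.
by apply: closed_comp; [move=> x _; exact: cf|exact: closed_ge].
Qed.

Definition cube n (a : R) : set 'rV[R]_n := [set x | forall j, `|x 0 j| <= a].

Lemma cube_compact n (a : R) : compact (@cube n a).
Proof.
have := @rV_compact R n (fun=> `[- a, a]%classic) (fun=> @segment_compact R (- a) a).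
congr compact; apply/seteqP; split => x /= h j; have := h j;
  by rewrite /= in_itv/= ler_norml.
Qed.

Lemma closed_bounded_compact n (A : set 'rV[R]_n) (a : R) :
  closed A -> (forall x, A x -> forall j, `|x 0 j| <= a) -> compact A.
Proof. by move=> cA Aa; apply: subclosed_compact cA (@cube_compact n a) Aa. Qed.

Lemma cube_cover n (x : 'rV[R]_n) : exists m : nat, cube m%:R x.
Proof.
exists (Num.bound (nrm x)) => j; apply: (le_trans (coord_le_nrm _ _)).
by rewrite ltW// archi_boundP// nrm_ge0.
Qed.

Lemma cube_mono n : nondecreasing_seq (fun m : nat => @cube n m%:R).
Proof.
move=> i j ij; rewrite subsetEset => x h l; apply: (le_trans (h l)).
by rewrite ler_nat.
Qed.

Lemma cube_closed n a : closed (@cube n a).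
Proof.
apply: compact_closed; [exact: norm_hausdorff|exact: cube_compact].
Qed.

Lemma sumset_compact n (A B : set 'rV[R]_n) (l : R) : compact A -> compact B ->
  compact [set (l *: a + (1 - l) *: b)%R | a in A & b in B].
Proof.
move=> cA cB.
have -> : [set (l *: a + (1 - l) *: b)%R | a in A & b in B] =
   (fun p : 'rV[R]_n * 'rV[R]_n => l *: p.1 + (1 - l) *: p.2) @` (A `*` B).
  apply/seteqP; split => [_ [a Aa [b Bb <-]]|_ [[a b] [/= Aa Bb] <-]].
    by exists (a, b).
  by exists a => //; exists b.
apply: continuous_compact; last exact: compact_setX.
apply: continuous_subspaceT => p; apply: cvgD.
  by apply: cvgZr; exact: cvg_fst.
by apply: cvgZr; exact: cvg_snd.
Qed.

End Topology.

(** * Log-concavity extended from compact to closed sets *)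

Section LogConcave.
Variables (R : realType) (n : nat) (mu : probability (borel_rV R n) R).
Hypothesis hlc : log_concave mu.
Local Open Scope ereal_scope.

Lemma mu_cube_lim (A : set 'rV[R]_n) (c : R) : closed A -> c%:E < mu A ->
  exists m : nat, c%:E < mu (A `&` @cube R n m%:R).
Proof.
move=> cA cmu.
have mF m : measurable (A `&` @cube R n m%:R : set (borel_rV R n)).
  by apply: closed_measurable_rV; apply: closedI => //; exact: cube_closed.
have AU : \bigcup_m (A `&` @cube R n m%:R) = A.
  rewrite -setI_bigcupr; apply/setIidPl => x _.
  by have [m xm] := cube_cover x; exists m.
have := @nondecreasing_cvg_mu _ _ _ mu (fun m => A `&` @cube R n m%:R : set (borel_rV R n)) mF.
rewrite AU => /(_ (closed_measurable_rV cA)).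
have nd : nondecreasing_seq (fun m => A `&` @cube R n m%:R : set (borel_rV R n)).
  by move=> i j ij; rewrite subsetEset; apply: setIS; rewrite -subsetEset; exact: cube_mono.
move=> /(_ nd) cv; apply: contrapT => /forallNP H.
have : mu A <= c%:E.
  by apply: cvge_le cv; apply: nearW => m; rewrite leNgt; apply/negP; exact: H.
by rewrite leNgt cmu.
Qed.

(** The sets used below are cylinders, closed but unbounded. They are exhausted by compact parts at
    the price of an arbitrarily small [eps] in the exponents; the containing set [C] spares the
    measurability of the Minkowski combination. *)
Lemma log_concave_expR (A B C : set 'rV[R]_n) (al be l : R) :
  closed A -> closed B -> closed C -> (0 < l < 1)%R ->
  (expR (- al))%:E <= mu A -> (expR (- be))%:E <= mu B ->
  (forall a b, A a -> B b -> C (l *: a + (1 - l) *: b)%R) ->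
  (expR (- (l * al + (1 - l) * be)))%:E <= mu C.
Proof.
move=> cA cB cC l01 alA beB ABC; have /andP[l0 l1] := l01.
have l1' : (0 < 1 - l)%R by rewrite subr_gt0.
have key (eps : R) : (0 < eps)%R ->
   (expR (- (l * (al + eps) + (1 - l) * (be + eps))))%:E <= mu C.
  move=> e0.
  have lt_e (x : R) : (expR (- (x + eps)) < expR (- x))%R by rewrite ltr_expR; lra.
  have lt_eE (x : R) : (expR (- (x + eps)))%:E < (expR (- x))%:E by rewrite lte_fin.
  have [i iA] := mu_cube_lim cA (lt_le_trans (lt_eE al) alA).
  have [j jB] := mu_cube_lim cB (lt_le_trans (lt_eE be) beB).
  have coA : compact (A `&` @cube R n i%:R).
    by apply: (subclosed_compact _ (@cube_compact R n i%:R)) => //; apply: closedI => //; exact: cube_closed.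
  have coB : compact (B `&` @cube R n j%:R).
    by apply: (subclosed_compact _ (@cube_compact R n j%:R)) => //; apply: closedI => //; exact: cube_closed.
  have := hlc coA coB l01.
  set S := [set _ | _ in _ & _ in _] => SS.
  have coS : compact S by exact: sumset_compact.
  apply: le_trans (le_trans SS _); last first.
    apply: le_measure; rewrite ?inE.
    - by apply: closed_measurable_rV; apply: compact_closed; [exact: norm_hausdorff|].
    - exact: closed_measurable_rV.
    - by move=> _ [a [Aa _] [b [Bb _] <-]]; exact: ABC.
  have pw (x t : R) : (expR (- x))%:E `^ t = (expR (- (t * x)))%:E.
    by rewrite poweR_EFin -expRM mulNr mulrC.
  rewrite opprD expRD EFinM -(pw (al + eps)%R l) -(pw (be + eps)%R (1 - l)%R); apply: lee_pmul.
  - exact: poweR_ge0.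
  - exact: poweR_ge0.
  - by apply: gt0_ler_poweR; rewrite ?in_itv/= ?leey ?lee_fin ?expR_ge0 ?measure_ge0//= ltW.
  - by apply: gt0_ler_poweR; rewrite ?in_itv/= ?leey ?lee_fin ?expR_ge0 ?measure_ge0//= ltW.
rewrite leNgt; apply/negP => lt.
have fC : mu C \is a fin_num by rewrite fin_num_measure//; exact: closed_measurable_rV.
move: lt key; rewrite -(fineK fC); set c := fine _; rewrite lte_fin.
set x := (l * al + (1 - l) * be)%R => lt key.
have c0 : (0 < c)%R.
  by have := key 1%R ltr01; rewrite lee_fin; apply: lt_le_trans; exact: expR_gt0.
have lnc : (ln c < - x)%R by rewrite -(expRK (- x)%R) ltr_ln ?posrE ?expR_gt0.
have e0 : (0 < (- x - ln c) / 2)%R by rewrite divr_gt0// subr_gt0.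
have := key _ e0; rewrite lee_fin => k1.
have : (expR (- (l * (al + (- x - ln c) / 2) + (1 - l) * (be + (- x - ln c) / 2))) <=
   expR (ln c))%R by rewrite lnK ?posrE.
by rewrite ler_expR; rewrite /x in lnc *; lra.
Qed.

End LogConcave.

(** * Covering the body of p-th marginals *)

Lemma continuous_absr (R : realType) (T : topologicalType) (f : T -> R) :
  continuous f -> continuous (fun x => `|f x|).
Proof. by move=> cf x; apply: cvg_norm; exact: cf. Qed.

Lemma continuous_expRf (R : realType) (T : topologicalType) (f : T -> R) :
  continuous f -> continuous (fun x => expR (f x)).
Proof. by move=> cf x; apply: (@continuous_comp _ _ _ f expR); [exact: cf|exact: continuous_expR]. Qed.

Section StepIntegral.
Variables (R : realType) (d : measure_display) (T : measurableType d).
Variable mu : probability T R.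
Variables (I : finType) (A : I -> set T).
Hypothesis mA : forall i, measurable (A i).

Lemma integral_cst_prob (c : R) : (\int[mu]_x c%:E = c%:E)%E.
Proof.
have -> : (\int[mu]_x c%:E = c%:E * mu setT)%E by exact: (integral_cst mu measurableT c%:E).
by rewrite (@probability_setT _ _ _ mu) mule1.
Qed.

Lemma measurable_step (w : I -> R) (c : R) :
  measurable_fun setT (fun x => c + \sum_i w i * \1_(A i) x).
Proof.
apply: measurable_funD => //.
apply: (@measurable_sum _ _ _ _ _ _ (fun i x => w i * \1_(A i) x)) => i.
by apply: measurable_funM => //; exact: measurable_indic.
Qed.

Lemma integral_step (w : I -> R) (c : R) : 0 <= c -> (forall i, 0 <= w i) ->
  (\int[mu]_x (c + \sum_i w i * \1_(A i) x)%:E = (c + \sum_i w i * fine (mu (A i)))%:E)%E.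
Proof.
move=> c0 w0; under eq_integral do rewrite EFinD -sumEFin.
have mw i : measurable_fun setT (fun x : T => (w i * \1_(A i) x)%:E : \bar R).
  by apply/measurable_EFinP; apply: measurable_funM => //; exact: measurable_indic.
have w0' i x : (0 <= (w i * \1_(A i) x)%:E)%E.
  by rewrite lee_fin mulr_ge0// indicE ler0n.
rewrite ge0_integralD//; last 2 first.
- by move=> x _; apply: sume_ge0.
- by apply: emeasurable_sum.
rewrite integral_cst_prob.
rewrite ge0_integral_sum// EFinD -sumEFin; congr (_ + _)%E; apply: eq_bigr => i _.
under eq_integral do rewrite EFinM.
rewrite ge0_integralZl_EFin//; last first.
  by apply/measurable_EFinP; exact: measurable_indic.
by rewrite integral_indic// setIT EFinM fineK// fin_num_measure.
Qed.

Lemma integral_le_step (D : set T) (f : T -> R) (w : I -> R) (c : R) :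
  measurable D -> measurable_fun setT f -> (forall x, 0 <= f x) ->
  0 <= c -> (forall i, 0 <= w i) ->
  (forall x, D x -> f x <= c + \sum_i w i * \1_(A i) x) ->
  (\int[mu]_(x in D) (f x)%:E <= (c + \sum_i w i * fine (mu (A i)))%:E)%E.
Proof.
move=> mD mf f0 c0 w0 fle; rewrite -integral_step//.
have g0 x : 0 <= c + \sum_i w i * \1_(A i) x.
  by rewrite addr_ge0// sumr_ge0// => i _; rewrite mulr_ge0// indicE ler0n.
apply: (@le_trans _ _ (\int[mu]_(x in D) (c + \sum_i w i * \1_(A i) x)%:E)%E).
  apply: ge0_le_integral => //.
  - by move=> x _; rewrite lee_fin.
  - by apply/measurable_EFinP; exact: measurable_funS mf.
  - by apply/measurable_EFinP; apply: (measurable_funS measurableT _ (measurable_step w c)).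
apply: ge0_subset_integral => //; last by move=> x _; rewrite lee_fin.
by apply/measurable_EFinP; exact: measurable_step.
Qed.

Lemma sum_measure_le (c : R) : 0 <= c -> (forall x, \sum_i \1_(A i) x <= c) ->
  \sum_i fine (mu (A i)) <= c.
Proof.
move=> c0 h; rewrite -lee_fin.
have := @integral_step (fun=> 1) 0 (lexx 0) (fun=> ler01).
rewrite add0r; under [in X in _ = X -> _]eq_bigr do rewrite mul1r.
move=> <-.
rewrite -[leRHS]integral_cst_prob.
apply: ge0_le_integral => //.
- by move=> x _; rewrite lee_fin add0r sumr_ge0// => i _; rewrite mul1r indicE ler0n.
- by apply/measurable_EFinP; exact: measurable_step.
move=> x _ /=; rewrite lee_fin add0r; apply: le_trans (h x).
by under eq_bigr do rewrite mul1r.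
Qed.

End StepIntegral.

Section Moments.
Variables (R : realType) (n : nat) (mu : probability (borel_rV R n) R).
Hypothesis hlc : log_concave mu.
Variables (k : nat) (L : 'M[R]_(n, k)).
Hypothesis k0 : (0 < k)%N.
Local Notation K := (k%:R : R).

Definition tube (z : 'rV[R]_k) : set 'rV[R]_n :=
  [set x | dot (x *m L - z) (x *m L - z) <= 4 * K].

(** A substitute for the density at [z] of the image of [mu] under [L]: the mass that the image
    gives to the ball of radius [2 sqrt k] about [z]. It inherits log-concavity from
    [log_concave_expR]. *)
Definition rho (z : 'rV[R]_k) : R := fine (mu (tube z)).

Hypothesis hcenter : ((3 / 4)%:E <= mu [set x | (dot (x *m L) (x *m L) <= K)%R])%E.

Lemma tube_closed z : closed (tube z).
Proof. by apply: closed_le; exact: continuous_dist2. Qed.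

Lemma tube_measurable z : measurable (tube z : set (borel_rV R n)).
Proof. by apply: closed_measurable_rV; exact: tube_closed. Qed.

Lemma rhoE z : mu (tube z) = (rho z)%:E.
Proof. by rewrite fineK// fin_num_measure//; exact: tube_measurable. Qed.

Lemma rho_ge0 z : 0 <= rho z.
Proof. by rewrite -lee_fin -rhoE measure_ge0. Qed.

Lemma dot_tri (T : nat) (u v : 'rV[R]_T) (a b : R) : 0 <= a -> 0 <= b ->
  dot u u <= a ^+ 2 -> dot v v <= b ^+ 2 -> dot (u + v) (u + v) <= (a + b) ^+ 2.
Proof.
move=> a0 b0 ua vb; rewrite -nrm2 lerXn2r ?nnegrE ?nrm_ge0 ?addr_ge0//.
apply: (le_trans (nrmD _ _)); apply: lerD.
  by rewrite -ler_sqr ?nnegrE ?nrm_ge0// nrm2.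
by rewrite -ler_sqr ?nnegrE ?nrm_ge0// nrm2.
Qed.

Let sk := Num.sqrt K.
Let sk0 : 0 <= sk. Proof. exact: sqrtr_ge0. Qed.
Let sk2 : sk ^+ 2 = K. Proof. by rewrite sqr_sqrtr. Qed.
Lemma Kge1 : 1 <= K. Proof. by rewrite ler1n. Qed.

Lemma rho_near0 z : dot z z <= K -> 3 / 4 <= rho z.
Proof.
move=> zk; rewrite -lee_fin -rhoE; apply: (le_trans hcenter); apply: le_measure.
- rewrite inE; apply: closed_measurable_rV.
  rewrite (_ : [set x | _] = [set x | dot (x *m L - 0) (x *m L - 0) <= K]); last first.
    by apply/funext => x /=; rewrite subr0.
  by apply: closed_le; exact: continuous_dist2.
- by rewrite inE; exact: tube_measurable.
rewrite /tube => x /= xk; have -> : 4 * K = (sk + sk) ^+ 2.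
  by transitivity (4 * sk ^+ 2); [rewrite sk2|ring].
apply: dot_tri => //; first by rewrite sk2.
by rewrite dotNl dotNr opprK sk2.
Qed.

Lemma rho_log_concave z w al be l : 0 < l < 1 ->
  expR (- al) <= rho z -> expR (- be) <= rho w ->
  expR (- (l * al + (1 - l) * be)) <= rho (l *: z + (1 - l) *: w).
Proof.
move=> l01 za wb; have /andP[l0 l1] := l01; rewrite -lee_fin -rhoE.
apply: (@log_concave_expR R n mu hlc (tube z) (tube w) (tube (l *: z + (1 - l) *: w)) al be l) => //.
- exact: tube_closed.
- exact: tube_closed.
- exact: tube_closed.
- by rewrite rhoE lee_fin.
- by rewrite rhoE lee_fin.
rewrite /tube => a b /= az bw.
have -> : (l *: a + (1 - l) *: b) *m L - (l *: z + (1 - l) *: w) =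
    (1 - (1 - l)) *: (a *m L - z) + (1 - l) *: (b *m L - w).
  by rewrite mulmxDl -!scalemxAl; apply/rowP => i; rewrite !mxE; ring.
rewrite dot_conv; set p := dot (_ - z) _ in az *; set q := dot (_ - w) _ in bw *.
have := dot_ge0 ((a *m L - z) - (b *m L - w)); set r := dot _ _ => r0.
have h0 : 0 <= (1 - l) * (1 - (1 - l)) * r by rewrite !mulr_ge0//; lra.
have h1 : (1 - (1 - l)) * p <= (1 - (1 - l)) * (4 * K) by rewrite ler_wpM2l//; lra.
have h2 : (1 - l) * q <= (1 - l) * (4 * K) by rewrite ler_wpM2l//; lra.
lra.
Qed.

Lemma expRN13 : expR (- (1 / 2)) <= 3 / 4 :> R.
Proof.
rewrite expRN -[leRHS]invrK lef_pV2 ?posrE ?expR_gt0 ?invr_gt0 ?divr_gt0//.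
by have := expR_ge1Dx (1 / 2 : R); lra.
Qed.

(** A superlevel set of [rho], hence convex. The level is high enough for at most [exp(5 k)]
    disjoint tubes to be heavy, and low enough to leave room for [4 k + 1/2] in [rho_le_exp]. *)
Definition heavy z : Prop := expR (- (5 * K)) <= rho z.

Lemma heavy_near0 z : dot z z <= K -> heavy z.
Proof.
move=> zk; apply: le_trans (rho_near0 zk); apply: le_trans expRN13.
by rewrite ler_expR; have := Kge1; lra.
Qed.

Section Direction.
Variable xi : 'rV[R]_k.
Hypothesis hxi : forall z, heavy z -> `|dot xi z| <= K.

Lemma nrm_direction : nrm xi <= sk.
Proof.
have [->|xi0] := eqVneq xi 0; first by rewrite nrm0.
have nx : 0 < nrm xi by rewrite lt_def nrm_ge0 nrm_eq0 xi0.
have hv : heavy ((sk / nrm xi) *: xi).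
  apply: heavy_near0; rewrite dotZl dotZr -nrm2 -sk2.
  by rewrite le_eqVlt; apply/orP; left; apply/eqP; field; rewrite gt_eqF.
have := hxi hv; rewrite dotZr -nrm2 ger0_norm; last by rewrite mulr_ge0 ?sqr_ge0// divr_ge0// ltW.
have -> : sk / nrm xi * nrm xi ^+ 2 = sk * nrm xi by field; rewrite gt_eqF.
rewrite -sk2 expr2 ler_pM2l// lt_def sk0 andbT; apply/eqP => s0.
by have := Kge1; rewrite -sk2 s0 expr0n/= ler10.
Qed.

(** Otherwise log-concavity along the segment from 0, where [rho] is at least [3/4], produces a
    heavy point on which [xi] exceeds [k]. *)
Lemma rho_le_exp z : K < `|dot xi z| -> rho z <= expR (- (2 * `|dot xi z|)).
Proof.
move: (normr_ge0 (dot xi z)) (@hxi z); move Ew : `|dot xi z| => w wge0 hz Kw.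
have K1 := Kge1; rewrite leNgt; apply/negP => lt.
have [w2|w2] := lerP w (2 * K).
  have Hz : heavy z by rewrite /heavy; apply: le_trans (ltW lt); rewrite ler_expR; lra.
  by have := hz Hz; rewrite leNgt Kw.
(* The point [l *: z] has pairing of absolute value [2 k] with [xi], and its exponent
   [l (2 w) + (1 - l) / 2] is at most [4 k + 1/2 <= 5 k]. *)
pose l := 2 * K / w.
have w0 : 0 < w by lra.
have l0 : 0 < l by rewrite divr_gt0//; lra.
have l1 : l < 1 by rewrite ltr_pdivrMr// mul1r.
have lw : l * w = 2 * K by rewrite /l divfK// gt_eqF.
have h : heavy (l *: z).
  have := @rho_log_concave z 0 (2 * w) (1 / 2) l; rewrite l0 l1 scaler0 addr0 => /(_ isT (ltW lt)) hl.
  have r0 : expR (- (1 / 2)) <= rho 0.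
    by apply: le_trans expRN13 _; apply: rho_near0; rewrite dot0l ler0n.
  apply: le_trans (hl r0); rewrite ler_expR.
  have : (1 - l) * (1 / 2) <= 1 / 2 by lra.
  lra.
have := hxi h; rewrite dotZr normrM (gtr0_norm l0) Ew lw; lra.
Qed.

(** Log-concavity between 0 and [z] bounds [rho (z / 2)] below by about the square root of [rho z],
    and the other square root pays for the exponential by [rho_le_exp]. The right side can be summed
    over a lattice, since the halved tubes have bounded overlap. *)
Lemma exp_rho_half z : K < `|dot xi z| ->
  expR `|dot xi z| * rho z <= 2 * rho (2^-1 *: z).
Proof.
move=> Kw; have r1 := rho_le_exp Kw; move: Kw r1; move: `|dot xi z| => w Kw r1.
have K1 := Kge1.
have [r0|r0] := eqVneq (rho z) 0; first by rewrite r0 mulr0 mulr_ge0 ?rho_ge0.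
have rp : 0 < rho z by rewrite lt_def r0 rho_ge0.
pose al := - ln (rho z).
have rE : rho z = expR (- al) by rewrite opprK lnK.
have alw : 2 * w <= al by rewrite rE ler_expR in r1; lra.
have h2 : 0 < (2^-1 : R) < 1 by lra.
have c0 : expR (- (1 / 2)) <= rho 0.
  by apply: le_trans expRN13 _; apply: rho_near0; rewrite dot0l ler0n.
have := @rho_log_concave z 0 al (1 / 2) 2^-1 h2; rewrite -rE lexx scaler0 addr0.
move=> /(_ isT c0) h.
apply: (@le_trans _ _ (2 * expR (- (2^-1 * al + (1 - 2^-1) * (1 / 2))))); last by rewrite ler_pM2l.
rewrite rE -expRD.
have -> : - (2^-1 * al + (1 - 2^-1) * (1 / 2)) = - (al / 2) + (- (1 / 4)) by field.
rewrite [X in _ <= 2 * X]expRD mulrCA.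
have : 1 <= 2 * expR (- (1 / 4)) :> R.
  by have := expR_ge1Dx (- (1 / 4) : R); lra.
move=> /(ler_wpM2l (expR_ge0 (- (al / 2)))); rewrite mulr1; apply: le_trans.
by rewrite ler_expR; lra.
Qed.

Lemma continuous_dotm : continuous (fun x : 'rV[R]_n => dot xi (x *m L)).
Proof.
apply: (continuous_bigsum (F := fun i (x : 'rV[R]_n) => xi 0 i * (x *m L) 0 i)) => i.
by apply: continuous_mul; [exact: cst_continuous|exact: continuous_lincoord].
Qed.

Lemma exp_dot_measurable :
  measurable_fun setT (fun x : borel_rV R n => expR `|dot xi ((x : 'rV[R]_n) *m L)|).
Proof.
apply: (@continuous_measurable_rV R n (fun x => expR `|dot xi (x *m L)|)).
by apply: continuous_expRf; apply: continuous_absr; exact: continuous_dotm.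
Qed.

Lemma linbox_measurable (M : nat) :
  measurable ([set x : 'rV[R]_n | forall j, `|(x *m L) 0 j| <= M%:R] : set (borel_rV R n)).
Proof.
rewrite (_ : [set x | _] = \bigcap_j [set x : 'rV[R]_n | `|(x *m L) 0 j| <= M%:R]); last first.
  by apply/seteqP; split => x /= h j; have := h j => //; exact.
apply: closed_measurable_rV; apply: closed_bigI => j _; apply: closed_le.
by apply: continuous_absr; exact: continuous_lincoord.
Qed.

(** The box is cut into unit cells, each inside the tube of its corner, on which the exponential
    varies by at most a factor [exp k]. Cells where [xi] is at most [k] contribute [exp(2 k)]; the
    others are handled by [exp_rho_half]. Finitely many cells are enough because of the box, which
    [moment_le] exhausts. *)
Lemma exp_moment_box (M : nat) :
  (\int[mu]_(x in [set x : 'rV[R]_n | forall j, (`|(x *m L) 0%R j| <= M%:R)%R])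
     (expR `|dot xi (x *m L)|)%:E <= (expR (21 * K))%:E)%E.
Proof.
have K1 := Kge1.
pose c (a : {ffun 'I_k -> 'I_(M.+1.*2)}) : 'rV[R]_k := \row_j ((a j)%:R - M.+1%:R).
pose Q a : set (borel_rV R n) :=
  [set x : 'rV[R]_n | forall j, c a 0 j <= (x *m L) 0 j <= c a 0 j + 1].
have mQ a : measurable (Q a).
  rewrite (_ : Q a = \bigcap_j [set x : 'rV[R]_n | c a 0 j <= (x *m L) 0 j <= c a 0 j + 1]); last first.
    by apply/seteqP; split => x /= h j; have := h j => //; exact.
  rewrite bigcap_mkcond -bigcap_mkcond.
  apply: closed_measurable_rV; apply: closed_bigI => j _.
  rewrite (_ : [set x | _] = [set x : 'rV[R]_n | c a 0 j <= (x *m L) 0 j] `&`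
     [set x : 'rV[R]_n | (x *m L) 0 j <= c a 0 j + 1]); last first.
    by apply/seteqP; split => x /=; [case/andP|case=> -> ->].
  by apply: closedI; [apply: closed_ge|apply: closed_le]; exact: continuous_lincoord.
have Qtube a : Q a `<=` tube (c a).
  move=> x Qx; rewrite /tube /=; apply: (@le_trans _ _ K); last lra.
  rewrite /dot (_ : K = \sum_(j < k) 1); last by rewrite sumr_const card_ord.
  apply: ler_sum => j _; have /andP[h1 h2] := Qx j; rewrite !mxE.
  by move: h1 h2; rewrite !mxE => h1 h2; rewrite -expr2 expr_le1//; lra.
have muQ a : fine (mu (Q a)) <= rho (c a).
  rewrite fine_le ?fin_num_measure//; [exact: tube_measurable|].
  by apply: le_measure; rewrite ?inE//; exact: tube_measurable.
pose w a := if K < `|dot xi (c a)| then expR (K + `|dot xi (c a)|) else 0.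
have w0 a : 0 <= w a by rewrite /w; case: ifP => // _; exact: expR_ge0.
have key : (forall x : 'rV[R]_n, (forall j, `|(x *m L) 0 j| <= M%:R) ->
    expR `|dot xi (x *m L)| <= expR (2 * K) + \sum_a w a * \1_(Q a) x).
  move=> x xM.
  have tr (j : 'I_k) : (Num.truncn ((x *m L) 0 j + M.+1%:R)%R < M.+1.*2)%N.
    have := xM j; rewrite ler_norml => /andP[h1 h2].
    have e : M.+1%:R = M%:R + 1 :> R by rewrite natr1.
    rewrite Num.Theory.truncn_lt_nat; last lra.
    by rewrite -addnn natrD; lra.
  pose a := [ffun j => Ordinal (tr j)].
  have Qa : Q a x.
    move=> j; rewrite /c mxE ffunE /=; have := xM j; rewrite ler_norml => /andP[h1 h2].
    have e : M.+1%:R = M%:R + 1 :> R by rewrite natr1.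
    have h0 : 0 <= (x *m L) 0 j + M.+1%:R by lra.
    have /andP[h3 h4] := Num.Theory.truncn_itv h0.
    move: h3 h4; rewrite -[X in _ < X -> _]natr1; lra.
  have d1 : `|dot xi (x *m L)| <= K + `|dot xi (c a)|.
    have -> : x *m L = (x *m L - c a) + c a by rewrite subrK.
    rewrite dotDr; apply: (le_trans (ler_normD _ _)); rewrite lerD2r.
    apply: (le_trans (dot_le_nrm _ _)); rewrite -sk2 expr2.
    apply: ler_pM; rewrite ?nrm_ge0 ?nrm_direction//.
    rewrite -ler_sqr ?nnegrE ?nrm_ge0// nrm2 sk2 /dot (_ : K = \sum_(j < k) 1); last by rewrite sumr_const card_ord.
    apply: ler_sum => j _; have /andP[h1 h2] := Qa j; rewrite !mxE.
    by move: h1 h2; rewrite !mxE => h1 h2; rewrite -expr2 expr_le1//; lra.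
  have [lt|ge] := ltrP K `|dot xi (c a)|; last first.
    rewrite -[leLHS]addr0; apply: lerD; first by rewrite ler_expR; lra.
    by apply: sumr_ge0 => b _; rewrite mulr_ge0// indicE ler0n.
  rewrite -[leLHS]add0r; apply: lerD; first exact: expR_ge0.
  rewrite (bigD1 a)//= -[leLHS]addr0; apply: lerD.
    by rewrite indicE mem_set// mulr1 /w lt ler_expR.
  by apply: sumr_ge0 => b _; rewrite mulr_ge0// indicE ler0n.
apply: le_trans (@integral_le_step R _ _ mu _ Q mQ _ _ w _ _ exp_dot_measurable _ (expR_ge0 _) w0 key) _.
- exact: linbox_measurable.
- by move=> x; exact: expR_ge0.
rewrite lee_fin.
have s1 : \sum_a w a * fine (mu (Q a)) <= \sum_a 2 * expR K * rho (2^-1 *: c a).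
  apply: ler_sum => a _; rewrite /w; case: ifP => [lt|_]; last first.
    by rewrite mul0r !mulr_ge0 ?expR_ge0 ?rho_ge0.
  rewrite expRD -mulrA [2 * _]mulrC -[leRHS]mulrA ler_pM2l ?expR_gt0//.
  by apply: le_trans (exp_rho_half lt); rewrite ler_pM2l ?expR_gt0.
(* The number of halved corners whose tube contains a given point counts lattice points in a ball of
   radius [4 sqrt k], whence [16 + 2] by [card_ball_le]. *)
have s2 : \sum_a rho (2^-1 *: c a) <= expR ((16 + 2) * K).
  apply: sum_measure_le; [by move=> a; exact: tube_measurable|exact: expR_ge0|].
  move=> x; have mm : (0 < M.+1.*2)%N by [].
  pose S := [set a | x \in tube (2^-1 *: c a)].
  rewrite (_ : \sum_a _ = #|[set a : {ffun 'I_k -> 'I_(M.+1.*2)} | x \in tube (2^-1 *: c a)]%SET|%:R); last first.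
    rewrite -sum1_card natr_sum [RHS]big_mkcond/=; apply: eq_bigr => a _.
    by rewrite indicE inE; case: (_ \in _).
  apply: (@card_ball_le R k _ (fun j => 2 * (x *m L) 0 j + M.+1%:R)) => a.
  rewrite inE => /set_mem; rewrite /tube /= /dot => h.
  have -> : \sum_j ((a j)%:R - (2 * (x *m L) 0 j + M.+1%:R)) ^+ 2 =
    4 * \sum_j (x *m L - 2^-1 *: c a) 0 j * (x *m L - 2^-1 *: c a) 0 j.
    by rewrite mulr_sumr; apply: eq_bigr => j _; rewrite !mxE; field.
  lra.
rewrite -mulr_sumr in s1.
have s3 := le_trans s1 (ler_wpM2l (mulr_ge0 (ler0n R 2) (expR_ge0 K)) s2).
apply: (le_trans (lerD (lexx _) s3)); rewrite -mulrA -expRD.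
have -> : 21 * K = (2 * K + 17 * K) + 2 * K by ring.
rewrite [leRHS]expRD.
have e1 : expR (2 * K) <= expR (2 * K + 17 * K) by rewrite ler_expR; lra.
have e2 : expR (K + (16 + 2) * K) = expR (2 * K + 17 * K) by congr expR; ring.
have e3 : 3 <= expR (2 * K) by have := expR_ge1Dx (2 * K); lra.
have := ler_wpM2l (expR_ge0 (2 * K + 17 * K)) e3; rewrite e2; lra.
Qed.

(** From [u^p <= p^p exp(u)] and the exponential moment [exp(21 k)], which [k <= p] turns into a
    [p]-th power. *)
Lemma moment_le (p : nat) : (0 < p)%N -> (k <= p)%N ->
  (\int[mu]_x (`|dot xi (x *m L)| ^+ p)%:E <= ((p%:R * expR 21) ^+ p)%:E)%E.
Proof.
move=> p0 kp; have P0 : 0 < p%:R :> R by rewrite ltr0n.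
have cvg : (\int[mu]_x (expR `|dot xi (x *m L)|)%:E <= (expR (21 * K))%:E)%E.
  pose F (m : nat) : set (borel_rV R n) := [set x : 'rV[R]_n | forall j, (`|(x *m L) 0%R j| <= m%:R)%R].
  have FT : \bigcup_m F m = setT.
    apply/seteqP; split => // x _; have [m hm] := cube_cover ((x : 'rV[R]_n) *m L).
    by exists m.
  rewrite -FT; apply: cvge_le (ge0_nondecreasing_set_cvg_integral _ _ _ _).
  - by apply: nearW => m; exact: exp_moment_box.
  - move=> i j ij; rewrite subsetEset => x h l; apply: (le_trans (h l)).
    by rewrite ler_nat.
  - by move=> i; exact: linbox_measurable.
  - by move=> i; apply/measurable_EFinP; apply: (measurable_funS measurableT _ exp_dot_measurable).
  - by move=> i x _; rewrite lee_fin expR_ge0.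
apply: (@le_trans _ _ (\int[mu]_x ((p%:R ^+ p)%:E * (expR `|dot xi (x *m L)|)%:E))%E).
  apply: ge0_le_integral => //.
  - apply/measurable_EFinP; apply: measurable_funX.
    apply: (@continuous_measurable_rV R n (fun x => `|dot xi (x *m L)|)).
    by apply: continuous_absr; exact: continuous_dotm.
  - apply/measurable_EFinP; apply: measurable_funM => //; exact: exp_dot_measurable.
  move=> x _; rewrite -EFinM lee_fin; move: `|dot xi (x *m L)| (normr_ge0 (dot xi (x *m L))) => u u0.
  have -> : expR u = expR (u / p%:R) ^+ p by rewrite -expRM_natl mulrC divfK// gt_eqF.
  rewrite -exprMn lerXn2r ?nnegrE ?mulr_ge0 ?expR_ge0//.
  rewrite mulrC -ler_pdivrMr//; have := expR_ge1Dx (u / p%:R); lra.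
rewrite ge0_integralZl_EFin//; last by apply/measurable_EFinP; exact: exp_dot_measurable.
rewrite exprMn EFinM; apply: lee_wpmul2l; first by rewrite lee_fin exprn_ge0.
apply: (le_trans cvg); rewrite lee_fin -expRM_natl ler_expR mulrC ler_wpM2r// ler_nat//.
Qed.

End Direction.

Lemma heavy_convex z w l : 0 < l < 1 -> heavy z -> heavy w ->
  heavy (l *: z + (1 - l) *: w).
Proof.
move=> l01 hz hw; have := rho_log_concave l01 hz hw; rewrite /heavy.
by rewrite (_ : l * (5 * K) + (1 - l) * (5 * K) = 5 * K)//; ring.
Qed.

Definition far (z w : 'rV[R]_k) := 16 * K < dot (z - w) (z - w).

Lemma far_disjoint z w x : far z w -> tube z x -> tube w x -> False.
Proof.
rewrite /far /tube /= => f tz tw;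
have e : 4 * K = (2 * sk) ^+ 2 by rewrite exprMn sk2; ring.
have := @dot_tri k (x *m L - w) (- (x *m L - z)) (2 * sk) (2 * sk).
rewrite -e dotNl dotNr opprK => /(_ (mulr_ge0 _ sk0) (mulr_ge0 _ sk0) tw tz) h.
have := h (ler0n R 2) (ler0n R 2).
rewrite (_ : x *m L - w - (x *m L - z) = z - w); last by apply/rowP => i; rewrite !mxE; ring.
rewrite (_ : (2 * sk + 2 * sk) ^+ 2 = 16 * K); last by rewrite -sk2; ring.
by rewrite leNgt f.
Qed.

Definition packing (cs : seq 'rV[R]_k) :=
  (forall i, (i < size cs)%N -> heavy (nth 0 cs i)) /\
  (forall i j, (i < j < size cs)%N -> far (nth 0 cs i) (nth 0 cs j)).

Lemma packing_size cs : packing cs -> (size cs)%:R <= expR (5 * K).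
Proof.
move=> [hv fr].
have s1 : \sum_(i < size cs) rho (nth 0 cs i) <= 1.
  apply: sum_measure_le => //; first by move=> i; exact: tube_measurable.
  move=> x; have [[i xi]|no] := pselect (exists i : 'I_(size cs), tube (nth 0 cs i) x); last first.
    rewrite big1// => i _; rewrite indicE memNset// => xi; apply: no; by exists i.
  rewrite (bigD1 i)//= big1 ?addr0; first by rewrite indicE; case: (_ \in _).
  move=> j ji; rewrite indicE memNset// => xj.
  have [ij|ij] := ltnP i j; first by apply: (far_disjoint (fr i j _) xi xj); rewrite ij ltn_ord.
  have {}ij : (j < i)%N by rewrite ltn_neqAle ij andbT; apply: contra_neq ji => /val_inj.
  by apply: (far_disjoint (fr j i _) xj xi); rewrite ij ltn_ord.
have s2 : \sum_(i < size cs) expR (- (5 * K)) <= \sum_(i < size cs) rho (nth 0 cs i).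
  by apply: ler_sum => i _; exact: hv.
have := le_trans s2 s1; rewrite sumr_const card_ord -[X in X <= _ -> _]mulr_natl expRN.
by rewrite ler_pdivrMr ?expR_gt0// mul1r.
Qed.

(** A packing of maximal size is a covering; [packing_size] guarantees that the maximum exists. *)
Lemma packing_exists : exists cs : seq 'rV[R]_k, (size cs)%:R <= expR (5 * K) /\
  forall z, heavy z -> exists2 c, c \in cs & dot (z - c) (z - c) <= 16 * K.
Proof.
pose P m := `[< exists2 cs, packing cs & size cs = m >].
have P0 : exists m, P m by exists 0%N; apply/asboolP; exists [::] => //; split => // i j; rewrite ltn0 andbF.
have Pb m : P m -> (m <= Num.truncn (expR (5 * K) : R))%N.
  move=> /asboolP[cs pc <-]; rewrite Num.Theory.truncn_ge_nat ?expR_ge0//.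
  exact: packing_size.
case: (ex_maxnP P0 Pb) => m /asboolP[cs pc sm] mx; exists cs; split; first exact: packing_size.
move=> z hz; apply: contrapT => no.
have {}no c : c \in cs -> far z c.
  by move=> cin; rewrite /far ltNge; apply/negP => h; apply: no; exists c.
have : (m.+1 <= m)%N.
  apply: mx; apply/asboolP; exists (z :: cs); last by rewrite /= sm.
  case: pc => hv fr; split => [[|i]|[|i] [|j]]//=.
  - by rewrite ltnS => /hv.
  - by rewrite ltnS => jl; apply: no; rewrite mem_nth.
  - by rewrite !ltnS => /fr.
by rewrite ltnn.
Qed.

(** Membership in the [p]-th centroid body of the image of [mu] under [L]. The support function is
    replaced by all upper bounds [H] of the [p]-th moment, so that neither roots nor finiteness
    intervene. *)
Definition in_Zp (p : nat) (y : 'rV[R]_k) := forall (xi : 'rV[R]_k) (H : R), 0 <= H ->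
  (\int[mu]_x (`|dot xi (x *m L)| ^+ p)%:E <= (H ^+ p)%:E)%E -> dot xi y <= H.

Definition heavy_diff (c : 'rV[R]_k) := exists z w, [/\ heavy z, heavy w & c = z - w].

Lemma heavy0 : heavy 0.
Proof. by apply: heavy_near0; rewrite dot0l ler0n. Qed.

Lemma heavy_diff_bounded : exists2 D, 0 <= D & forall c, heavy_diff c -> nrm c <= D.
Proof.
have [cs [_ hcs]] := packing_exists.
have D0 : 0 <= \sum_(c <- cs) nrm c by apply: sumr_ge0 => c _; exact: nrm_ge0.
have hz z : heavy z -> nrm z <= \sum_(c <- cs) nrm c + 4 * sk.
  move=> /hcs[c cin zc]; rewrite (_ : z = c + (z - c)); last by rewrite addrC subrK.
  apply: (le_trans (nrmD _ _)); apply: lerD.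
    rewrite (big_rem c)//= -[leLHS]addr0 lerD2l; apply: sumr_ge0 => b _; exact: nrm_ge0.
  rewrite -ler_sqr ?nnegrE ?nrm_ge0 ?mulr_ge0// nrm2 exprMn sk2; lra.
exists (2 * (\sum_(c <- cs) nrm c + 4 * sk)); first by rewrite mulr_ge0// addr_ge0// mulr_ge0.
move=> _ [z [w [zh wh ->]]]; apply: (le_trans (nrmD _ _)); rewrite nrmN.
by have := hz _ zh; have := hz _ wh; lra.
Qed.

(** A rescaled point of the centroid body far from the convex symmetric set of heavy differences
    would be separated from it by some [xi]. That [xi] is bounded by [k] on heavy points, so
    [moment_le] bounds its [p]-th moment, and [in_Zp] contradicts the separation. *)
Lemma near_heavy_diff p y : (0 < p)%N -> (k <= p)%N -> in_Zp p y ->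
  let y' := (K / (p%:R * expR 21)) *: y in
  exists2 c, heavy_diff c & dot (y' - c) (y' - c) <= K.
Proof.
move=> p0 kp yZ y'; apply: contrapT => no.
have {}no c : heavy_diff c -> K < dot (y' - c) (y' - c).
  by move=> hc; rewrite ltNge; apply/negP => h; apply: no; exists c.
have K1 := Kge1; have P0 : 0 < p%:R :> R by rewrite ltr0n.
have C0 : heavy_diff 0 by exists 0, 0; rewrite subr0; split => //; exact: heavy0.
have [D D0 hD] := heavy_diff_bounded.
pose E := [set dot (y' - c) (y' - c) | c in heavy_diff].
have iE : has_inf E.
  split; first by exists (dot (y' - 0) (y' - 0)), 0.
  by exists 0 => _ [c _ <-]; exact: dot_ge0.
pose D' := 2 * D + K; have D'0 : 0 < D' by rewrite /D'; lra.
(* The distance to the set need not be attained, so [c0] is only nearly closest, with error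
   [t k / 4] in the squared distance. Moving a fraction [t] from [c0] towards [c] has a second-order
   term of at most [t k / 4] too, which leaves a usable first variation. *)
pose t := K / (4 * D' ^+ 2).
have t0 : 0 < t by rewrite divr_gt0 ?mulr_gt0 ?exprn_gt0//; lra.
have tD : t * D' ^+ 2 = K / 4 by rewrite /t; field; rewrite gt_eqF.
have t1 : t < 1.
  rewrite ltr_pdivrMr ?mulr_gt0 ?exprn_gt0// mul1r expr2.
  have : K * K <= D' * D' by apply: ler_pM; rewrite /D'; lra.
  have : K * 1 <= K * K by rewrite ler_pM2l; lra.
  lra.
have [_ [c0 hc0 <-]] := inf_adherent (mulr_gt0 t0 (divr_gt0 (lt_le_trans ltr01 K1) (ltr0n R 4))) iE.
set v := y' - c0 => near.
have key c : heavy_diff c -> dot v c <= dot v y' - 3 / 4 * K.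
  move=> hc; have hct : heavy_diff (t *: c + (1 - t) *: c0).
    case: (hc) => z [w [zh wh ->]]; case: (hc0) => z0 [w0 [zh0 wh0 ->]].
    have t01 : 0 < t < 1 by rewrite t0 t1.
    exists (t *: z + (1 - t) *: z0), (t *: w + (1 - t) *: w0); split; try exact: heavy_convex.
    by apply/rowP => i; rewrite !mxE; ring.
  have := @ge_inf _ E iE.2 _ (ex_intro2 _ _ _ hct erefl).
  rewrite (_ : y' - _ = v - t *: (c - c0)); last by apply/rowP => i; rewrite !mxE; ring.
  have -> : dot (v - t *: (c - c0)) (v - t *: (c - c0)) =
      dot v v - 2 * t * dot v (c - c0) + t * (t * dot (c - c0) (c - c0)).
    move: (v) (c - c0) => w e; rewrite dotBl !dotBr !dotZl !dotZr (dotC e w); ring.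
  have cc : dot (c - c0) (c - c0) <= D' ^+ 2.
    rewrite -nrm2 lerXn2r ?nnegrE ?nrm_ge0 ?(ltW D'0)//; apply: (le_trans (nrmD _ _)).
    by rewrite nrmN; have := hD _ hc; have := hD _ hc0; rewrite /D'; lra.
  have v2 : K < dot v v by exact: no.
  have vy : dot v v = dot v y' - dot v c0 by rewrite /v dotBr.
  rewrite [dot v (c - c0)]dotBr; move: (dot v c) cc near v2 vy; move: (dot (c - c0) _) => q u cc near v2 vy inf_le.
  have : t * (2 * (u - dot v c0)) <= t * (t * q + K / 4) by lra.
  rewrite ler_pM2l//.
  have : t * q <= t * D' ^+ 2 by rewrite ler_pM2l.
  lra.
(* A level between the supremum over the heavy differences, at most [dot v y' - 3/4 k], and the
   value at [y']. It is positive because 0 is a heavy difference. *)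
pose B := dot v y' - K / 2.
have B0 : 0 < B by have := key 0 C0; rewrite dot0r /B; lra.
have hle c : heavy_diff c -> dot v c <= B by move=> /key; rewrite /B; lra.
pose xi := (K / B) *: v.
have hxi z : heavy z -> `|dot xi z| <= K.
  move=> hz; rewrite dotZl normrM gtr0_norm; last by rewrite divr_gt0//; lra.
  have : `|dot v z| <= B.
    rewrite ler_norml; apply/andP; split.
      rewrite lerNl -dotNr; apply: hle; exists 0, z; rewrite sub0r; split => //; exact: heavy0.
    by apply: hle; exists z, 0; rewrite subr0; split => //; exact: heavy0.
  move=> vz; rewrite -mulrA -[leRHS]mulr1 ler_pM2l; last lra.
  by rewrite ler_pdivrMl// mulr1.
have := yZ xi (p%:R * expR 21) _ (moment_le hxi p0 kp).
rewrite mulr_ge0 ?expR_ge0 ?ler0n// => /(_ isT) h.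
have e21 := expR_gt0 (21 : R).
have : dot xi y' <= K.
  rewrite dotZr mulrAC ler_pdivrMr ?mulr_gt0//; apply: ler_wpM2l => //; lra.
rewrite dotZl mulrAC ler_pdivrMr// ler_pM2l; last lra.
rewrite /B; lra.
Qed.

(** Differences of the centres for heavy points: [5 k + 5 k] in the exponent of their number, and
    radius [sqrt k + 4 sqrt k + 4 sqrt k]. *)
Lemma Zp_covering p : (0 < p)%N -> (k <= p)%N ->
  exists cs : seq 'rV[R]_k, (size cs)%:R <= expR (10 * K) /\
  forall y, in_Zp p y -> exists2 c, c \in cs &
    dot ((K / (p%:R * expR 21)) *: y - c) ((K / (p%:R * expR 21)) *: y - c) <= 81 * K.
Proof.
move=> p0 kp; have [cs [scs hcs]] := packing_exists.
exists [seq a - b | a <- cs, b <- cs]; split.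
  rewrite size_allpairs natrM (_ : 10 * K = 5 * K + 5 * K); last ring.
  by rewrite expRD ler_pM.
move=> y /(near_heavy_diff p0 kp)/= [_ [z [w [/hcs[a ain za] /hcs[b bin wb] ->]]] yzw].
exists (a - b); first by apply: allpairs_f.
move: yzw; set y' := _ *: y => yzw.
have e : 16 * K = (4 * sk) ^+ 2 by rewrite exprMn sk2; ring.
rewrite e in za wb; rewrite -sk2 in yzw.
have wb' : dot (- (w - b)) (- (w - b)) <= (4 * sk) ^+ 2 by rewrite dotNl dotNr opprK.
have h4 : 0 <= 4 * sk by rewrite mulr_ge0.
have h1 := dot_tri h4 h4 za wb'.
have h2 := dot_tri sk0 (addr_ge0 h4 h4) yzw h1.
rewrite (_ : y' - (a - b) = y' - (z - w) + (z - a + - (w - b))); last first.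
  by apply/rowP => i; rewrite !mxE; ring.
apply: (le_trans h2); rewrite -sk2; have -> : (sk + (4 * sk + 4 * sk)) ^+ 2 = 81 * sk ^+ 2 by ring.
exact: lexx.
Qed.

End Moments.

(** * Marginals of an isotropic log-concave measure *)

Section Isotropic.
Variables (R : realType) (n : nat) (mu : probability (borel_rV R n) R).

Lemma markov_rV (f : 'rV[R]_n -> R) (c t : R) : continuous f -> (forall x, 0 <= f x) ->
  (\int[mu]_x (f x)%:E <= c%:E)%E -> 0 < t ->
  (mu [set x : 'rV[R]_n | (t <= f x)%R] <= (c / t)%:E)%E.
Proof.
move=> cf f0 fc t0; set A := [set x | _].
have mA : measurable (A : set (borel_rV R n)).
  by apply: closed_measurable_rV; exact: closed_ge.
have : (\int[mu]_x (t%:E * (\1_A x)%:E) <= c%:E)%E.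
  apply: le_trans fc; apply: ge0_le_integral => //.
  - by move=> x _; rewrite -EFinM lee_fin mulr_ge0 ?(ltW t0)// indicE ler0n.
  - by apply: measurable_funeM; apply/measurable_EFinP; exact: measurable_indic.
  - by apply/measurable_EFinP; exact: continuous_measurable_rV.
  move=> x _; rewrite -EFinM lee_fin indicE; case: (boolP (x \in A)) => [/set_mem xA|_].
    by rewrite mulr1.
  by rewrite mulr0.
rewrite ge0_integralZl_EFin//; last 2 first.
- by apply/measurable_EFinP; exact: measurable_indic.
- exact: ltW.
rewrite integral_indic// setIT -[X in (X <= _)%E]muleC -lee_pdivlMr//.
Qed.

Hypothesis hiso : isotropic mu.

Lemma measurable_coord2 (i j : 'I_n) :
  measurable_fun setT (fun x : borel_rV R n => (x : 'rV[R]_n) 0%R i * (x : 'rV[R]_n) 0%R j).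
Proof.
apply: (@continuous_measurable_rV R n (fun x => x 0%R i * x 0%R j)).
by apply: continuous_mul; exact: continuous_coord.
Qed.

Lemma integral_coord2 (i j : 'I_n) :
  (\int[mu]_x ((x : 'rV[R]_n) 0%R i * (x : 'rV[R]_n) 0%R j)%:E = (i == j)%:R%:E)%E.
Proof.
case: hiso => h1 h2; have := h2 i j.
rewrite covariance.unlock !h1 /= expectation.unlock !mxE => <-.
apply: eq_integral => x _; congr EFin.
rewrite (_ : (_ * _) x = (x 0 i - 0) * (x 0 j - 0))//; by rewrite !subr0.
Qed.

Lemma integrable_coord2 (i j : 'I_n) :
  mu.-integrable setT (fun x : borel_rV R n => ((x : 'rV[R]_n) 0%R i * (x : 'rV[R]_n) 0%R j)%:E).
Proof.
have sq (l : 'I_n) : mu.-integrable setT (fun x : borel_rV R n => ((x : 'rV[R]_n) 0%R l * (x : 'rV[R]_n) 0%R l)%:E).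
  apply/integrableP; split; first by apply/measurable_EFinP; exact: measurable_coord2.
  under eq_integral => x _ do rewrite gee0_abs ?lee_fin -?expr2 ?sqr_ge0// expr2.
  by rewrite integral_coord2 eqxx ltry.
apply: (@le_integrable _ _ _ mu setT measurableT _
   (fun x : borel_rV R n => ((x : 'rV[R]_n) 0%R i * (x : 'rV[R]_n) 0%R i)%:E +
      ((x : 'rV[R]_n) 0%R j * (x : 'rV[R]_n) 0%R j)%:E)%E).
- by apply/measurable_EFinP; exact: measurable_coord2.
- move=> x _; rewrite -EFinD !abse_EFin lee_fin.
  move: (x 0%R i) (x 0%R j) => a b; rewrite [leRHS]ger0_norm; last by rewrite addr_ge0// -expr2 sqr_ge0.
  by rewrite ler_norml; apply/andP; split; have := sqr_ge0 (a + b); have := sqr_ge0 (a - b);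
    rewrite !expr2 !mulrDl !mulrDr ?mulNr ?mulrN; nra.
- by apply: integrableD => //; exact: sq.
Qed.

Lemma second_moment (u : 'rV[R]_n) :
  (\int[mu]_x (dot u x ^+ 2)%:E = (dot u u)%:E)%E.
Proof.
pose f (ij : 'I_n * 'I_n) (x : borel_rV R n) :=
  ((u 0%R ij.1 * u 0%R ij.2)%:E * ((x : 'rV[R]_n) 0%R ij.1 * (x : 'rV[R]_n) 0%R ij.2)%:E)%E.
rewrite (eq_integral (fun x => \sum_ij f ij x)%E); last first.
  move=> x _; rewrite /dot expr2 mulr_suml.
  under eq_bigr do rewrite mulr_sumr.
  rewrite pair_big/= -sumEFin; apply: eq_bigr => -[i j] _ /=.
  by rewrite /f -EFinM; congr EFin => /=; ring.
rewrite integral_sum//; last by move=> [i j]; apply: integrableZl => //; exact: integrable_coord2.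
rewrite (eq_bigr (fun ij : 'I_n * 'I_n => (u 0 ij.1 * u 0 ij.2 * (ij.1 == ij.2)%:R)%:E)); last first.
  move=> [i j] _; rewrite integralZl ?integral_coord2//; exact: integrable_coord2.
rewrite sumEFin; congr EFin; rewrite -(pair_bigA _ (fun i j => u 0 i * u 0 j * (i == j)%:R))/=.
apply: eq_bigr => i _; rewrite (bigD1 i)//= eqxx mulr1 big1 ?addr0// => j ji.
by rewrite eq_sym (negbTE ji) mulr0.
Qed.

Definition hs (m l : nat) (L : 'M[R]_(m, l)) : R := \sum_j \sum_i L i j ^+ 2.

Lemma second_moment_mx (k : nat) (L : 'M[R]_(n, k)) :
  (\int[mu]_x (dot (x *m L) (x *m L))%:E = (hs L)%:E)%E.
Proof.
rewrite (eq_integral (fun x : borel_rV R n => \sum_j (dot (col j L)^T (x : 'rV[R]_n) ^+ 2)%:E)%E); last first.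
  move=> x _; rewrite sumEFin; congr EFin; apply: eq_bigr => j _; rewrite -expr2.
  by congr (_ ^+ 2); rewrite mxE /dot; apply: eq_bigr => i _; rewrite !mxE mulrC.
rewrite ge0_integral_sum//; last 2 first.
- move=> j; apply/measurable_EFinP.
  apply: (@continuous_measurable_rV R n (fun x => dot (col j L)^T x ^+ 2)).
  by apply: continuous_mul; exact: continuous_dot.
- by move=> j x _; rewrite lee_fin sqr_ge0.
rewrite -sumEFin; apply: eq_bigr => j _; rewrite second_moment; congr EFin.
by apply: eq_bigr => i _; rewrite !mxE expr2.
Qed.

Lemma continuous_nrm2_mx (k : nat) (L : 'M[R]_(n, k)) :
  continuous (fun x : 'rV[R]_n => dot (x *m L) (x *m L)).
Proof.
rewrite (_ : (fun x => _) = (fun x => dot (x *m L - 0) (x *m L - 0))).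
  exact: continuous_dist2.
by apply/funext => x; rewrite subr0.
Qed.

Lemma tail_mx (k : nat) (L : 'M[R]_(n, k)) (t : R) : 0 < t ->
  (mu [set x : 'rV[R]_n | (t <= dot (x *m L) (x *m L))%R] <= (hs L / t)%:E)%E.
Proof.
move=> t0; apply: markov_rV => //; first exact: continuous_nrm2_mx.
- by move=> x; exact: dot_ge0.
- by rewrite second_moment_mx.
Qed.

(** By isotropy [hs L] is the second moment of the image, so Markov's inequality leaves mass at most
    [1/4] outside the ball. *)
Lemma center_mx (k : nat) (L : 'M[R]_(n, k)) : (0 < k)%N -> hs L <= k%:R / 4 ->
  ((3 / 4)%:E <= mu [set x | (dot (x *m L) (x *m L) <= k%:R)%R])%E.
Proof.
move=> k0 hL; have K0 : 0 < k%:R :> R by rewrite ltr0n.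
have mA : measurable ([set x : 'rV[R]_n | (dot (x *m L) (x *m L) <= k%:R)%R] : set (borel_rV R n)).
  by apply: closed_measurable_rV; apply: closed_le; exact: continuous_nrm2_mx.
have := tail_mx L K0; set T := [set x | _] => hT.
have mT : measurable (T : set (borel_rV R n)).
  by apply: closed_measurable_rV; apply: closed_ge; exact: continuous_nrm2_mx.
have : (mu (~` T) <= mu [set x | (dot (x *m L) (x *m L) <= k%:R)%R])%E.
  apply: le_measure; rewrite ?inE//; first exact: measurableC.
  by move=> x /negP; rewrite -ltNge => /ltW.
apply: le_trans; rewrite (@probability_setC _ _ _ mu)//.
have fT : mu T \is a fin_num by exact: fin_num_measure.
rewrite -(fineK fT) -EFinB lee_fin; rewrite -(fineK fT) lee_fin in hT.
have : hs L / k%:R <= 1 / 4 by rewrite ler_pdivrMr//; lra.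
lra.
Qed.

Hypothesis hlc : log_concave mu.

(** The one-dimensional case of [moment_le], with [L] the functional [u] scaled so that
    [hs L = 1/4]. It makes the marginal norms finite and supplies the crude Lipschitz bound
    [hp_nrm]. *)
Lemma dot_moment (p : nat) (u : 'rV[R]_n) : (0 < p)%N ->
  (\int[mu]_x (`|dot u x| ^+ p)%:E <= ((expR 26 * p%:R * nrm u) ^+ p)%:E)%E.
Proof.
move=> p0; have [->|u0] := eqVneq u 0.
  rewrite nrm0 mulr0 expr0n gtn_eqF//=.
  under eq_integral do rewrite dot0l normr0 expr0n gtn_eqF//.
  by rewrite integral_cst_prob.
have nu : 0 < nrm u by rewrite lt_def nrm_ge0 nrm_eq0 u0.
pose L : 'M[R]_(n, 1) := (2 * nrm u)^-1 *: u^T.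
have xL (x : 'rV[R]_n) : x *m L = (dot u x / (2 * nrm u))%:M.
  rewrite /L -scalemxAr; apply/matrixP => i j; rewrite !mxE !ord1 eqxx mulr1n mulrC /dot.
  by congr (_ * _); apply: eq_bigr => l _; rewrite !mxE mulrC.
have hL : hs L = 1 / 4.
  rewrite /hs big_ord1; under eq_bigr do rewrite !mxE exprMn.
  rewrite -mulr_sumr (_ : \sum_i _ = dot u u); last by apply: eq_bigr => i _; rewrite expr2.
  by rewrite -nrm2; field; rewrite gt_eqF.
have hc : ((3 / 4)%:E <= mu [set x | (dot (x *m L) (x *m L) <= 1%:R)%R])%E.
  by apply: center_mx; rewrite ?hL.
(* A heavy point lies within [r] of 0: the tube of a farther one sits where the image is at least
   [exp 3], a set of mass at most [exp(-6) / 4], below the heavy level [exp(-5)]. *)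
pose r : R := expR 3 + 2; have r0 : 0 < r by rewrite addr_gt0 ?expR_gt0.
pose xi : 'rV[R]_1 := r^-1%:M.
have e3 := expR_gt0 (3 : R).
have hxi z : heavy mu L z -> `|dot xi z| <= 1%:R.
  rewrite /dot big_ord1 mxE eqxx mulr1n normrM gtr0_norm ?invr_gt0// ler_pdivrMl// mulr1 => hz.
  rewrite leNgt; apply/negP => lt.
  have : (mu (tube L z) <= (1 / 4 / expR 6)%:E)%E.
    rewrite -hL; apply: le_trans (tail_mx L (expR_gt0 6)).
    apply: le_measure; rewrite ?inE; [exact: tube_measurable| |].
      by apply: closed_measurable_rV; apply: closed_ge; exact: continuous_nrm2_mx.
    move=> x; rewrite /tube /= mulr1 /dot !big_ord1 ![(x *m L - z) _ _]mxE [(- z) _ _]mxE; move: ((x *m L) 0 0) (z 0 0) lt => a b lt.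
    have -> : expR 6 = expR 3 * expR 3 :> R by rewrite -expRD; congr expR; lra.
    move=> h; have ab : `|a - b| <= 2 by rewrite -ler_sqr ?nnegrE// real_normK ?num_real// expr2; lra.
    have : `|b| <= `|a| + 2.
      by rewrite -[b](subrK a) addrC (le_trans (ler_normD _ _))// lerD2l distrC.
    move=> hb; have : expR 3 <= `|a| by rewrite /r in lt; lra.
    move=> ea; have -> : a * a = `|a| * `|a| by rewrite -normrM ger0_norm// -expr2 sqr_ge0.
    by apply: ler_pM => //; exact: ltW.
  rewrite rhoE lee_fin => h; move: hz; rewrite /heavy leNgt => /negP; apply.
  apply: (le_lt_trans h); rewrite mulr1 expRN ltr_pdivrMr ?expR_gt0//.
  have -> : expR 6 = expR 5 * expR 1 :> R by rewrite -expRD; congr expR; lra.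
  rewrite mulrA mulVf ?gt_eqF ?expR_gt0// mul1r; have := expR_ge1Dx (1 : R); lra.
have := @moment_le R n mu hlc 1 L isT hc xi hxi p p0 p0.
pose c : R := r^-1 / (2 * nrm u); have c0 : 0 < c by rewrite divr_gt0 ?invr_gt0// mulr_gt0.
rewrite (eq_integral (fun x : borel_rV R n => ((c ^+ p)%:E * (`|dot u (x : 'rV[R]_n)| ^+ p)%:E)%E)); last first.
  move=> x _; rewrite -EFinM -exprMn; congr EFin; congr (_ ^+ p).
  rewrite xL {1}/dot big_ord1 !mxE !eqxx !mulr1n -[X in X * `|_|](gtr0_norm c0) -normrM; congr `|_|.
  by rewrite /c; field; rewrite !gt_eqF.
rewrite ge0_integralZl_EFin//; last 2 first.
- apply/measurable_EFinP; apply: (@continuous_measurable_rV R n (fun x => `|dot u x| ^+ p)).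
  move=> x; apply: (@continuous_comp _ _ _ (fun x => `|dot u x|) (fun y => y ^+ p)).
    by apply: continuous_absr; exact: continuous_dot.
  exact: exprn_continuous.
- by rewrite exprn_ge0// ltW.
rewrite muleC -lee_pdivlMr ?exprn_gt0// => h; apply: (le_trans h).
rewrite -exprVn -EFinM -exprMn lee_fin lerXn2r ?nnegrE ?mulr_ge0 ?invr_ge0 ?expR_ge0 ?(ltW c0) ?nrm_ge0 ?ler0n//.
have -> : p%:R * expR 21 * c^-1 = (expR 21 * (2 * r)) * p%:R * nrm u by rewrite /c; field; rewrite !gt_eqF.
apply: ler_wpM2r; first exact: nrm_ge0.
apply: ler_wpM2r; first exact: ler0n.
have -> : expR 26 = expR 21 * (expR 3 * expR 2) :> R by rewrite -!expRD; congr expR; lra.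
rewrite ler_pM2l ?expR_gt0// /r.
have h3 := expR_ge1Dx (3 : R); have h2 := expR_ge1Dx (2 : R).
have : expR 3 * 3 <= expR 3 * expR 2 :> R by rewrite ler_pM2l//; lra.
lra.
Qed.

Section Hp.
Variable p : nat.
Hypothesis p0 : (0 < p)%N.
Let P0 : 0 < p%:R :> R. Proof. by rewrite ltr0n. Qed.

Definition hp (u : 'rV[R]_n) : R :=
  fine (\int[mu]_x (`|dot u x| ^+ p)%:E)%E `^ p%:R^-1.

Lemma abs_dot_pow_measurable (u : 'rV[R]_n) :
  measurable_fun setT (fun x : borel_rV R n => `|dot u (x : 'rV[R]_n)| ^+ p).
Proof.
apply: (@continuous_measurable_rV R n (fun x => `|dot u x| ^+ p)).
move=> x; apply: (@continuous_comp _ _ _ (fun x => `|dot u x|) (fun y => y ^+ p)).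
  by apply: continuous_absr; exact: continuous_dot.
exact: exprn_continuous.
Qed.

Lemma int_ge0 u : (0 <= \int[mu]_x (`|dot u x| ^+ p)%:E)%E.
Proof. by apply: integral_ge0 => x _; rewrite lee_fin exprn_ge0. Qed.

Lemma int_fin u : (\int[mu]_x (`|dot u x| ^+ p)%:E)%E \is a fin_num.
Proof.
rewrite ge0_fin_numE ?int_ge0//; exact: le_lt_trans (dot_moment u p0) (ltry _).
Qed.

Lemma hp_ge0 u : 0 <= hp u.
Proof. exact: powR_ge0. Qed.

Lemma hpX u : ((hp u ^+ p)%:E = \int[mu]_x (`|dot u x| ^+ p)%:E)%E.
Proof.
rewrite -(fineK (int_fin u)); congr EFin.
by rewrite /hp -powR_mulrn ?powR_ge0// -powRrM mulVf ?gt_eqF// powRr1// fine_ge0// int_ge0.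
Qed.

Lemma hp_le u H : 0 <= H -> (\int[mu]_x (`|dot u x| ^+ p)%:E <= (H ^+ p)%:E)%E -> hp u <= H.
Proof. by move=> H0; rewrite -hpX lee_fin ler_pXn2r// nnegrE hp_ge0. Qed.

Lemma hp_nrm u : hp u <= expR 26 * p%:R * nrm u.
Proof. by apply: hp_le; rewrite ?dot_moment// !mulr_ge0 ?expR_ge0 ?nrm_ge0. Qed.

Lemma hp_Lnorm u : ((hp u)%:E = 'N[mu]_p%:R%:E[EFin \o (fun x => dot u x)])%E.
Proof.
rewrite Lnorm.unlock /hp -poweR_EFin fineK ?int_fin//; congr poweR.
by apply: eq_integral => x _; rewrite /comp abse_EFin poweR_EFin powR_mulrn.
Qed.

Lemma hp_seminorm : seminorm hp.
Proof.
split=> [u v|a u].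
  suff : ((hp (u + v))%:E <= (hp u)%:E + (hp v)%:E)%E by rewrite -EFinD lee_fin.
  have := hp_Lnorm (u + v); move: (hp (u + v)) => a ->.
  have := hp_Lnorm u; move: (hp u) => b ->; have := hp_Lnorm v; move: (hp v) => c ->.
  have mf w : measurable_fun setT (fun x : borel_rV R n => dot w (x : 'rV[R]_n)).
    by apply: continuous_measurable_rV; exact: continuous_dot.
  have := minkowski_EFin mu (mf u) (mf v) (_ : 1 <= p%:R); rewrite ler1n p0 => /(_ isT).
  apply: le_trans; rewrite le_eqVlt; apply/orP; left; apply/eqP; apply: eq_Lnorm => x /=.
  by rewrite dotDl.
apply/eqP; rewrite -(@eqrXn2 _ p)//; [|exact: hp_ge0|by rewrite mulr_ge0// hp_ge0].
apply/eqP; rewrite exprMn; apply: (@EFin_inj R); rewrite EFinM.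
have := hpX (a *: u); move: (hp (a *: u)) => b ->; have := hpX u; move: (hp u) => c ->.
rewrite -ge0_integralZl_EFin//; last first.
  by apply/measurable_EFinP; exact: abs_dot_pow_measurable.
by apply: eq_integral => x _; rewrite -EFinM -exprMn dotZl normrM.
Qed.

End Hp.
End Isotropic.

(** * Hahn-Banach for sublinear functions on row vectors *)

Section HahnBanach.
Variables (R : realType) (d : nat).
Implicit Types q : 'rV[R]_d -> R.

Definition sublinear q := (forall u v, q (u + v) <= q u + q v) /\
  (forall a u, 0 <= a -> q (a *: u) = a * q u).

(** A sublinear function below [q] that is linear along [v]; linearity along other vectors already
    obtained is kept ([push_keep]). *)
Definition push q v : 'rV[R]_d -> R :=
  fun u => inf [set q (u + t *: v) - t * q v | t in [set t | 0 <= t]].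

Lemma sublinear0 q : sublinear q -> q 0 = 0.
Proof. by move=> sq; rewrite -[X in q X](scale0r 0) sq.2// mul0r. Qed.

Lemma push_has_inf q v u : sublinear q ->
  has_inf [set q (u + t *: v) - t * q v | t in [set t | 0 <= t]].
Proof.
move=> sq; split; first by exists (q (u + 0 *: v) - 0 * q v), 0 => //=.
exists (- q (- u)) => _ [t /= t0 <-]; rewrite -sq.2//.
have := sq.1 (u + t *: v) (- u); rewrite addrC addKr; lra.
Qed.

Lemma push_le q v u t : sublinear q -> 0 <= t -> push q v u <= q (u + t *: v) - t * q v.
Proof. by move=> sq t0; apply: ge_inf; [exact: (push_has_inf v u sq).2|exists t]. Qed.

Lemma push_le_self q v u : sublinear q -> push q v u <= q u.
Proof. by move=> sq; have := push_le v u sq (lexx 0); rewrite scale0r addr0 mul0r subr0. Qed.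

Lemma le_push q v u c : sublinear q ->
  (forall t, 0 <= t -> c <= q (u + t *: v) - t * q v) -> c <= push q v u.
Proof.
move=> sq h; apply: lb_le_inf; first exact: (push_has_inf v u sq).1.
by move=> _ [t t0 <-]; exact: h.
Qed.

Lemma push_sublinear q v : sublinear q -> sublinear (push q v).
Proof.
move=> sq; have hZ a u : 0 < a -> push q v (a *: u) <= a * push q v u.
  move=> a0; rewrite -ler_pdivrMl//; apply: le_push => // t t0.
  rewrite ler_pdivrMl//; have := push_le v (a *: u) sq (mulr_ge0 (ltW a0) t0).
  by rewrite -scalerA -scalerDr sq.2 ?(ltW a0)// mulrBr mulrA.
split=> [u w|a u].
  rewrite -lerBlDr; apply: le_push => // t t0; rewrite lerBlDl -lerBlDr.
  apply: le_push => // r r0; have := push_le v (u + w) sq (addr_ge0 t0 r0).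
  have := sq.1 (u + t *: v) (w + r *: v).
  by rewrite addrACA -scalerDl; lra.
rewrite le_eqVlt => /orP[/eqP<-|a0].
  rewrite scale0r mul0r; apply/eqP; rewrite eq_le; apply/andP; split.
    by have := push_le_self v 0 sq; rewrite (sublinear0 sq).
  by apply: le_push => // t t0; rewrite add0r sq.2// subrr.
apply/eqP; rewrite eq_le hZ//= -ler_pdivlMl//.
by rewrite -{1}[u](scalerK (lt0r_neq0 a0)) hZ// invr_gt0.
Qed.

Lemma push_lin q v : sublinear q -> push q v (- v) <= - q v.
Proof.
move=> sq; have := push_le v (- v) sq ler01.
by rewrite scale1r addNr sublinear0// mul1r sub0r.
Qed.

Definition lin_along q w := q (- w) <= - q w.

Lemma push_along q v : sublinear q -> lin_along (push q v) v.
Proof.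
move=> sq; apply: (le_trans (push_lin v sq)); rewrite lerN2; exact: push_le_self.
Qed.

Lemma push_keep q v w : sublinear q -> lin_along q w -> lin_along (push q v) w.
Proof.
move=> sq qw; apply: (le_trans (push_le_self v (- w) sq)); apply: (le_trans qw).
by rewrite lerN2; exact: push_le_self.
Qed.

(** Pushing first along [g] fixes the value at [g], then pushing along every basis vector makes the
    function linear. *)
Lemma norming_functional (q : 'rV[R]_d -> R) g : sublinear q ->
  exists y, (forall u, dot u y <= q u) /\ dot g y = q g.
Proof.
move=> sq; pose e (i : 'I_d) : 'rV[R]_d := delta_mx 0 i.
have [q' [sq' q'q q'g q'e]] : exists q', [/\ sublinear q', forall u, q' u <= q u,
    q' (- g) <= - q g & forall i, lin_along q' (e i)].
  have : forall s : seq 'I_d, exists q', [/\ sublinear q', forall u, q' u <= q u,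
    q' (- g) <= - q g & forall i, i \in s -> lin_along q' (e i)].
    elim => [|i s [q' [sq' q'q q'g q's]]].
      exists (push q g); split=> //; [exact: push_sublinear| |exact: push_lin].
      by move=> u; exact: push_le_self.
    exists (push q' (e i)); split.
    - exact: push_sublinear.
    - by move=> u; exact: le_trans (push_le_self _ _ sq') (q'q u).
    - exact: le_trans (push_le_self _ _ sq') q'g.
    - move=> j; rewrite inE => /orP[/eqP->|js]; first exact: push_along.
      by apply: push_keep => //; exact: q's.
  move=> /(_ (enum 'I_d))[q' [a b c h]]; exists q'; split => // i; apply: h.
  by rewrite mem_enum.
have qN u : - q' u <= q' (- u).
  by have := sq'.1 u (- u); rewrite subrr sublinear0//; lra.
pose y : 'rV[R]_d := \row_i q' (e i).
have le_y u : q' u <= dot u y.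
  have qs (s : seq 'I_d) : q' (\sum_(i <- s) u 0 i *: e i) <= \sum_(i <- s) u 0 i * q' (e i).
    elim: s => [|i s IH]; first by rewrite !big_nil sublinear0.
    rewrite !big_cons; apply: (le_trans (sq'.1 _ _)); apply: lerD => //.
    have [u0|u0] := lerP 0 (u 0 i); first by rewrite sq'.2.
    have -> : u 0 i *: e i = (- u 0 i) *: (- e i) by rewrite scalerN scaleNr opprK.
    have u0' : 0 <= - u 0 i by rewrite oppr_ge0 ltW.
    by rewrite sq'.2//; have := ler_wpM2l u0' (q'e i); rewrite mulrNN.
  rewrite {1}(row_sum_delta u); apply: (le_trans (qs _)); rewrite /dot.
  by under [in X in _ <= X]eq_bigr do rewrite mxE.
have yE u : dot u y = q' u.
  apply/eqP; rewrite eq_le le_y andbT.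
  by have := le_y (- u); have := qN u; rewrite dotNl; lra.
exists y; split => [u|]; first by rewrite yE.
apply/eqP; rewrite eq_le; apply/andP; split; first by rewrite yE.
by have := yE (- g); rewrite dotNl; lra.
Qed.

End HahnBanach.

(** * Gaussian averages of marginals *)

Section Frames.
Variable R : realType.

Lemma nrm_frame k p (B : 'M[R]_(k, p)) (u : 'rV[R]_k) : B *m B^T = 1%:M ->
  dot (u *m B) (u *m B) = dot u u.
Proof. by move=> BB; rewrite dot_mulmx -mulmxA BB mulmx1. Qed.

Lemma nrm_frameT k p (B : 'M[R]_(k, p)) (v : 'rV[R]_p) : B *m B^T = 1%:M ->
  nrm (v *m B^T) <= nrm v.
Proof.
move=> BB; have e : nrm (v *m B^T *m B) = nrm (v *m B^T) by rewrite /nrm nrm_frame.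
have [->|n0] := eqVneq (nrm (v *m B^T)) 0; first exact: nrm_ge0.
have np : 0 < nrm (v *m B^T) by rewrite lt_def n0 nrm_ge0.
rewrite -(ler_pM2r np) -[leLHS]expr2 nrm2 dot_mulmx trmxK.
by apply: le_trans (ler_norm _) _; apply: (le_trans (dot_le_nrm _ _)); rewrite e.
Qed.

Lemma row_frame k p (B : 'M[R]_(k, p)) j : B *m B^T = 1%:M -> dot (row j B) (row j B) = 1.
Proof.
move=> BB; have := congr1 (fun M : 'M[R]_k => M j j) BB; rewrite !mxE eqxx mulr1n => <-.
by apply: eq_bigr => i _; rewrite !mxE.
Qed.

(* Householder reflection exchanging a unit vector with the first basis vector. *)
Lemma orthogonal_with_first_row k (eta : 'rV[R]_k.+1) : dot eta eta = 1 ->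
  exists2 H : 'M[R]_k.+1, H *m H^T = 1%:M & row 0 H = eta.
Proof.
move=> e1; pose d : 'rV[R]_k.+1 := delta_mx 0 0; pose w := eta - d.
have dd : dot d d = 1.
  by rewrite /dot (bigD1 0)//= !mxE !eqxx mulr1 big1 ?addr0// => j j0; rewrite !mxE eqxx (negbTE j0) mulr0.
have dE v : dot d v = v 0 0.
  by rewrite /dot (bigD1 0)//= !mxE !eqxx mul1r big1 ?addr0// => j j0; rewrite !mxE eqxx (negbTE j0) mul0r.
have [w0|w0] := eqVneq w 0.
  exists 1%:M; first by rewrite trmx1 mulmx1.
  by rewrite row1 -/d; apply/eqP; rewrite eq_sym -subr_eq0 -/w w0.
have ww : dot w w != 0 by rewrite dot_eq0.
have wwE : dot w w = 2 - 2 * dot d eta by rewrite /w dotBl !dotBr e1 dd (dotC eta d); ring.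
pose c := 2 / dot w w; pose P := w^T *m w.
have PP : P *m P = dot w w *: P.
  rewrite /P mulmxA -(mulmxA w^T) (_ : w *m w^T = (dot w w)%:M); first by rewrite mul_mx_scalar scalemxAl.
  by apply/matrixP => i j; rewrite !ord1 -dotE mxE eqxx mulr1n.
have PT : P^T = P by rewrite trmx_mul trmxK.
exists (1%:M - c *: P).
  have -> : (1%:M - c *: P)^T = 1%:M - c *: P.
    by rewrite -[in RHS]PT; apply/matrixP => i j; rewrite !mxE eq_sym.
  rewrite mulmxBl mulmxBr !mul1mx -scalemxAl mulmxBr mulmx1 -scalemxAr PP.
  rewrite scalerA; have -> : c *: (P - (c * dot w w) *: P) = - (c *: P).
    have -> : c * dot w w = 2 by rewrite /c divfK.
    by rewrite -[P in P - _]scale1r -scalerBl (_ : 1 - 2 = -1 :> R) ?scaleN1r ?scalerN//; ring.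
  by rewrite opprK subrK.
rewrite rowE mulmxBr mulmx1 -scalemxAr /P mulmxA (_ : d *m w^T = (dot d w)%:M); last first.
  by apply/matrixP => i j; rewrite !ord1 -dotE mxE eqxx mulr1n.
rewrite mul_scalar_mx scalerA; have -> : c * dot d w = -1.
  have wd : dot d w = - (dot w w / 2) by rewrite wwE /w dotBr dd; field.
  by rewrite wd /c; field.
by rewrite scaleN1r opprK /w addrC subrK.
Qed.

(** The trace is computed in an orthonormal basis chosen adaptively: inside the current subspace of
    dimension [k + 1] the good direction [eta] is completed by a Householder reflection, contributes
    at most [be / (k + 1)], and is split off. This is where the harmonic sum arises. *)
Lemma trace_frame_bound p (T : 'M[R]_p) (be : R) :
  (forall k (B : 'M[R]_(k.+1, p)), (k < p)%N -> B *m B^T = 1%:M ->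
     exists2 eta : 'rV[R]_k.+1, dot eta eta = 1 & nrm (eta *m B *m T) <= be / k.+1%:R) ->
  \tr T <= \sum_(j < p) be / j.+1%:R.
Proof.
move=> h; suff H k (B : 'M[R]_(k, p)) : (k <= p)%N -> B *m B^T = 1%:M ->
    \tr (B *m T *m B^T) <= \sum_(j < k) be / j.+1%:R.
  by have := H p 1%:M (leqnn p); rewrite trmx1 !mulmx1 mul1mx; apply.
elim: k B => [|k IH] B kp BB.
  by rewrite big_ord0 [\tr _]big_ord0.
have [eta e1 he] := h k B kp BB.
have [H HH He] := orthogonal_with_first_row e1.
have HTH : H^T *m H = 1%:M by exact: mulmx1C HH.
pose B1 : 'M[R]_(1 + k, p) := H *m B.
have BB1 : B1 *m B1^T = 1%:M by rewrite /B1 trmx_mul mulmxA -(mulmxA H) BB mulmx1.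
have -> : \tr (B *m T *m B^T) = \tr (B1 *m T *m B1^T).
  have -> : B1 *m T *m B1^T = H *m (B *m T *m B^T *m H^T) by rewrite /B1 trmx_mul !mulmxA.
  by rewrite (mxtrace_mulC H) -(mulmxA _ H^T) HTH mulmx1.
have e0 : usubmx B1 = eta *m B.
  by apply/rowP => j; rewrite !mxE -He; apply: eq_bigr => i _; rewrite !mxE; congr (H _ _ * _); apply: val_inj.
have Bd : dsubmx B1 *m (dsubmx B1)^T = 1%:M.
  move: BB1; rewrite -[in X in X -> _](vsubmxK B1); move: (usubmx B1) (dsubmx B1) => U D.
  rewrite tr_col_mx mul_col_row => /(congr1 drsubmx); rewrite block_mxKdr => ->.
  apply/matrixP => i j; rewrite !mxE.
  by congr (_%:R); apply/eqP/eqP => [/rshift_inj|->].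
have -> : \tr (B1 *m T *m B1^T) = \tr (usubmx B1 *m T *m (usubmx B1)^T) +
    \tr (dsubmx B1 *m T *m (dsubmx B1)^T).
  rewrite -[in X in X = _](vsubmxK B1); move: (usubmx B1) (dsubmx B1) => U D.
  by rewrite tr_col_mx mul_col_mx mul_col_row mxtrace_block.
rewrite [leRHS]big_ord_recr/= [leLHS]addrC; apply: lerD; first by apply: (IH (dsubmx B1)) => //; exact: ltnW.
rewrite e0 /mxtrace big_ord1 -dotE; apply: le_trans (ler_norm _) _.
apply: le_trans (dot_le_nrm _ _) _.
have -> : nrm (eta *m B) = 1 by rewrite /nrm nrm_frame// e1 sqrtr1.
by rewrite mulr1.
Qed.

Lemma harmonic_le p : (0 < p)%N -> \sum_(j < p) j.+1%:R^-1 <= 1 + ln p%:R :> R.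
Proof.
elim: p => // -[_ _|p IH _]; first by rewrite big_ord1 ln1 addr0 invr1.
rewrite big_ord_recr/=; have := IH isT.
have h : p.+2%:R^-1 <= ln p.+2%:R - ln p.+1%:R :> R.
  rewrite -ln_div ?posrE// -[leLHS]expRK ler_ln ?posrE ?expR_gt0 ?divr_gt0//.
  rewrite -[X in X <= _]invrK -expRN -[leRHS]invrK lef_pV2 ?posrE ?expR_gt0 ?invr_gt0 ?divr_gt0// invf_div.
  apply: le_trans (expR_ge1Dx _); rewrite le_eqVlt; apply/orP; left; apply/eqP.
  have e : p.+1%:R = p.+2%:R - 1 :> R by rewrite -[p.+2%:R]natr1 addrK.
  by rewrite e mulrBl mul1r divff.
move: h; move: (ln _) (ln _) (_^-1) (\sum_(_ < _) _) => a b c d; lra.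
Qed.

End Frames.

Section GaussRows.
Variables (R : realType) (q m : nat).

Definition gvec (e : signs ('I_q * 'I_m)) : 'rV[R]_q :=
  \row_j ((Num.sqrt m%:R)^-1 * \sum_b sgb R (e (j, b))).

Definition swap_copy (b b' : 'I_m) (e : signs ('I_q * 'I_m)) : signs ('I_q * 'I_m) :=
  [ffun i => e (i.1, tperm b b' i.2)].

Lemma swap_copyK b b' : involutive (swap_copy b b').
Proof. by move=> e; apply/ffunP => -[j c]; rewrite !ffunE /= tpermK. Qed.

Lemma gvec_swap b b' e : gvec (swap_copy b b' e) = gvec e.
Proof.
apply/rowP => j; rewrite !mxE; congr (_ * _).
rewrite [RHS](reindex_inj (@perm_inj _ (tperm b b'))) /=.
by apply: eq_bigr => c _; rewrite ffunE.
Qed.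

Lemma wcoef_copy d (phi : 'rV[R]_q -> 'rV[R]_d) j b b' :
  wcoef (fun e => phi (gvec e)) [set (j, b)]%SET = wcoef (fun e => phi (gvec e)) [set (j, b')]%SET.
Proof.
rewrite /wcoef; congr (_ *: _).
rewrite (reindex (swap_copy b b'))/=; last by apply: onW_bij; exact: inv_bij (swap_copyK b b').
by apply: eq_bigr => e _; rewrite gvec_swap !walsh1 ffunE /= tpermL.
Qed.

Lemma dot_wcoef1 d (f : signs ('I_q * 'I_m) -> 'rV[R]_d) i v :
  dot (wcoef f [set i]%SET) v = @mean R _ (fun e : signs _ => sgb R (e i) * dot (f e) v).
Proof.
rewrite /wcoef dotZl dot_suml /mean; congr (_ * _).
by apply: eq_bigr => e _; rewrite dotZl walsh1.
Qed.

(** The [m] copies of a coordinate are exchangeable, so their linear coefficients coincide, and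
    Bessel's inequality divides the total [F^2] among them. *)
Lemma wcoef_copy_small d (phi : 'rV[R]_q -> 'rV[R]_d) (F : R) j b : 0 <= F ->
  (forall e, nrm (phi (gvec e)) <= F) ->
  nrm (wcoef (fun e => phi (gvec e)) [set (j, b)]%SET) <= F / Num.sqrt m%:R.
Proof.
move=> F0 hF; have m0 : (0 < m)%N by case: (m) b => [[]|].
have M0 : 0 < m%:R :> R by rewrite ltr0n.
set f := fun e => phi (gvec e).
rewrite ler_pdivlMr ?sqrtr_gt0// -ler_sqr ?nnegrE ?mulr_ge0 ?nrm_ge0 ?sqrtr_ge0//.
rewrite exprMn nrm2 sqr_sqrtr ?(ltW M0)// mulrC.
have -> : m%:R * dot (wcoef f [set (j, b)]%SET) (wcoef f [set (j, b)]%SET) =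
    \sum_b' dot (wcoef f [set (j, b')]%SET) (wcoef f [set (j, b')]%SET).
  rewrite -[X in X%:R * _]card_ord mulr_natl -sumr_const; apply: eq_bigr => b' _.
  by rewrite (wcoef_copy phi j b b').
apply: (@le_trans _ _ (@mean R _ (fun e : signs _ => dot (f e) (f e)))); last first.
  rewrite -[leRHS](@mean_cst R (signs ('I_q * 'I_m)) _ (card_signs_gt0 _)); apply: ler_mean => e.
  by rewrite -[dot _ _]nrm2 lerXn2r ?nnegrE ?nrm_ge0//; exact: hF.
apply: le_trans (bessel f).
pose inj b' : {set 'I_q * 'I_m} := [set (j, b')]%SET.
have ii : injective inj by move=> x y /setP/(_ (j, x)); rewrite !inE eqxx => /esym/eqP[].
rewrite (bigID (fun S : {set 'I_q * 'I_m} => S \in [set inj b' | b' : 'I_m]%SET))/= -[leLHS]addr0.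
apply: lerD; last by apply: sumr_ge0 => S _; exact: dot_ge0.
by rewrite big_imset/=; [|by move=> x y _ _; exact: ii].
Qed.

End GaussRows.

Section TheoremOne.
Variables (R : realType) (n : nat) (mu : probability (borel_rV R n) R).
Hypothesis hiso : isotropic mu.
Hypothesis hlc : log_concave mu.
Variables (p : nat) (A : 'M[R]_(p, n)) (sg : R).
Hypothesis p0 : (0 < p)%N.
Hypothesis sg0 : 0 < sg.
Hypothesis hA : forall u : 'rV[R]_p, nrm (u *m A) <= sg * nrm u.
Local Notation mean := (@mean R).
Local Notation sgb := (@sgb R).
Let N (xi : 'rV[R]_p) := hp mu p (xi *m A).
Let P0 : 0 < p%:R :> R. Proof. by rewrite ltr0n. Qed.

Lemma hp_mx_sublinear : sublinear N.
Proof.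
have hs := hp_seminorm hiso hlc p0; split=> [u v|a u a0]; first by rewrite /N mulmxDl hs.1.
by rewrite /N -scalemxAl hs.2 ger0_norm.
Qed.

Lemma norm_support y : (forall xi, dot xi y <= N xi) -> nrm y <= expR 26 * p%:R * sg.
Proof.
move=> hy; have [->|y0] := eqVneq (nrm y) 0; first by rewrite !mulr_ge0 ?expR_ge0// ltW.
have yp : 0 < nrm y by rewrite lt_def y0 nrm_ge0.
rewrite -(ler_pM2r yp) -[leLHS]expr2 nrm2; apply: (le_trans (hy y)).
apply: (le_trans (hp_nrm hiso hlc p0 _)); rewrite -[leRHS]mulrA ler_pM2l//.
by rewrite mulr_gt0// expR_gt0.
Qed.

(** The factor [(2 sg)^-1] brings the second moment of each coordinate below [1/4], as [center_mx]
    requires. *)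
Lemma frame_hs k (B : 'M[R]_(k, p)) : B *m B^T = 1%:M ->
  hs ((2 * sg)^-1 *: (B *m A)^T) <= k%:R / 4.
Proof.
move=> BB; rewrite /hs.
apply: (@le_trans _ _ (\sum_(j < k) 4^-1)); last by rewrite sumr_const card_ord mulr_natl.
apply: ler_sum => j _; under eq_bigr do rewrite !mxE exprMn.
rewrite -mulr_sumr; have -> : \sum_i (\sum_l B j l * A l i) ^+ 2 = dot (row j B *m A) (row j B *m A).
  by rewrite /dot; apply: eq_bigr => i _; rewrite !mxE -expr2; congr (_ ^+ 2); apply: eq_bigr => l _; rewrite !mxE.
have : dot (row j B *m A) (row j B *m A) <= sg ^+ 2.
  rewrite -nrm2 lerXn2r ?nnegrE ?nrm_ge0 ?(ltW sg0)//; apply: (le_trans (hA _)).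
  by rewrite /nrm row_frame// sqrtr1 mulr1.
move: (dot _ _) => t h; apply: (@le_trans _ _ ((2 * sg)^-1 ^+ 2 * sg ^+ 2)).
  by rewrite ler_wpM2l// sqr_ge0.
by rewrite le_eqVlt; apply/orP; left; apply/eqP; field; rewrite gt_eqF.
Qed.

Lemma frame_in_Zp k (B : 'M[R]_(k, p)) y : (forall xi, dot xi y <= N xi) ->
  in_Zp mu ((2 * sg)^-1 *: (B *m A)^T) p ((2 * sg)^-1 *: (y *m B^T)).
Proof.
move=> hy xi H H0; have c0 : 0 < (2 * sg)^-1 by rewrite invr_gt0 mulr_gt0.
have E (x : 'rV[R]_n) : dot xi (x *m ((2 * sg)^-1 *: (B *m A)^T)) =
    dot ((2 * sg)^-1 *: (xi *m B *m A)) x.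
  by rewrite -scalemxAr dotZr dotZl -mulmxA dot_mulmx.
under eq_integral do rewrite E.
move=> /(hp_le hiso hlc p0 H0); apply: le_trans.
rewrite dotZr (hp_seminorm hiso hlc p0).2 gtr0_norm// ler_pM2l//.
by rewrite -dot_mulmx; exact: hy.
Qed.

(* The constant [36 p e^21 / k] is twice the radius of [Zp_covering]. *)
Lemma small_direction k (B : 'M[R]_(k.+1, p)) (I : finType) (w : I -> 'rV[R]_p)
    (z err : signs I -> 'rV[R]_p) (L : R) (mm : nat) :
  (k < p)%N -> B *m B^T = 1%:M -> 1 <= L ->
  (forall e : signs I, \sum_i sgb (e i) *: w i = z e - err e) ->
  (forall xi e, `|dot xi (z e)| <= L * N xi) ->
  mean (fun e => dot (err e) (err e)) <= 2^-1 * (18 * sg * p%:R * expR 21) ^+ 2 / p%:R ->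
  ~~ odd mm -> (p <= mm)%N -> 2 * expR 104 <= mm%:R :> R ->
  (forall i, nrm (w i) * p%:R * mm%:R <= sg * Num.sqrt mm%:R) ->
  exists2 eta : 'rV[R]_k.+1, dot eta eta = 1 &
    \sum_i dot (w i) (eta *m B) ^+ 2 <= (expR 52 * (36 * sg * L * p%:R * expR 21 / k.+1%:R)) ^+ 2.
Proof.
move=> kp BB L1 wE zle errle omm pmm bigmm small.
set K := k.+1; have K0 : 0 < K%:R :> R by rewrite ltr0n.
pose rho : R := 36 * sg * L * p%:R * expR 21 / K%:R.
have e21 := expR_gt0 (21 : R).
have L0 : 0 < L by lra.
have rho0 : 0 < rho by rewrite divr_gt0// !mulr_gt0.
(* The constant is half of [104 = 96 + 8]: a probability of [exp(-12 k)] has eighth power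
   [exp(-96 k)], and [small_ball] loses [exp(8 k)]. *)
pose s : R := expR 52 * rho; have s0 : 0 < s by rewrite mulr_gt0 ?expR_gt0.
(* If every unit vector of the row space violated the bound, the projected sign sums would satisfy
   the expansion hypothesis of [small_ball]. But they stay, half of the time, near one of at most
   [exp(10 k)] centres, so one ball would have too large a probability. *)
have [//|no] := pselect (exists2 eta : 'rV[R]_k.+1, dot eta eta = 1 &
    \sum_i dot (w i) (eta *m B) ^+ 2 <= s ^+ 2).
have hsB : hs ((2 * sg)^-1 *: (B *m A)^T) <= K%:R / 4 by exact: frame_hs.
have [cs [scs hcs]] := Zp_covering hlc (ltn0Sn k) (center_mx hiso (ltn0Sn k) hsB) p0 kp.
pose kap : R := K%:R / (p%:R * expR 21).
have kap0 : 0 < kap by rewrite divr_gt0// mulr_gt0.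
pose tt : R := 2 * sg * L / kap; have tt0 : 0 < tt by rewrite divr_gt0// !mulr_gt0.
have rhoE : rho = 18 * tt by rewrite /rho /tt /kap; field; rewrite !gt_eqF.
pose lin (e : signs I) := \sum_i sgb (e i) *: (w i *m B^T).
pose t2 := (9 * tt) ^+ 2 * K%:R.
have sK : Num.sqrt K%:R ^+ 2 = K%:R :> R by rewrite sqr_sqrtr// ltW.
(* The radius [rho sqrt k] is shared equally between the covering of the body containing [z e / L]
   and the error [err e]. *)
have close e : dot (err e) (err e) <= t2 -> exists2 c, c \in cs &
    dot (lin e - tt *: c) (lin e - tt *: c) <= rho ^+ 2 * K%:R.
  move=> he; have zZ xi : dot xi (L^-1 *: z e) <= N xi.
    rewrite dotZr ler_pdivrMl//; exact: le_trans (ler_norm _) (zle xi e).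
  have [c cin hc] := hcs _ (@frame_in_Zp _ B _ zZ); exists c => //.
  have -> : lin e - tt *: c = (z e *m B^T - tt *: c) + - (err e *m B^T).
    rewrite /lin; under eq_bigr do rewrite scalemxAl.
    by rewrite -mulmx_suml wE mulmxBl addrAC.
  have -> : rho ^+ 2 * K%:R = (9 * tt * Num.sqrt K%:R + 9 * tt * Num.sqrt K%:R) ^+ 2.
    by rewrite rhoE -[in LHS]sK; ring.
  have q0 : 0 <= 9 * tt * Num.sqrt K%:R by rewrite mulr_ge0 ?sqrtr_ge0// mulr_ge0// ltW.
  apply: dot_tri => //.
    have -> : z e *m B^T - tt *: c = tt *: (kap *: ((2 * sg)^-1 *: (L^-1 *: z e *m B^T)) - c).
      rewrite scalerBr !scalerA -scalemxAl scalerA; congr (_ - _); rewrite -[LHS]scale1r.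
      by congr (_ *: _); rewrite /tt; field; rewrite !gt_eqF.
    rewrite dotZl dotZr mulrA -expr2 (_ : (9 * tt * Num.sqrt K%:R) ^+ 2 = tt ^+ 2 * (81 * K%:R)); last first.
      by rewrite !exprMn sK; ring.
    by rewrite ler_pM2l ?exprn_gt0.
  rewrite dotNl dotNr opprK; apply: (@le_trans _ _ (dot (err e) (err e))).
    by rewrite -!nrm2 lerXn2r ?nnegrE ?nrm_ge0// nrm_frameT.
  by apply: (le_trans he); rewrite /t2 -[in leLHS]sK; have -> : (9 * tt * Num.sqrt K%:R) ^+ 2 = (9 * tt) ^+ 2 * Num.sqrt K%:R ^+ 2 by ring.
pose ind c e : R := (dot (lin e - tt *: c) (lin e - tt *: c) <= rho ^+ 2 * K%:R)%R%:R.
have t20 : 0 < t2 by apply: mulr_gt0 => //; apply: exprn_gt0; apply: mulr_gt0.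
have errt2 : mean (fun e => dot (err e) (err e)) <= 2^-1 * t2.
  apply: (le_trans errle); rewrite -mulrA ler_pM2l ?invr_gt0//.
  have -> : t2 = (18 * sg * p%:R * expR 21) ^+ 2 * (L ^+ 2 / K%:R).
    by rewrite /t2 /tt /kap; field; rewrite !gt_eqF.
  rewrite ler_pM2l ?exprn_gt0 ?mulr_gt0//.
  apply: (@le_trans _ _ K%:R^-1); first by rewrite lef_pV2 ?posrE// ler_nat.
  by rewrite -[leLHS]mul1r ler_pM2r ?invr_gt0// expr_ge1//; lra.
have half : 2^-1 <= mean (fun e => \sum_(c <- cs) ind c e).
  apply: (@le_trans _ _ (mean (fun e => 1 - t2^-1 * dot (err e) (err e)))).
    rewrite meanD mean_cst ?card_signs_gt0// meanN meanZ.
    have : t2^-1 * mean (fun e => dot (err e) (err e)) <= t2^-1 * (2^-1 * t2) by rewrite ler_pM2l ?invr_gt0.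
    have -> : t2^-1 * (2^-1 * t2) = 2^-1 by field; rewrite gt_eqF.
    lra.
  apply: ler_mean => e; have sum0 (r : seq 'rV[R]_K) : 0 <= \sum_(c <- r) ind c e by apply: sumr_ge0.
  have [he|he] := lerP (dot (err e) (err e)) t2; last first.
    apply: le_trans (sum0 _); rewrite subr_le0 mulrC ler_pdivlMr// mul1r; exact: ltW.
  have [c cin hc] := close e he; rewrite (big_rem c)//= {1}/ind hc.
  have h1 := sum0 (rem c cs); have h2 : 0 <= t2^-1 * dot (err e) (err e).
    by rewrite mulr_ge0 ?dot_ge0// invr_ge0 ltW.
  by rewrite mulr1n; lra.
rewrite mean_sum in half.
(* Otherwise the [exp(10 k)] balls together would have probability at most [exp(-2 k) < 1/2]. *)
have [c hc] : exists c, expR (- (12 * K%:R)) <= mean (ind c).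
  apply: contrapT => /forallNP noc.
  have lt1 : \sum_(c <- cs) mean (ind c) <= (size cs)%:R * expR (- (12 * K%:R)).
    elim: (cs) => [|c r IH]; first by rewrite big_nil mul0r.
    rewrite big_cons /= -[(size r).+1%:R]natr1 mulrDl mul1r addrC lerD//.
    by have /negP := noc c; rewrite -ltNge => /ltW.
  have lt2 : (size cs)%:R * expR (- (12 * K%:R)) <= expR (- (2 * K%:R)) :> R.
    apply: (@le_trans _ _ (expR (10 * K%:R) * expR (- (12 * K%:R)))); first by rewrite ler_pM2r ?expR_gt0.
    by rewrite -expRD ler_expR; lra.
  have : 2^-1 <= expR (- (2 * K%:R)) :> R by lra.
  rewrite expRN lef_pV2 ?posrE ?expR_gt0//; have := expR_ge1Dx (2 * K%:R : R).
  have : 1 <= K%:R :> R by rewrite ler1n.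
  lra.
have sb := @small_ball R I K mm (fun i => w i *m B^T) (tt *: c) rho s rho0 (ltW s0).
have H1 : (K <= mm)%N by exact: leq_trans kp pmm.
have H2 : (0 < mm)%N by exact: leq_trans H1.
have H3 : 2 * s ^+ 2 <= rho ^+ 2 * mm%:R.
  rewrite /s exprMn (_ : expR 52 ^+ 2 = expR 104); last by rewrite -expRM_natl; congr expR; lra.
  rewrite mulrA mulrC ler_pM2l ?exprn_gt0//.
have H4 i : nrm (w i *m B^T) * K%:R * mm%:R <= rho * Num.sqrt mm%:R.
  apply: (@le_trans _ _ (nrm (w i) * p%:R * mm%:R)).
    rewrite ler_wpM2r// ler_pM ?nrm_ge0 ?nrm_frameT ?ler_nat//.
  apply: (le_trans (small i)); apply: ler_wpM2r; first exact: sqrtr_ge0.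
  rewrite /rho ler_pdivlMr//; have kpR : K%:R <= p%:R :> R by rewrite ler_nat.
  have e1 : 1 <= expR 21 :> R by have := expR_ge1Dx (21 : R); lra.
  have h1 : sg * K%:R <= sg * p%:R by rewrite ler_pM2l.
  have h2 : sg * p%:R * 1 <= sg * p%:R * (36 * L * expR 21).
    rewrite ler_pM2l ?mulr_gt0//; have : 1 * 1 <= L * expR 21 by apply: ler_pM.
    lra.
  lra.
have H5 eta : s ^+ 2 * dot eta eta <= \sum_i dot (w i *m B^T) eta ^+ 2.
  have [->|e0] := eqVneq eta 0.
    by rewrite dot0l mulr0 sumr_ge0// => i _; exact: sqr_ge0.
  have ne : 0 < nrm eta by rewrite lt_def nrm_ge0 nrm_eq0 e0.
  have h : s ^+ 2 <= \sum_i dot (w i) ((nrm eta)^-1 *: eta *m B) ^+ 2.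
    rewrite leNgt; apply/negP => lt; apply: no; exists ((nrm eta)^-1 *: eta); last exact: ltW.
    by rewrite dotZl dotZr -nrm2; field; rewrite gt_eqF.
  rewrite -nrm2 -ler_pdivlMr ?exprn_gt0// mulr_suml; apply: (le_trans h).
  rewrite le_eqVlt; apply/orP; left; apply/eqP; apply: eq_bigr => i _.
  by rewrite -scalemxAl dotZr exprMn exprVn mulrC dot_mulmx trmxK.
have := sb H1 H2 omm H3 H4 H5.
have e8 : expR (- (96 * K%:R)) <= mean (ind c) ^+ 8.
  rewrite (_ : expR _ = expR (- (12 * K%:R)) ^+ 8); last by rewrite -expRM_natl; congr expR; lra.
  by rewrite lerXn2r ?nnegrE ?expR_ge0//; apply: mean_ge0 => e; exact: ler0n.
move=> /(le_trans e8); rewrite ler_pdivlMr; last first.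
  apply: exprn_gt0; apply: ltr_wpDr => //; apply: divr_ge0; last exact: sqr_ge0.
  by apply: mulr_ge0 => //; exact: sqr_ge0.
have -> : 2 * s ^+ 2 / rho ^+ 2 = 2 * expR 104.
  rewrite /s exprMn (_ : expR 52 ^+ 2 = expR 104); last by rewrite -expRM_natl; congr expR; lra.
  by field; rewrite gt_eqF.
have : expR (104 * K%:R) < (1 + 2 * expR 104) ^+ K :> R.
  rewrite [X in expR X]mulrC expRM_natl ltrXn2r ?expR_ge0//.
  by have := expR_gt0 (104 : R); lra.
rewrite -(@ltr_pM2l _ (expR (- (96 * K%:R)))) ?expR_gt0// -expRD => lt104 le.
have := lt_le_trans lt104 le.
by rewrite ltr_expR (_ : - (96 * K%:R) + 104 * K%:R = 8 * K%:R) ?ltxx//; ring.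
Qed.

(** About [2 ln p] nodes in [[0, 1/2]]: the uncancelled odd powers are of order [4^-m], below
    [1 / p], while the mass stays linear in the number of nodes. This is the logarithmic K-convexity
    constant. *)
Lemma coefs_for_p : exists (J : finType) (c r : J -> R),
  [/\ forall j, `|r j| <= 1, \sum_j c j * r j = 1,
    forall k, (0 < k)%N -> `|\sum_j c j * r j ^+ k.*2.+1| <= expR (- 5) / p%:R &
    1 <= \sum_j `|c j| <= expR 9 * (1 + ln p%:R)].
Proof.
(* With [m >= x] the tail is at most [8 exp(- x / 2) = 8 exp(-8) / p], and [8 exp(-3) <= 1] leaves
   [exp(-5) / p]. *)
pose x : R := 2 * ln p%:R + 16.
have lp0 : 0 <= ln p%:R :> R by rewrite ln_ge0// ler1n.
have x0 : 0 <= x by rewrite /x; lra.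
have [m [m0 xm mx]] : exists m : nat, [/\ (0 < m)%N, x <= m%:R & m%:R <= x + 1].
  exists (Num.truncn x).+1; have /andP[h1 h2] := Num.Theory.truncn_itv x0; split => //; first exact: ltW.
  by rewrite -[X in X <= _]natr1; lra.
have [c [r [r01 cr1 crk cm]]] := interpolation_coefs R m0.
have r1 j : `|r j| <= 1 / 2 by have /andP[a b] := r01 j; rewrite ger0_norm.
exists 'I_m, c, r; split => //.
- by move=> j; apply: (le_trans (r1 j)); lra.
- move=> k k0; have [km|mk] := ltnP k m.
    by rewrite crk ?k0// normr0 divr_ge0 ?expR_ge0.
  apply: (@le_trans _ _ ((\sum_j `|c j|) * (1 / 2) ^+ m.*2.+1)).
    apply: (le_trans (ler_norm_sum _ _ _)); rewrite mulr_suml; apply: ler_sum => j _.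
    rewrite normrM ler_wpM2l// normrX; apply: (@le_trans _ _ ((1 / 2) ^+ k.*2.+1)).
      by rewrite lerXn2r ?nnegrE// divr_ge0.
    by apply: ler_wiXn2l; rewrite ?ltnS ?leq_double//; lra.
  apply: (@le_trans _ _ (16 * m%:R * (1 / 2) ^+ m.*2.+1)); first by rewrite ler_wpM2r// exprn_ge0// divr_ge0.
  have -> : (1 / 2) ^+ m.*2.+1 = (1 / 2) * ((1 / 2) ^+ m * (1 / 2) ^+ m) :> R.
    by rewrite exprS -addnn exprD.
  have m2 : m%:R * (1 / 2) ^+ m <= 1 :> R.
    rewrite exprMn expr1n mul1r exprVn ler_pdivrMr ?exprn_gt0// mul1r -natrX ler_nat.
    exact: ltnW (ltn_expl _ _).
  have h2 : (1 / 2) ^+ m <= expR (- x / 2) :> R.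
    apply: (@le_trans _ _ (expR (- (1 / 2)) ^+ m)).
      rewrite lerXn2r ?nnegrE ?expR_ge0 ?divr_ge0//.
      by have := expR_ge1Dx (- (1 / 2) : R); lra.
    rewrite -expRM_natl ler_expR; lra.
  have -> : 16 * m%:R * ((1 / 2) * ((1 / 2) ^+ m * (1 / 2) ^+ m)) = 8 * ((m%:R * (1 / 2) ^+ m) * (1 / 2) ^+ m) :> R by field.
  apply: (@le_trans _ _ (8 * (1 * expR (- x / 2)))).
    by rewrite ler_pM2l// ler_pM// ?mulr_ge0 ?exprn_ge0 ?divr_ge0.
  have -> : - x / 2 = - ln p%:R + (- 5 + - 3) by rewrite /x; field.
  rewrite !expRD expRN lnK ?posrE// mul1r.
  have h8 : 8 * expR (- 3) <= 1 :> R.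
    rewrite expRN ler_pdivrMr ?expR_gt0// mul1r.
    have -> : expR 3 = expR 1 ^+ 3 :> R by rewrite -expRM_natl mulr1.
    have -> : 8 = 2 ^+ 3 :> R by rewrite -natrX.
    by rewrite lerXn2r ?nnegrE ?expR_ge0//; have := expR_ge1Dx (1 : R); lra.
  have h0 : 0 <= expR (- 5) / p%:R :> R by rewrite divr_ge0 ?expR_ge0.
  have := ler_wpM2l h0 h8; rewrite mulr1; apply: le_trans.
  by rewrite le_eqVlt; apply/orP; left; apply/eqP; ring.
apply/andP; split.
  apply: (@le_trans _ _ (\sum_j `|c j * r j|)).
    by rewrite -[X in X <= _]normr1 -cr1; exact: ler_norm_sum.
  apply: ler_sum => j _; rewrite normrM -[leRHS]mulr1 ler_wpM2l//.
  by apply: (le_trans (r1 j)); lra.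
apply: (le_trans cm); apply: (@le_trans _ _ (272 * (1 + ln p%:R))).
  rewrite /x in mx; lra.
rewrite ler_wpM2r//; first lra.
have -> : expR 9 = expR 1 ^+ 9 :> R by rewrite -expRM_natl mulr1.
apply: (@le_trans _ _ (2 ^+ 9)); first by rewrite -natrX ler_nat.
by rewrite lerXn2r ?nnegrE ?expR_ge0//; have := expR_ge1Dx (1 : R); lra.
Qed.

(** Choosing a support vector [phi g] for every [g], the mean norm is the mean of [dot g (phi g)].
    Only the linear Walsh part of [phi] contributes, and it does so through the trace of a matrix,
    to which [trace_frame_bound] and [small_direction] apply. *)
Lemma gauss_hp_square : exists2 m, (0 < m)%N &
  mean (fun e : signs ('I_p * 'I_m) => hp mu p (gvec R e *m A)) <=
  expR 90 * sg * p%:R * (1 + ln p%:R) ^+ 2.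
Proof.
have lp0 : 0 <= ln p%:R :> R by rewrite ln_ge0// ler1n.
have [J [c [r [r1 cr1 crk /andP[L1 Lle]]]]] := coefs_for_p.
set L := \sum_j `|c j| in L1 Lle.
have [phi hphi] : exists phi : 'rV[R]_p -> 'rV[R]_p, forall g,
    (forall u, dot u (phi g) <= N u) /\ dot g (phi g) = N g.
  exists (fun g => xget 0 [set y | (forall u, dot u y <= N u) /\ dot g y = N g]) => g.
  have [y hy] := norming_functional g hp_mx_sublinear.
  by have := @xgetPex _ 0 [set y | (forall u, dot u y <= N u) /\ dot g y = N g] (ex_intro _ y hy).
have [mm [omm pmm bigmm]] : exists mm, [/\ ~~ odd mm, (p <= mm)%N & 2 * expR 104 <= mm%:R :> R].
  pose q := Num.truncn (expR 104 : R).
  have /andP[_ hq] := Num.Theory.truncn_itv (expR_ge0 104 : 0 <= _ :> R).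
  exists (q.+1 * p).*2; split; first by rewrite odd_double.
    by rewrite -addnn; apply: leq_trans (leq_addr _ _); rewrite leq_pmull.
  have : (q.+1 <= q.+1 * p)%N by rewrite leq_pmulr.
  rewrite -(ler_nat R) -addnn natrD => h; lra.
pose F : R := expR 26 * p%:R * sg.
have F0 : 0 < F by rewrite !mulr_gt0 ?expR_gt0.
(* So many copies are taken that each linear coefficient, of norm at most [F / sqrt m], is short
   enough for [small_ball]. *)
have [m m0 mbig] : exists2 m, (0 < m)%N & F * p%:R * mm%:R <= sg * Num.sqrt mm%:R * Num.sqrt m%:R.
  have mm0 : 0 < Num.sqrt mm%:R :> R by rewrite sqrtr_gt0 ltr0n (leq_trans p0).
  pose y := F * p%:R * mm%:R / (sg * Num.sqrt mm%:R).
  have y0 : 0 <= y by rewrite divr_ge0 ?mulr_ge0 ?(ltW sg0) ?(ltW F0) ?sqrtr_ge0.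
  exists (Num.truncn (y ^+ 2)).+1 => //.
  rewrite -ler_pdivrMl ?mulr_gt0// mulrC -/y.
  have -> : y = Num.sqrt (y ^+ 2) by rewrite sqrtr_sqr ger0_norm.
  rewrite sqr_sqrtr ?sqr_ge0// ler_wsqrtr//.
  by have /andP[_ /ltW] := Num.Theory.truncn_itv (sqr_ge0 y).
exists m => //.
pose f (e : signs ('I_p * 'I_m)) := phi (gvec R e).
have fN e u : dot u (f e) <= N u by exact: (hphi _).1.
have NN u : N (- u) = N u by rewrite /N mulNmx (seminormN (hp_seminorm hiso hlc p0)).
have fN' e u : `|dot u (f e)| <= N u.
  rewrite ler_norml fN andbT lerNl -dotNl -NN; exact: fN.
have fF e : nrm (f e) <= F by apply: norm_support => u; exact: fN.
have [z [err [wE zle errle]]] := @linear_part_approx R _ p J c r (expR (- 5) / p%:R) f r1 (divr_ge0 (expR_ge0 (- 5)) (ltW P0)) cr1 crk.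
pose w i := wcoef f [set i]%SET.
pose T : 'M[R]_p := \matrix_(l, j) ((Num.sqrt m%:R)^-1 * \sum_b w (j, b) 0 l).
have M0 : 0 < m%:R :> R by rewrite ltr0n.
have trT : mean (fun e : signs ('I_p * 'I_m) => hp mu p (gvec R e *m A)) = \tr T.
  rewrite (@eq_mean R _ _ (fun e => dot (gvec R e) (f e))); last by move=> e; rewrite (hphi _).2.
  rewrite /dot mean_sum /mxtrace; apply: eq_bigr => j _; rewrite mxE.
  under eq_mean do rewrite mxE -mulrA.
  rewrite meanZ; congr (_ * _); under eq_mean do rewrite mulr_suml.
  rewrite mean_sum; apply: eq_bigr => b _.
  have := dot_wcoef1 f (j, b) (delta_mx 0 j); rewrite -/(w (j, b)).
  have dd (v : 'rV[R]_p) : dot v (delta_mx 0 j) = v 0 j.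
    by rewrite /dot (bigD1 j)//= mxE !eqxx mulr1 big1 ?addr0// => l lj; rewrite mxE eqxx (negbTE lj) mulr0.
  by rewrite dd => ->; apply: eq_mean => e; rewrite dd.
rewrite trT; pose be : R := expR 79 * sg * L * p%:R.
apply: (@le_trans _ _ (be * (1 + ln p%:R))); last first.
  rewrite /be (_ : expR 90 = expR 79 * expR 11); last by rewrite -expRD; congr expR; lra.
  have e911 : expR 9 <= expR 11 :> R by rewrite ler_expR; lra.
  have : L <= expR 11 * (1 + ln p%:R) by apply: (le_trans Lle); rewrite ler_wpM2r//; lra.
  move=> Lh; have := ler_wpM2l (_ : 0 <= expR 79 * sg * p%:R * (1 + ln p%:R)) Lh.
  rewrite !mulr_ge0 ?expR_ge0 ?(ltW sg0)//; last lra.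
  by move=> /(_ isT); rewrite expr2; lra.
apply: (@le_trans _ _ (\sum_(j < p) be / j.+1%:R)); last first.
  by rewrite -mulr_sumr ler_wpM2l ?harmonic_le// !mulr_ge0 ?expR_ge0 ?(ltW sg0)//; lra.
apply: trace_frame_bound => k B kp BB.
have small i : nrm (w i) * p%:R * mm%:R <= sg * Num.sqrt mm%:R.
  case: i => j b; have := wcoef_copy_small (phi := phi) j b (ltW F0) (fun e => fF e).
  rewrite -/f -/(w _) => h; rewrite -(@ler_pM2r _ (Num.sqrt m%:R)) ?sqrtr_gt0//.
  apply: le_trans mbig; rewrite ler_pdivlMr ?sqrtr_gt0// in h.
  have -> : nrm (w (j, b)) * p%:R * mm%:R * Num.sqrt m%:R = nrm (w (j, b)) * Num.sqrt m%:R * (p%:R * mm%:R) by ring.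
  by rewrite -[leRHS]mulrA ler_wpM2r// mulr_ge0.
have zle' xi e : `|dot xi (z e)| <= L * N xi by apply: zle => e'; exact: fN'.
(* The precision [exp(-5) / p] cancels the [p] and the excess of [exp 26] over [exp 21] in the crude
   bound [F] on the support vectors. *)
have errle' : mean (fun e => dot (err e) (err e)) <= 2^-1 * (18 * sg * p%:R * expR 21) ^+ 2 / p%:R.
  apply: (le_trans errle); apply: (@le_trans _ _ ((expR (- 5) / p%:R) ^+ 2 * F ^+ 2)).
    rewrite ler_wpM2l ?sqr_ge0// -[leRHS](@mean_cst R (signs ('I_p * 'I_m)) _ (card_signs_gt0 _)).
    by apply: ler_mean => e; rewrite -nrm2 lerXn2r ?nnegrE ?nrm_ge0 ?(ltW F0).
  have -> : (expR (- 5) / p%:R) ^+ 2 * F ^+ 2 = (sg * expR 21) ^+ 2.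
    rewrite /F (_ : expR 26 = expR 5 * expR 21); last by rewrite -expRD; congr expR; lra.
    by rewrite expRN; field; rewrite !gt_eqF ?expR_gt0.
  have -> : 2^-1 * (18 * sg * p%:R * expR 21) ^+ 2 / p%:R = (sg * expR 21) ^+ 2 * (162 * p%:R).
    by field; rewrite gt_eqF.
  rewrite -[leLHS]mulr1 ler_wpM2l ?sqr_ge0//.
  have : 1 <= p%:R :> R by rewrite ler1n.
  lra.
have [eta e1 he] := small_direction kp BB L1 wE zle' errle' omm pmm bigmm small.
exists eta => //.
rewrite -ler_sqr ?nnegrE ?nrm_ge0 ?divr_ge0 ?mulr_ge0 ?expR_ge0 ?(ltW sg0)//; last lra.
rewrite nrm2; apply: (@le_trans _ _ (\sum_i dot (w i) (eta *m B) ^+ 2)).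
  rewrite (eq_bigr (fun jb : 'I_p * 'I_m => dot (w (jb.1, jb.2)) (eta *m B) ^+ 2)); last by case.
  rewrite -(pair_bigA _ (fun j b => dot (w (j, b)) (eta *m B) ^+ 2))/= [leLHS]/dot; apply: ler_sum => j _.
  rewrite -expr2 mxE; have -> : \sum_l (eta *m B) 0 l * T l j =
      (Num.sqrt m%:R)^-1 * \sum_b dot (w (j, b)) (eta *m B).
    rewrite -[in RHS]dot_suml /dot mulr_sumr; apply: eq_bigr => l _.
    by rewrite [T _ _]mxE summxE mulrC -mulrA.
  rewrite exprMn exprVn sqr_sqrtr ?(ltW M0)// ler_pdivrMl//.
  (* Cauchy-Schwarz over the [m] copies of a coordinate passes from the entries of [T] to the
     individual coefficients that [small_direction] controls. *)
  have := dot_CS (\row_(b < m) (dot (w (j, b)) (eta *m B))) (const_mx 1).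
  rewrite (_ : dot _ (const_mx 1) = \sum_b dot (w (j, b)) (eta *m B)); last first.
    by apply: eq_bigr => b _; rewrite !mxE mulr1.
  rewrite (_ : dot (const_mx 1) (const_mx 1) = m%:R); last first.
    by rewrite /dot (eq_bigr (fun=> 1)) ?sumr_const ?card_ord// => b _; rewrite !mxE mulr1.
  rewrite mulrC (_ : dot (\row_b _) _ = \sum_b dot (w (j, b)) (eta *m B) ^+ 2)//.
  by apply: eq_bigr => b _; rewrite !mxE expr2.
apply: (le_trans he); rewrite lerXn2r ?nnegrE ?divr_ge0 ?mulr_ge0 ?expR_ge0 ?(ltW sg0)//; try lra.
rewrite mulrA ler_wpM2r ?invr_ge0// /be.
have -> : expR 79 = expR 52 * expR 21 * expR 1 ^+ 6 :> R.
  by rewrite -expRM_natl -!expRD; congr expR; lra.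
have e6 : 36 <= expR 1 ^+ 6 :> R.
  apply: (@le_trans _ _ (2 ^+ 6)); first by rewrite -natrX ler_nat.
  by rewrite lerXn2r ?nnegrE ?expR_ge0//; have := expR_ge1Dx (1 : R); lra.
have h0 : 0 <= expR 52 * expR 21 * (sg * L * p%:R) by rewrite !mulr_ge0 ?expR_ge0 ?(ltW sg0)//; lra.
have := ler_wpM2l h0 e6; move: (expR 52) (expR 21) (expR 1 ^+ 6) => a b c' h; lra.
Qed.

End TheoremOne.

(** * Nets of the unit ball and norms of random sign matrices *)

Section Net.
Variables (R : realType) (q : nat).
Hypothesis q0 : (0 < q)%N.
Let sq : R := Num.sqrt q%:R.
Let sq0 : 0 < sq. Proof. by rewrite sqrtr_gt0 ltr0n. Qed.
Let sq2 : sq ^+ 2 = q%:R. Proof. by rewrite sqr_sqrtr. Qed.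

Notation grid := {ffun 'I_q -> 'I_(q.*2.*2.+1)}.

(** The lattice of step [1 / (2 sqrt q)]: rounding every coordinate moves a point by at most [1/2]
    in the Euclidean norm. *)
Definition gridpt (a : grid) : 'rV[R]_q := \row_j (((a j)%:R - q.*2%:R) / (2 * sq)).

Definition net : {set grid} := [set a | dot (gridpt a) (gridpt a) <= 9 / 4]%SET.

Lemma gridpt_dot a : 4 * q%:R * dot (gridpt a) (gridpt a) = \sum_j ((a j)%:R - q.*2%:R) ^+ 2.
Proof.
rewrite /dot mulr_sumr; apply: eq_bigr => j _; rewrite !mxE -sq2; field.
by rewrite gt_eqF.
Qed.

Lemma card_net : #|net|%:R <= expR (11 * q%:R) :> R.
Proof.
rewrite (_ : 11 = 9 + 2); last lra.
apply: (@card_ball_le R q _ (fun=> q.*2%:R)) => a; rewrite inE -gridpt_dot => h.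
have : 4 * q%:R * dot (gridpt a) (gridpt a) <= 4 * q%:R * (9 / 4) by rewrite ler_pM2l// mulr_gt0// ltr0n.
lra.
Qed.

Lemma near_net (x : 'rV[R]_q) : nrm x <= 1 ->
  exists2 a, a \in net & nrm (x - gridpt a) <= 1 / 2.
Proof.
move=> x1; have q1 : 1 <= q%:R :> R by rewrite ler1n.
have sqq : sq <= q%:R by rewrite -sq2 expr2 ler_peMl ?(ltW sq0)// -(@ler_sqr R) ?nnegrE ?(ltW sq0)// expr1n sq2.
have xj j : `|x 0 j| <= 1 by apply: le_trans x1; exact: coord_le_nrm.
have q2 : q.*2%:R = 2 * q%:R :> R by rewrite -addnn natrD; ring.
have hb j : 0 <= 2 * sq * x 0 j + q.*2%:R <= 4 * q%:R.
  have : `|2 * sq * x 0 j| <= 2 * q%:R.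
    rewrite normrM ger0_norm ?mulr_ge0 ?(ltW sq0)// -[leRHS]mulr1; apply: ler_pM => //.
      by rewrite mulr_ge0 ?(ltW sq0).
    by rewrite ler_pM2l.
  by rewrite ler_norml q2 => /andP[? ?]; apply/andP; split; lra.
have tr (j : 'I_q) : (Num.truncn (2 * sq * x 0 j + q.*2%:R)%R < q.*2.*2.+1)%N.
  have /andP[h1 h2] := hb j; rewrite ltnS -(ler_nat R); apply: (@le_trans _ _ (2 * sq * x 0 j + q.*2%:R)).
    by have /andP[] := Num.Theory.truncn_itv h1.
  by apply: (le_trans h2); rewrite -!addnn !natrD; lra.
pose a : grid := [ffun j => Ordinal (tr j)].
have near : nrm (x - gridpt a) <= 1 / 2.
  rewrite -ler_sqr ?nnegrE ?nrm_ge0 ?divr_ge0// nrm2.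
  rewrite -(@ler_pM2l _ (4 * q%:R)); last by rewrite mulr_gt0// ltr0n.
  have -> : 4 * q%:R * dot (x - gridpt a) (x - gridpt a) =
     \sum_j (2 * sq * x 0 j + q.*2%:R - (a j)%:R) ^+ 2.
    rewrite /dot mulr_sumr; apply: eq_bigr => j _; rewrite !mxE -[in LHS]sq2; field.
    by rewrite gt_eqF.
  apply: (@le_trans _ _ (\sum_(j < q) 1)); last by rewrite sumr_const card_ord -mulr_natl; lra.
  apply: ler_sum => j _; rewrite ffunE /=; have /andP[h1 _] := hb j.
  have /andP[h2] := Num.Theory.truncn_itv h1; rewrite -[X in _ < X -> _]natr1 => h3.
  by rewrite expr_le1//; lra.
exists a => //; rewrite inE -nrm2.
have : nrm (gridpt a) <= 3 / 2.
  have -> : gridpt a = x - (x - gridpt a) by rewrite opprB addrC subrK.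
  by apply: (le_trans (nrmD _ _)); rewrite nrmN; lra.
move=> h; have -> : 9 / 4 = (3 / 2) ^+ 2 :> R by field.
by rewrite lerXn2r ?nnegrE ?nrm_ge0 ?divr_ge0.
Qed.

(** A point of the unit ball differs from a net point by half a unit vector at most, so the supremum
    [M] satisfies [M <= t + M / 2]. The bound [F] only ensures that the supremum is finite. *)
Lemma net_bound (h : 'rV[R]_q -> R) (F t : R) : seminorm h ->
  (forall x, h x <= F * nrm x) -> (forall a, a \in net -> h (gridpt a) <= t) ->
  forall x, h x <= 2 * t * nrm x.
Proof.
move=> hS hF ht; pose E := [set h x | x in [set x | nrm x <= 1]].
have sE : has_sup E.
  split; first by exists (h 0), 0 => //=; rewrite nrm0.
  exists `|F| => _ [x /= x1 <-]; apply: (le_trans (hF x)).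
  apply: (@le_trans _ _ (`|F| * nrm x)); first by rewrite ler_wpM2r ?nrm_ge0// ler_norm.
  by rewrite -[leRHS]mulr1 ler_wpM2l.
have hs x : h x <= sup E * nrm x.
  have [->|x0] := eqVneq x 0; first by rewrite seminorm0// nrm0 mulr0.
  have nx : 0 < nrm x by rewrite lt_def nrm_ge0 nrm_eq0 x0.
  rewrite -ler_pdivrMr// mulrC -[X in X * _]gtr0_norm ?invr_gt0// -hS.2.
  apply: sup_ubound; first exact: sE.2.
  by exists ((nrm x)^-1 *: x) => //=; rewrite nrmZ gtr0_norm ?invr_gt0// mulVf// gt_eqF.
have : sup E <= t + sup E / 2.
  apply: ge_sup; first exact: sE.1.
  move=> _ [x /= x1 <-]; have [a an xa] := near_net x1.
  have -> : x = gridpt a + (x - gridpt a) by rewrite addrC subrK.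
  apply: (le_trans (hS.1 _ _)); apply: lerD; first exact: ht.
  apply: (le_trans (hs _)); have s0 : 0 <= sup E.
    apply: le_trans (seminorm_ge0 hS 0) _; apply: sup_ubound; first exact: sE.2.
    by exists 0 => //=; rewrite nrm0.
  by apply: le_trans (ler_wpM2l s0 xa) _; lra.
move=> st x; apply: (le_trans (hs x)); apply: ler_wpM2r; first exact: nrm_ge0.
lra.
Qed.

End Net.

Section OperatorNorm.
Variables (R : realType) (p r n : nat).
Hypotheses (p0 : (0 < p)%N) (r0 : (0 < r)%N) (n0 : (0 < n)%N).
Local Notation mean := (@mean R).
Local Notation sgb := (@sgb R).
Notation B := ('I_p * 'I_r)%type.

Definition rowmx (e : signs ('I_n * B)) : 'M[R]_(p, n) :=
  \matrix_(j, i) ((Num.sqrt r%:R)^-1 * \sum_c sgb (e (i, (j, c)))).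

Lemma nrm_mulmx_frob k l (A : 'M[R]_(k, l)) : exists F, forall x, nrm (x *m A) <= F * nrm x.
Proof.
exists (\sum_i nrm (row i A)) => x; rewrite mulmx_sum_row mulr_suml.
elim/big_ind2 : _ => [|x1 x2 y1 y2 h1 h2|i _]; first by rewrite nrm0.
  by apply: (le_trans (nrmD _ _)); exact: lerD.
by rewrite nrmZ mulrC ler_wpM2l ?nrm_ge0// coord_le_nrm.
Qed.

Lemma operator_norm_net (A : 'M[R]_(p, n)) t :
  (forall a b, a \in net R p -> b \in net R n -> `|dot (gridpt R a *m A) (gridpt R b)| <= t) ->
  forall x, nrm (x *m A) <= 4 * t * nrm x.
Proof.
move=> ht; have [F hF] := nrm_mulmx_frob A.
have sA : seminorm (fun x : 'rV[R]_p => nrm (x *m A)).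
  by split=> [u v|a u]; [rewrite mulmxDl nrmD|rewrite -scalemxAl nrmZ].
have -> : 4 * t = 2 * (2 * t) by ring.
apply: (net_bound p0 sA hF) => a an.
have [->|z0] := eqVneq (nrm (gridpt R a *m A)) 0.
  have [|b bn _] := @near_net R n n0 0; first by rewrite nrm0.
  by rewrite mulr_ge0//; apply: le_trans (ht a b an bn).
have zp : 0 < nrm (gridpt R a *m A) by rewrite lt_def z0 nrm_ge0.
rewrite -(ler_pM2r zp) -[leLHS]expr2 nrm2; apply: le_trans (ler_norm _) _.
apply: (@net_bound R n n0 (fun y => `|dot (gridpt R a *m A) y|) (nrm (gridpt R a *m A))).
- by split=> [u v|c u]; [rewrite dotDr ler_normD|rewrite dotZr normrM].
- by move=> y; exact: dot_le_nrm.
- by move=> b bn; exact: ht.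
Qed.

Lemma bilinear_mgf (u : 'rV[R]_p) (v : 'rV[R]_n) l :
  mean (fun e => expR (l * dot (u *m rowmx e) v)) <= expR (l ^+ 2 * dot u u * dot v v).
Proof.
have R0 : 0 < r%:R :> R by rewrite ltr0n.
pose x (k : 'I_n * B) : R := l * u 0 k.2.1 * v 0 k.1 / Num.sqrt r%:R.
have E e : l * dot (u *m rowmx e) v = \sum_k sgb (e k) * x k.
  rewrite (eq_bigr (fun k : 'I_n * B => sgb (e (k.1, k.2)) * x (k.1, k.2))); last by case.
  rewrite -(pair_bigA _ (fun i b => sgb (e (i, b)) * x (i, b)))/= /dot mulr_sumr.
  apply: eq_bigr => i _; rewrite mxE mulr_suml mulr_sumr.
  rewrite (eq_bigr (fun b : B => sgb (e (i, (b.1, b.2))) * x (i, (b.1, b.2)))); last by case.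
  rewrite -(pair_bigA _ (fun j c => sgb (e (i, (j, c))) * x (i, (j, c))))/=.
  apply: eq_bigr => j _; rewrite mxE /x /= -mulr_suml.
  by move: (\sum_c _) => S; field; rewrite sqrtr_eq0 -ltNge.
rewrite (@eq_mean R _ _ (fun e : signs ('I_n * B) => \prod_k expR (sgb (e k) * x k))); last first.
  by move=> e; rewrite E expR_sum.
rewrite (mean_prod (fun k b => expR (sgb b * x k))).
have -> : l ^+ 2 * dot u u * dot v v = \sum_k x k ^+ 2.
  rewrite (eq_bigr (fun k : 'I_n * B => x (k.1, k.2) ^+ 2)); last by case.
  rewrite -(pair_bigA _ (fun i b => x (i, b) ^+ 2))/= [dot v v]/dot mulr_sumr.
  apply: eq_bigr => i _; rewrite /dot mulr_sumr !mulr_suml.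
  rewrite (eq_bigr (fun b : B => x (i, (b.1, b.2)) ^+ 2)); last by case.
  rewrite -(pair_bigA _ (fun j c => x (i, (j, c)) ^+ 2))/=.
  apply: eq_bigr => j _; rewrite /x /= sumr_const card_ord -[RHS]mulr_natl.
  have sr : Num.sqrt r%:R ^+ 2 = r%:R :> R by rewrite sqr_sqrtr// ltW.
  by rewrite expr_div_n sr; field; rewrite gt_eqF.
rewrite expR_sum; apply: ler_prod => k _; rewrite sgb_true sgb_false mulN1r mul1r.
rewrite divr_ge0 ?addr_ge0 ?expR_ge0//=; have := cosh_le (x k).
by rewrite addrC.
Qed.

(** A union bound over two nets: at the inverse temperature [sqrt (n + p)] the exponential moments
    of the bilinear forms and the cardinalities of the nets are both [exp(O(n + p))]. The exponent
    19 is [11 + 6 + 2], and [77 = 1 + 4 * 19]. *)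
Lemma mean_operator_norm : exists sg : signs ('I_n * B) -> R,
  [/\ forall e, 0 < sg e, forall e x, nrm (x *m rowmx e) <= sg e * nrm x &
   mean sg <= 77 * Num.sqrt (n + p)%:R].
Proof.
pose X (ab : _ * _) e := dot (gridpt R ab.1 *m rowmx e) (gridpt R ab.2).
pose S := finset.setX (net R p) (net R n).
pose t e := \big[Num.max/0]_(ab in S) `|X ab e|.
have t0 e : 0 <= t e by apply: bigmax_ge_id.
exists (fun e => 1 + 4 * t e); split.
- by move=> e; have := t0 e; lra.
- move=> e x; apply: (@le_trans _ _ (4 * t e * nrm x)); last first.
    by apply: ler_wpM2r; [exact: nrm_ge0|lra].
  apply: operator_norm_net => a b an bn.
  rewrite -[dot _ _]/(X (a, b) e) /t.
  by apply: (le_bigmax_cond _ (fun ab => `|X ab e|)); rewrite finset.in_setX an bn.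
pose N : R := (n + p)%:R; have N1 : 1 <= N by rewrite ler1n addn_gt0 n0.
pose l := Num.sqrt N; have l2 : l ^+ 2 = N by rewrite sqr_sqrtr//; lra.
have l1 : 1 <= l by rewrite -[X in X <= _]sqrtr1 ler_wsqrtr.
have expt e : expR (l * t e) <= 1 + \sum_(ab in S) (expR (l * X ab e) + expR (- l * X ab e)).
  have s0 : 0 <= \sum_(ab in S) (expR (l * X ab e) + expR (- l * X ab e)).
    by apply: sumr_ge0 => ab _; rewrite addr_ge0 ?expR_ge0.
  have [->|[ab abS ->]] : t e = 0 \/ exists2 ab, ab \in S & t e = `|X ab e|.
    rewrite /t; elim/big_ind : _ => [|x y [->|[a aS ->]] [->|[b bS ->]]|ab abS]; try by [left|right; eexists].
    - by left; rewrite maxxx.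
    - by right; exists b => //; apply/max_idPr.
    - by right; exists a => //; apply/max_idPl.
    - by right; case: (leP `|X a e| `|X b e|) => _; [exists b|exists a].
    - by right; exists ab.
  - by rewrite mulr0 expR0; lra.
  rewrite (bigD1 ab)//=; set s1 := \sum_(_ | _) _.
  have s10 : 0 <= s1 by apply: sumr_ge0 => cd _; rewrite addr_ge0 ?expR_ge0.
  have e1 := expR_ge0 (l * X ab e); have e2 := expR_ge0 (- l * X ab e).
  have [x0|x0] := lerP 0 (X ab e); first by rewrite ger0_norm//; lra.
  rewrite ltr0_norm// (_ : l * - X ab e = - l * X ab e); [lra|ring].
have mt : l * mean t <= 19 * N.
  rewrite -ler_expR -meanZ; apply: (le_trans (expR_mean_le _ (card_signs_gt0 _))).
  apply: (le_trans (ler_mean expt)); rewrite meanD mean_cst ?card_signs_gt0// mean_sum.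
  apply: (@le_trans _ _ (1 + \sum_(ab in S) 2 * expR (6 * N))).
    rewrite lerD2l; apply: ler_sum => -[a b]; rewrite finset.in_setX !inE /= => /andP[ha hb].
    rewrite meanD; have bd l' : l' ^+ 2 = N -> mean (fun e => expR (l' * X (a, b) e)) <= expR (6 * N).
      move=> l'2; apply: (le_trans (bilinear_mgf _ _ _)); rewrite ler_expR l'2 -!mulrA.
      have d : dot (gridpt R a) (gridpt R a) * dot (gridpt R b) (gridpt R b) <= 9 / 4 * (9 / 4).
        by apply: ler_pM => //; exact: dot_ge0.
      by have := ler_wpM2l (le_trans ler01 N1) d; rewrite /=; lra.
    by have := bd l l2; have := bd (- l) (etrans (sqrrN l) l2); lra.
  rewrite sumr_const cardsX -[X in 1 + X]mulr_natl natrM.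
  have c1 := card_net R p0; have c2 := card_net R n0.
  have : #|net R p|%:R * #|net R n|%:R <= expR (11 * N) :> R.
    rewrite (_ : 11 * N = 11 * p%:R + 11 * n%:R) ?expRD; last by rewrite /N natrD; ring.
    exact: ler_pM.
  move=> c; have := ler_wpM2r (mulr_ge0 (ler0n R 2) (expR_ge0 (6 * N))) c.
  have -> : 19 * N = 11 * N + (6 * N + 2 * N) by ring.
  rewrite !expRD => h; apply: (le_trans (lerD (lexx 1) h)).
  have e1 : 1 <= expR (11 * N) * expR (6 * N).
    by rewrite -expRD -[leLHS]expR0 ler_expR; lra.
  have e2 : 3 <= expR (2 * N) by have := expR_ge1Dx (2 * N); lra.
  have := ler_wpM2l (le_trans ler01 e1) e2; lra.
have : mean t <= 19 * l by rewrite -(@ler_pM2l _ l) ?(lt_le_trans ltr01)//; apply: (le_trans mt); rewrite -l2; lra.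
rewrite meanD mean_cst ?card_signs_gt0// meanZ -/l -/N; lra.
Qed.

End OperatorNorm.

(** * From dimension [p] to dimension [n], and from weights to copies *)

Section GaussMean.
Variable R : realType.
Local Notation mean := (@mean R).
Local Notation sgb := (@sgb R).

Definition gv n (B : finType) (e : signs ('I_n * B)) : 'rV[R]_n :=
  \row_i ((Num.sqrt #|B|%:R)^-1 * \sum_b sgb (e (i, b))).

Lemma sum_signs_rV n (B : finType) (e : signs ('I_n * B)) :
  \sum_k sgb (e k) *: (delta_mx 0 k.1 : 'rV[R]_n) = \row_i \sum_b sgb (e (i, b)).
Proof.
rewrite (eq_bigr (fun k : 'I_n * B => sgb (e (k.1, k.2)) *: (delta_mx 0 k.1 : 'rV[R]_n))); last by case.
rewrite -(pair_bigA _ (fun i b => sgb (e (i, b)) *: (delta_mx 0 i : 'rV[R]_n)))/=.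
apply/rowP => i; rewrite summxE mxE (bigD1 i)//= [X in _ + X]big1 ?addr0 => [|j ji].
  by rewrite summxE; apply: eq_bigr => b _; rewrite !mxE !eqxx mulr1.
by rewrite summxE big1// => b _; rewrite !mxE eqxx eq_sym (negbTE ji) mulr0.
Qed.

Section ThmTwo.
Variables (n : nat) (mu : probability (borel_rV R n) R).
Hypothesis hiso : isotropic mu.
Hypothesis hlc : log_concave mu.
Variables (p r : nat).
Hypotheses (p0 : (0 < p)%N) (r0 : (0 < r)%N) (n0 : (0 < n)%N).
Notation B := ('I_p * 'I_r)%type.

(** Signs attached to the [p] rows of the sign matrix. Flipping by them preserves the uniform law,
    so they may be averaged over with the matrix held fixed. *)
Definition flip_rows (eps : signs 'I_p) : signs ('I_n * B) := [ffun k => eps k.2.1].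

Lemma rowmx_flip eps e :
  gv (flip (flip_rows eps) e) = \sum_j sgb (eps j) *: ((Num.sqrt p%:R)^-1 *: row j (rowmx R e)).
Proof.
apply/rowP => i; rewrite summxE mxE.
rewrite (eq_bigr (fun b : B => sgb (flip (flip_rows eps) e (i, (b.1, b.2))))); last by case.
rewrite -(pair_bigA _ (fun j c => sgb (flip (flip_rows eps) e (i, (j, c)))))/= mulr_sumr.
apply: eq_bigr => j _; rewrite !mxE card_prod !card_ord natrM sqrtrM// invfM.
rewrite (eq_bigr (fun c => sgb (eps j) * sgb (e (i, (j, c))))); last first.
  by move=> c _; rewrite !ffunE /= sgb_addb.
rewrite -mulr_sumr; ring.
Qed.

(** With the sign matrix fixed, [gv] is a random sign combination of its [p] rows. [domination]
    turns single signs into the normalized sums of [gauss_hp_square], which applies with [sg] the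
    operator norm; the mean of the latter is of order [sqrt (n + p)]. *)
Theorem mean_hp_gv :
  mean (fun e : signs ('I_n * B) => hp mu p (gv e)) <=
  expR 97 * Num.sqrt p%:R * Num.sqrt (n + p)%:R * (1 + ln p%:R) ^+ 2.
Proof.
have hS := hp_seminorm hiso hlc p0.
have [sg [sg0 hsg msg]] := mean_operator_norm R p0 r0 n0.
have P0 : 0 < p%:R :> R by rewrite ltr0n.
have sp0 : 0 < Num.sqrt p%:R :> R by rewrite sqrtr_gt0.
have sp2 : Num.sqrt p%:R ^+ 2 = p%:R :> R by rewrite sqr_sqrtr// ltW.
move El : ((1 + ln p%:R) ^+ 2) => l2.
have fixedA e : mean (fun eps : signs 'I_p => hp mu p (gv (flip (flip_rows eps) e))) <=
    (2 * expR 90 * Num.sqrt p%:R * l2) * sg e.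
  have [m m0 hm] := gauss_hp_square hiso hlc p0 (sg0 e) (hsg e).
  have sm0 : 0 < Num.sqrt m%:R :> R by rewrite sqrtr_gt0 ltr0n.
  rewrite (@eq_mean R _ _ (fun eps : signs 'I_p => (Num.sqrt p%:R * Num.sqrt m%:R)^-1 *
      hp mu p (\sum_j (sgb (eps j) * Num.sqrt m%:R) *: row j (rowmx R e)))); last first.
    move=> eps; rewrite rowmx_flip -[X in X * _]ger0_norm ?invr_ge0 ?mulr_ge0 ?sqrtr_ge0// -hS.2.
    congr hp; rewrite scaler_sumr; apply: eq_bigr => j _; rewrite !scalerA; congr (_ *: _).
    by field; rewrite !gt_eqF.
  rewrite meanZ; have := @domination R _ (hp mu p) hS _ ('I_p * 'I_m)%type fst (fun=> Num.sqrt m%:R)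
      (fun j => row j (rowmx R e)).
  rewrite (_ : mean (fun w : signs ('I_p * 'I_m) => hp mu p _) =
    mean (fun w : signs ('I_p * 'I_m) => Num.sqrt m%:R * hp mu p (gvec R w *m rowmx R e))); last first.
    apply: eq_mean => w; rewrite -[X in X * _]ger0_norm ?sqrtr_ge0// -hS.2; congr hp.
    rewrite mulmx_sum_row scaler_sumr.
    rewrite (eq_bigr (fun k : 'I_p * 'I_m => sgb (w (k.1, k.2)) *: row k.1 (rowmx R e))); last by case.
    rewrite -(pair_bigA _ (fun j b => sgb (w (j, b)) *: row j (rowmx R e)))/=.
    apply: eq_bigr => j _; rewrite -scaler_suml scalerA mxE mulrA mulfV ?gt_eqF// mul1r.
    by [].
  rewrite meanZ => dom.
  rewrite mulrC ler_pdivrMr ?mulr_gt0//.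
  apply: (le_trans (dom _)).
    move=> j; rewrite ger0_norm ?sqrtr_ge0// ler_wsqrtr// ler_nat.
    rewrite -[m in leqLHS]card_ord -(card_imset _ (f := fun b : 'I_m => (j, b))) ?subset_leq_card//; last first.
      by move=> b b' [].
    by apply/fintype.subsetP => _ /imsetP[b _ ->]; rewrite inE /= eqxx.
  have := ler_wpM2l (_ : 0 <= 2 * Num.sqrt m%:R) hm; rewrite mulr_ge0 ?sqrtr_ge0// => /(_ isT) h.
  rewrite -mulrA mulrA; apply: (le_trans h); rewrite El -[p%:R in leLHS]sp2.
  by rewrite le_eqVlt; apply/orP; left; apply/eqP; ring.
move: (hp mu p) {hS} fixedA => h fixedA.
have -> : mean (fun e : signs ('I_n * B) => h (gv e)) =
    mean (fun e => mean (fun eps : signs 'I_p => h (gv (flip (flip_rows eps) e)))).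
  rewrite [RHS]mean_exchange [RHS](@eq_mean R _ _ (fun=> mean (fun e : signs ('I_n * B) => h (gv e)))).
    by rewrite [RHS]mean_cst// card_signs_gt0.
  by move=> eps; exact: (mean_flip (flip_rows eps) (fun e : signs ('I_n * B) => h (gv e))).
apply: (le_trans (ler_mean fixedA)); rewrite meanZ.
have l20 : 0 <= l2 by rewrite -El sqr_ge0.
have h0 : 0 <= 2 * expR 90 * Num.sqrt p%:R * l2 by rewrite !mulr_ge0 ?expR_ge0 ?sqrtr_ge0.
apply: (le_trans (ler_wpM2l h0 msg)).
have e6 : 154 <= expR 7 :> R.
  have -> : expR 7 = expR (1 / 2) ^+ 14 :> R by rewrite -expRM_natl; congr expR; field.
  apply: (@le_trans _ _ ((3 / 2) ^+ 14)); first lra.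
  by rewrite lerXn2r ?nnegrE ?expR_ge0 ?divr_ge0//; have := expR_ge1Dx (1 / 2 : R); lra.
rewrite (_ : expR 97 = expR 7 * expR 90); last by rewrite -expRD; congr expR; lra.
have h1 : 0 <= expR 90 * Num.sqrt p%:R * l2 * Num.sqrt (n + p)%:R by rewrite !mulr_ge0 ?expR_ge0 ?sqrtr_ge0.
have := ler_wpM2l h1 e6; lra.
Qed.

End ThmTwo.

Lemma owner_map (B : finType) n (f : 'I_n -> nat) : (\sum_i f i <= #|B|)%N -> (0 < n)%N ->
  exists own : B -> 'I_n, forall i, (f i <= #|[pred b | own b == i]|)%N.
Proof.
move=> fB n0; pose s := flatten [seq nseq (f i) i | i <- enum 'I_n].
have ss : (size s <= #|B|)%N.
  rewrite /s size_flatten /shape -map_comp sumnE big_map big_enum /=.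
  by rewrite (eq_bigr f)// => i _; rewrite size_nseq.
have cs i : count_mem i s = f i.
  rewrite /s count_flatten -map_comp sumnE big_map big_enum (bigD1 i)//= count_nseq /= eqxx mul1n.
  by rewrite big1 ?addn0// => j ji; rewrite /= count_nseq /= (negbTE ji).
pose own (b : B) := nth (Ordinal n0) s (enum_rank b); exists own => i.
pose t := in_tuple s; have tE (k : 'I_(size s)) : tnth t k = nth (Ordinal n0) s k by rewrite (tnth_nth (Ordinal n0)).
have -> : f i = #|[pred k | tnth t k == i]|.
  by rewrite -cs cardE /enum_mem size_filter -[s in LHS](map_tnth_enum t) count_map enumT.
pose g (k : 'I_(size s)) : B := enum_val (widen_ord ss k).
have gi : injective g by move=> k l /enum_val_inj/(congr1 val)/= /val_inj.
rewrite -(card_imset _ gi); apply: subset_leq_card; apply/fintype.subsetP => _ /imsetP[k + ->].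
by rewrite !inE /own /g enum_valK /= tE.
Qed.

(** The coordinate [j] receives about [#|B| v_j^2 / 2] of the copies in [B], so that [domination]
    compares the signs weighted by [v] with the equally weighted copies of [gv]. *)
Lemma mean_sign_rows n (B : finType) (h : 'rV[R]_n -> R) (v : 'rV[R]_n) : seminorm h ->
  (0 < n)%N -> (2 * n <= #|B|)%N -> dot v v = 1 ->
  mean (fun G : signs ('I_n * 'I_n) => h (\row_i \sum_j sgb (G (i, j)) * v 0 j)) <=
  4 * mean (fun e : signs ('I_n * B) => h (gv e)).
Proof.
move=> hS n0 nB v1; pose M : R := #|B|%:R.
have M0 : 0 < M by rewrite ltr0n (leq_trans _ nB)// muln_gt0.
have v2 j : 0 <= M / 2 * v 0 j ^+ 2 by rewrite mulr_ge0 ?sqr_ge0// divr_ge0// ltW.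
(* Rounding up adds at most one copy per coordinate: the total is at most [#|B| / 2 + n], hence at
   most [#|B|]. *)
pose f j := (Num.truncn (M / 2 * v 0 j ^+ 2)).+1.
have fB : (\sum_j f j <= #|B|)%N.
  rewrite -(ler_nat R) natr_sum -/M; apply: (@le_trans _ _ (\sum_(j < n) (M / 2 * v 0 j ^+ 2 + 1))).
    apply: ler_sum => j _; rewrite /f -[leLHS]natr1 lerD2r.
    by have /andP[] := Num.Theory.truncn_itv (v2 j).
  rewrite big_split/= -mulr_sumr (_ : \sum_j v 0 j ^+ 2 = 1); last by rewrite -v1; apply: eq_bigr => j _; rewrite expr2.
  rewrite sumr_const card_ord; have : (2 * n)%:R <= M by rewrite ler_nat.
  rewrite natrM; lra.
have [own hown] := owner_map fB n0.
pose kap := Num.sqrt (M / 2); have kap0 : 0 < kap by rewrite sqrtr_gt0 divr_gt0.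
have sM0 : 0 < Num.sqrt M by rewrite sqrtr_gt0.
pose o (k : 'I_n * B) := (k.1, own k.2).
pose c (k : 'I_n * 'I_n) := kap * v 0 k.2.
have dom := @domination R _ h hS ('I_n * 'I_n)%type ('I_n * B)%type o c (fun k => delta_mx 0 k.1).
have -> : mean (fun G : signs ('I_n * 'I_n) => h (\row_i \sum_j sgb (G (i, j)) * v 0 j)) =
    kap^-1 * mean (fun G : signs ('I_n * 'I_n) => h (\sum_k (sgb (G k) * c k) *: delta_mx 0 k.1)).
  rewrite -meanZ; apply: eq_mean => G; rewrite -[X in X * _]ger0_norm ?invr_ge0 ?ltW// -hS.2; congr h.
  rewrite scaler_sumr (eq_bigr (fun k : 'I_n * 'I_n => (sgb (G (k.1, k.2)) * v 0 k.2) *: delta_mx 0 k.1)); last first.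
    by move=> [i j] _ /=; rewrite scalerA /c; congr (_ *: _); field; rewrite gt_eqF.
  rewrite -(pair_bigA _ (fun i j => (sgb (G (i, j)) * v 0 j) *: (delta_mx 0 i : 'rV[R]_n)))/=.
  apply/rowP => i; rewrite [RHS]summxE mxE [RHS](bigD1 i)//= [X in _ + X]big1 ?addr0 => [|j ji].
    by rewrite summxE; apply: eq_bigr => b _; rewrite !mxE !eqxx mulr1.
  by rewrite summxE big1// => b _; rewrite !mxE eqxx eq_sym (negbTE ji) mulr0.
rewrite ler_pdivrMl//; apply: (le_trans (dom _)).
  move=> [i j]; rewrite /c /= normrM (gtr0_norm kap0).
  rewrite -ler_sqr ?nnegrE ?mulr_ge0 ?sqrtr_ge0 ?(ltW kap0)// exprMn real_normK ?num_real//.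
  rewrite !sqr_sqrtr ?ler0n//; last by rewrite divr_ge0// ltW.
  have /andP[_ h2] := Num.Theory.truncn_itv (v2 j); apply: (le_trans (ltW h2)); rewrite ler_nat.
  apply: (leq_trans (hown j)); rewrite -(card_imset _ (f := fun b : B => (i, b))); last by move=> b b' [].
  apply: subset_leq_card; apply/fintype.subsetP => _ /imsetP[b + ->].
  by rewrite !inE /o /= xpair_eqE eqxx.
rewrite (_ : mean _ = mean (fun e : signs ('I_n * B) => Num.sqrt M * h (gv e))); last first.
  apply: eq_mean => w; rewrite -[X in X * _]ger0_norm ?sqrtr_ge0// -hS.2; congr h.
  rewrite sum_signs_rV; apply/rowP => i; rewrite !mxE mulrA mulfV ?gt_eqF// mul1r//.
rewrite meanZ [leLHS]mulrA [leRHS]mulrA; apply: ler_wpM2r; first by apply: mean_ge0 => e; exact: seminorm_ge0.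
have : Num.sqrt M <= 2 * kap.
  rewrite -ler_sqr ?nnegrE ?sqrtr_ge0 ?mulr_ge0 ?(ltW kap0)// exprMn !sqr_sqrtr ?(ltW M0)//; last by rewrite divr_ge0// ltW.
  lra.
lra.
Qed.

End GaussMean.

(** * Volume *)

Section GeneralKhinchine.
Variable R : realType.
Local Notation mean := (@mean R).
Local Notation sgb := (@sgb R).

Lemma rademacher_mgf n (a : 'I_n -> R) : \sum_i a i ^+ 2 = 1 ->
  mean (fun e : signs 'I_n => expR (\sum_i sgb (e i) * a i)) <= expR 1.
Proof.
move=> a1; rewrite (@eq_mean R _ _ (fun e : signs 'I_n => \prod_i expR (sgb (e i) * a i))); last first.
  by move=> e; rewrite expR_sum.
rewrite (mean_prod (fun i b => expR (sgb b * a i))) -[in leRHS]a1 [leRHS]expR_sum; apply: ler_prod => i _.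
rewrite sgb_true sgb_false mulN1r mul1r divr_ge0 ?addr_ge0 ?expR_ge0//=.
by have := cosh_le (a i); rewrite addrC.
Qed.

(** The moment argument of [khinchine] for arbitrary weights, with a cruder constant because the
    fourth moment is read off the exponential moment. *)
Lemma khinchine_unit n (a : 'I_n -> R) : \sum_i a i ^+ 2 = 1 ->
  1 / 128 <= mean (fun e : signs 'I_n => `|\sum_i sgb (e i) * a i|).
Proof.
move=> a1; pose S (e : signs 'I_n) := \sum_i sgb (e i) * a i.
have S2 : mean (fun e => S e ^+ 2) = 1.
  have -> : mean (fun e => S e ^+ 2) =
      \sum_i \sum_j mean (fun e : signs 'I_n => (a i * a j) * (sgb (e i) * sgb (e j))).
    under [RHS]eq_bigr do rewrite -mean_sum.
    rewrite -mean_sum; apply: eq_mean => e; rewrite /S expr2 mulr_suml.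
    by apply: eq_bigr => i _; rewrite mulr_sumr; apply: eq_bigr => j _; ring.
  rewrite -a1; apply: eq_bigr => i _; rewrite (bigD1 i)//= big1 ?addr0 => [|j ji].
    by rewrite meanZ mean_sgb2 eqxx mulr1 expr2.
  by rewrite meanZ mean_sgb2 eq_sym (negbTE ji) mulr0.
have e3 : expR 1 <= 3 :> R.
  have -> : expR 1 = (expR (- (1 / 8)))^-1 ^+ 8 :> R by rewrite -expRN -expRM_natl; congr expR; field.
  apply: (@le_trans _ _ ((8 / 7) ^+ 8)); last lra.
  rewrite lerXn2r ?nnegrE ?invr_ge0 ?expR_ge0// -[leRHS]invf_div lef_pV2 ?posrE ?expR_gt0//.
  by have := expR_ge1Dx (- (1 / 8) : R); lra.
have S4 : mean (fun e => S e ^+ 4) <= 1536.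
  apply: (@le_trans _ _ (mean (fun e => 256 * expR (S e) + 256 * expR (- S e)))).
    apply: ler_mean => e; have t4 (t : R) : 0 <= t -> t ^+ 4 <= 256 * expR t.
      move=> t0; have -> : expR t = expR (t / 4) ^+ 4 by rewrite -expRM_natl; congr expR; field.
      have -> : t ^+ 4 = 256 * (t / 4) ^+ 4 by field.
      rewrite ler_pM2l// lerXn2r ?nnegrE ?divr_ge0 ?expR_ge0//.
      by have := expR_ge1Dx (t / 4); lra.
    have e1 := expR_ge0 (S e); have e2 := expR_ge0 (- S e).
    have [s0|s0] := lerP 0 (S e); first by have := t4 _ s0; lra.
    have : 0 <= - S e by lra.
    by move=> /t4; rewrite (_ : (- S e) ^+ 4 = S e ^+ 4); [lra|ring].
  rewrite meanD !meanZ; have m1 := rademacher_mgf a1.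
  have m2 : mean (fun e : signs 'I_n => expR (- S e)) <= expR 1.
    have an : \sum_i (- a i) ^+ 2 = 1 by rewrite -a1; apply: eq_bigr => i _; rewrite sqrrN.
    have := rademacher_mgf an; apply: le_trans; rewrite le_eqVlt; apply/orP; left; apply/eqP.
    by apply: eq_mean => e; congr expR; rewrite /S -sumrN; apply: eq_bigr => i _; rewrite mulrN.
  rewrite -/S in m1; lra.
have pt e : 1 / 64 * S e ^+ 2 - (1 / 64) ^+ 3 * S e ^+ 4 <= `|S e|.
  set x := `|S e|; have x0 : 0 <= x by exact: normr_ge0.
  have -> : S e ^+ 2 = x ^+ 2 by rewrite real_normK ?num_real.
  have -> : S e ^+ 4 = x ^+ 4 by rewrite -[4%N]/(2 * 2)%N !exprM real_normK ?num_real.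
  have [u u0 ->] : exists2 u, 0 <= u & x = 64 * u by exists (x / 64); [rewrite divr_ge0|field].
  have -> : 1 / 64 * (64 * u) ^+ 2 - (1 / 64) ^+ 3 * (64 * u) ^+ 4 = 64 * u * (u - u ^+ 3) by field.
  rewrite -[leRHS]mulr1; apply: ler_wpM2l; first by rewrite mulr_ge0.
  have [u1|u1] := lerP u 1; first by have : 0 <= u ^+ 3 by [rewrite exprn_ge0]; lra.
  have : 1 * u <= u ^+ 2 * u by apply: ler_wpM2r => //; rewrite expr_ge1//; lra.
  by rewrite -exprSr mul1r; lra.
apply: (le_trans _ (ler_mean pt)); rewrite meanD meanN !meanZ S2; lra.
Qed.

Lemma khinchine_rV n (a : 'rV[R]_n) :
  nrm a / 128 <= mean (fun e : signs 'I_n => `|\sum_i sgb (e i) * a 0 i|).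
Proof.
have [->|a0] := eqVneq a 0; first by rewrite nrm0 mul0r mean_ge0.
have na : 0 < nrm a by rewrite lt_def nrm_ge0 nrm_eq0 a0.
have h : \sum_i (a 0 i / nrm a) ^+ 2 = 1.
  under eq_bigr do rewrite expr_div_n.
  rewrite -mulr_suml (_ : \sum_i _ = nrm a ^+ 2) ?mulfV ?gt_eqF ?exprn_gt0//.
  by rewrite nrm2; apply: eq_bigr => i _; rewrite expr2.
have := ler_wpM2l (ltW na) (khinchine_unit h); rewrite -meanZ => H.
apply: (@le_trans _ _ (nrm a * (1 / 128))); first by rewrite mul1r.
apply: (le_trans H); rewrite le_eqVlt; apply/orP; left; apply/eqP; apply: eq_mean => e.
rewrite -[X in X * _](gtr0_norm na) -normrM mulr_sumr; congr `|_|; apply: eq_bigr => i _.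
by field; rewrite gt_eqF.
Qed.

End GeneralKhinchine.

Section Volume.
Variable R : realType.

Lemma volume_mono k (S T : set 'rV[R]_k) : S `<=` T -> (volume S <= volume T)%E.
Proof.
move=> ST; apply: ereal_inf_le_tmp => _ [ab [ab1 ab2] <-]; exists ab => //; split => //.
exact: subset_trans ab2.
Qed.

Lemma box_prod_ge0 k (a b : 'rV[R]_k) : (forall i, a 0 i <= b 0 i) ->
  0 <= \prod_i (b 0 i - a 0 i).
Proof. by move=> ab; apply: prodr_ge0 => i _; rewrite subr_ge0. Qed.

Lemma volume_ge0 k (S : set 'rV[R]_k) : (0 <= volume S)%E.
Proof.
apply: le_ereal_inf_tmp => _ [ab [ab1 _] <-]; apply: nneseries_ge0 => j _ _.
by rewrite lee_fin box_prod_ge0.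
Qed.

Lemma volume_le_boxes k (I : finType) (a b : I -> 'rV[R]_k) (S : set 'rV[R]_k) : (0 < k)%N ->
  (forall i j, a i 0 j <= b i 0 j) -> (forall x, S x -> exists i, box (a i) (b i) x) ->
  (volume S <= (\sum_i \prod_j (b i 0 j - a i 0 j))%:E)%E.
Proof.
move=> k0 ab cov.
(* Indices beyond [#|I|] get the degenerate box at 0, whose product of side lengths vanishes as
   [0 < k]. *)
pose f (m : nat) : 'rV[R]_k * 'rV[R]_k := oapp (fun i : 'I_#|I| => (a (enum_val i), b (enum_val i))) (0, 0) (insub m).
pose g m : R := \prod_j ((f m).2 0 j - (f m).1 0 j).
have f1 m j : (f m).1 0 j <= (f m).2 0 j by rewrite /f; case: (insub m) => [i|] //=; exact: ab.
have g0 m : 0 <= g m by exact: box_prod_ge0.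
have gz m : (#|I| <= m)%N -> g m = 0.
  move=> Im; rewrite /g /f insubN -?leqNgt//=; case: (k) k0 => // k' _.
  by rewrite big_ord_recl subrr mul0r.
apply: (@le_trans _ _ (\sum_(0 <= m <oo) (g m)%:E)%E).
  apply: ereal_inf_lbound; exists f => //; split => // x /cov[i xi].
  exists (enum_rank i) => //; rewrite /f valK /= enum_rankK//.
apply: lime_le; first by apply: is_cvg_nneseries => m _ _; rewrite lee_fin.
apply: nearW => m; apply: (@le_trans _ _ (\sum_(0 <= l < #|I| + m) (g l)%:E)%E).
  by rewrite [leRHS](@big_cat_nat _ _ _ m)//= ?leq_addl// leeDl// sume_ge0// => l _; rewrite lee_fin.
rewrite (@big_cat_nat _ _ _ #|I|)//= ?leq_addr// [X in (_ + X)%E]big_nat [X in (_ + X)%E]big1 ?adde0; last first.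
  by move=> l /andP[Il _]; rewrite gz.
rewrite big_mkord sumEFin lee_fin [leRHS](reindex_onto (fun i : 'I_#|I| => enum_val i) enum_rank); last by move=> i _; rewrite enum_rankK.
rewrite le_eqVlt; apply/orP; left; apply/eqP; apply: eq_big => [i|i _]; first by rewrite enum_valK eqxx.
by rewrite /g /f valK.
Qed.

Lemma rcons1_0 n (a : R) (x : 'rV[R]_n) : rcons1 a x 0 ord0 = a.
Proof. by rewrite mxE unlift_none. Qed.

Lemma rcons1_lift n (a : R) (x : 'rV[R]_n) i : rcons1 a x 0 (lift ord0 i) = x 0 i.
Proof. by rewrite mxE liftK. Qed.

(** The lower bound for covers of a cube is generalized to weighted covers, so that slicing along
    the first coordinate yields an instance in dimension [k] whose weights carry the indicators of
    the sides. Integrating the slices reduces it to one-dimensional Lebesgue measure. *)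
Lemma cube_weighted_cover (s : R) k (ab : nat -> 'rV[R]_k * 'rV[R]_k) (w : nat -> R) (c : R) :
  0 <= s -> 0 <= c -> (forall j, 0 <= w j) -> (forall j i, (ab j).1 0 i <= (ab j).2 0 i) ->
  (forall x, cube s x -> (c%:E <= \sum_(0 <= j <oo) (w j *
     \prod_i (\1_(`[(ab j).1 0 i, (ab j).2 0 i] : set R) (x 0 i)))%:E)%E) ->
  ((c * (2 * s) ^+ k)%:E <= \sum_(0 <= j <oo) (w j * \prod_i ((ab j).2 0 i - (ab j).1 0 i))%:E)%E.
Proof.
move=> s0; elim: k ab w c => [|k IH] ab w c c0 w0 le_ab cov.
  have := cov 0; rewrite expr0 mulr1 => /(_ _)/le_trans; apply; first by case.
  by under eq_eseriesr do rewrite big_ord0; under [leRHS]eq_eseriesr do rewrite big_ord0.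
pose tl j : 'rV[R]_k * 'rV[R]_k := (\row_i (ab j).1 0 (lift ord0 i), \row_i (ab j).2 0 (lift ord0 i)).
pose P j := \prod_(i < k) ((ab j).2 0 (lift ord0 i) - (ab j).1 0 (lift ord0 i)).
have P0 j : 0 <= P j by apply: prodr_ge0 => i _; rewrite subr_ge0.
pose ind j t : R := \1_(`[(ab j).1 0 ord0, (ab j).2 0 ord0] : set R) t.
have ind0 j t : 0 <= ind j t by rewrite /ind indicE ler0n.
have slice t : `[- s, s]%classic t ->
    ((c * (2 * s) ^+ k)%:E <= \sum_(0 <= j <oo) (w j * P j * ind j t)%:E)%E.
  move=> ts; have := IH tl (fun j => w j * ind j t) c c0 (fun j => mulr_ge0 (w0 j) (ind0 j t)).
  have le_tl j i : (tl j).1 0 i <= (tl j).2 0 i by rewrite !mxE.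
  move=> /(_ le_tl) H; apply: le_trans (H _) _ => [x xs|].
    apply: le_trans (cov (rcons1 t x) _) _.
      move=> j; case: (unliftP ord0 j) => [i ->|->]; first by rewrite rcons1_lift; exact: xs.
      by rewrite rcons1_0; move: ts; rewrite /= in_itv/= ler_norml.
    apply: lee_nneseries => [j _ _|j _].
      by rewrite lee_fin mulr_ge0// prodr_ge0// => i _; rewrite indicE ler0n.
    rewrite lee_fin big_ord_recl -mulrA rcons1_0; apply: ler_wpM2l => //.
    apply: ler_wpM2l; first by rewrite indicE ler0n.
    rewrite le_eqVlt; apply/orP; left; apply/eqP; apply: eq_bigr => i _.
    by rewrite !mxE liftK.
  rewrite le_eqVlt; apply/orP; left; apply/eqP; apply: eq_eseriesr => j _; congr EFin.
  by under eq_bigr do rewrite !mxE; rewrite -/(P j); ring.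
have mI (u v : R) : measurable (`[u, v]%classic : set R) by exact: measurable_itv.
have lamI (u v : R) : u <= v -> lebesgue_measure (`[u, v]%classic : set R) = (v - u)%:E.
  by move=> uv; rewrite lebesgue_measure_itv/= lte_fin; case: ltgtP uv => // -> _; rewrite subrr.
have -> : ((c * (2 * s) ^+ k.+1)%:E = \int[lebesgue_measure]_(t in `[(- s)%R, s]) (c * (2 * s) ^+ k)%:E)%E.
  transitivity ((c * (2 * s) ^+ k)%:E * lebesgue_measure (`[(- s)%R, s]%classic : set R))%E.
    by rewrite lamI; [rewrite -EFinM exprSr; congr EFin; ring|lra].
  by rewrite [RHS](integral_cst _ _ (c * (2 * s) ^+ k)%:E).
apply: (@le_trans _ _ (\int[lebesgue_measure]_(t in `[(- s)%R, s]) (\sum_(0 <= j <oo) (w j * P j * ind j t)%:E))%E).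
  apply: ge0_le_integral => //.
  - by move=> t _; rewrite lee_fin mulr_ge0// exprn_ge0// mulr_ge0.
  - apply: ge0_emeasurable_sum => [j t _ _|j _]; first by rewrite lee_fin !mulr_ge0.
    by apply/measurable_EFinP; apply: measurable_funM => //; exact: measurable_indic.
rewrite integral_nneseries//; last 2 first.
- by move=> j; apply/measurable_EFinP; apply: measurable_funM => //; exact: measurable_indic.
- by move=> j t _; rewrite lee_fin !mulr_ge0.
apply: lee_nneseries => [j _ _|j _].
  by apply: integral_ge0 => t _; rewrite lee_fin !mulr_ge0.
under eq_integral do rewrite EFinM.
rewrite ge0_integralZl_EFin//; last 3 first.
- by move=> t _; rewrite lee_fin.
- by apply/measurable_EFinP; exact: measurable_indic.
- by rewrite mulr_ge0.
rewrite integral_indic//; apply: (@le_trans _ _ ((w j * P j)%:E * lebesgue_measure (`[(ab j).1 0%R ord0, (ab j).2 0%R ord0]%classic : set R))%E).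
  by apply: lee_wpmul2l; [rewrite lee_fin mulr_ge0|apply: le_measure; rewrite ?inE//; exact: measurableI].
by rewrite lamI// -EFinM lee_fin big_ord_recl -/(P j) le_eqVlt; apply/orP; left; apply/eqP; ring.
Qed.

Lemma volume_cube_ge k (s : R) : 0 <= s -> (((2 * s) ^+ k)%:E <= volume (@cube R k s))%E.
Proof.
move=> s0; apply: le_ereal_inf_tmp => _ [ab [ab1 ab2] <-].
have := @cube_weighted_cover s k ab (fun=> 1) 1 s0 ler01 (fun=> ler01) ab1.
move=> H; apply: le_trans (le_trans _ (H _)) _; [by rewrite mul1r| |by under eq_eseriesr do rewrite mul1r].
move=> x /ab2[j _ xj].
apply: le_trans (nneseries_lim_ge j.+1 _) => [|l _ _]; last first.
  by rewrite lee_fin mul1r prodr_ge0// => i _; rewrite indicE ler0n.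
rewrite big_nat_recr//= -[leLHS]add0e; apply: leeD.
  by apply: sume_ge0 => l _; rewrite lee_fin mul1r prodr_ge0// => i _; rewrite indicE ler0n.
rewrite mul1r big1// => i _; rewrite indicE mem_set//= in_itv/=; exact: xj.
Qed.

(** The ball contains the cube of half-side [1 / sqrt k]. *)
Lemma omega_ge k : (0 < k)%N -> (((2 / Num.sqrt k%:R) ^+ k)%:E <= omega R k)%E.
Proof.
move=> k0; have K0 : 0 < k%:R :> R by rewrite ltr0n.
apply: le_trans (@volume_cube_ge k (Num.sqrt k%:R)^-1 _) _; first by rewrite invr_ge0 sqrtr_ge0.
apply: volume_mono => x xs; rewrite /euclidean_unit_ball /= /dot.
apply: (@le_trans _ _ (\sum_(i < k) k%:R^-1)); last by rewrite sumr_const card_ord -[leLHS]mulr_natl mulfV ?gt_eqF.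
apply: ler_sum => i _; rewrite -expr2 -real_normK ?num_real//.
rewrite -[X in _ <= X^-1](sqr_sqrtr (ltW K0)) -exprVn lerXn2r ?nnegrE ?invr_ge0 ?sqrtr_ge0//.
Qed.

(* Cells of side [m / k] inside the cube; [card_le_expR_mean] counts those that meet the set. *)
Lemma volume_le_mean_width k (S : set 'rV[R]_k) (H : signs 'I_k -> R) (m : R) : (0 < k)%N ->
  0 < m -> (forall (e : signs 'I_k) y, S y -> \sum_j sgb R (e j) * y 0 j <= H e) ->
  @mean R _ H <= m -> (volume S <= ((4 * expR 2 * m / k%:R) ^+ k)%:E)%E.
Proof.
move=> k0 m0 SH Hm; have K0 : 0 < k%:R :> R by rewrite ltr0n.
pose dl := m / k%:R; have dl0 : 0 < dl by rewrite divr_gt0.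
pose Hb := \sum_(e : signs 'I_k) `|H e|.
have yb y j : S y -> `|y 0 j| <= Hb.
  move=> Sy; pose e : signs 'I_k := [ffun i => y 0 i < 0].
  have E i : sgb R (e i) * y 0 i = `|y 0 i|.
    rewrite /e ffunE; have [h|h] := ltrP (y 0 i) 0.
      by rewrite sgb_true mulN1r ltr0_norm.
    by rewrite sgb_false mul1r ger0_norm.
  have := SH e y Sy; rewrite (eq_bigr _ (fun i _ => E i)) => h.
  apply: (@le_trans _ _ (\sum_i `|y 0 i|)).
    by rewrite (bigD1 j)//= lerDl sumr_ge0.
  apply: (le_trans h); apply: (le_trans (ler_norm _)); rewrite /Hb (bigD1 e)//= lerDl sumr_ge0//.
have [M hM] : exists M : nat, Hb / dl <= M%:R.
  exists (Num.truncn (Hb / dl)).+1; have h0 : 0 <= Hb / dl by rewrite divr_ge0 ?(ltW dl0)// sumr_ge0.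
  by have /andP[_ /ltW] := Num.Theory.truncn_itv h0.
pose MM := M.*2.+1.
pose a (f : {ffun 'I_k -> 'I_MM}) : 'rV[R]_k := \row_j (((f j)%:R - M%:R) * dl).
pose b (f : {ffun 'I_k -> 'I_MM}) : 'rV[R]_k := \row_j (((f j)%:R - M%:R + 1) * dl).
pose Sf : {set {ffun 'I_k -> 'I_MM}} := [set f | `[< exists2 y, S y & box (a f) (b f) y >]]%SET.
pose I := {f : {ffun 'I_k -> 'I_MM} | f \in Sf}.
have cov y : S y -> exists i : I, box (a (val i)) (b (val i)) y.
  move=> Sy; have yd j : - M%:R <= y 0 j / dl <= M%:R.
    rewrite -ler_norml normrM [X in _ * X]gtr0_norm ?invr_gt0//; apply: le_trans hM.
    by rewrite ler_pM2r ?invr_gt0// yb.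
  have h0 j : 0 <= y 0 j / dl + M%:R by have /andP[h _] := yd j; lra.
  have tr (j : 'I_k) : (Num.truncn (y 0 j / dl + M%:R)%R < MM)%N.
    rewrite /MM ltnS -(ler_nat R); have /andP[h1 _] := Num.Theory.truncn_itv (h0 j).
    by apply: (le_trans h1); have /andP[_ h2] := yd j; rewrite -addnn natrD; lra.
  pose f : {ffun 'I_k -> 'I_MM} := [ffun j => Ordinal (tr j)].
  have bf : box (a f) (b f) y.
    move=> j; rewrite !mxE ffunE /=; have /andP[h1 h2] := Num.Theory.truncn_itv (h0 j).
    have yE : y 0 j = y 0 j / dl * dl by rewrite divfK// gt_eqF.
    rewrite -[X in _ < X]natr1 in h2.
    by rewrite [in X in _ <= X]yE [X in _ && (X <= _)]yE !ler_pM2r//; apply/andP; split; lra.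
  have fS : f \in Sf by rewrite inE; apply/asboolP; exists y.
  by exists (exist _ f fS).
apply: le_trans (@volume_le_boxes k I (fun i => a (val i)) (fun i => b (val i)) S k0 _ cov) _.
  by move=> i j; rewrite !mxE ler_pM2r//; lra.
rewrite lee_fin (eq_bigr (fun=> dl ^+ k)); last first.
  move=> i _; rewrite (eq_bigr (fun=> dl)) ?prodr_const ?card_ord// => j _.
  by rewrite !mxE; ring.
rewrite sumr_const -[leLHS]mulr_natl card_sig.
(* Rounding to a corner costs at most 1 per coordinate, [k] in total. The shift by [M], which keeps
   the indices natural, averages out over the signs. *)
have cS : #|Sf|%:R <= 4 ^+ k * expR (@mean R _ (fun e : signs 'I_k => H e / dl + (k%:R + \sum_j sgb R (e j) * M%:R))).
  apply: card_le_expR_mean => e f; rewrite inE => /asboolP[y Sy bf].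
  apply: (@le_trans _ _ (\sum_j (sgb R (e j) * y 0 j / dl + (1 + sgb R (e j) * M%:R)))).
    apply: ler_sum => j _; have := bf j; rewrite !mxE => /andP[]; rewrite -ler_pdivlMr// => h1; rewrite -ler_pdivrMr// => h2.
    have : `|sgb R (e j) * ((f j)%:R - M%:R - y 0 j / dl)| <= 1.
      by rewrite normrM norm_sgb mul1r ler_norml; apply/andP; split; lra.
    move=> /(le_trans (ler_norm _)); rewrite !mulrBr mulrA; lra.
  rewrite !big_split/= -mulr_suml sumr_const card_ord lerD2r ler_pM2r ?invr_gt0//; exact: SH.
have mE : @mean R _ (fun e : signs 'I_k => H e / dl + (k%:R + \sum_j sgb R (e j) * M%:R)) <= 2 * k%:R.
  rewrite !meanD mean_cst ?card_signs_gt0// mean_sum big1 ?addr0; last first.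
    by move=> j _; under eq_mean do rewrite mulrC; rewrite meanZ mean_sgb mulr0.
  rewrite (_ : @mean R _ (fun e => H e / dl) = @mean R _ H / dl); last first.
    by rewrite mulrC -meanZ; apply: eq_mean => e; rewrite mulrC.
  have : @mean R _ H / dl <= m / dl by rewrite ler_pM2r ?invr_gt0.
  have -> : m / dl = k%:R by rewrite /dl; field; rewrite !gt_eqF.
  lra.
have -> : (4 * expR 2 * m / k%:R) ^+ k = 4 ^+ k * expR (2 * k%:R) * dl ^+ k.
  by rewrite [2 * _]mulrC expRM_natl -!exprMn; congr (_ ^+ _); rewrite /dl; ring.
rewrite ler_pM2r ?exprn_gt0//; apply: (le_trans _ (le_trans cS _)).
  by rewrite ler_nat subset_leq_card//; apply/fintype.subsetP => f.
by rewrite ler_pM2l ?exprn_gt0// ler_expR.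
Qed.

End Volume.

(** * Bounded functions on the Grassmannian *)

Section BoundedMeasurable.
Variables (R : realType) (d : measure_display) (T : measurableType d).

(** Boundedness makes integrability under a probability automatic, so linearity and monotonicity of
    [EP] ask for nothing but [bm]. *)
Definition bm (f : T -> R) := measurable_fun setT f /\ exists c, forall x, `|f x| <= c.

Lemma bm_cst c : bm (fun=> c).
Proof. by split => //; exists `|c|. Qed.

Lemma bmD f g : bm f -> bm g -> bm (fun x => f x + g x).
Proof.
move=> [mf [c hc]] [mg [e he]]; split; first exact: measurable_funD.
by exists (c + e) => x; apply: (le_trans (ler_normD _ _)); exact: lerD.
Qed.

Lemma bmM f g : bm f -> bm g -> bm (fun x => f x * g x).
Proof.
move=> [mf [c hc]] [mg [e he]]; split; first exact: measurable_funM.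
by exists (c * e) => x; rewrite normrM; apply: ler_pM.
Qed.

Lemma bmZ c f : bm f -> bm (fun x => c * f x).
Proof. by move=> bf; apply: bmM => //; exact: bm_cst. Qed.

Lemma bm_sum (I : Type) (r : seq I) (F : I -> T -> R) : (forall i, bm (F i)) ->
  bm (fun x => \sum_(i <- r) F i x).
Proof.
move=> bF; elim: r => [|i r IH].
  by rewrite (_ : (fun x => _) = fun=> 0); [exact: bm_cst|apply/funext => x; rewrite big_nil].
rewrite (_ : (fun x => _) = fun x => F i x + \sum_(i <- r) F i x); first exact: bmD.
by apply/funext => x; rewrite big_cons.
Qed.

Lemma bmX f k : bm f -> bm (fun x => f x ^+ k).
Proof.
move=> bf; elim: k => [|k IH]; first exact: bm_cst.
by under eq_fun do rewrite exprS; exact: bmM.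
Qed.

Lemma bm_max f g : bm f -> bm g -> bm (fun x => Num.max (f x) (g x)).
Proof.
move=> [mf [c hc]] [mg [e he]]; split; first exact: measurable_maxr.
by exists (Num.max c e) => x; case: (leP (f x) (g x)) => _; rewrite le_max ?hc ?he ?orbT.
Qed.

Lemma bm_bigmax (I : finType) (F : I -> T -> R) : (forall i, bm (F i)) ->
  bm (fun x => \big[Num.max/0]_i F i x).
Proof.
move=> bF; elim: (index_enum I) => [|i r IH].
  by rewrite (_ : (fun x => _) = fun=> 0); [exact: bm_cst|apply/funext => x; rewrite big_nil].
rewrite (_ : (fun x => _) = fun x => Num.max (F i x) (\big[Num.max/0]_(i <- r) F i x)); first exact: bm_max.
by apply/funext => x; rewrite big_cons.
Qed.

Lemma bm_nrm n (f : T -> 'rV[R]_n) : (forall j, bm (fun x => f x 0 j)) -> bm (fun x => nrm (f x)).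
Proof.
move=> bf; have bd : bm (fun x => dot (f x) (f x)).
  by apply: (@bm_sum _ _ (fun j x => f x 0 j * f x 0 j)) => j; exact: bmM.
case: bd => md [c hc]; split.
  apply: (measurableT_comp (f := @Num.sqrt R)) => //.
  exact: (continuous_measurable_fun (@sqrt_continuous R)).
exists (Num.sqrt c) => x; rewrite ger0_norm ?nrm_ge0// ler_wsqrtr//.
by apply: le_trans (hc x); exact: ler_norm.
Qed.

Variable P : probability T R.

Lemma bm_integrable f : bm f -> P.-integrable setT (EFin \o f).
Proof.
move=> [mf [c hc]]; apply: measurable_bounded_integrable => //.
  by apply: (@le_lt_trans _ _ 1%E); [exact: probability_le1|exact: ltry].
by exists c; split; rewrite ?num_real// => r cr x _; apply: (le_trans (hc x)); exact: ltW.
Qed.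

Definition EP (f : T -> R) : R := \int[P]_x f x.

Lemma EPD f g : bm f -> bm g -> EP (fun x => f x + g x) = EP f + EP g.
Proof. by move=> bf bg; rewrite /EP RintegralD//; exact: bm_integrable. Qed.

Lemma EPZ c f : bm f -> EP (fun x => c * f x) = c * EP f.
Proof. by move=> bf; rewrite /EP RintegralZl//; exact: bm_integrable. Qed.

Lemma EP_cst c : EP (fun=> c) = c.
Proof.
rewrite /EP Rintegral_cst//; transitivity (c * fine (1%:E : \bar R)); last by rewrite mulr1.
by congr (_ * fine _); exact: probability_setT.
Qed.

Lemma EP_le f g : bm f -> bm g -> (forall x, f x <= g x) -> EP f <= EP g.
Proof. by move=> bf bg fg; apply: le_Rintegral => //; exact: bm_integrable. Qed.

Lemma EP_ge0 f : bm f -> (forall x, 0 <= f x) -> 0 <= EP f.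
Proof. by move=> bf f0; rewrite -(EP_cst 0); apply: EP_le => //; exact: bm_cst. Qed.

Lemma EP_sum (I : Type) (r : seq I) (F : I -> T -> R) : (forall i, bm (F i)) ->
  EP (fun x => \sum_(i <- r) F i x) = \sum_(i <- r) EP (F i).
Proof.
move=> bF; elim: r => [|i r IH].
  by rewrite big_nil -[RHS](EP_cst 0); congr EP; apply/funext => x; rewrite big_nil.
rewrite big_cons -IH -EPD//; last exact: bm_sum.
by congr EP; apply/funext => x; rewrite big_cons.
Qed.

Lemma bm_mean (I : finType) (F : I -> T -> R) : (forall i, bm (F i)) ->
  bm (fun x => @mean R I (fun i => F i x)).
Proof. by move=> bF; apply: bmZ; exact: bm_sum. Qed.

Lemma EP_mean (I : finType) (F : I -> T -> R) : (forall i, bm (F i)) ->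
  EP (fun x => @mean R I (fun i => F i x)) = @mean R I (fun i => EP (F i)).
Proof. by move=> bF; rewrite /mean EPZ ?EP_sum//; exact: bm_sum. Qed.

Lemma EP_abs f : bm f -> `|EP f| <= EP (fun x => `|f x|).
Proof.
move=> bf; have [mf [c hc]] := bf.
have ba : bm (fun x => `|f x|) by split; [exact: measurableT_comp|exists c => x; rewrite normr_id].
rewrite ler_norml; apply/andP; split; last by apply: EP_le => // x; exact: ler_norm.
rewrite -[leLHS]mulN1r -EPZ//; apply: EP_le => //; first exact: bmZ.
by move=> x; rewrite mulN1r lerNl -normrN ler_norm.
Qed.

Lemma EP_sqr f : bm f -> EP f ^+ 2 <= EP (fun x => f x ^+ 2).
Proof.
move=> bf; have b2 := bmX 2 bf; rewrite -subr_ge0.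
have -> : EP (fun x => f x ^+ 2) - EP f ^+ 2 = EP (fun x => (f x ^+ 2 + (- 2 * EP f) * f x) + EP f ^+ 2).
  have b1 : bm (fun x => - 2 * EP f * f x) by exact: bmZ.
  by rewrite (EPD (bmD b2 b1) (bm_cst _)) (EPD b2 b1) (EPZ _ bf) EP_cst; ring.
apply: EP_ge0 => [|x]; first by apply: bmD; [apply: bmD => //; exact: bmZ|exact: bm_cst].
by rewrite (_ : _ + _ = (f x - EP f) ^+ 2) ?sqr_ge0//; ring.
Qed.

Lemma EP_ae f g (A : set T) : bm f -> bm g -> measurable A -> P A = 1%E ->
  (forall x, A x -> f x = g x) -> EP f = EP g.
Proof.
move=> bf bg mA A1 fg.
have bi h : bm h -> bm (fun x => h x * \1_A x).
  move=> bh; apply: bmM => //; split; first exact: measurable_indic.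
  by exists 1 => x; rewrite indicE; case: (_ \in _); rewrite ?normr1 ?normr0.
have EA h : bm h -> EP h = EP (fun x => h x * \1_A x).
  move=> bh; rewrite /EP /Rintegral; congr fine; apply: ae_eq_integral => //.
  - by apply/measurable_EFinP; case: bh.
  - by apply/measurable_EFinP; case: (bi _ bh).
  exists (~` A); split; first exact: measurableC.
    transitivity (1 - P A)%E; first exact: (probability_setC P mA).
    by rewrite A1 subee.
  by move=> x /= nx Ax; apply: nx => _; rewrite indicE mem_set// mulr1.
rewrite (EA f)// (EA g)//; congr EP; apply/funext => x; rewrite indicE.
by case: (boolP (x \in A)) => [/set_mem/fg->|_]//; rewrite !mulr0.
Qed.

End BoundedMeasurable.

Lemma continuous_vsum (R : realType) (T : topologicalType) (E : normedModType R) (I : Type)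
    (r : seq I) (F : I -> T -> E) :
  (forall i, continuous (F i)) -> continuous (fun x => \sum_(i <- r) F i x).
Proof.
move=> cF; elim: r => [|i r IH] x.
  by under eq_fun do rewrite big_nil; exact: cvg_cst.
under eq_fun do rewrite big_cons.
by apply: cvgD; [exact: cF|exact: IH].
Qed.

(** * Orthonormal bases, projections and rotations of subspaces *)

Section Subspaces.
Variables (R : realType) (n : nat).
Implicit Types (F : {vspace 'rV[R]_n}) (x y z : 'rV[R]_n).

Lemma row_frame_free k (B : 'M[R]_(k, n)) : B *m B^T = 1%:M -> free [tuple row i B | i < k].
Proof.
move=> BB; apply/freeP => c h i.
have : dot (\sum_(j < k) c j *: [tuple row i B | i < k]`_j) (row i B) = 0 by rewrite h dot0l.
rewrite dot_suml (bigD1 i)//= big1 ?addr0 => [|j ji].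
  by rewrite dotZl (nth_map i) ?size_enum_ord// nth_ord_enum row_frame// mulr1.
rewrite dotZl (nth_map i) ?size_enum_ord// nth_ord_enum.
have := congr1 (fun M : 'M[R]_k => M j i) BB; rewrite !mxE (negbTE ji) /= => e.
have -> : dot (row j B) (row i B) = 0 by rewrite -[RHS]e; apply: eq_bigr => l _; rewrite !mxE.
by rewrite mulr0.
Qed.

Lemma frame_dim k (B : 'M[R]_(k, n)) F : B *m B^T = 1%:M -> (forall i, row i B \in F) ->
  (k <= \dim F)%N.
Proof.
move=> BB BF; have := row_frame_free BB; rewrite /free => /eqP; rewrite size_tuple => <-.
by apply: dimvS; apply/span_subvP => _ /mapP[i _ ->].
Qed.

Lemma mulmx_frame_span k (B : 'M[R]_(k, n)) (c : 'rV[R]_k) F :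
  (forall i, row i B \in F) -> c *m B \in F.
Proof. by move=> BF; rewrite mulmx_sum_row; apply: memv_suml => i _; exact: memvZ. Qed.

Lemma frame_extend k (B : 'M[R]_(k, n)) F z : B *m B^T = 1%:M -> (forall i, row i B \in F) ->
  z \in F -> z != z *m B^T *m B ->
  exists2 C : 'M[R]_(k.+1, n), C *m C^T = 1%:M & forall i, row i C \in F.
Proof.
move=> BB BF zF zne; pose w := z - z *m B^T *m B.
have w0 : w != 0 by rewrite subr_eq0.
have nw : nrm w != 0 by rewrite nrm_eq0.
have wB : w *m B^T = 0 by rewrite mulmxBl -!mulmxA BB mulmx1 subrr.
pose q := (nrm w)^-1 *: w.
have qq : q *m q^T = 1%:M.
  apply/matrixP => i j; rewrite !ord1 -dotE dotZl dotZr -nrm2 mxE eqxx /=; field; exact: nw.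
have qB : q *m B^T = 0 by rewrite -scalemxAl wB scaler0.
have Bq : B *m q^T = 0 by rewrite -[LHS]trmxK trmx_mul trmxK qB trmx0.
have CC : col_mx q B *m (col_mx q B)^T = 1%:M.
  by rewrite tr_col_mx mul_col_row qq qB Bq BB -scalar_mx_block.
exists (col_mx q B : 'M[R]_(1 + k, n)); first exact: CC.
suff Crow (i : 'I_(1 + k)) : row i (col_mx q B) \in F by exact: Crow.
case: (fintype.splitP i) => j ij.
  have -> : i = lshift k j by apply: val_inj; rewrite /= ij.
  by rewrite rowKu ord1 row_id memvZ// memvB// mulmx_frame_span.
have -> : i = rshift 1 j by apply: val_inj; rewrite /= ij.
by rewrite rowKd.
Qed.

Lemma frame_exists F k : (k <= \dim F)%N ->
  exists2 B : 'M[R]_(k, n), B *m B^T = 1%:M & forall i, row i B \in F.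
Proof.
elim: k => [_|k IH kF]; first by exists 0 => [|[]//]; apply/matrixP => -[].
have [B BB BF] := IH (ltnW kF).
have /subvPn[z zF zV] : ~~ (F <= <<[tuple row i B | i < k]>>)%VS.
  apply/negP => /dimvS; have := dim_span [tuple row i B | i < k]; rewrite size_tuple => h1 h2.
  by have := leq_ltn_trans (leq_trans h2 h1) kF; rewrite ltnn.
apply: (@frame_extend _ B F z BB BF zF); apply: contra zV => /eqP ->.
apply: mulmx_frame_span => i; apply: memv_span; apply/mapP; exists i => //; exact: mem_enum.
Qed.

Lemma orthonormal_basisP F : orthonormal_basis F *m (orthonormal_basis F)^T = 1%:M /\
  forall i, row i (orthonormal_basis F) \in F.
Proof.
have [B BB BF] := frame_exists (leqnn (\dim F)).
by have := @xgetPex _ 0 [set B : 'M[R]_(\dim F, n) | B *m B^T = 1%:M /\ forall i, row i B \in F]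
  (ex_intro _ B (conj BB BF)).
Qed.

Lemma basis_complete F z : z \in F -> z = z *m (orthonormal_basis F)^T *m orthonormal_basis F.
Proof.
have [BB BF] := orthonormal_basisP F; move=> zF; apply/eqP; apply/negPn/negP => zne.
have [C CC CF] := frame_extend BB BF zF zne.
by have := frame_dim CC CF; rewrite ltnn.
Qed.

Lemma orth_proj_unique F x y : y \in F -> (forall z, z \in F -> dot (x - y) z = 0) ->
  orth_proj F x = y.
Proof.
move=> yF hy; have [] := @xgetPex _ 0 [set y | y \in F /\ forall z, z \in F -> dot (x - y) z = 0]
  (ex_intro _ y (conj yF hy)).
rewrite -/(orth_proj F x); set p := orth_proj F x => pF hp.
have dF : p - y \in F by exact: memvB.
have : dot (p - y) (p - y) = 0.
  rewrite {1}(_ : p - y = (x - y) - (x - p)); last by apply/rowP => i; rewrite !mxE; ring.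
  by rewrite dotBl hy// hp// subrr.
by move=> /eqP; rewrite dot_eq0 subr_eq0 => /eqP.
Qed.

Lemma orth_projE F x : orth_proj F x = x *m (orthonormal_basis F)^T *m orthonormal_basis F.
Proof.
have [BB BF] := orthonormal_basisP F; apply: orth_proj_unique; first exact: mulmx_frame_span.
move=> z zF; rewrite (basis_complete zF) dotBl [dot (x *m _ *m _) _]dot_mulmx.
by rewrite -[z *m _ *m _ *m _]mulmxA BB mulmx1 [dot (x *m _) _]dot_mulmx trmxK subrr.
Qed.

Lemma orth_proj_mem F x : orth_proj F x \in F.
Proof. by rewrite orth_projE; apply: mulmx_frame_span; case: (orthonormal_basisP F). Qed.

Lemma orth_projD F x y : orth_proj F (x + y) = orth_proj F x + orth_proj F y.
Proof. by rewrite !orth_projE !mulmxDl. Qed.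

Lemma orth_projZ F a x : orth_proj F (a *: x) = a *: orth_proj F x.
Proof. by rewrite !orth_projE -!scalemxAl. Qed.

Lemma orth_proj_sum F (I : Type) (r : seq I) (G : I -> 'rV[R]_n) :
  orth_proj F (\sum_(i <- r) G i) = \sum_(i <- r) orth_proj F (G i).
Proof. by rewrite orth_projE !mulmx_suml; apply: eq_bigr => i _; rewrite orth_projE. Qed.

Lemma orth_proj_dot F x y : dot (orth_proj F x) y = dot x (orth_proj F y).
Proof. by rewrite !orth_projE dot_mulmx dot_mulmx trmxK. Qed.

Lemma nrm_orth_proj F x : nrm (orth_proj F x) = nrm (x *m (orthonormal_basis F)^T).
Proof. by rewrite orth_projE /nrm nrm_frame//; case: (orthonormal_basisP F). Qed.

Lemma nrm_orth_proj_le F x : nrm (orth_proj F x) <= nrm x.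
Proof. by rewrite nrm_orth_proj; apply: nrm_frameT; case: (orthonormal_basisP F). Qed.

Lemma sum_delta_rV x : x = \sum_a x 0 a *: delta_mx 0 a.
Proof. exact: row_sum_delta. Qed.

(** The trace of the projection. It expresses the dimension through measurable functions of [F],
    hence the measurability of [grassmannian]. *)
Lemma sum_nrm_orth_proj F : \sum_b nrm (orth_proj F (delta_mx 0 b)) ^+ 2 = (\dim F)%:R.
Proof.
have [BB _] := orthonormal_basisP F.
transitivity (\sum_b \sum_j orthonormal_basis F j b ^+ 2).
  apply: eq_bigr => b _; rewrite nrm_orth_proj nrm2 /dot; apply: eq_bigr => j _.
  by rewrite -rowE !mxE expr2.
rewrite exchange_big/= -[X in _ = X%:R]card_ord -sumr_const; apply: eq_bigr => j _.
rewrite -(row_frame j BB); apply: eq_bigr => b _; by rewrite mxE expr2.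
Qed.

Lemma rotate_proj (U : 'M[R]_n) F x : U *m U^T = 1%:M ->
  orth_proj (rotate U F) (x *m U) = orth_proj F x *m U.
Proof.
move=> UU; apply: orth_proj_unique.
  by have := memv_img (linfun (mulmxr U)) (orth_proj_mem F x); rewrite lfunE.
move=> z /memv_imgP[w wF ->]; rewrite lfunE /= -mulmxBl dot_mulmx -mulmxA UU mulmx1.
by rewrite dotBl orth_proj_dot [X in _ - dot _ X](_ : _ = w) ?subrr// [RHS](basis_complete wF) orth_projE.
Qed.

Lemma proj_measurable x (a : 'I_n) :
  measurable_fun setT (fun F : subspaces R n => (orth_proj F x) 0 a).
Proof.
apply: (measurability _ (measurable_realfun.RGenOpens.measurableE R)).
move=> _ [_ [u [v ->] <-]]; rewrite setTI; apply: sub_sigma_algebra.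
exists x, [set y : 'rV[R]_n | `]u, v[%classic (y 0 a)]; split => //.
by have /continuousP/(_ _ (@interval_open R (BRight u) (BLeft v) isT isT)) := (@continuous_coord R n a).
Qed.

Lemma proj_bm x (a : 'I_n) : bm (fun F : subspaces R n => (orth_proj F x) 0 a).
Proof.
split; first exact: proj_measurable.
exists (nrm x) => F; exact: le_trans (coord_le_nrm _ _) (nrm_orth_proj_le _ _).
Qed.

Lemma nrm_proj_bm x : bm (fun F : subspaces R n => nrm (orth_proj F x)).
Proof. by apply: bm_nrm => j; exact: proj_bm. Qed.

Lemma dim_bm : bm (fun F : subspaces R n => (\dim F)%:R : R).
Proof.
under eq_fun do rewrite -sum_nrm_orth_proj.
by apply: bm_sum => b; apply: bmX; exact: nrm_proj_bm.
Qed.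

Lemma grassmannian_measurable k : measurable (@grassmannian R n k : set (subspaces R n)).
Proof.
rewrite (_ : grassmannian _ = (fun F : subspaces R n => (\dim F)%:R : R) @^-1` [set k%:R]).
  by rewrite -[X in measurable X]setTI; apply: (dim_bm.1) => //; exact: measurable_set1.
apply/seteqP; split => F /=; rewrite /grassmannian /=; first by move->.
by move/eqP; rewrite eqr_nat => /eqP.
Qed.

Lemma rotate_measurable (U : 'M[R]_n) : U *m U^T = 1%:M ->
  measurable_fun setT (rotate U : subspaces R n -> subspaces R n).
Proof.
move=> UU; apply: (@measurability _ _ (subspaces R n) (subspaces R n) setT (rotate U) (@subspace_generators R n) erefl).
move=> _ [_ [x [V [oV ->]]] <-]; rewrite setTI; apply: sub_sigma_algebra.
exists (x *m U^T), [set y : 'rV[R]_n | V (y *m U)]; split.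
  have cU : continuous (fun y : 'rV[R]_n => y *m U).
    under eq_fun do rewrite mulmx_sum_row.
    apply: (@continuous_vsum _ _ _ _ _ (fun i (y : 'rV[R]_n) => y 0 i *: row i U)) => i y.
    have c := @continuous_coord R n i y.
    exact: (@cvgZr_tmp R _ _ _ _ (fun y : 'rV[R]_n => y 0 i) (y 0 i) (row i U) c).
  by move/continuousP : cU; exact.
apply/seteqP; split => F /=; rewrite -rotate_proj// -mulmxA (mulmx1C UU) mulmx1//.
Qed.

Lemma EP_rotate k (nu : probability (subspaces R n) R) (hnu : haar_grassmannian k nu)
    (U : 'M[R]_n) (f : subspaces R n -> R) : U *m U^T = 1%:M -> bm f -> (forall F, 0 <= f F) ->
  EP nu (fun F => f (rotate U F)) = EP nu f.
Proof.
move=> UU [mf [c hc]] f0; rewrite /EP /Rintegral; congr fine.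
have mU := rotate_measurable UU.
rewrite -(@ge0_integral_pushforward _ _ _ _ _ _ mU nu setT (fun F => (f F)%:E))//; last 2 first.
- by apply/measurable_EFinP.
- by move=> F _; rewrite lee_fin.
apply: eq_measure_integral => A mA _; rewrite /pushforward.
by case: hnu => _; apply.
Qed.

End Subspaces.

(** * Mean width through random lines *)

Section AlmostEverywhere.
Variables (R : realType) (d : measure_display) (T : measurableType d) (P : probability T R).

Lemma EP_le_ae (f g : T -> R) (A : set T) : bm f -> bm g -> measurable A -> P A = 1%E ->
  (forall x, A x -> f x <= g x) -> EP P f <= EP P g.
Proof.
move=> bf bg mA A1 fg; rewrite (@EP_ae _ _ _ P g (fun x => Num.max (f x) (g x)) A)//; last 2 first.
- exact: bm_max.
- by move=> x /fg fgx; apply/esym/max_idPr.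
apply: EP_le => //; first exact: bm_max.
by move=> x; rewrite le_max lexx.
Qed.

End AlmostEverywhere.

Section MaxFun.
Variables (R : realType) (n N : nat) (x : 'I_N -> 'rV[R]_n).

Definition hK (y : 'rV[R]_n) : R := \big[Num.max/0]_i `|dot (x i) y|.

Lemma le_hK y i : `|dot (x i) y| <= hK y.
Proof. exact: (le_bigmax_cond _ (fun i => `|dot (x i) y|)). Qed.

Lemma hK_le y c : 0 <= c -> (forall i, `|dot (x i) y| <= c) -> hK y <= c.
Proof. by move=> c0 hc; apply: bigmax_le. Qed.

Lemma hK_ge0 y : 0 <= hK y.
Proof. exact: bigmax_ge_id. Qed.

Lemma hK_seminorm : seminorm hK.
Proof.
split=> [u v|a u].
  apply: hK_le => [|i]; first by rewrite addr_ge0 ?hK_ge0.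
  by rewrite dotDr; apply: (le_trans (ler_normD _ _)); apply: lerD; exact: le_hK.
have le b v : hK (b *: v) <= `|b| * hK v.
  apply: hK_le => [|i]; first by rewrite mulr_ge0 ?hK_ge0.
  by rewrite dotZr normrM ler_wpM2l// le_hK.
have [->|a0] := eqVneq a 0.
  apply/eqP; rewrite eq_le le/= normr0 mul0r; exact: hK_ge0.
apply/eqP; rewrite eq_le le/= -ler_pdivlMl ?normr_gt0// -normfV.
by apply: le_trans (le _ _); rewrite scalerA mulVf// scale1r.
Qed.

Lemma polytope_dot z g : symmetric_polytope x z -> dot g z <= hK g.
Proof.
move=> zK; apply: (zK [set z | dot g z <= hK g]); split.
  move=> u v l; rewrite !inE /= => ug vg.
  have -> : conv l u v = l%:num *: (u : 'rV[R]_n) + (1 - l%:num) *: (v : 'rV[R]_n) by [].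
  rewrite dotDr !dotZr.
  have l0 : 0 <= l%:num by [].
  have l1 : 0 <= 1 - l%:num by rewrite subr_ge0.
  by have := ler_wpM2l l0 ug; have := ler_wpM2l l1 vg; lra.
move=> _ [i [->|->]] /=; rewrite ?dotNr dotC; apply: le_trans (le_hK g i); first exact: ler_norm.
by rewrite -normrN ler_norm.
Qed.

End MaxFun.

Section Lines.
Variables (R : realType) (n' : nat).
Local Notation n := n'.+1.
Variable nu1 : probability (subspaces R n) R.
Hypothesis hnu1 : haar_grassmannian 1 nu1.
Local Notation mean := (@mean R).
Local Notation sgb := (@sgb R).
Local Notation E1 := (EP nu1).
Local Notation N_ L y := (nrm (orth_proj L y)).

Lemma line_direction (L : {vspace 'rV[R]_n}) : \dim L = 1%N ->
  exists2 u, dot u u = 1 & forall y, N_ L y = `|dot u y|.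
Proof.
move=> L1; have [BB _] := orthonormal_basisP L.
have key d (B : 'M[R]_(d, n)) : d = 1%N -> B *m B^T = 1%:M ->
    exists2 u, dot u u = 1 & forall y, nrm (y *m B^T) = `|dot u y|.
  move=> d1; subst d => BB'; exists (row ord0 B); first exact: row_frame.
  move=> y; rewrite /nrm /dot big_ord1 -expr2 sqrtr_sqr; congr `|_|; rewrite mxE.
  by apply: eq_bigr => a _; rewrite !mxE mulrC.
by have [u u1 hu] := key _ _ L1 BB; exists u => // y; rewrite nrm_orth_proj.
Qed.

Lemma gr1_full : nu1 (grassmannian 1) = 1%E.
Proof. by case: hnu1. Qed.

Lemma E1_rot_sqr (f g : 'rV[R]_n) (phi : R -> R) : dot f f = 1 -> dot g g = 1 ->
  (forall z, bm (fun L : subspaces R n => phi (N_ L z))) -> (forall t, 0 <= phi t) ->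
  E1 (fun L => phi (N_ L f)) = E1 (fun L => phi (N_ L g)).
Proof.
move=> f1 g1 bphi phi0.
pose e0 : 'rV[R]_n := delta_mx 0 0.
suff H v : dot v v = 1 -> E1 (fun L => phi (N_ L v)) = E1 (fun L => phi (N_ L e0)).
  exact (eq_trans (H f f1) (esym (H g g1))).
move=> v1; have [H HH Hv] := orthogonal_with_first_row v1.
have vE : v = e0 *m H by rewrite -rowE.
have := EP_rotate hnu1 HH (bphi v) (fun L => phi0 _) => <-; congr EP; apply/funext => L.
by congr phi; rewrite vE rotate_proj// /nrm nrm_frame.
Qed.

Lemma E1_sqr_unit f : dot f f = 1 -> E1 (fun L => N_ L f ^+ 2) = n%:R^-1.
Proof.
move=> f1; have b2 z : bm (fun L : subspaces R n => N_ L z ^+ 2) by apply: bmX; exact: nrm_proj_bm.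
have dd b : dot (delta_mx 0 b : 'rV[R]_n) (delta_mx 0 b) = 1.
  by rewrite /dot (bigD1 b)//= !mxE !eqxx mulr1 big1 ?addr0// => j jb; rewrite !mxE eqxx (negbTE jb) mulr0.
have : E1 (fun L => \sum_b N_ L (delta_mx 0 b) ^+ 2) = 1.
  rewrite -[RHS](EP_cst nu1); apply: (EP_ae _ _ (@grassmannian_measurable R n 1) gr1_full) => [| |L].
  - by apply: bm_sum => b; exact: b2.
  - exact: bm_cst.
  - by rewrite sum_nrm_orth_proj /grassmannian /= => ->.
rewrite (@EP_sum _ _ _ nu1 _ _ (fun b (L : subspaces R n) => N_ L (delta_mx 0 b) ^+ 2)); last by move=> b; exact: b2.
rewrite (eq_bigr (fun=> E1 (fun L : subspaces R n => N_ L f ^+ 2))); last first.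
  by move=> b _; apply: (@E1_rot_sqr _ _ (fun t => t ^+ 2)) => // t; exact: sqr_ge0.
rewrite sumr_const card_ord -[X in X = _ -> _]mulr_natl => h.
have nn : n%:R != 0 :> R by rewrite pnatr_eq0.
by apply: (mulfI nn); rewrite mulfV.
Qed.

Lemma E1_sqr v : E1 (fun L => N_ L v ^+ 2) = dot v v / n%:R.
Proof.
have [->|v0] := eqVneq v 0.
  rewrite dot0l mul0r -[RHS](EP_cst nu1); congr EP; apply/funext => L.
  by rewrite -(scale0r 0) orth_projZ scale0r nrm0 expr0n.
have nv : nrm v != 0 by rewrite nrm_eq0.
have u1 : dot ((nrm v)^-1 *: v) ((nrm v)^-1 *: v) = 1 by rewrite dotZl dotZr -nrm2; field.
rewrite -(E1_sqr_unit u1) -EPZ; last by apply: bmX; exact: nrm_proj_bm.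
congr EP; apply/funext => L; rewrite orth_projZ nrmZ exprMn -nrm2 ger0_norm ?invr_ge0 ?nrm_ge0//.
by rewrite mulrA -exprMn mulfV// expr1n mul1r.
Qed.

(** The mean absolute coordinate of a uniform unit vector in any fixed direction, of order
    [1 / sqrt n]. *)
Definition kappa : R := E1 (fun L => N_ L (delta_mx 0 0)).

Lemma E1_abs_unit f : dot f f = 1 -> E1 (fun L => N_ L f) = kappa.
Proof.
move=> f1; rewrite /kappa.
have ab (g : 'rV[R]_n) : (fun L : subspaces R n => N_ L g) = fun L => `|N_ L g|.
  by apply/funext => L; rewrite ger0_norm ?nrm_ge0.
rewrite ab [in RHS]ab; apply: (@E1_rot_sqr _ _ (fun t => `|t|)) => //.
  by rewrite /dot (bigD1 0)//= !mxE !eqxx mulr1 big1 ?addr0// => j j0; rewrite !mxE eqxx (negbTE j0) mulr0.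
by move=> z; rewrite -ab; exact: nrm_proj_bm.
Qed.

(** By rotation invariance [kappa] is also the mean over all normalized sign vectors; exchanging the
    means, Khinchine's inequality applies on each line. *)
Lemma kappa_ge : (128 * Num.sqrt n%:R)^-1 <= kappa.
Proof.
have s0 : 0 < Num.sqrt n%:R :> R by rewrite sqrtr_gt0 ltr0n.
have unit (e : signs 'I_n) : dot ((Num.sqrt n%:R)^-1 *: signvec R e) ((Num.sqrt n%:R)^-1 *: signvec R e) = 1.
  rewrite dotZl dotZr (_ : dot (signvec R e) _ = n%:R); last first.
    rewrite /dot (eq_bigr (fun=> 1)) ?sumr_const ?card_ord// => i _.
    by rewrite !mxE sgb_sqr.
  have s2 : Num.sqrt n%:R ^+ 2 = n%:R :> R by rewrite sqr_sqrtr.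
  by rewrite mulrA -invfM -expr2 s2 mulVf// pnatr_eq0.
have -> : kappa = E1 (fun L => mean (fun e : signs 'I_n => N_ L ((Num.sqrt n%:R)^-1 *: signvec R e))).
  rewrite EP_mean; last by move=> e; exact: nrm_proj_bm.
  under eq_mean do rewrite E1_abs_unit//.
  by rewrite mean_cst ?card_signs_gt0.
rewrite -[leLHS](EP_cst nu1); apply: (EP_le_ae _ _ (@grassmannian_measurable R n 1) gr1_full) => [| |L L1].
- exact: bm_cst.
- by apply: bm_mean => e; exact: nrm_proj_bm.
have [u u1 hu] := line_direction L1.
rewrite (@eq_mean R _ _ (fun e : signs 'I_n => (Num.sqrt n%:R)^-1 * `|\sum_i sgb (e i) * u 0 i|)); last first.
  move=> e; rewrite hu dotZr normrM ger0_norm ?invr_ge0 ?ltW//; congr (_ * `|_|).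
  by apply: eq_bigr => i _; rewrite mxE mulrC.
rewrite meanZ invfM mulrC ler_pM2l ?invr_gt0//; have := khinchine_rV u.
by rewrite /nrm u1 sqrtr1 mul1r.
Qed.

Section Family.
Variable N : nat.
Implicit Types (y : 'I_N -> 'rV[R]_n).

Definition mxn y (L : subspaces R n) : R := \big[Num.max/0]_i N_ L (y i).

Lemma mxn_bm y : bm (mxn y).
Proof. by apply: bm_bigmax => i; exact: nrm_proj_bm. Qed.

Lemma le_mxn y L i : N_ L (y i) <= mxn y L.
Proof. exact: (le_bigmax_cond _ (fun i => N_ L (y i))). Qed.

Lemma mxn_le y L c : 0 <= c -> (forall i, N_ L (y i) <= c) -> mxn y L <= c.
Proof. by move=> c0 hc; apply: bigmax_le. Qed.

Lemma mxn_ge0 y L : 0 <= mxn y L.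
Proof. exact: bigmax_ge_id. Qed.

(** Half the mean width of the convex hull of the points [y i] and [- y i], with the uniform
    direction drawn as a random line. *)
Definition J y : R := E1 (mxn y).

Lemma J_ge0 y : 0 <= J y.
Proof. by apply: EP_ge0 => [|L]; [exact: mxn_bm|exact: mxn_ge0]. Qed.

Lemma J_rot (U : 'M[R]_n) y : U *m U^T = 1%:M -> J (fun i => y i *m U) = J y.
Proof.
move=> UU; rewrite /J -(EP_rotate hnu1 UU (mxn_bm _)); last by move=> L; exact: mxn_ge0.
congr EP; apply/funext => L; rewrite /mxn; apply: eq_bigr => i _.
by rewrite rotate_proj// /nrm nrm_frame.
Qed.

Lemma J_add y z : J (fun i => y i + z i) <= J y + J z.
Proof.
rewrite /J -EPD; [|exact: mxn_bm|exact: mxn_bm].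
apply: EP_le => [| |L]; [exact: mxn_bm|by apply: bmD; exact: mxn_bm|].
apply: mxn_le => [|i]; first by rewrite addr_ge0 ?mxn_ge0.
by rewrite orth_projD; apply: (le_trans (nrmD _ _)); apply: lerD; exact: le_mxn.
Qed.

Lemma J_scale a y : J (fun i => a *: y i) = `|a| * J y.
Proof.
have le b z : J (fun i => b *: z i) <= `|b| * J z.
  rewrite /J -EPZ; last exact: mxn_bm.
  apply: EP_le => [| |L]; [exact: mxn_bm|by apply: bmZ; exact: mxn_bm|].
  apply: mxn_le => [|i]; first by rewrite mulr_ge0 ?mxn_ge0.
  by rewrite orth_projZ nrmZ ler_wpM2l// le_mxn.
have [->|a0] := eqVneq a 0.
  apply/eqP; rewrite eq_le le/= normr0 mul0r; exact: J_ge0.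
apply/eqP; rewrite eq_le le/= -ler_pdivlMl ?normr_gt0// -normfV.
apply: le_trans (le _ _); rewrite le_eqVlt; apply/orP; left; apply/eqP; congr J.
by apply/funext => i; rewrite scalerA mulVf// scale1r.
Qed.

Lemma J_mean (I : finType) (z : I -> 'I_N -> 'rV[R]_n) :
  J (fun i => #|I|%:R^-1 *: \sum_w z w i) <= mean (fun w => J (z w)).
Proof.
rewrite J_scale ger0_norm ?invr_ge0// /mean ler_wpM2l ?invr_ge0//.
elim: (index_enum I) => [|w r IH].
  rewrite big_nil -(EP_cst nu1 0); apply: EP_le => [| |L]; [exact: mxn_bm|exact: bm_cst|].
  by apply: mxn_le => // i; rewrite big_nil -(scale0r 0) orth_projZ scale0r nrm0.
rewrite big_cons; apply: le_trans (lerD (lexx _) IH); apply: le_trans (J_add _ _).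
by rewrite le_eqVlt; apply/orP; left; apply/eqP; congr J; apply/funext => i; rewrite big_cons.
Qed.

(* Reflections along the rows of [B] preserve [J]; averaging over them, the signs
   may be chosen so that the coordinates of a random line are nonnegative, and
   these are then replaced by their common mean [kappa]. *)
Lemma mean_width_le_J k (B : 'M[R]_(k, n)) (x : 'I_N -> 'rV[R]_n) : B *m B^T = 1%:M ->
  mean (fun e : signs 'I_k => hK x (signvec R e *m B)) <=
  128 * Num.sqrt n%:R * J (fun i => x i *m B^T *m B).
Proof.
move=> BB; have s0 : 0 < Num.sqrt n%:R :> R by rewrite sqrtr_gt0 ltr0n.
pose De (e : signs 'I_k) : 'M[R]_k := diag_mx (signvec R e).
have DeT e : (De e)^T = De e by rewrite tr_diag_mx.
have DD e : De e *m De e = 1%:M.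
  rewrite mulmx_diag; apply/matrixP => i j; rewrite !mxE; case: (i == j) => //.
  by rewrite !mulr1n sgb_sqr.
(* The orthogonal map acting by the diagonal signs [e] on the row space of [B] and trivially on its
   complement. *)
pose U e : 'M[R]_n := B^T *m De e *m B + (1%:M - B^T *m B).
have BU e : B *m U e = De e *m B.
  by rewrite mulmxDr mulmxBr mulmx1 !mulmxA BB !mul1mx subrr addr0.
have UT e : (U e)^T = U e.
  by rewrite /U linearD linearB /= trmx1 !trmx_mul trmxK DeT mulmxA.
have UU e : U e *m (U e)^T = 1%:M.
  rewrite UT {1}/U mulmxDl mulmxBl mul1mx -!mulmxA BU (mulmxA (De e) (De e)) DD mul1mx.
  by rewrite /U -!mulmxA [X in X - _]addrC addrK addrC subrK.
have JU e : J (fun i => x i *m B^T *m B) = J (fun i => x i *m B^T *m De e *m B).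
  rewrite -(J_rot (fun i => x i *m B^T *m B) (UU e)); congr J; apply/funext => i.
  by rewrite -mulmxA BU mulmxA.
have bN (a : 'I_k) : bm (fun L : subspaces R n => N_ L (row a B)) by exact: nrm_proj_bm.
pose cf (e : signs 'I_k) i (L : subspaces R n) : R := \sum_a sgb (e a) * dot (x i) (row a B) * N_ L (row a B).
have bt (e : signs 'I_k) i a : bm (fun L : subspaces R n => sgb (e a) * dot (x i) (row a B) * N_ L (row a B)).
  exact: (bmZ (sgb (e a) * dot (x i) (row a B)) (bN a)).
have bcf e i : bm (cf e i) by apply: (@bm_sum _ _ _ _ _ (fun a (L : subspaces R n) => sgb (e a) * dot (x i) (row a B) * N_ L (row a B))) => a; exact: bt.
have babs e i : bm (fun L => `|cf e i L|).
  have [mf [c hc]] := bcf e i; split; first exact: measurableT_comp.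
  by exists c => L; rewrite normr_id.
pose f1 L := mean (fun e : signs 'I_k => \big[Num.max/0]_i `|cf e i L|).
have bf1 : bm f1 by apply: bm_mean => e; apply: bm_bigmax => i; exact: babs.
have f1J : E1 f1 <= J (fun i => x i *m B^T *m B).
  have -> : J (fun i => x i *m B^T *m B) = E1 (fun L => mean (fun e => mxn (fun i => x i *m B^T *m De e *m B) L)).
    rewrite EP_mean; last by move=> e; exact: mxn_bm.
    rewrite -[LHS](@mean_cst R (signs 'I_k) _ (card_signs_gt0 _)); apply: eq_mean => e; exact: JU.
  apply: (EP_le_ae _ _ (@grassmannian_measurable R n 1) gr1_full) => [//| |L L1].
    by apply: bm_mean => e; exact: mxn_bm.
  have [u u1 hu] := line_direction L1.
  pose g : signs 'I_k := [ffun a => dot u (row a B) < 0].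
  rewrite /f1 -(mean_flip g); apply: ler_mean => e; apply: bigmax_le => [|i _]; first exact: mxn_ge0.
  apply: le_trans (le_mxn _ L i); rewrite hu le_eqVlt; apply/orP; left; apply/eqP; congr `|_|.
  rewrite dotC dot_mulmx dotC.
  rewrite /cf [RHS]/dot; apply: eq_bigr => a _; rewrite hu.
  rewrite ffunE sgb_addb /g ffunE.
  have -> : (u *m B^T) 0 a = dot u (row a B) by rewrite mxE; apply: eq_bigr => b _; rewrite !mxE.
  have -> : (x i *m B^T *m De e) 0 a = dot (x i) (row a B) * sgb (e a).
    rewrite mul_mx_diag !mxE; congr (_ * _); apply: eq_bigr => b _; by rewrite !mxE.
  have [h|h] := ltrP (dot u (row a B)) 0.
    rewrite sgb_true ltr0_norm//; ring.
  by rewrite sgb_false ger0_norm//; ring.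
have k0 := kappa_ge.
have kp : 0 < kappa by apply: lt_le_trans k0; rewrite invr_gt0 mulr_gt0.
(* The mean of a maximum of absolute values is at least the absolute value of each mean, and in the
   mean of [cf e i] every coordinate of the line contributes the same [kappa]. *)
have lower : kappa * mean (fun e : signs 'I_k => hK x (signvec R e *m B)) <= E1 f1.
  rewrite -meanZ EP_mean; last by move=> e; apply: bm_bigmax => i; exact: babs.
  apply: ler_mean => e; have bmx : bm (fun L => \big[Num.max/0]_i `|cf e i L|) by apply: bm_bigmax.
  rewrite mulrC -ler_pdivlMr//; apply: hK_le => [|i].
    by rewrite divr_ge0 ?(ltW kp)//; apply: EP_ge0 => // L; exact: bigmax_ge_id.
  rewrite ler_pdivlMr//; apply: (@le_trans _ _ (E1 (fun L => `|cf e i L|))); last first.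
    by apply: EP_le => // L; exact: (le_bigmax_cond _ (fun i => `|cf e i L|)).
  apply: le_trans (EP_abs nu1 (bcf e i)); rewrite (@EP_sum _ _ _ nu1 _ _ (fun a (L : subspaces R n) => sgb (e a) * dot (x i) (row a B) * N_ L (row a B))); last by move=> a; exact: bt.
  rewrite -[X in _ * X](gtr0_norm kp) -normrM le_eqVlt; apply/orP; left; apply/eqP; congr `|_|.
  rewrite mulmx_sum_row dot_sumr mulr_suml; apply: eq_bigr => a _.
  have EE : E1 (fun L => sgb (e a) * dot (x i) (row a B) * N_ L (row a B)) = sgb (e a) * dot (x i) (row a B) * kappa.
    by rewrite (EPZ nu1 (sgb (e a) * dot (x i) (row a B)) (bN a)) (E1_abs_unit (row_frame a BB)).
  rewrite dotZr mxE; exact (esym EE).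
apply: (@le_trans _ _ (kappa^-1 * J (fun i => x i *m B^T *m B))).
  by rewrite ler_pdivlMl//; exact: le_trans lower f1J.
apply: ler_wpM2r; first exact: J_ge0.
by rewrite -[leRHS]invrK lef_pV2 ?posrE ?invr_gt0 ?mulr_gt0.
Qed.

End Family.
End Lines.

(** * Traces and signed shifts *)

Section PowerMean.
Variable R : realType.
Local Notation mean := (@mean R).

Lemma tangent_exprn (f m : R) k : 0 <= f -> 0 <= m ->
  m ^+ k.+1 + k.+1%:R * m ^+ k * (f - m) <= f ^+ k.+1.
Proof.
move=> f0 m0; elim: k => [|k IH]; first by rewrite !expr1 expr0; lra.
have := ler_wpM2l f0 IH; rewrite -[f * f ^+ _]exprS; apply: le_trans; rewrite -subr_ge0.
have -> : f * (m ^+ k.+1 + k.+1%:R * m ^+ k * (f - m)) -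
    (m ^+ k.+2 + k.+2%:R * m ^+ k.+1 * (f - m)) = k.+1%:R * m ^+ k * (f - m) ^+ 2.
  by rewrite !exprS -[k.+2%:R]natr1; ring.
by rewrite mulr_ge0 ?sqr_ge0// mulr_ge0 ?exprn_ge0.
Qed.

Lemma mean_exprn (T : finType) (F : T -> R) k : (0 < #|T|)%N -> (forall t, 0 <= F t) ->
  mean F ^+ k <= mean (fun t => F t ^+ k).
Proof.
move=> T0 F0; case: k => [|k]; first by rewrite expr0 mean_cst.
have m0 := mean_ge0 F0; move E : (mean F) m0 => m m0.
have := ler_mean (fun t => tangent_exprn k (F0 t) m0); apply: le_trans.
rewrite meanD meanZ mean_cst// meanD E mean_cst// subrr mulr0 addr0; exact: lexx.
Qed.

(** Jensen's inequality for the inverse, from its tangent line at the mean. *)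
Lemma mean_inv_ge (T : finType) (F : T -> R) : (0 < #|T|)%N -> (forall t, 0 < F t) ->
  (mean F)^-1 <= mean (fun t => (F t)^-1).
Proof.
move=> T0 F0; have [t0 ht] := exists_ge_mean F T0.
have m0 : 0 < mean F.
  rewrite /mean mulr_gt0 ?invr_gt0 ?ltr0n//.
  by rewrite (bigD1 t0)//= ltr_pwDl// sumr_ge0// => t _; exact: ltW.
move E : (mean F) m0 => m m0.
have key t : 2 * m^-1 + (- m^-2) * F t <= (F t)^-1.
  rewrite -subr_ge0; have Ft := F0 t.
  have -> : (F t)^-1 - (2 * m^-1 + (- m^-2) * F t) = (F t - m) ^+ 2 * m^-2 * (F t)^-1.
    by field; rewrite !gt_eqF.
  by rewrite mulr_ge0 ?invr_ge0 ?(ltW Ft)// mulr_ge0 ?sqr_ge0// invr_ge0 sqr_ge0.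
have := ler_mean key; apply: le_trans; rewrite meanD mean_cst// meanZ E.
by rewrite le_eqVlt; apply/orP; left; apply/eqP; field; rewrite gt_eqF.
Qed.

Lemma mean_signs_index (I J : finType) (f : I -> J) (F : signs I -> R) : bijective f ->
  mean F = mean (fun e : signs J => F [ffun i => e (f i)]).
Proof.
move=> [g fK gK]; apply: mean_reindex; exists (fun e : signs I => [ffun j => e (g j)]) => e.
  by apply/ffunP => j; rewrite !ffunE gK.
by apply/ffunP => i; rewrite !ffunE fK.
Qed.

End PowerMean.

Section Matrices.
Variables (R : realType) (n : nat).
Local Notation mean := (@mean R).
Local Notation sgb := (@sgb R).
Implicit Types (u v w : 'rV[R]_n) (S V : 'M[R]_n).

Definition reflection w : 'M[R]_n := 1%:M - (2 / dot w w) *: (w^T *m w).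

Lemma reflection_orth w : reflection w *m (reflection w)^T = 1%:M.
Proof.
have T : (reflection w)^T = reflection w.
  by rewrite /reflection linearB linearZ /= trmx1 trmx_mul trmxK.
have ww : w^T *m w *m (w^T *m w) = dot w w *: (w^T *m w).
  rewrite mulmxA -[w^T *m w *m w^T]mulmxA; have -> : w *m w^T = (dot w w)%:M.
    by rewrite dotE [LHS]mx11_scalar.
  by rewrite mul_mx_scalar -scalemxAl.
rewrite T /reflection mulmxBl mul1mx mulmxBr mulmx1 -scalemxAl -scalemxAr ww !scalerA.
have [->|w0] := eqVneq w 0; first by rewrite mulmx0 !scaler0 !subr0.
have d0 : dot w w != 0 by rewrite dot_eq0.
rewrite (_ : 2 / dot w w * (2 / dot w w) * dot w w = 2 / dot w w + 2 / dot w w); last by field.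
by rewrite scalerDl; move: (_ *: _) => A; rewrite opprB addrK subrK.
Qed.

Lemma orth_mul (U V : 'M[R]_n) : U *m U^T = 1%:M -> V *m V^T = 1%:M ->
  (U *m V) *m (U *m V)^T = 1%:M.
Proof. by move=> UU VV; rewrite trmx_mul mulmxA -(mulmxA U) VV mulmx1. Qed.

Lemma mxtrace_outer S (u v : 'rV[R]_n) : \tr (S *m (u^T *m v)) = dot (v *m S) u.
Proof. by rewrite mulmxA mxtrace_mulC mulmxA /mxtrace big_ord1 -dotE. Qed.

Lemma mxtrace_hs (S : 'M[R]_n) : \tr (S *m S^T) = hs S.
Proof.
rewrite /hs exchange_big; apply: eq_bigr => i _; rewrite mxE.
by apply: eq_bigr => j _; rewrite mxE expr2.
Qed.

Lemma hs_orth S V : V *m V^T = 1%:M -> hs (S *m V) = hs S.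
Proof. by move=> VV; rewrite -!mxtrace_hs trmx_mul mulmxA -(mulmxA S) VV mulmx1. Qed.

Lemma linear_le_quadratic (d c : R) : (forall t, t * d <= t ^+ 2 * c) -> d = 0.
Proof.
move=> h; have c1 : 0 < `|c| + 1 by rewrite ltr_pwDr.
have := h (d / (`|c| + 1)); rewrite exprMn -subr_ge0.
have -> : d ^+ 2 * (`|c| + 1)^-1 ^+ 2 * c - d / (`|c| + 1) * d =
    d ^+ 2 * (c - `|c| - 1) * (`|c| + 1)^-2 by field; rewrite gt_eqF.
rewrite pmulr_lge0 ?invr_gt0 ?exprn_gt0// => hd.
have cc := ler_norm c; have d2 := sqr_ge0 d.
by apply/eqP; rewrite -sqrf_eq0 eq_le d2 andbT; nra.
Qed.

(* At a maximum of [V |-> \tr (S V)] over the orthogonal group, products of two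
   reflections show that the bilinear form of [S] is symmetric, and a single one
   that it is nonnegative. *)
Lemma trace_max_psd S : (forall V, V *m V^T = 1%:M -> \tr (S *m V) <= \tr S) ->
  (forall u, 0 <= dot (u *m S) u) /\ forall u v, dot (u *m S) v = dot (v *m S) u.
Proof.
move=> hS; have psd u : 0 <= dot (u *m S) u.
  have [->|u0] := eqVneq u 0; first by rewrite dot0r.
  have d0 : 0 < dot u u by rewrite lt_def dot_ge0 dot_eq0 u0.
  have := hS _ (reflection_orth u).
  rewrite /reflection mulmxBr mulmx1 -scalemxAr linearB linearZ /= mxtrace_outer => h.
  have : 0 <= 2 / dot u u * dot (u *m S) u by lra.
  by rewrite pmulr_rge0// divr_gt0.
split=> // u v.
have two a b : dot a b * dot (b *m S) a <=
    (dot (a *m S) a * dot b b + dot (b *m S) b * dot a a) / 2.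
  have [->|a0] := eqVneq a 0; first by rewrite !(dot0r, dot0l, mul0mx, mulr0, mul0r, addr0).
  have [->|b0] := eqVneq b 0; first by rewrite !(dot0r, dot0l, mul0mx, mulr0, mul0r, addr0).
  have da : 0 < dot a a by rewrite lt_def dot_ge0 dot_eq0 a0.
  have db : 0 < dot b b by rewrite lt_def dot_ge0 dot_eq0 b0.
  have := hS _ (orth_mul (reflection_orth a) (reflection_orth b)).
  have ab : a^T *m a *m (b^T *m b) = dot a b *: (a^T *m b).
    rewrite mulmxA -(mulmxA a^T); have -> : a *m b^T = (dot a b)%:M.
      by rewrite dotE [LHS]mx11_scalar.
    by rewrite mul_mx_scalar -scalemxAl.
  have hp : reflection a *m reflection b = 1%:M - (2 / dot a a) *: (a^T *m a) -
      (2 / dot b b) *: (b^T *m b) + (2 / dot a a * (2 / dot b b) * dot a b) *: (a^T *m b).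
    rewrite /reflection mulmxBl mul1mx -scalemxAl [(_ *m (1%:M - _))]mulmxBr mulmx1 -scalemxAr ab.
    move: (a^T *m a) (b^T *m b) (a^T *m b) => P Q T; apply/matrixP => i j; rewrite !mxE; ring.
  rewrite hp mulmxDr !mulmxBr mulmx1 -!scalemxAr !(linearD, linearN, linearZ) /= !mxtrace_outer.
  move: (dot (a *m S) a) (dot (b *m S) b) (dot (b *m S) a) (dot a b) => A B C D h0.
  have h : \tr S + 2 / dot a a * (- A) + 2 / dot b b * (- B) + 2 / dot a a * (2 / dot b b) * D * C <= \tr S := h0.
  have h' : 0 <= A / dot a a + B / dot b b - 2 * (D * C) / (dot a a * dot b b).
    rewrite (_ : 2 * (D * C) / (dot a a * dot b b) = 2^-1 * (2 / dot a a * (2 / dot b b) * D * C)); last by field; rewrite !gt_eqF.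
    lra.
  rewrite -subr_ge0 (_ : _ - _ = (A / dot a a + B / dot b b - 2 * (D * C) / (dot a a * dot b b)) * (dot a a * dot b b / 2)).
    by rewrite mulr_ge0// divr_ge0// mulr_ge0// ltW.
  by field; rewrite !gt_eqF.
have sym a b : dot (a *m S) b <= dot (b *m S) a -> dot (a *m S) b = dot (b *m S) a.
  move=> _; have [->|a0] := eqVneq a 0; first by rewrite mul0mx dot0l dot0r.
  have da : 0 < dot a a by rewrite lt_def dot_ge0 dot_eq0 a0.
  have := @linear_le_quadratic (dot a a * (dot (a *m S) b - dot (b *m S) a))
    (dot (b *m S) b * dot a a + dot (a *m S) a * dot b b - 2 * (dot b a * dot (a *m S) b)).
  suff H : forall t, t * (dot a a * (dot (a *m S) b - dot (b *m S) a)) <= t ^+ 2 *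
      (dot (b *m S) b * dot a a + dot (a *m S) a * dot b b - 2 * (dot b a * dot (a *m S) b)).
    by move=> /(_ H) /eqP; rewrite mulf_eq0 gt_eqF//= subr_eq0 => /eqP.
  move=> t; have := two (a + t *: b) a.
  rewrite mulmxDl -scalemxAl !dotDl !dotDr !dotZl !dotZr (dotC b a).
  move: (dot (a *m S) a) (dot (b *m S) b) (dot (a *m S) b) (dot (b *m S) a) (dot a a) (dot a b) (dot b b) => A B C D x y z h.
  nra.
by case/orP: (le_total (dot (u *m S) v) (dot (v *m S) u)) => /sym.
Qed.

(** Here the form of [S] is symmetric and nonnegative. Its nonnegativity at [u - sg^-1 u S] gives
    [|u S|^2 <= sg <u S, u>], to be summed over an orthonormal basis. *)
Lemma hs_le_trace S (sg : R) : 0 < sg -> (forall u, nrm (u *m S) <= sg * nrm u) ->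
  (forall V, V *m V^T = 1%:M -> \tr (S *m V) <= \tr S) -> hs S <= sg * \tr S.
Proof.
move=> s0 hsg /trace_max_psd[psd sym].
have key u : dot (u *m S) (u *m S) <= sg * dot (u *m S) u.
  have := psd (u - sg^-1 *: (u *m S)); rewrite mulmxBl -scalemxAl.
  have hB : dot (u *m S *m S) (u *m S) <= sg * dot (u *m S) (u *m S).
    apply: le_trans (ler_norm _) _; apply: le_trans (dot_le_nrm _ _) _.
    by rewrite -nrm2 expr2 mulrA ler_wpM2r ?nrm_ge0.
  rewrite dotBl !dotBr !dotZl !dotZr [dot (u *m S *m S) u]sym.
  move: hB; move: (dot (u *m S *m S) (u *m S)) (dot (u *m S) (u *m S)) (dot (u *m S) u) => A B C hB h.
  have : sg^-1 * (sg^-1 * A) <= sg^-1 * B.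
    by rewrite ler_pM2l ?invr_gt0// ler_pdivrMl.
  move=> h2; have : sg^-1 * B <= C by lra.
  by rewrite ler_pdivrMl.
have dd i : dot (delta_mx 0 i *m S) (delta_mx 0 i) = S i i.
  rewrite -rowE /dot (bigD1 i)//= !mxE !eqxx mulr1 big1 ?addr0// => j ji.
  by rewrite !mxE (negbTE ji) mulr0.
have := ler_sum (index_enum 'I_n) (fun i (_ : true) => key (delta_mx 0 i)).
rewrite -mulr_sumr [X in _ <= _ * X](eq_bigr (fun i => S i i)) => [|i _]; last exact: dd.
apply: le_trans; rewrite /hs exchange_big /=; apply: ler_sum => i _.
by rewrite -rowE /dot le_eqVlt; apply/orP; left; apply/eqP; apply: eq_bigr => j _; rewrite !mxE expr2.
Qed.

Lemma continuous_vec_mx i j : continuous (fun z : 'rV[R]_(n * n) => vec_mx z i j).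
Proof.
have -> : (fun z : 'rV[R]_(n * n) => vec_mx z i j) = fun z => z 0 (mxvec_index i j).
  by apply/funext => z; rewrite mxE.
exact: continuous_coord.
Qed.

Lemma orthogonal_trace_max S : exists2 V : 'M[R]_n, V *m V^T = 1%:M &
  forall U : 'M[R]_n, U *m U^T = 1%:M -> \tr (S *m U) <= \tr (S *m V).
Proof.
(* The orthogonal group is written as the zero set of a continuous function on row vectors, where
   compactness and the extreme value theorem are available. *)
pose f (z : 'rV[R]_(n * n)) : R := \sum_i \sum_j
  (((\sum_l vec_mx z i l * vec_mx z j l) + - (i == j)%:R) * ((\sum_l vec_mx z i l * vec_mx z j l) + - (i == j)%:R)).
have cf : continuous f.
  apply: continuous_bigsum => i; apply: continuous_bigsum => j.
  have c1 : continuous (fun z : 'rV[R]_(n * n) => (\sum_l vec_mx z i l * vec_mx z j l) + - (i == j)%:R).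
    have cst (c : R) : continuous (fun _ : 'rV[R]_(n * n) => c) by exact: cst_continuous.
    apply: (@continuous_add R 'rV[R]_(n * n) (fun z => \sum_l vec_mx z i l * vec_mx z j l) (fun=> - (i == j)%:R) _ (cst _)).
    by apply: continuous_bigsum => l; apply: continuous_mul; exact: continuous_vec_mx.
  exact: continuous_mul.
pose O := [set z : 'rV[R]_(n * n) | vec_mx z *m (vec_mx z)^T = 1%:M].
have OE (z : 'rV[R]_(n * n)) : (vec_mx z : 'M[R]_n) *m (vec_mx z)^T = \matrix_(i, j) \sum_l vec_mx z i l * vec_mx z j l.
  by apply/matrixP => i j; rewrite [LHS]mxE [RHS]mxE; apply: eq_bigr => l _; rewrite [(vec_mx z)^T _ _]mxE.
have Of : O = [set z | f z <= 0].
  rewrite eqEsubset; split => z; rewrite /O /=.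
    rewrite OE => /matrixP h; rewrite /f big1// => i _; rewrite big1// => j _.
    by have := h i j; rewrite !mxE => ->; case: (i == j); rewrite ?mulr1n ?mulr0n ?subrr ?mulr0 ?oppr0 ?addr0 ?mulr0.
  move=> f0; rewrite OE; apply/matrixP => i j; rewrite !mxE.
  have nn a b : 0 <= ((\sum_l vec_mx z a l * vec_mx z b l) + - (a == b)%:R) * ((\sum_l vec_mx z a l * vec_mx z b l) + - (a == b)%:R) by rewrite -expr2 sqr_ge0.
  have fe : f z = 0 by apply/eqP; rewrite eq_le f0/= sumr_ge0// => a _; apply: sumr_ge0 => b _.
  have /eqP := fe; rewrite psumr_eq0; last by move=> a _; apply: sumr_ge0 => b _.
  move=> /allP/(_ i (mem_index_enum _))/=; rewrite psumr_eq0; last by move=> b _.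
  move=> /allP/(_ j (mem_index_enum _))/=; rewrite mulf_eq0 orbb subr_eq0 => /eqP ->.
  by case: (i == j).
have Oc : compact O.
  apply: (@closed_bounded_compact R _ O 1); first by rewrite Of; exact: closed_le.
  move=> z; rewrite /O /= OE => /matrixP h k; case/mxvec_indexP: k => i j.
  have := h i i; rewrite !mxE eqxx mulr1n => h1.
  have e : vec_mx z i j = z 0 (mxvec_index i j) by rewrite mxE.
  rewrite -e -(@ler_sqr R) ?nnegrE// expr1n real_normK ?num_real// -h1.
  by rewrite (bigD1 j)//= -expr2 lerDl sumr_ge0// => l _; rewrite -expr2 sqr_ge0.
have O0 : O !=set0.
  by exists (mxvec 1%:M); rewrite /O /= mxvecK trmx1 mulmx1.
have cg : continuous (fun z : 'rV[R]_(n * n) => \tr (S *m vec_mx z)).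
  rewrite (_ : (fun z => _) = fun z : 'rV[R]_(n * n) => \sum_i \sum_j (fun=> S i j) z * vec_mx z j i).
    apply: continuous_bigsum => i; apply: continuous_bigsum => j; apply: continuous_mul; last exact: continuous_vec_mx.
    exact: cst_continuous.
  by apply/funext => z; apply: eq_bigr => i _; rewrite !mxE; apply: eq_bigr => j _; rewrite mxE.
have [z zO hz] := EVT_max_rV O0 Oc (continuous_subspaceT cg).
exists (vec_mx z); first by move: zO; rewrite inE.
by move=> U UU; have := hz (mxvec U); rewrite inE /O /= mxvecK; apply.
Qed.

(** A substitute for the polar decomposition: if [V] maximizes the trace of [S V], then [S V] is
    symmetric and nonnegative. The result bounds the trace norm below by [hs S / sg]. *)
Lemma polar_trace S (sg : R) : 0 < sg -> (forall u, nrm (u *m S) <= sg * nrm u) ->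
  exists2 V : 'M[R]_n, V *m V^T = 1%:M & hs S <= sg * \tr (S *m V).
Proof.
move=> s0 hsg; have [V VV hV] := orthogonal_trace_max S; exists V => //.
rewrite -(hs_orth S VV); apply: hs_le_trace => // [u|U UU].
  by rewrite mulmxA (_ : nrm (u *m S *m V) = nrm (u *m S))// /nrm nrm_frame.
by rewrite -mulmxA; apply: hV; exact: orth_mul.
Qed.

End Matrices.

Section SignedShifts.
Variables (R : realType) (n' : nat).
Local Notation n := n'.+1.
Local Notation mean := (@mean R).
Local Notation sgb := (@sgb R).

(** A cyclic shift of the coordinates followed by sign changes. Conjugation by these finitely many
    orthogonal matrices averages any matrix to a scalar one, as Haar measure on the orthogonal group
    would. *)
Definition shift_mx (w : signs 'I_n * 'I_n) : 'M[R]_n :=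
  \matrix_(a, c) (sgb (w.1 a) * (c == a + w.2)%:R).

Lemma shift_mx_orth w : shift_mx w *m (shift_mx w)^T = 1%:M.
Proof.
apply/matrixP => a b; rewrite !mxE (bigD1 (a + w.2))//= big1 ?addr0 => [|c ca].
  rewrite !mxE eqxx mulr1 (inj_eq (addIr _)); have [->|ab] := eqVneq a b.
    by rewrite mulr1 sgb_sqr.
  by rewrite !mulr0.
by rewrite !mxE (negbTE ca) mulr0 mul0r.
Qed.

Lemma mean_shift_mx (S : 'M[R]_n) c d :
  mean (fun w => ((shift_mx w)^T *m S *m shift_mx w) c d) = (\tr S / n%:R) * (c == d)%:R.
Proof.
have E w : ((shift_mx w)^T *m S *m shift_mx w) c d = \sum_a \sum_b
    (S a b * ((c == a + w.2)%:R * (d == b + w.2)%:R)) * (sgb (w.1 a) * sgb (w.1 b)).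
  rewrite mxE exchange_big /=; apply: eq_bigr => b _; rewrite mxE mulr_suml.
  by apply: eq_bigr => a _; rewrite !mxE; ring.
rewrite (eq_mean E) mean_pair mean_exchange.
have E2 (s : 'I_n) : mean (fun e : signs 'I_n => \sum_a \sum_b
    (S a b * ((c == a + s)%:R * (d == b + s)%:R)) * (sgb (e a) * sgb (e b))) =
    \sum_a S a a * ((c == a + s)%:R * (c == d)%:R).
  rewrite mean_sum; apply: eq_bigr => a _; rewrite mean_sum.
  rewrite (bigD1 a)//= big1 ?addr0 => [|b ba].
    rewrite meanZ mean_sgb2 eqxx mulr1; congr (_ * _).
    by have [->|] := eqVneq c (a + s); rewrite ?mul0r// eq_sym.
  by rewrite meanZ mean_sgb2 [a == b]eq_sym (negbTE ba) mulr0.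
rewrite (eq_mean E2) mean_sum /mxtrace mulr_suml mulr_suml; apply: eq_bigr => a _.
rewrite meanZ -mulrA; congr (_ * _); rewrite /mean card_ord -mulr_suml mulrA; congr (_ * _).
rewrite (bigD1 (c - a))//= [a + (c - a)]addrC subrK eqxx big1 ?addr0 ?mulr1// => s sc.
by have /negbTE -> // : c != a + s by apply: contra sc => /eqP ->; rewrite [a + s]addrC addrK.
Qed.

Lemma gv_shift (B : finType) (w : signs 'I_n * 'I_n) (F : 'rV[R]_n -> R) :
  mean (fun e : signs ('I_n * B) => F (gv R e *m shift_mx w)) =
  mean (fun e : signs ('I_n * B) => F (gv R e)).
Proof.
pose tw (e : signs ('I_n * B)) : signs ('I_n * B) :=
  [ffun p : 'I_n * B => e (p.1 - w.2, p.2) (+) w.1 (p.1 - w.2)].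
have tb : bijective tw.
  exists (fun e : signs ('I_n * B) => [ffun p : 'I_n * B => e (p.1 + w.2, p.2) (+) w.1 p.1] : signs ('I_n * B)) => e;
    apply/ffunP => -[i b]; rewrite !ffunE /= ?addrK ?subrK -addbA addbb addbF//.
rewrite [RHS](mean_reindex _ tb); apply: eq_mean => e; congr F; apply/rowP => c.
rewrite !mxE (bigD1 (c - w.2))//= big1 ?addr0 => [|a ac].
  rewrite !mxE subrK eqxx mulr1 -mulrA; congr (_ * _); rewrite mulr_suml; apply: eq_bigr => b _.
  by rewrite ffunE sgb_addb.
by rewrite !mxE -subr_eq eq_sym (negbTE ac) !mulr0.
Qed.

End SignedShifts.

(** * Averages of rotated bodies *)

Lemma mxvec_index_bij m n : bijective (fun p : 'I_m * 'I_n => mxvec_index p.1 p.2).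
Proof.
case: (curry_mxvec_bij m n) => g h1 h2; exists g => [[i j]|k]; first by have := h1 (i, j) isT.
by rewrite -[RHS](h2 k isT); case: (g k).
Qed.

Lemma bm_EP (R : realType) d1 d2 (T1 : measurableType d1) (T2 : measurableType d2)
    (P : probability T2 R) (f : T1 * T2 -> R) :
  bm f -> (forall p, 0 <= f p) -> bm (fun x => EP P (fun y => f (x, y))).
Proof.
move=> [mf [c hc]] f0; have bs x : bm (fun y => f (x, y)).
  split; first exact: measurableT_comp mf (pair1_measurable x).
  by exists c => y.
split; last first.
  exists c => x; apply: le_trans (EP_abs P (bs x)) _; rewrite -(EP_cst P c).
  apply: EP_le => //; last exact: bm_cst.
  by split; [exact: measurableT_comp (bs x).1|exists c => y; rewrite normr_id].
rewrite /EP /Rintegral; apply: (measurableT_comp (fine_measurable measurableT)).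
apply: (@measurable_fun_fubini_tonelli_F _ _ T1 T2 R P (EFin \o f)) => [|p].
  exact: measurableT_comp mf.
by rewrite lee_fin.
Qed.

Section Quermass.
Variables (R : realType) (n' : nat).
Local Notation n := n'.+1.
Variables (nu1 : probability (subspaces R n) R) (k : nat) (nuk : probability (subspaces R n) R).
Hypotheses (hnu1 : haar_grassmannian 1 nu1) (hnuk : haar_grassmannian k nuk).
Local Notation mean := (@mean R).
Local Notation sgb := (@sgb R).
Local Notation J := (@J R n' nu1 _).

(** A bound valid in each direction [u] is integrated over a random line; Cauchy-Schwarz and the
    second moment [|v|^2 / n] of a projection produce the gain of [1 / sqrt n]. *)
Lemma mean_J_le (I : finType) (N m : nat) (y : I -> 'I_N -> 'rV[R]_n) (w : 'I_m -> 'rV[R]_n) (c : R) :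
  0 <= c -> (forall u, dot u u = 1 ->
    mean (fun e => \big[Num.max/0]_i `|dot u (y e i)|) <= c * nrm (\row_a dot u (w a))) ->
  mean (fun e => J (y e)) <= c * Num.sqrt ((\sum_a dot (w a) (w a)) / n%:R).
Proof.
move=> c0 hu; rewrite -EP_mean; last by move=> e; exact: mxn_bm.
pose g (L : subspaces R n) : R := nrm (\row_a nrm (orth_proj L (w a))).
have bg : bm g by apply: bm_nrm => a; under eq_fun do rewrite mxE; exact: nrm_proj_bm.
apply: (@le_trans _ _ (EP nu1 (fun L => c * g L))).
  apply: (EP_le_ae _ _ (@grassmannian_measurable R n 1) (gr1_full hnu1)) => [| |L L1].
  - by apply: bm_mean => e; exact: mxn_bm.
  - exact: bmZ.
  have [u u1 hL] := line_direction L1.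
  have -> : g L = nrm (\row_a dot u (w a)).
    apply/eqP; rewrite -(@eqrXn2 _ 2) ?nrm_ge0//; apply/eqP; rewrite !nrm2.
    by apply: eq_bigr => a _; rewrite !mxE hL -!expr2 real_normK ?num_real.
  apply: le_trans (hu u u1); apply: ler_mean => e; rewrite /mxn le_eqVlt; apply/orP; left.
  by apply/eqP; apply: eq_bigr => i _; rewrite hL.
rewrite EPZ// ler_wpM2l//.
have s0 : 0 <= (\sum_a dot (w a) (w a)) / n%:R :> R.
  by rewrite divr_ge0// sumr_ge0// => a _; exact: dot_ge0.
have e0 : 0 <= EP nu1 g by apply: EP_ge0 => // L; exact: nrm_ge0.
rewrite -(@ler_sqr R) ?nnegrE ?sqrtr_ge0// sqr_sqrtr//; apply: (le_trans (EP_sqr nu1 bg)).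
have -> : (fun L => g L ^+ 2) = fun L : subspaces R n => \sum_a nrm (orth_proj L (w a)) ^+ 2.
  by apply/funext => L; rewrite nrm2; apply: eq_bigr => a _; rewrite !mxE expr2.
rewrite (@EP_sum _ _ _ nu1 _ _ (fun a (L : subspaces R n) => nrm (orth_proj L (w a)) ^+ 2)); last first.
  by move=> a; apply: bmX; exact: nrm_proj_bm.
rewrite mulr_suml le_eqVlt; apply/orP; left; apply/eqP; apply: eq_bigr => a _.
by rewrite (E1_sqr hnu1).
Qed.

Variables (N : nat) (x : 'I_N -> 'rV[R]_n).

(** The mean width of the projection onto [F] of the body transformed by [M], measured in the whole
    space. *)
Definition psi (M : 'M[R]_n) (F : subspaces R n) : R := J (fun i => orth_proj F (x i *m M)).

Lemma psi_bm M : bm (psi M).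
Proof.
pose G (p : subspaces R n * subspaces R n) : R :=
  \big[Num.max/0]_i nrm (orth_proj p.2 (orth_proj p.1 (x i *m M))).
have bc (a : 'I_n) z : bm (fun p : subspaces R n * subspaces R n => (orth_proj p.1 z) 0 a).
  have [mf [c hc]] := proj_bm z a; split; last by exists c => p; exact: hc.
  exact: measurableT_comp mf measurable_fst.
have bc2 (a : 'I_n) z : bm (fun p : subspaces R n * subspaces R n => (orth_proj p.2 z) 0 a).
  have [mf [c hc]] := proj_bm z a; split; last by exists c => p; exact: hc.
  exact: measurableT_comp mf measurable_snd.
have bG : bm G.
  apply: (@bm_bigmax _ _ _ _ (fun i (p : subspaces R n * subspaces R n) => nrm (orth_proj p.2 (orth_proj p.1 (x i *m M))))) => i.
  apply: bm_nrm => j.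
  have -> : (fun p : subspaces R n * subspaces R n => (orth_proj p.2 (orth_proj p.1 (x i *m M))) 0 j) =
      fun p => \sum_a (orth_proj p.1 (x i *m M)) 0 a * (orth_proj p.2 (delta_mx 0 a)) 0 j.
    apply/funext => p; rewrite [X in orth_proj p.2 X]sum_delta_rV orth_proj_sum summxE.
    by apply: eq_bigr => a _; rewrite orth_projZ mxE.
  apply: (@bm_sum _ _ _ _ _ (fun a (p : subspaces R n * subspaces R n) => (orth_proj p.1 (x i *m M)) 0 a * (orth_proj p.2 (delta_mx 0 a)) 0 j)) => a.
  by apply: bmM; [exact: bc|exact: bc2].
by apply: (bm_EP nu1 bG) => p; exact: bigmax_ge_id.
Qed.

Lemma psi_ge0 M F : 0 <= psi M F.
Proof. exact: J_ge0. Qed.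

Lemma psi_rotate (V M : 'M[R]_n) F : V *m V^T = 1%:M ->
  psi (M *m V) F = psi M (rotate V^T F).
Proof.
move=> VV; have VV' : V^T *m V^T^T = 1%:M by rewrite trmxK (mulmx1C VV).
rewrite /psi -[LHS](@J_rot _ _ _ hnu1 _ _ _ VV'); congr J; apply/funext => i.
by rewrite -rotate_proj// mulmxA -mulmxA VV mulmx1.
Qed.

Lemma psi_mean (I : finType) (M : I -> 'M[R]_n) (t : R) F : 0 <= t ->
  #|I|%:R^-1 *: \sum_w M w = t%:M -> t * psi 1%:M F <= mean (fun w => psi (M w) F).
Proof.
move=> t0 tM; rewrite -{1}(ger0_norm t0) -J_scale; apply: le_trans (J_mean nu1 _).
rewrite le_eqVlt; apply/orP; left; apply/eqP; congr J; apply/funext => i.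
by rewrite -orth_proj_sum -!orth_projZ mulmx1 -mulmx_sumr -mul_mx_scalar -tM -scalemxAr.
Qed.

(* Averaging [W^T Ga V W] over signed shifts [W] gives a scalar matrix, while
   the right factor [V W] only rotates [F]. *)
Lemma rotation_average (Ga : 'M[R]_n) (sg : R) : 0 < sg -> (forall u, nrm (u *m Ga) <= sg * nrm u) ->
  (hs Ga / (sg * n%:R)) ^+ k * EP nuk (fun F => psi 1%:M F ^+ k) <=
  mean (fun w => EP nuk (fun F => psi ((shift_mx R w)^T *m Ga) F ^+ k)).
Proof.
move=> s0 hG; have [V VV hV] := polar_trace s0 hG.
pose t := \tr (Ga *m V) / n%:R.
have hs0 : 0 <= hs Ga by apply: sumr_ge0 => j _; apply: sumr_ge0 => i _; exact: sqr_ge0.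
have tge : hs Ga / (sg * n%:R) <= t.
  rewrite /t invfM mulrA ler_pM2r ?invr_gt0 ?ltr0n//.
  by rewrite ler_pdivrMr// mulrC.
have q0 : 0 <= hs Ga / (sg * n%:R) by rewrite divr_ge0// mulr_ge0// ltW.
have t0 : 0 <= t := le_trans q0 tge.
pose M w := (shift_mx R w)^T *m (Ga *m V) *m shift_mx R w.
have ME w : EP nuk (fun F => psi (M w) F ^+ k) =
    EP nuk (fun F => psi ((shift_mx R w)^T *m Ga) F ^+ k).
  have UU : (V *m shift_mx R w) *m (V *m shift_mx R w)^T = 1%:M.
    by apply: orth_mul => //; exact: shift_mx_orth.
  have UU' : (V *m shift_mx R w)^T *m (V *m shift_mx R w)^T^T = 1%:M.
    by rewrite trmxK (mulmx1C UU).
  have f0 (F : subspaces R n) : 0 <= psi ((shift_mx R w)^T *m Ga) F ^+ k by rewrite exprn_ge0// psi_ge0.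
  have MM : M w = ((shift_mx R w)^T *m Ga) *m (V *m shift_mx R w) by rewrite /M !mulmxA.
  have fe : (fun F => psi (M w) F ^+ k) =
      fun F => psi ((shift_mx R w)^T *m Ga) (rotate (V *m shift_mx R w)^T F) ^+ k.
    apply/funext => F.
    exact (congr1 (fun z => z ^+ k) (eq_trans (congr1 (fun Q => psi Q F) MM) (psi_rotate _ F UU))).
  exact (eq_trans (congr1 (EP nuk) fe) (EP_rotate hnuk UU' (bmX k (psi_bm ((shift_mx R w)^T *m Ga))) f0)).
have bM w : bm (fun F => psi (M w) F ^+ k) by apply: bmX; exact: psi_bm.
have Mt : #|{: signs 'I_n * 'I_n}|%:R^-1 *: \sum_w M w = t%:M.
  apply/matrixP => c d; rewrite mxE summxE.
  have := mean_shift_mx (Ga *m V) c d; rewrite /mean => ->.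
  by rewrite mxE; case: (c == d); rewrite ?mulr1 ?mulr0.
apply: (@le_trans _ _ (EP nuk (fun F => mean (fun w => psi (M w) F ^+ k)))); last first.
  have EM := @EP_mean _ _ _ nuk _ (fun w F => psi (M w) F ^+ k) bM.
  rewrite le_eqVlt; apply/orP; left; apply/eqP; exact (eq_trans EM (eq_mean ME)).
have b1 : bm (fun F => psi 1%:M F ^+ k) by apply: bmX; exact: psi_bm.
rewrite -(EPZ nuk _ b1); apply: (EP_le _ (bmZ _ b1) (bm_mean bM)) => F.
have W0 : (0 < #|{: signs 'I_n * 'I_n}|)%N by rewrite card_prod muln_gt0 card_signs_gt0 card_ord.
apply: le_trans (mean_exprn k W0 (fun w => psi_ge0 (M w) F)).
rewrite -exprMn; apply: lerXn2r; rewrite ?nnegrE.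
- by rewrite mulr_ge0// psi_ge0.
- by apply: mean_ge0 => w; exact: psi_ge0.
by apply: le_trans (psi_mean F t0 Mt); rewrite ler_wpM2r// psi_ge0.
Qed.

End Quermass.

(** * Moments of the projected mean width *)

Section SignMatrices.
Variables (R : realType) (n' : nat) (B : finType).
Local Notation n := n'.+1.
Hypothesis nB : (2 * n <= #|B|)%N.
Local Notation mean := (@mean R).
Local Notation sgb := (@sgb R).

Definition sign_mx (e : signs 'I_(n * n)) : 'M[R]_n := vec_mx (signvec R e).

Lemma sign_mxE e i j : sign_mx e i j = sgb (e (mxvec_index i j)).
Proof. by rewrite !mxE. Qed.

Lemma dot_mxvec (z : 'rV[R]_(n * n)) :
  \sum_a dot (row a (vec_mx z)) (row a (vec_mx z : 'M[R]_n)) = dot z z.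
Proof.
rewrite [RHS]/dot (reindex _ (onW_bij _ (mxvec_index_bij n n)))/=.
rewrite -(pair_bigA _ (fun a j => z 0 (mxvec_index a j) * z 0 (mxvec_index a j)))/=.
by apply: eq_bigr => a _; apply: eq_bigr => j _; rewrite !mxE.
Qed.

Lemma mean_sign_mx (h : 'rV[R]_n -> R) (v : 'rV[R]_n) : seminorm h -> dot v v = 1 ->
  mean (fun e => h (v *m (sign_mx e)^T)) <= 4 * mean (fun e : signs ('I_n * B) => h (gv R e)).
Proof.
move=> hS v1; have := mean_sign_rows hS (ltn0Sn n') nB v1.
rewrite (mean_signs_index _ (mxvec_index_bij n n)); apply: le_trans.
apply: ler_mean => e; rewrite le_eqVlt; apply/orP; left; apply/eqP; congr h; apply/rowP => i.
by rewrite !mxE; apply: eq_bigr => j _; rewrite ffunE /= mxE sign_mxE mulrC.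
Qed.

(** Khinchine for the rank-one matrix [y^T v] with [v] a unit vector, followed by [mean_sign_mx]:
    [512 = 128 * 4]. *)
Lemma nrm_le_gv (y : 'rV[R]_n) :
  nrm y <= 512 * mean (fun e : signs ('I_n * B) => `|dot y (gv R e)|).
Proof.
pose v : 'rV[R]_n := delta_mx 0 0.
have v1 : dot v v = 1.
  by rewrite /dot (bigD1 0)//= !mxE !eqxx mulr1 big1 ?addr0// => j j0; rewrite !mxE eqxx (negbTE j0) mulr0.
have hS : seminorm (fun z : 'rV[R]_n => `|dot y z|).
  by split=> [u z|a u]; [rewrite dotDr; exact: ler_normD|rewrite dotZr normrM].
have := mean_sign_mx hS v1.
pose a : 'rV[R]_(n * n) := mxvec (y^T *m v).
have aE i j : a 0 (mxvec_index i j) = y 0 i * v 0 j.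
  by rewrite /a mxvecE mxE big_ord1 mxE.
have na : nrm a = nrm y.
  rewrite /nrm; congr Num.sqrt; rewrite -dot_mxvec.
  transitivity (\sum_i (y 0 i * y 0 i) * dot v v); last by rewrite v1; apply: eq_bigr => i _; rewrite mulr1.
  apply: eq_bigr => i _; rewrite /dot mulr_sumr; apply: eq_bigr => j _; rewrite !mxE.
  by rewrite aE !mxE; ring.
have := khinchine_rV a; rewrite na.
have -> : mean (fun e : signs 'I_(n * n) => `|\sum_i sgb (e i) * a 0 i|) =
    mean (fun e => `|dot y (v *m (sign_mx e)^T)|).
  apply: eq_mean => e; congr `|_|.
  rewrite (reindex _ (onW_bij _ (mxvec_index_bij n n)))/=.
  rewrite -(pair_bigA _ (fun i j => sgb (e (mxvec_index i j)) * a 0 (mxvec_index i j)))/=.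
  rewrite [RHS]/dot; apply: eq_bigr => i _; rewrite mxE mulr_sumr; apply: eq_bigr => j _.
  by rewrite aE [_^T _ _]mxE sign_mxE; ring.
by move: (nrm y) (mean _) (mean _) => p q r; lra.
Qed.

Lemma sign_mx_norm : exists sg : signs 'I_(n * n) -> R,
  [/\ forall e, 0 < sg e, forall e u, nrm (u *m sign_mx e) <= sg e * nrm u &
      mean sg <= 110 * Num.sqrt n%:R].
Proof.
have [sg [sg0 hsg msg]] := mean_operator_norm R (ltn0Sn n') (ltn0Sn 0) (ltn0Sn n').
pose f (p : 'I_n * ('I_n * 'I_1)) : 'I_(n * n) := mxvec_index p.2.1 p.1.
have fb : bijective f.
  have [g gK Kg] := mxvec_index_bij n n.
  exists (fun l => ((g l).2, ((g l).1, ord0))) => [[i [j c]]|l]; last by rewrite /f /= Kg.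
  by rewrite /f /= (gK (j, i)) /= (ord1 c).
exists (fun e => sg [ffun p => e (f p)]); split=> [e|e u|].
- exact: sg0.
- have <- : rowmx R [ffun p => e (f p)] = sign_mx e.
    apply/matrixP => j i; rewrite sign_mxE mxE big_ord1 ffunE sqrtr1 invr1 mul1r.
    by congr (sgb (e _)).
  exact: hsg.
rewrite -(mean_signs_index sg fb); apply: (le_trans msg).
have n0 : 0 <= n%:R :> R by [].
rewrite -(@ler_sqr R) ?nnegrE ?mulr_ge0// !exprMn sqr_sqrtr// sqr_sqrtr// natrD.
by move: (n%:R) n0 => m m0; lra.
Qed.

End SignMatrices.

Section QuermassMoment.
Variables (R : realType) (n' : nat) (B : finType).
Local Notation n := n'.+1.
Hypothesis nB : (2 * n <= #|B|)%N.
Variables (nu1 : probability (subspaces R n) R) (k : nat) (nuk : probability (subspaces R n) R).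
Hypotheses (hnu1 : haar_grassmannian 1 nu1) (hnuk : haar_grassmannian k nuk) (k0 : (0 < k)%N).
Local Notation mean := (@mean R).
Local Notation sgb := (@sgb R).
Variables (N : nat) (x : 'I_N -> 'rV[R]_n) (l : R).
Hypotheses (l0 : 0 < l) (hl : mean (fun e : signs ('I_n * B) => hK x (gv R e)) <= l).
Local Notation psi := (psi nu1 x).
Local Notation D := (516 * l * Num.sqrt (k%:R / n%:R)).

Let c512 : 0 < 512 :> R. Proof. by rewrite ltr0n. Qed.
Let c4 : 0 < 4 :> R. Proof. by rewrite ltr0n. Qed.

Lemma nrm_points i : nrm (x i) <= 512 * l.
Proof.
apply: (le_trans (nrm_le_gv nB (x i))); apply: (ler_wpM2l (ler0n R 512)).
by apply: le_trans hl; apply: ler_mean => e; exact: le_hK.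
Qed.

Lemma dot_psi u w Ga i (F : {vspace 'rV[R]_n}) :
  dot u (orth_proj F (x i *m ((shift_mx R w)^T *m Ga))) =
  dot (x i) (orth_proj F u *m Ga^T *m shift_mx R w).
Proof.
by rewrite -orth_proj_dot [LHS]dotC dot_mulmx trmx_mul trmxK mulmxA.
Qed.

(** Since [psi] is a seminorm in [z], this is a Lipschitz constant on the cube of sign matrices: the
    points have norm at most [512 l], and a random line retains [1 / sqrt n] of a vector. A mean
    over [unit] lets [mean_J_le] be reused. *)
Lemma psi_lipschitz w (z : 'rV[R]_(n * n)) F :
  psi ((shift_mx R w)^T *m vec_mx z) F <= 512 * l * (Num.sqrt n%:R)^-1 * nrm z.
Proof.
have L0 : 0 <= 512 * l := mulr_ge0 (ltW c512) (ltW l0).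
pose y (_ : unit) i := orth_proj F (x i *m ((shift_mx R w)^T *m vec_mx z)).
have row_eq u : \row_a dot u (orth_proj F (row a (vec_mx z : 'M[R]_n))) = orth_proj F u *m (vec_mx z)^T.
  apply/rowP => a; rewrite mxE -orth_proj_dot [RHS]mxE; apply: eq_bigr => j _.
  by rewrite [row _ _ _ _]mxE [(_^T) _ _]mxE.
have key u : dot u u = 1 -> mean (fun e : unit => \big[Num.max/0]_i `|dot u (y e i)|) <=
    512 * l * nrm (\row_a dot u (orth_proj F (row a (vec_mx z : 'M[R]_n)))).
  move=> _; rewrite (_ : mean _ = \big[Num.max/0]_i `|dot u (y tt i)|); last first.
    by rewrite /mean card_unit invr1 mul1r (big_pred1 tt)//; case.
  apply: bigmax_le => [|i _]; first by rewrite mulr_ge0 ?nrm_ge0.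
  rewrite /y dot_psi row_eq; apply: (le_trans (dot_le_nrm _ _)).
  rewrite (_ : nrm (_ *m shift_mx R w) = nrm (orth_proj F u *m (vec_mx z)^T)); last first.
    by rewrite /nrm nrm_frame//; exact: shift_mx_orth.
  by rewrite ler_wpM2r ?nrm_ge0// nrm_points.
have := mean_J_le hnu1 L0 key.
rewrite (_ : mean _ = psi ((shift_mx R w)^T *m vec_mx z) F); last first.
  by rewrite /mean card_unit invr1 mul1r (big_pred1 tt)//; case.
move=> /le_trans; apply; rewrite -[leRHS]mulrA; apply: (ler_wpM2l L0); rewrite sqrtrM; last first.
  by apply: sumr_ge0 => a _; exact: dot_ge0.
rewrite sqrtrV// mulrC ler_wpM2l ?invr_ge0// ler_wsqrtr// -dot_mxvec.
apply: ler_sum => a _; rewrite -!nrm2 lerXn2r ?nnegrE ?nrm_ge0//; exact: nrm_orth_proj_le.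
Qed.

Lemma psi_mean_le w (F : {vspace 'rV[R]_n}) : \dim F = k ->
  mean (fun e => psi ((shift_mx R w)^T *m sign_mx R e) F) <= 4 * l * Num.sqrt (k%:R / n%:R).
Proof.
move=> Fk; have L0 : 0 <= 4 * l := mulr_ge0 (ltW c4) (ltW l0).
pose y (e : signs 'I_(n * n)) i := orth_proj F (x i *m ((shift_mx R w)^T *m sign_mx R e)).
have key u : dot u u = 1 -> mean (fun e => \big[Num.max/0]_i `|dot u (y e i)|) <=
    4 * l * nrm (\row_a dot u (orth_proj F (delta_mx 0 a))).
  move=> _; have -> : \row_a dot u (orth_proj F (delta_mx 0 a)) = orth_proj F u.
    apply/rowP => a; rewrite mxE -orth_proj_dot /dot (bigD1 a)//= !mxE !eqxx mulr1.
    by rewrite big1 ?addr0// => j ja; rewrite !mxE (negbTE ja) andbF mulr0.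
  pose h (z : 'rV[R]_n) := hK x (z *m shift_mx R w).
  have hS : seminorm h.
    have [h1 h2] := hK_seminorm x; split=> [p q|a p]; rewrite /h; first by rewrite mulmxDl.
    by rewrite -scalemxAl h2.
  have -> : mean (fun e => \big[Num.max/0]_i `|dot u (y e i)|) =
      mean (fun e => h (orth_proj F u *m (sign_mx R e)^T)).
    by apply: eq_mean => e; rewrite /h /hK; apply: eq_bigr => i _; rewrite /y dot_psi.
  have [->|v0] := eqVneq (orth_proj F u) 0.
    rewrite nrm0 mulr0 le_eqVlt; apply/orP; left; apply/eqP.
    rewrite (@eq_mean _ _ _ (fun=> 0)) => [|e]; first by rewrite mean_cst// card_signs_gt0.
    by rewrite mul0mx (seminorm0 hS).
  move: (orth_proj F u) v0 => v v0; have nv : 0 < nrm v by rewrite lt_def nrm_ge0 nrm_eq0 v0.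
  have v1 : dot ((nrm v)^-1 *: v) ((nrm v)^-1 *: v) = 1.
    by rewrite dotZl dotZr -nrm2; field; rewrite gt_eqF.
  have hm := mean_sign_mx nB hS v1.
  have hg : mean (fun e : signs ('I_n * B) => h (gv R e)) <= l.
    by rewrite /h (gv_shift B w (hK x)).
  have -> : mean (fun e => h (v *m (sign_mx R e)^T)) =
      nrm v * mean (fun e => h (((nrm v)^-1 *: v) *m (sign_mx R e)^T)).
    rewrite -meanZ; apply: eq_mean => e; rewrite -scalemxAl hS.2 gtr0_norm ?invr_gt0//.
    by rewrite mulrA mulfV ?gt_eqF// mul1r.
  rewrite mulrC ler_pM2r//; exact: (le_trans hm (ler_wpM2l (ltW c4) hg)).
have := mean_J_le hnu1 L0 key; rewrite (_ : \sum_a _ = k%:R); first by [].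
by rewrite -Fk -sum_nrm_orth_proj; apply: eq_bigr => a _; rewrite nrm2.
Qed.

(** Concentration over the sign matrix: [516] dominates both the 4 of the mean and the 512 of the
    Lipschitz constant, whose product with [sqrt k] is also of order [l sqrt (k / n)]. *)
Lemma psi_moment w (F : {vspace 'rV[R]_n}) : \dim F = k ->
  mean (fun e => psi ((shift_mx R w)^T *m sign_mx R e) F ^+ k) <= (expR 9 * D) ^+ k.
Proof.
move=> Fk; pose H (z : 'rV[R]_(n * n)) := psi ((shift_mx R w)^T *m vec_mx z) F.
have n0 : 0 < n%:R :> R by rewrite ltr0n.
have sn : 0 < Num.sqrt n%:R :> R by rewrite sqrtr_gt0.
have sk : 0 < Num.sqrt k%:R :> R by rewrite sqrtr_gt0 ltr0n.
have skn : Num.sqrt (k%:R / n%:R) = Num.sqrt k%:R / Num.sqrt n%:R :> R by rewrite sqrtrM// sqrtrV.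
have Hadd z z' : H (z + z') <= H z + H z'.
  apply: le_trans (J_add nu1 _ _); rewrite le_eqVlt; apply/orP; left; apply/eqP; congr (J nu1).
  by apply/funext => i; rewrite linearD /= !mulmxDr orth_projD.
have Hscale a z : H (a *: z) = `|a| * H z.
  rewrite -(J_scale nu1); congr (J nu1); apply/funext => i.
  by rewrite linearZ /= -!scalemxAr orth_projZ.
have a0 : 0 <= 512 * l * (Num.sqrt n%:R)^-1 by apply: (mulr_ge0 (mulr_ge0 (ltW c512) (ltW l0))); rewrite invr_ge0 ltW.
have D0 : 0 < D.
  by rewrite skn; apply: (mulr_gt0 (mulr_gt0 _ l0) (divr_gt0 sk sn)); rewrite ltr0n.
have cH : cvx H.
  move=> t z z' /andP[t0 t1]; apply: (le_trans (Hadd _ _)).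
  by rewrite !Hscale !ger0_norm ?subr_ge0.
have lip z z' : H z - H z' <= 512 * l * (Num.sqrt n%:R)^-1 * nrm (z - z').
  apply: le_trans (psi_lipschitz w (z - z') F).
  by rewrite lerBlDr -{1}(subrK z' z); exact: Hadd.
have le4 : 4 * l <= 516 * l by rewrite (ler_pM2r l0) ler_nat.
have le5 : 512 * l <= 516 * l by rewrite (ler_pM2r l0) ler_nat.
have mD : mean (fun e => H (signvec R e)) <= D.
  by apply: (le_trans (psi_mean_le w Fk)); apply: (ler_wpM2r (sqrtr_ge0 _)).
have aD : 512 * l * (Num.sqrt n%:R)^-1 * Num.sqrt k%:R <= D.
  rewrite skn mulrAC mulrA; apply: ler_wpM2r; first by rewrite invr_ge0 ltW.
  exact: (ler_wpM2r (ltW sk) le5).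
exact: (moment_concentration cH (fun z => psi_ge0 nu1 x _ F) a0 lip D0 k0 mD aD).
Qed.

(** A sign matrix has [hs] equal to [n^2] and operator norm of mean order [sqrt n], so
    [rotation_average] loses only a factor of order [sqrt n] to the power [k]. Jensen's inequality
    for powers and for inverses replaces the random operator norm by its mean. *)
Lemma EP_psi_exprn : EP nuk (fun F => psi 1%:M F ^+ k) <= (110 * expR 9 * D / Num.sqrt n%:R) ^+ k.
Proof.
have n0 : 0 < n%:R :> R by rewrite ltr0n.
have sn : 0 < Num.sqrt n%:R :> R by rewrite sqrtr_gt0.
have s2 : Num.sqrt n%:R ^+ 2 = n%:R :> R by rewrite sqr_sqrtr// ltW.
have [sg [sg0 hsg msg]] := sign_mx_norm R n'.
have bp M : bm (fun F => psi M F ^+ k) by apply: bmX; exact: psi_bm.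
have I0 := card_signs_gt0 'I_(n * n).
set I := EP nuk (fun F => psi 1%:M F ^+ k).
have I_ge0 : 0 <= I by apply: (EP_ge0 nuk (bp 1%:M)) => F; rewrite exprn_ge0// psi_ge0.
have hsE e : hs (sign_mx R e : 'M[R]_n) = n%:R ^+ 2.
  rewrite /hs (eq_bigr (fun=> n%:R)) => [|j _].
    by rewrite sumr_const card_ord -[LHS]mulr_natl expr2.
  rewrite (eq_bigr (fun=> 1)) => [|i _]; first by rewrite sumr_const card_ord.
  by rewrite sign_mxE expr2 sgb_sqr.
have step e : (n%:R * (sg e)^-1) ^+ k * I <=
    mean (fun w => EP nuk (fun F => psi ((shift_mx R w)^T *m sign_mx R e) F ^+ k)).
  have := rotation_average hnu1 hnuk x (sg0 e) (hsg e).
  rewrite hsE (_ : n%:R ^+ 2 / (sg e * n%:R) = n%:R * (sg e)^-1)//.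
  by have := sg0 e; move: (sg e) => s sp; field; rewrite !gt_eqF.
have up : mean (fun e => mean (fun w => EP nuk (fun F => psi ((shift_mx R w)^T *m sign_mx R e) F ^+ k))) <=
    (expR 9 * D) ^+ k.
  rewrite mean_exchange; apply: (@le_trans _ _ (mean (fun _ : signs 'I_n * 'I_n => (expR 9 * D) ^+ k))).
    apply: ler_mean => w.
    have bw e : bm (fun F => psi ((shift_mx R w)^T *m sign_mx R e) F ^+ k) by exact: bp.
    have EM := @EP_mean _ _ _ nuk _ (fun e F => psi ((shift_mx R w)^T *m sign_mx R e) F ^+ k) bw.
    apply: (@le_trans _ _ (EP nuk (fun F => mean (fun e => psi ((shift_mx R w)^T *m sign_mx R e) F ^+ k)))).
      rewrite le_eqVlt; apply/orP; left; apply/eqP; exact (esym EM).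
    rewrite -[leRHS](EP_cst nuk).
    have bmw : bm (fun F => mean (fun e => psi ((shift_mx R w)^T *m sign_mx R e) F ^+ k)) := bm_mean bw.
    refine (@EP_le_ae _ _ _ nuk _ (fun=> (expR 9 * D) ^+ k) _ bmw (bm_cst _ _) (@grassmannian_measurable R n k) hnuk.1 _).
    by move=> F Fk; exact: psi_moment.
  by rewrite mean_cst// card_prod muln_gt0 card_signs_gt0 card_ord.
have low : (Num.sqrt n%:R / 110) ^+ k * I <= mean (fun e => (n%:R * (sg e)^-1) ^+ k * I).
  under eq_mean do rewrite mulrC.
  rewrite meanZ mulrC; apply: ler_wpM2l => //.
  have q0 e : 0 <= n%:R * (sg e)^-1 by rewrite mulr_ge0 ?ler0n// invr_ge0 ltW.
  apply: le_trans (mean_exprn k I0 q0).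
  have a1 : 0 <= Num.sqrt n%:R / 110 :> R by rewrite divr_ge0 ?ler0n// ltW.
  have b1 := mean_ge0 q0; apply: lerXn2r; rewrite ?nnegrE; [exact: a1|exact: b1|].
  rewrite meanZ -ler_pdivrMl//; apply: le_trans (mean_inv_ge I0 sg0).
  have m0 : 0 < mean sg.
    have [t ht] := exists_ge_mean (fun e => - sg e) I0.
    by move: ht; rewrite meanN lerN2; exact: lt_le_trans.
  apply: (@le_trans _ _ (110 * Num.sqrt n%:R)^-1); last by rewrite lef_pV2 ?posrE// mulr_gt0.
  rewrite le_eqVlt; apply/orP; left; apply/eqP.
  by move: s2 sn; move: (Num.sqrt n%:R) => a <- a0; field; exact: lt0r_neq0.
have := le_trans low (le_trans (ler_mean step) up).
rewrite mulrC -ler_pdivlMr ?exprn_gt0 ?divr_gt0// -expr_div_n => /le_trans; apply.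
rewrite le_eqVlt; apply/orP; left; apply/eqP; congr (_ ^+ k).
by move: sn; move: (Num.sqrt n%:R) (expR 9) (D) => a b c a0; field; rewrite gt_eqF.
Qed.

End QuermassMoment.

(** * Quermassintegrals and mean width *)

(** The integral of a nonnegative function is a supremum over simple functions below it, hence
    monotone as it stands. This is how volumes of projections are integrated over the
    Grassmannian. *)
Lemma ge0_le_integral_nonmeasurable (R : realType) d (T : measurableType d)
    (mu : measure T R) (D : set T) (f g : T -> \bar R) :
  (forall x, D x -> (0 <= f x)%E) -> (forall x, D x -> (f x <= g x)%E) ->
  (\int[mu]_(x in D) f x <= \int[mu]_(x in D) g x)%E.
Proof.
move=> f0 fg; have g0 x : D x -> (0 <= g x)%E by move=> Dx; exact: le_trans (f0 _ Dx) (fg _ Dx).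
rewrite (ge0_integralE _ f0) (ge0_integralE _ g0).
apply: ge_ereal_sup => _ [h hf <-]; apply: ereal_sup_ubound; exists h => // x.
apply: (le_trans (hf x)); rewrite /patch; case: ifPn => // xD.
by apply: fg; rewrite inE in xD.
Qed.

Lemma integral_EP (R : realType) d (T : measurableType d) (P : probability T R) (f : T -> R) :
  bm f -> (\int[P]_x (f x)%:E = (EP P f)%:E)%E.
Proof.
by move=> bf; rewrite /EP /Rintegral fineK//; exact: integrable_fin_num (bm_integrable P bf).
Qed.

Section QuermassBound.
Variables (R : realType) (n' : nat).
Local Notation n := n'.+1.
Variables (nu1 : probability (subspaces R n) R).
Hypotheses (hnu1 : haar_grassmannian 1 nu1).
Local Notation mean := (@mean R).

(** The mean width of the projection in its own coordinates is bounded by [mean_width_le_J]; the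
    slack [eta] provides the positive bound that [volume_le_mean_width] requires. *)
Lemma subspace_volume_le N (x : 'I_N -> 'rV[R]_n) (F : {vspace 'rV[R]_n}) eta :
  (0 < \dim F)%N -> 0 < eta ->
  (subspace_volume F (orth_proj F @` symmetric_polytope x) <=
   ((4 * expR 2 * (128 * Num.sqrt n%:R * (psi nu1 x 1%:M F + eta)) / (\dim F)%:R) ^+ \dim F)%:E)%E.
Proof.
move=> F0 eta0; have [BB BF] := orthonormal_basisP F; set B := orthonormal_basis F in BB BF.
have sn : 0 < Num.sqrt n%:R :> R by rewrite sqrtr_gt0 ltr0n.
have c0 : 0 < 128 * Num.sqrt n%:R :> R by rewrite mulr_gt0 ?ltr0n.
have p0 := psi_ge0 nu1 x 1%:M F.
apply: (@volume_le_mean_width _ _ _ (fun e => hK x (signvec R e *m B))) => //.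
- by apply: (mulr_gt0 c0); exact: ltr_wpDl.
- move=> e y [z zK zy].
  have -> : \sum_j sgb R (e j) * y 0 j = dot (signvec R e *m B) (y *m B).
    rewrite dot_mulmx -mulmxA BB mulmx1; apply: eq_bigr => j _; by rewrite mxE.
  rewrite -/B in zy; rewrite -zy -orth_proj_dot orth_projE -/B -mulmxA [X in dot X _]mulmxA.
  by rewrite -[signvec R e *m B *m _]mulmxA BB mulmx1; exact: polytope_dot.
have := mean_width_le_J hnu1 x BB => /le_trans; apply; apply: (ler_wpM2l (ltW c0)).
rewrite (_ : J nu1 _ = psi nu1 x 1%:M F); first by rewrite lerDl ltW.
by congr (J nu1); apply/funext => i; rewrite mulmx1 orth_projE.
Qed.

Variables (B : finType) (k : nat) (nuk : probability (subspaces R n) R).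
Hypotheses (nB : (2 * n <= #|B|)%N) (hnuk : haar_grassmannian k nuk) (k0 : (0 < k)%N).

Definition quermass_cst : R := 1024 * (110 * 516) * (expR 2 * expR 9).

Lemma quermass_cst_gt0 : 0 < quermass_cst.
Proof.
apply: (mulr_gt0 _ (mulr_gt0 (expR_gt0 _) (expR_gt0 _))).
by apply: mulr_gt0; [|apply: mulr_gt0]; rewrite ltr0n.
Qed.

Lemma quermass_le N (x : 'I_N -> 'rV[R]_n) l : 0 < l ->
  mean (fun e : signs ('I_n * B) => hK x (gv R e)) <= l ->
  (quermassintegral k nuk (symmetric_polytope x) <= (quermass_cst * l / Num.sqrt n%:R)%:E)%E.
Proof.
move=> l0 hl; have sn : 0 < Num.sqrt n%:R :> R by rewrite sqrtr_gt0 ltr0n.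
have sk : 0 < Num.sqrt k%:R :> R by rewrite sqrtr_gt0 ltr0n.
have kR : 0 < k%:R :> R by rewrite ltr0n.
have sk2 : Num.sqrt k%:R ^+ 2 = k%:R :> R by rewrite sqr_sqrtr// ltW.
have := EP_psi_exprn nB hnu1 hnuk k0 l0 hl.
(* The bound on the [k]-th moment of [psi] serves at the same time as the positive slack. *)
move E : (110 * _ * _ / _) => eta hI.
have etaE : eta = 110 * 516 * expR 9 * l * Num.sqrt k%:R / Num.sqrt n%:R ^+ 2.
  rewrite -E sqrtrM; last exact: ltW.
  by rewrite sqrtrV ?ler0n//; move: (Num.sqrt n%:R) sn => a a0; field; exact: lt0r_neq0.
have eta0 : 0 < eta.
  rewrite etaE; apply: (divr_gt0 _ (exprn_gt0 2 sn)); apply: (mulr_gt0 _ sk); apply: (mulr_gt0 _ l0).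
  by apply: (mulr_gt0 _ (expR_gt0 _)); apply: mulr_gt0; rewrite ltr0n.
pose A : R := 4 * expR 2 * (128 * Num.sqrt n%:R) / k%:R.
have c4 : 0 < 4 :> R by rewrite ltr0n.
have c2 : 0 < 2 :> R by rewrite ltr0n.
have A0 : 0 < A.
  by apply: (divr_gt0 _ kR); apply: (mulr_gt0 (mulr_gt0 c4 (expR_gt0 _))); apply: (mulr_gt0 _ sn); rewrite ltr0n.
pose p := psi nu1 x 1%:M; have p0 F : 0 <= p F := psi_ge0 nu1 x 1%:M F.
have bp : bm p := psi_bm nu1 x 1%:M.
have bq : bm (fun F => (A * (p F + eta)) ^+ k).
  by apply: bmX; apply: bmZ; apply: bmD => //; exact: bm_cst.
have mG := @grassmannian_measurable R n k.
have vol : (\int[nuk]_(F in grassmannian k) subspace_volume F (orth_proj F @` symmetric_polytope x)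
    <= ((4 * A * eta) ^+ k)%:E)%E.
  apply: (@le_trans _ _ (\int[nuk]_(F in grassmannian k) ((A * (p F + eta)) ^+ k)%:E)%E).
    apply: ge0_le_integral_nonmeasurable => F Fk; first exact: volume_ge0.
    have d0 : (0 < \dim F)%N by rewrite Fk.
    have := subspace_volume_le x d0 eta0; rewrite Fk; move=> /le_trans; apply.
    rewrite lee_fin le_eqVlt; apply/orP; left; apply/eqP; congr (_ ^+ _).
    by rewrite /A -/p; field; exact: lt0r_neq0.
  apply: (@le_trans _ _ (\int[nuk]_F ((A * (p F + eta)) ^+ k)%:E)%E).
    apply: ge0_subset_integral => //; first by apply/measurable_EFinP; exact: bq.1.
    by move=> F _; rewrite lee_fin exprn_ge0 ?(mulr_ge0 (ltW A0) (addr_ge0 (p0 F) (ltW eta0))).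
  rewrite integral_EP// lee_fin.
  have bk : bm (fun F => p F ^+ k) by exact: bmX.
  have bke : bm (fun F => p F ^+ k + eta ^+ k) by apply: bmD => //; exact: bm_cst.
  (* From [(q + eta)^k <= 2^k (q^k + eta^k)] and the moment bound the mean is at most
     [2 (2 A eta)^k], hence at most [(4 A eta)^k] as [0 < k]. *)
  apply: (@le_trans _ _ (EP nuk (fun F => (2 * A) ^+ k * (p F ^+ k + eta ^+ k)))).
    apply: (EP_le _ bq (bmZ _ bke)) => F.
    move: (p F) (p0 F) (A) (ltW A0) => q q0 a a0.
    rewrite [leLHS]exprMn [(2 * a) ^+ k]exprMn -[leRHS]mulrA [leRHS]mulrCA.
    apply: ler_wpM2l; first by rewrite exprn_ge0.
    have pw r : 0 <= r -> q + eta <= 2 * r -> (q + eta) ^+ k <= 2 ^+ k * r ^+ k.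
      move=> r0 qr; rewrite -exprMn; apply: lerXn2r => //; rewrite nnegrE.
        exact: (addr_ge0 q0 (ltW eta0)).
      exact: (mulr_ge0 (ltW c2) r0).
    have [h|h] := leP q eta.
      apply: (le_trans (pw eta (ltW eta0) _)); first by move: h; lra.
      by rewrite ler_wpM2l ?exprn_ge0 ?(ltW c2)// lerDr exprn_ge0.
    apply: (le_trans (pw q q0 _)); first by move: h; lra.
    by rewrite ler_wpM2l ?exprn_ge0 ?(ltW c2)// lerDl exprn_ge0 ?(ltW eta0).
  rewrite (EPZ nuk _ bke) (EPD nuk bk (bm_cst _ _)) EP_cst.
  apply: (@le_trans _ _ ((2 * A) ^+ k * (2 * eta ^+ k))).
    apply: ler_wpM2l; first by rewrite exprn_ge0 ?(mulr_ge0 (ltW c2) (ltW A0)).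
    by rewrite mulr_natl mulr2n lerD2r.
  rewrite (_ : 4 * A * eta = 2 * A * (2 * eta)); last by ring.
  rewrite [leRHS]exprMn; apply: ler_wpM2l; first by rewrite exprn_ge0 ?(mulr_ge0 (ltW c2) (ltW A0)).
  rewrite [leRHS]exprMn; apply: ler_wpM2r; first by rewrite exprn_ge0// ltW.
  by rewrite -[leLHS]expr1 ler_weXn2l// ler1n.
have om : ((omega R k)^-1 <= ((Num.sqrt k%:R / 2) ^+ k)%:E)%E.
  have q0 : 0 < (2 / Num.sqrt k%:R) ^+ k :> R := exprn_gt0 k (divr_gt0 c2 sk).
  have -> : ((Num.sqrt k%:R / 2 : R) ^+ k)%:E = (((2 / Num.sqrt k%:R : R) ^+ k)%:E^-1)%E.
    by rewrite inver gt_eqF// -exprVn invf_div.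
  rewrite lee_pV2 ?inE ?lee_fin ?(ltW q0)//; last exact: volume_ge0.
  exact: omega_ge.
rewrite /quermassintegral.
pose t : R := Num.sqrt k%:R / 2 * (4 * A * eta).
have t0 : 0 <= t := ltW (mulr_gt0 (divr_gt0 sk c2) (mulr_gt0 (mulr_gt0 c4 A0) eta0)).
have tk : (t ^+ k)%:E = (((Num.sqrt k%:R / 2) ^+ k)%:E * ((4 * A * eta) ^+ k)%:E)%E.
  by rewrite -EFinM -exprMn.
have tE : quermass_cst * l / Num.sqrt n%:R = t.
  rewrite /t /A etaE /quermass_cst; move: sk2 sn sk.
  move: (Num.sqrt n%:R) (Num.sqrt k%:R) (expR 2) (expR 9) => a b c d <- a0 b0.
  by field; rewrite !lt0r_neq0.
rewrite tE; apply: (@le_trans _ _ ((t ^+ k)%:E `^ k%:R^-1)%E).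
  have X0 : (0 <= (omega R k)^-1 * \int[nuk]_(F in grassmannian k)
      subspace_volume F (orth_proj F @` symmetric_polytope x))%E.
    apply: mule_ge0; first by rewrite inve_ge0; exact: volume_ge0.
    by apply: integral_ge0 => F _; exact: volume_ge0.
  apply: gt0_ler_poweR; rewrite ?in_itv/= ?leey ?andbT ?invr_ge0//.
    by rewrite lee_fin exprn_ge0.
  rewrite tk; apply: lee_pmul => //; first by rewrite inve_ge0; exact: volume_ge0.
  by apply: integral_ge0 => F _; exact: volume_ge0.
by rewrite poweR_EFin -powR_mulrn// -powRrM mulfV ?lt0r_neq0// powRr1.
Qed.

End QuermassBound.

(** * Semicontinuity of volume *)

Import HBNNSimple.

(* Reverse Fatou for lower integrals: the [g_ m] need not be measurable. *)
Lemma lower_integral_lt (R : realType) d (T : measurableType d) (P : probability T R)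
    (D : set T) (g_ : nat -> T -> \bar R) (g : T -> \bar R) (C b : R) :
  0 <= C ->
  (forall m x, D x -> (0 <= g_ m x)%E) -> (forall m x, D x -> (g_ m x <= C%:E)%E) ->
  (forall m m' x, D x -> (m <= m')%N -> (g_ m' x <= g_ m x)%E) ->
  (forall x, D x -> (0 <= g x)%E) ->
  (forall x c, D x -> (g x < c)%E -> exists m, (g_ m x < c)%E) ->
  (\int[P]_(x in D) g x < b%:E)%E -> exists m, (\int[P]_(x in D) g_ m x < b%:E)%E.
Proof.
move=> C0 g_0 gC gmono g0 glim hb; apply: contrapT => hno.
have hge m : (b%:E <= \int[P]_(x in D) g_ m x)%E.
  by rewrite leNgt; apply/negP => h; apply: hno; exists m.
have I0 : (0 <= \int[P]_(x in D) g x)%E by exact: integral_ge0.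
have [c gc cb] : exists2 c : R, (\int[P]_(x in D) g x < c%:E)%E & c < b.
  move: hb I0; case: (\int[P]_(x in D) g x)%E => [v| |]//.
  by rewrite lte_fin => vb _; exists ((v + b) / 2); rewrite ?lte_fin; lra.
(* The simple functions below [g_ m] are measurable even if [g_ m] is not. Their tail suprema are
   dominated by [C], and the limit of these is at most [g] since [g_] decreases. *)
have hex m : exists h : {nnsfun T >-> R},
    (forall x, ((h x)%:E <= (g_ m \_ D) x)%E) /\ (c%:E < sintegral P h)%E.
  have : (c%:E < \int[P]_(x in D) g_ m x)%E by apply: lt_le_trans (hge m); rewrite lte_fin.
  by rewrite (ge0_integralE _ (g_0 m)) => /ereal_sup_gt[_ [h hh <-] ch]; exists h.
have [h hP] := choice hex.
pose hE j x : \bar R := (h j x)%:E.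
have mh j : measurable_fun setT (hE j) by apply/measurable_EFinP.
have patch0 m x : ((g_ m \_ D) x <= C%:E)%E.
  by rewrite /patch; case: ifPn => [/set_mem/gC//|_]; rewrite lee_fin.
have hC j x : (hE j x <= C%:E)%E by exact: le_trans ((hP j).1 x) (patch0 j x).
have es_le m x y : (forall j, (m <= j)%N -> (hE j x <= y)%E) -> (esups (hE^~ x) m <= y)%E.
  by move=> hy; apply: ge_ereal_sup => _ [j /= mj <-]; exact: hy.
have es_ge m x : (hE m x <= esups (hE^~ x) m)%E by apply: ereal_sup_ubound; exists m => /=.
have es0 m x : (0 <= esups (hE^~ x) m)%E by apply: le_trans (es_ge m x); rewrite lee_fin.
have cvi x := @cvg_esups_inf R (hE^~ x).
have cvl x : esups (hE^~ x) @ \oo --> limn_esup (hE^~ x) by rewrite limn_esup_lim; exact: is_cvg_esups.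
have finf m x : (limn_esup (hE^~ x) <= esups (hE^~ x) m)%E.
  rewrite limn_esup_lim (cvg_lim _ (cvi x))//.
  by apply: ereal_inf_lbound; exists m.
have [_ _ cv] := @dominated_convergence _ T R P setT measurableT
  (fun m x => esups (hE^~ x) m) (fun x => limn_esup (hE^~ x)) (cst C%:E)
  (fun m => measurable_fun_esups mh m) (measurable_fun_limn_esup mh)
  (aeW _ (fun x _ => cvl x))
  (bm_integrable P (bm_cst _ C) : P.-integrable setT (cst C%:E))
  (aeW _ (fun x m _ => eq_rect_r (fun y => (y <= _)%E) (es_le m x _ (fun j _ => hC j x)) (gee0_abs (es0 m x)))).
have : (c%:E <= \int[P]_x limn_esup (hE^~ x))%E.
  rewrite -(cvg_lim _ cv)//; apply: lime_ge; first by apply/cvg_ex; eexists; exact: cv.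
  apply: nearW => m; apply: (@le_trans _ _ (sintegral P (h m))); first exact: ltW (hP m).2.
  rewrite -integralT_nnsfun; apply: ge0_le_integral_nonmeasurable => x _; last exact: es_ge.
  by rewrite lee_fin.
apply/negP; rewrite -ltNge; apply: le_lt_trans gc; rewrite [leRHS]integral_mkcond.
apply: ge0_le_integral_nonmeasurable => x _.
  rewrite limn_esup_lim (cvg_lim _ (cvi x))//.
  by apply: le_ereal_inf_tmp => _ [m _ <-].
rewrite /patch; case: ifPn => [/set_mem Dx|xD].
  rewrite leNgt; apply/negP => /(glim x _ Dx)[m]; apply/negP; rewrite -leNgt.
  apply: le_trans (finf m x) _; apply: es_le => j mj; apply: le_trans (gmono _ _ _ Dx mj).
  by apply: le_trans ((hP j).1 x) _; rewrite /patch mem_set.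
apply: le_trans (finf 0%N x) _; apply: es_le => j _.
by apply: le_trans ((hP j).1 x) _; rewrite /patch (negbTE xD).
Qed.

Section Fattening.
Variables (R : realType).

Definition fat n (S : set 'rV[R]_n) (a : R) : set 'rV[R]_n :=
  [set z | exists2 z0, S z0 & forall j, `|z 0 j - z0 0 j| <= a].

Lemma fat_mono n (S T : set 'rV[R]_n) a b : S `<=` T -> a <= b -> fat S a `<=` fat T b.
Proof. by move=> ST ab z [z0 /ST Tz h]; exists z0 => // j; exact: le_trans (h j) ab. Qed.

Lemma fat_fat n (S : set 'rV[R]_n) a b : fat (fat S a) b `<=` fat S (a + b).
Proof.
move=> z [z1 [z0 Sz h0] h1]; exists z0 => // j.
by rewrite -(subrK (z1 0 j) (z 0 j)) -addrA addrC; apply: le_trans (ler_normD _ _) (lerD (h0 j) (h1 j)).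
Qed.

Lemma prod_perturb k (l : 'I_k -> R) : (forall i, 0 <= l i) ->
  exists2 M, 0 <= M & forall e, 0 <= e <= 1 -> \prod_i (l i + 2 * e) <= \prod_i l i + M * e.
Proof.
elim: k l => [|k IH] l l0; first by exists 0 => // e _; rewrite !big_ord0; lra.
have [M M0 hM] := IH (fun i => l (lift ord0 i)) (fun i => l0 _).
pose p := \prod_(i < k) l (lift ord0 i); have p0 : 0 <= p by apply: prodr_ge0.
exists (M * l ord0 + 2 * p + 2 * M) => [|e /andP[e0 e1]].
  by have := l0 ord0; nra.
rewrite !big_ord_recl; have := hM e; rewrite e0 e1 => /(_ isT) h.
have a0 : 0 <= l ord0 + 2 * e by have := l0 ord0; lra.
apply: (le_trans (ler_wpM2l a0 h)); rewrite -/p -subr_ge0.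
rewrite (_ : _ - _ = 2 * M * (e * (1 - e))); last by ring.
by rewrite mulr_ge0 ?mulr_ge0 ?subr_ge0.
Qed.

(** Volume is upper semicontinuous on compact sets. Each box of a cover with total below [c] is
    enlarged at a cost of at most [eta / 2^(j+1)], and compactness makes the gained room uniform
    over [S]. *)
Lemma volume_fat k (S : set 'rV[R]_k) (c : R) : compact S -> (volume S < c%:E)%E ->
  exists2 a, 0 < a & (volume (fat S a) < c%:E)%E.
Proof.
move=> Sc /ereal_inf_lt[_ [ab [ab1 ab2] <-]] hc.
pose p j : R := \prod_i ((ab j).2 0 i - (ab j).1 0 i).
have p0 j : 0 <= p j by apply: prodr_ge0 => i _; rewrite subr_ge0.
have [eta eta0 heta] : exists2 eta : R, 0 < eta & (\sum_(0 <= j <oo) (p j)%:E + eta%:E < c%:E)%E.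
  have : (0 <= \sum_(0 <= j <oo) (p j)%:E)%E by apply: nneseries_ge0 => j _ _; rewrite lee_fin.
  move: hc; case: (\sum_(0 <= j <oo) (p j)%:E)%E => [v| |]//.
  by rewrite lte_fin => vc _; exists ((c - v) / 2); rewrite -?EFinD ?lte_fin; lra.
have hex j : exists e : R, 0 < e /\
    \prod_i (((ab j).2 0 i - (ab j).1 0 i) + 2 * e) <= p j + eta / (2 ^ j.+1)%:R.
  have l0 i : 0 <= (ab j).2 0 i - (ab j).1 0 i by rewrite subr_ge0.
  have [M M0 hM] := prod_perturb l0.
  have q0 : 0 < eta / (2 ^ j.+1)%:R by rewrite divr_gt0// ltr0n expn_gt0.
  exists (Num.min 1 (eta / (2 ^ j.+1)%:R / (M + 1))).
  have M1 : 0 < M + 1 by rewrite ltr_wpDl.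
  have e0 : 0 < Num.min 1 (eta / (2 ^ j.+1)%:R / (M + 1)) by rewrite lt_min ltr01 divr_gt0.
  split=> //; apply: (le_trans (hM _ _)); first by rewrite (ltW e0)/= ge_min lexx.
  rewrite lerD2l; apply: (@le_trans _ _ (M * (eta / (2 ^ j.+1)%:R / (M + 1)))).
    by rewrite ler_wpM2l// ge_min lexx orbT.
  rewrite mulrCA -[leRHS]mulr1 ler_wpM2l ?(ltW q0)// ler_pdivrMr// mul1r; lra.
have [e he] := choice hex.
pose ab' j := ((ab j).1 - const_mx (e j), (ab j).2 + const_mx (e j)).
have near_box : \forall a \near 0^'+, S `<=` [set x | forall y : 'rV[R]_k,
    (forall i, `|y 0 i - x 0 i| <= a) -> (\bigcup_j box (ab' j).1 (ab' j).2) y].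
  have := (compact_near_coveringP S).1 Sc R (0 : R)^'+
    (fun a x => forall y : 'rV[R]_k, (forall i, `|y 0 i - x 0 i| <= a) ->
      (\bigcup_j box (ab' j).1 (ab' j).2) y) _; apply => x Sx.
  have [j _ xj] := ab2 x Sx; have ej := (he j).1.
  exists ([set x' | ball x (e j / 2) x'], [set a : R | a < e j / 2]).
    split; first by apply: nbhsx_ballx; rewrite divr_gt0.
    by apply: nbhs_right_lt; rewrite divr_gt0.
  move=> [x' a] /= [[_ xx'] ae] y hy; exists j => // i; rewrite !mxE.
  have /andP[h1 h2] := xj i; have h4 := hy i.
  have h3 : `|x 0 i - x' 0 i| < e j / 2 := xx' 0 i.
  move: h3 h4; rewrite ltr_norml ler_norml => /andP[h3 h3'] /andP[h4 h4'].
  by apply/andP; split; lra.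
have [a a0 Sa] : exists2 a : R, 0 < a & S `<=` [set x | forall y : 'rV[R]_k,
    (forall i, `|y 0 i - x 0 i| <= a) -> (\bigcup_j box (ab' j).1 (ab' j).2) y].
  near (0 : R)^'+ => a; exists a; first by near: a; exact: nbhs_right_gt.
  by near: a; exact: near_box.
exists a => //; apply: le_lt_trans heta.
apply: le_trans (_ : \sum_(0 <= j <oo) ((p j)%:E + (eta / (2 ^ j.+1)%:R)%:E) <= _)%E; last first.
  by apply: (@epsilon_trick _ (fun j => (p j)%:E) eta xpredT) => [j|]; rewrite ?lee_fin// ltW.
apply: (@le_trans _ _ (\sum_(0 <= j <oo) (\prod_i ((ab' j).2 0 i - (ab' j).1 0 i))%:E)%E).
  apply: ereal_inf_lbound; exists ab' => //; split=> [j i|z [z0 Sz0 hz]].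
    by rewrite !mxE; have := ab1 j i; have := (he j).1; lra.
  exact: (Sa z0 Sz0 z hz).
apply: lee_nneseries => j *.
  by rewrite lee_fin; apply: prodr_ge0 => i _; rewrite !mxE; have := ab1 j i; have := (he j).1; lra.
rewrite -EFinD lee_fin; apply: le_trans (he j).2; rewrite le_eqVlt; apply/orP; left; apply/eqP.
by apply: eq_bigr => i _; rewrite !mxE; ring.
Unshelve. all: by end_near.
Qed.

End Fattening.

(** * Measurability of the quermassintegrals *)

Section ConvexHull.
Variables (R : realType) (n : nat).
Implicit Types (C : set 'rV[R]_n).

Definition segment_closed C := forall a b t, 0 <= t <= 1 -> C a -> C b -> C (t *: a + (1 - t) *: b).

Lemma convex_setP C : @convex_set R 'rV[R]_n C <-> segment_closed C.
Proof.
split=> [cC a b t /andP[t0 t1] Ca Cb|cC a b l]; last first.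
  rewrite !inE => Ca Cb; apply: (cC a b l%:num) => //.
  by apply/andP; split; [exact: ge0|exact: le1].
have := cC a b (Itv01 t0 t1); rewrite !inE => /(_ Ca Cb).
by move=> H; exact H.
Qed.

Lemma segment_closed_comb C (I : eqType) (r : seq I) (y : I -> 'rV[R]_n) (a : I -> R) z :
  segment_closed C -> C z -> (forall i, C (y i)) -> (forall i, 0 <= a i) ->
  \sum_(i <- r) a i <= 1 ->
  C (\sum_(i <- r) a i *: y i + (1 - \sum_(i <- r) a i) *: z).
Proof.
move=> cC Cz Cy; elim: r a => [|i r IH] a a0 ha.
  by rewrite !big_nil add0r subr0 scale1r.
rewrite !big_cons in ha *; move E : (\sum_(j <- r) a j) ha => s ha.
have s0 : 0 <= s by rewrite -E; apply: sumr_ge0 => j _.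
have [a1|a1] := eqVneq (a i) 1.
  have s00 : s = 0 by apply/eqP; rewrite eq_le s0 andbT; move: ha; rewrite a1; lra.
  rewrite s00 a1 addr0 subrr scale0r addr0 scale1r big1_seq ?addr0// => j /andP[_ jr].
  have : a j <= s by rewrite -E (big_rem j jr)/= lerDl sumr_ge0.
  by rewrite s00 => aj; rewrite (_ : a j = 0) ?scale0r//; apply/eqP; rewrite eq_le aj a0.
have b0 : 0 < 1 - a i by rewrite subr_gt0 lt_neqAle a1/=; move: ha s0; lra.
have := IH (fun j => a j / (1 - a i)) _ _; rewrite -mulr_suml E => h.
have {}h : C (\sum_(j <- r) (a j / (1 - a i)) *: y j + (1 - s / (1 - a i)) *: z).
  apply: h => [j|]; first by rewrite divr_ge0// ltW.
  by rewrite ler_pdivrMr// mul1r; move: ha; lra.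
have := cC _ _ (a i) _ (Cy i) h; rewrite a0 => /=; have -> : a i <= 1 by move: b0; lra.
move=> /(_ isT); congr C; rewrite -addrA; congr (_ + _).
rewrite scalerDr scaler_sumr scalerA; congr (_ + _ *: z).
  by apply: eq_bigr => j _; rewrite scalerA mulrC divfK// gt_eqF.
by rewrite mulrBr mulr1 mulrC divfK ?gt_eqF//; lra.
Qed.

Variables (N : nat) (x : 'I_N -> 'rV[R]_n).
Local Notation K := (symmetric_polytope x).

Lemma polytope_min C : segment_closed C -> (forall i, C (x i) /\ C (- x i)) -> K `<=` C.
Proof.
move=> cC Cx; apply: smallest_sub; first exact/convex_setP.
by move=> _ [i [->|->]]; have [] := Cx i.
Qed.

Lemma polytope_segment_closed : segment_closed K.
Proof.
move=> a b t t01 Ka Kb C [cC CS]; apply: ((convex_setP C).1 cC) => //; [exact: Ka|exact: Kb].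
Qed.

Lemma polytope_vertex i : K (x i) /\ K (- x i).
Proof. by split=> C [_ CS]; apply: CS; exists i; [left|right]. Qed.

Definition vertex_mx : 'M[R]_(N, n) := \matrix_(i, j) x i 0 j.

Lemma mulmx_vertex (t : 'rV[R]_N) : t *m vertex_mx = \sum_i t 0 i *: x i.
Proof.
rewrite mulmx_sum_row; apply: eq_bigr => i _; congr (_ *: _).
by apply/rowP => j; rewrite !mxE.
Qed.

(** The hull is the linear image of the unit ball of the [l^1] norm, hence compact. *)
Lemma polytopeE : (0 < N)%N ->
  K = (fun t => t *m vertex_mx) @` [set t : 'rV[R]_N | \sum_i `|t 0 i| <= 1].
Proof.
move=> N0; rewrite eqEsubset; split.
  apply: polytope_min.
    move=> _ _ s /andP[s0 s1] [t ht <-] [u hu <-]; exists (s *: t + (1 - s) *: u).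
      rewrite /=; apply: (@le_trans _ _ (\sum_i (s * `|t 0 i| + (1 - s) * `|u 0 i|))).
        apply: ler_sum => i _; rewrite !mxE; apply: (le_trans (ler_normD _ _)).
        have s1' : 0 <= 1 - s by rewrite subr_ge0.
        by rewrite !normrM (ger0_norm s0) (ger0_norm s1').
      by rewrite big_split/= -!mulr_sumr; move: ht hu => /=; nra.
    by rewrite mulmxDl -!scalemxAl.
  have d1 i (c : R) : `|c| = 1 -> \sum_j `|(c *: delta_mx 0 i : 'rV[R]_N) 0 j| <= 1.
    move=> c1; rewrite (bigD1 i)//= big1 ?addr0 => [|j ji].
      by rewrite !mxE !eqxx mulr1 c1.
    by rewrite !mxE (negbTE ji) andbF mulr0 normr0.
  have dx i (c : R) : (c *: delta_mx 0 i) *m vertex_mx = c *: x i.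
    by rewrite -scalemxAl -rowE; congr (_ *: _); apply/rowP => j; rewrite !mxE.
  move=> i; split; [exists (1 *: delta_mx 0 i)|exists (-1 *: delta_mx 0 i)].
  - by apply: d1; rewrite normr1.
  - by rewrite dx scale1r.
  - by apply: d1; rewrite normrN normr1.
  - by rewrite dx scaleN1r.
move=> _ [t ht <-]; rewrite mulmx_vertex.
have K0 : K 0.
  have [k1 k2] := polytope_vertex (Ordinal N0).
  have := polytope_segment_closed (_ : 0 <= 2^-1 <= 1) k1 k2.
  rewrite scalerN (_ : 1 - 2^-1 = 2^-1 :> R) ?subrr; first by apply; lra.
  lra.
pose y i := if 0 <= t 0 i then x i else - x i.
have := @segment_closed_comb K 'I_N (index_enum 'I_N) y (fun i => `|t 0 i|) 0 polytope_segment_closed K0 _ _ ht.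
rewrite scaler0 addr0; rewrite (eq_bigr (fun i => t 0 i *: x i)) => [|i _].
  apply=> // i; have [h1 h2] := polytope_vertex i; by rewrite /y; case: ifP.
by rewrite /y; case: (leP 0 (t 0 i)) => h; rewrite ?(ger0_norm h)// (ltr0_norm h) scalerN scaleNr opprK.
Qed.

End ConvexHull.

Lemma continuous_scalel (R : realType) (T : topologicalType) (V : normedModType R) (f : T -> R) (v : V) :
  continuous f -> continuous (fun x => f x *: v).
Proof. by move=> cf x; apply: cvgZl; exact: cf. Qed.

Lemma continuous_mulmx (R : realType) a b (M : 'M[R]_(a, b)) :
  continuous (fun t : 'rV[R]_a => t *m M).
Proof.
have -> : (fun t : 'rV[R]_a => t *m M) = fun t => \sum_i t 0 i *: row i M.
  by apply/funext => t; rewrite mulmx_sum_row.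
apply: (@continuous_vsum R 'rV[R]_a 'rV[R]_b _ _ (fun i (t : 'rV[R]_a) => t 0 i *: row i M)) => i.
by apply: continuous_scalel; exact: continuous_coord.
Qed.

Lemma polytope_compact (R : realType) n N (x : 'I_N -> 'rV[R]_n) : (0 < N)%N ->
  compact (symmetric_polytope x).
Proof.
move=> N0; rewrite polytopeE//; apply: continuous_compact.
  by apply: continuous_subspaceT; exact: continuous_mulmx.
apply: (@closed_bounded_compact R _ _ 1).
  apply: closed_le; apply: (@continuous_bigsum R 'rV[R]_N _ _ (fun i (t : 'rV[R]_N) => `|t 0 i|)) => i.
  by apply: continuous_absr; exact: continuous_coord.
move=> t /= ht j; apply: le_trans ht; rewrite (bigD1 j)//= lerDl sumr_ge0//.
Qed.

Lemma fat_polytope (R : realType) n N (x y : 'I_N -> 'rV[R]_n) a :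
  (forall i j, `|y i 0 j - x i 0 j| <= a) -> symmetric_polytope y `<=` fat (symmetric_polytope x) a.
Proof.
move=> xy; apply: polytope_min => [u v t /andP[t0 t1] [u0 Ku hu] [v0 Kv hv]|i]; last first.
  have [h1 h2] := polytope_vertex x i; split; [exists (x i)|exists (- x i)] => // j.
  by rewrite !mxE -opprD normrN.
exists (t *: u0 + (1 - t) *: v0) => [|j]; first by apply: polytope_segment_closed => //; rewrite t0.
rewrite !mxE (_ : _ - _ = t * (u 0 j - u0 0 j) + (1 - t) * (v 0 j - v0 0 j)); last by ring.
have t1' : 0 <= 1 - t by rewrite subr_ge0.
apply: (le_trans (ler_normD _ _)); rewrite !normrM (ger0_norm t0) (ger0_norm t1').
by have := hu j; have := hv j; nra.
Qed.

Section ProjectionVolume.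
Variables (R : realType) (n : nat).
Implicit Types (F : {vspace 'rV[R]_n}) (S : set 'rV[R]_n).

Local Notation vproj F S := (subspace_volume F (orth_proj F @` S)).

Lemma proj_coordsE F S : [set y : 'rV[R]_(\dim F) | (orth_proj F @` S) (y *m orthonormal_basis F)] =
  (fun z => z *m (orthonormal_basis F)^T) @` S.
Proof.
have [BB _] := orthonormal_basisP F.
rewrite eqEsubset; split=> [y [z Sz zy]|_ [z Sz <-]]; exists z => //; last by rewrite orth_projE.
by have := congr1 (fun w => w *m (orthonormal_basis F)^T) zy; rewrite orth_projE -!mulmxA BB !mulmx1.
Qed.

Lemma vproj_ge0 F S : (0 <= vproj F S)%E.
Proof. exact: volume_ge0. Qed.

Lemma vproj_mono F S S' : S `<=` S' -> (vproj F S <= vproj F S')%E.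
Proof. by move=> SS; apply: volume_mono => y [z Sz zy]; exists z => //; exact: SS. Qed.

Lemma nrm_le_coord (z : 'rV[R]_n) a : 0 <= a -> (forall j, `|z 0 j| <= a) -> nrm z <= n%:R * a.
Proof.
move=> a0 za; rewrite -(@ler_sqr R) ?nnegrE ?nrm_ge0 ?mulr_ge0// nrm2 /dot.
apply: (@le_trans _ _ (\sum_(i < n) a ^+ 2)).
  by apply: ler_sum => i _; rewrite -expr2 -real_normK ?num_real// lerXn2r ?nnegrE.
rewrite sumr_const card_ord -[leLHS]mulr_natl exprMn ler_wpM2r ?sqr_ge0//.
by rewrite -natrX ler_nat; case: (n) => // m; rewrite leq_pmulr.
Qed.

Lemma vproj_fat F S c : compact S -> (vproj F S < c%:E)%E ->
  exists2 a, 0 < a & (vproj F (fat S a) < c%:E)%E.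
Proof.
move=> Sc; rewrite /subspace_volume proj_coordsE => h.
have cS : compact ((fun z : 'rV[R]_n => z *m (orthonormal_basis F)^T) @` S).
  by apply: continuous_compact => //; apply: continuous_subspaceT; exact: continuous_mulmx.
have [a a0 ha] := volume_fat cS h; exists (a / n.+1%:R); first by rewrite divr_gt0.
apply: le_lt_trans ha; rewrite proj_coordsE; apply: volume_mono => _ [z [z0 Sz hz] <-].
exists (z0 *m (orthonormal_basis F)^T); first by exists z0.
move=> j; have -> : (z *m (orthonormal_basis F)^T) 0 j - (z0 *m (orthonormal_basis F)^T) 0 j =
    ((z - z0) *m (orthonormal_basis F)^T) 0 j by rewrite mulmxBl !mxE.
apply: (le_trans (coord_le_nrm _ _)); have [BB _] := orthonormal_basisP F.
apply: (le_trans (nrm_frameT _ BB)).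
have a1 : 0 <= a / n.+1%:R by rewrite divr_ge0// ltW.
apply: (le_trans (nrm_le_coord a1 _)) => [i|]; first by rewrite !mxE.
by rewrite mulrCA ger_pMr// ler_pdivrMr// mul1r ler_nat.
Qed.

Lemma vproj_bound F S r : (0 < \dim F)%N -> 0 <= r -> (forall z, S z -> nrm z <= r) ->
  (vproj F S <= ((2 * r) ^+ \dim F)%:E)%E.
Proof.
move=> F0 r0 Sr; rewrite /subspace_volume proj_coordsE; have [BB _] := orthonormal_basisP F.
apply: (le_trans (@volume_le_boxes _ _ unit (fun=> const_mx (- r)) (fun=> const_mx r) _ F0 _ _)).
- by move=> _ j; rewrite !mxE; lra.
- move=> _ [z Sz <-]; exists tt => i; rewrite [const_mx _ _ _]mxE [const_mx r _ _]mxE -ler_norml.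
  apply: (le_trans (coord_le_nrm _ _)); apply: (le_trans (nrm_frameT _ BB)); exact: Sr.
rewrite (big_pred1 tt); last by case.
rewrite (eq_bigr (fun=> 2 * r)) => [|j _]; last by rewrite !mxE; ring.
by rewrite prodr_const card_ord.
Qed.

Variables (N : nat) (k : nat) (nu : probability (subspaces R n) R).
Hypotheses (N0 : (0 < N)%N) (k0 : (0 < k)%N).

Definition vint S : \bar R := (\int[nu]_(F in grassmannian k) vproj F S)%E.

Lemma vint_mono S S' : S `<=` S' -> (vint S <= vint S')%E.
Proof.
by move=> SS; apply: ge0_le_integral_nonmeasurable => F _; [exact: vproj_ge0|exact: vproj_mono].
Qed.

(** The closed neighbourhoods decrease with [m], and each projected volume is upper semicontinuous
    by [vproj_fat]; [lower_integral_lt] transfers this to the integral. *)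
Lemma vint_fat (x : 'I_N -> 'rV[R]_n) b : (vint (symmetric_polytope x) < b%:E)%E ->
  exists m : nat, (vint (fat (symmetric_polytope x) m.+1%:R^-1) < b%:E)%E.
Proof.
have Kc := @polytope_compact R n N x N0.
pose r := \sum_i nrm (x i) + n%:R * 1.
have r0 : 0 <= r by rewrite addr_ge0 ?mulr_ge0//; apply: sumr_ge0 => i _; exact: nrm_ge0.
have Kr z : symmetric_polytope x z -> nrm z <= \sum_i nrm (x i).
  apply: (@polytope_min _ _ _ x [set z | nrm z <= \sum_i nrm (x i)]) => [u v t /andP[t0 t1]|i] /=.
    move=> hu hv; apply: (le_trans (nrmD _ _)); rewrite !nrmZ !ger0_norm ?subr_ge0//; nra.
  by rewrite nrmN (bigD1 i)//= lerDl; split; apply: sumr_ge0 => j _; exact: nrm_ge0.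
have fr m z : fat (symmetric_polytope x) m.+1%:R^-1 z -> nrm z <= r.
  move=> [z0 Kz hz]; rewrite -(subrK z0 z) addrC; apply: (le_trans (nrmD _ _)).
  apply: lerD; first exact: Kr.
  apply: nrm_le_coord => // j; rewrite !mxE; apply: (le_trans (hz j)).
  by rewrite invf_le1// ler1n.
rewrite /vint; apply: (@lower_integral_lt R _ (subspaces R n) nu (grassmannian k)
  (fun m F => vproj F (fat (symmetric_polytope x) m.+1%:R^-1))
  (fun F => vproj F (symmetric_polytope x)) ((2 * r) ^+ k) b) => [|m F _|m F Fk|m m' F _ mm|F _|F c Fk].
- by rewrite exprn_ge0// mulr_ge0.
- exact: vproj_ge0.
- by have := @vproj_bound F _ r _ r0 (fr m); rewrite Fk; apply.
- by apply: vproj_mono; apply: fat_mono => //; rewrite lef_pV2 ?posrE// ler_nat.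
- exact: vproj_ge0.
case: c => [c| |]; last by move=> h; have := le_lt_trans (vproj_ge0 _ _) h.
  move=> /(vproj_fat Kc)[a a0 ha]; exists (Num.bound a^-1).
  apply: le_lt_trans ha; apply: vproj_mono; apply: fat_mono => //.
  rewrite -[leRHS]invrK lef_pV2 ?posrE ?invr_gt0//; apply: ltW.
  by apply: (lt_le_trans (archi_boundP _)); rewrite ?invr_ge0 ?(ltW a0)// ler_nat.
move=> _; exists 0%N; have := @vproj_bound F _ r _ r0 (fr 0%N); rewrite Fk => /(_ k0) h.
by apply: (le_lt_trans h); exact: ltry.
Qed.

Variables (d : measure_display) (T : measurableType d) (P : probability T R).
Variable X : 'I_N -> {RV P >-> borel_rV R n}.

Lemma near_point_measurable i (r : 'rV[R]_n) a :
  measurable [set w : T | forall j, `|X i w 0 j - r 0 j| <= a].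
Proof.
have -> : [set w : T | forall j, `|X i w 0 j - r 0 j| <= a] =
    X i @^-1` [set z : 'rV[R]_n | forall j, `|z 0 j - r 0 j| <= a] by [].
rewrite -[X in measurable X]setTI; apply: (measurable_funPT (X i)) => //.
apply: closed_measurable_rV.
have -> : [set z : 'rV[R]_n | forall j, `|z 0 j - r 0 j| <= a] =
    \bigcap_(j in [set: 'I_n]) [set z : 'rV[R]_n | `|z 0 j - r 0 j| <= a].
  by rewrite eqEsubset; split=> [z h j _|z h j]; [exact: h|exact: (h j I)].
have cc (j : 'I_n) : continuous (fun u : 'rV[R]_n => u 0 j) by exact: continuous_coord.
have cst (c : R) : continuous (fun _ : 'rV[R]_n => c) by exact: cst_continuous.
apply: closed_bigI => j _; apply: (@closed_le R 'rV[R]_n (fun z => `|z 0 j - r 0 j|)).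
apply: continuous_absr; exact: (@continuous_add R 'rV[R]_n _ _ (cc j) (cst (- r 0 j))).
Qed.

(** By [vint_fat] and monotonicity, the integral is below [b] exactly when the points lie near some
    rational configuration whose fattened hull still has integral below [b]. There are countably
    many such conditions, each closed in the points. *)
Lemma vint_measurable : measurable_fun setT (fun w : T => vint (symmetric_polytope (fun i => X i w))).
Proof.
apply: (measurability _ (ErealGenInftyO.measurableE R)) => _ [_ [b ->] <-]; rewrite setTI.
pose rv (q : {ffun 'I_N * 'I_n -> rat}) i : 'rV[R]_n := \row_j ratr (q (i, j)).
pose A (p : {ffun 'I_N * 'I_n -> rat} * nat) : set T :=
  [set w | (vint (fat (symmetric_polytope (rv p.1)) p.2.+1%:R^-1) < b%:E)%E /\
    forall i j, `|X i w 0 j - rv p.1 i 0 j| <= p.2.+1%:R^-1].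
have mA p : measurable (A p).
  have [h|h] := pselect (vint (fat (symmetric_polytope (rv p.1)) p.2.+1%:R^-1) < b%:E)%E; last first.
    by rewrite (_ : A p = set0)// -subset0 => w [].
  rewrite (_ : A p = \bigcap_(i in [set: 'I_N])
      [set w | forall j, `|X i w 0 j - rv p.1 i 0 j| <= p.2.+1%:R^-1]); last first.
    by rewrite eqEsubset; split=> [w [_ hw] i _|w hw]; [exact: hw|split=> // i; exact: (hw i I)].
  by apply: fin_bigcap_measurable => // i _; exact: near_point_measurable.
rewrite (_ : _ @^-1` _ = \bigcup_m (oapp A set0 (unpickle m))); last first.
  rewrite eqEsubset; split=> [w /= |w [m _]].
    (* Half of the margin [1 / (m + 1)]: it is spent once on the approximation by rationals and once
       on the fattening. *)
    rewrite in_itv /= => /vint_fat[m hm]; pose dl : R := (2 * m).+2%:R^-1.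
    have dl0 : 0 < dl by rewrite invr_gt0.
    have hq (p : 'I_N * 'I_n) : exists q : rat, `|X p.1 w 0 p.2 - ratr q| <= dl.
      have [|q] := @rat_in_itvoo R (X p.1 w 0 p.2 - dl) (X p.1 w 0 p.2 + dl); first by lra.
      by rewrite in_itv /= => /andP[h1 h2]; exists q; rewrite ler_norml; apply/andP; split; lra.
    have [q hq'] := choice hq; pose qf := [ffun p => q p].
    exists (pickle (qf, (2 * m).+1)) => //; rewrite pickleK /= /A /=.
    have near i j : `|X i w 0 j - rv qf i 0 j| <= dl by rewrite mxE ffunE; exact: (hq' (i, j)).
    split=> //; apply: le_lt_trans hm; apply: vint_mono.
    have : symmetric_polytope (rv qf) `<=` fat (symmetric_polytope (fun i => X i w)) dl.
      by apply: fat_polytope => i j; rewrite distrC.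
    move=> h z [z0 /h hz0 hz]; have := @fat_fat _ _ (symmetric_polytope (fun i => X i w)) dl dl z.
    move=> /(_ (ex_intro2 _ _ z0 hz0 hz)); apply: fat_mono => //.
    rewrite /dl le_eqVlt; apply/orP; left; apply/eqP.
    rewrite (_ : (2 * m).+2%:R = 2 * m.+1%:R :> R); last by rewrite -natrM mulnS.
    have : m.+1%:R != 0 :> R by rewrite pnatr_eq0.
    by move: (m.+1%:R : R) => r r0; field.
  case: (unpickle m) => [p|//] /= [hp hw].
  rewrite in_itv /=; apply: le_lt_trans hp; apply: vint_mono; apply: fat_polytope => i j.
  exact: hw.
by apply: bigcupT_measurable => m; case: (unpickle m) => [p|]//=.
Qed.

Lemma quermass_measurable (c : \bar R) :
  measurable [set w : T | (quermassintegral k nu (symmetric_polytope (fun i => X i w)) <= c)%E].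
Proof.
rewrite -[X in measurable X]setTI; apply: emeasurable_fun_infty_c => //.
apply: (measurableT_comp (measurable_poweR _)); apply: emeasurable_funM => //.
exact: vint_measurable.
Qed.

End ProjectionVolume.

(** * Tail of the mean width *)

Lemma bigmax_exprn_le (R : realType) (J : Type) (r : seq J) (f : J -> R) p : (forall i, 0 <= f i) ->
  (\big[Num.max/0]_(i <- r) f i) ^+ p.+1 <= \sum_(i <- r) f i ^+ p.+1.
Proof.
move=> f0; elim: r => [|i r IH]; first by rewrite !big_nil expr0n.
rewrite !big_cons; case: (leP (f i)) => _.
  by apply: (le_trans IH); rewrite lerDr exprn_ge0.
by rewrite lerDl sumr_ge0// => j _; rewrite exprn_ge0.
Qed.

Section TailOfMeanMax.
Variables (R : realType) (d : measure_display) (T : measurableType d) (P : probability T R).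
Variables (I : finType) (N p : nat) (f : I -> 'I_N -> T -> R) (b : I -> R) (al : R).
Hypotheses (I0 : (0 < #|I|)%N) (b0 : forall e, 0 < b e) (al0 : 0 < al).
Hypotheses (mf : forall e i, measurable_fun setT (f e i)) (f0 : forall e i w, 0 <= f e i w).
Hypothesis fb : forall e i, (\int[P]_w (f e i w ^+ p.+1)%:E <= (b e ^+ p.+1)%:E)%E.
Local Notation mean := (@mean R).

Let B0 := mean b.

Let B0_gt0 : 0 < B0.
Proof.
have [t ht] := exists_ge_mean (fun e => - b e) I0.
by move: ht; rewrite meanN lerN2; exact: lt_le_trans.
Qed.

(** The factors [b e / (#|I| B0)] form a probability on [I], and dividing by [b e ^+ p.+1]
    normalizes the moments; hence [Y] has expectation at most [N]. *)
Let c e : R := #|I|%:R^-1 * (b e / B0 / b e ^+ p.+1).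

Let Y w : R := \sum_(q : I * 'I_N) c q.1 * f q.1 q.2 w ^+ p.+1.

Let c0 e : 0 <= c e.
Proof. by rewrite mulr_ge0 ?invr_ge0// !divr_ge0 ?exprn_ge0 ?(ltW (b0 e)) ?(ltW B0_gt0). Qed.

Lemma weighted_moment_le : (\int[P]_w (Y w)%:E <= N%:R%:E)%E.
Proof.
have mq q : measurable_fun setT (fun w => f q.1 q.2 w ^+ p.+1) by exact: measurable_funX.
have -> : (\int[P]_w (Y w)%:E = \int[P]_w \sum_(q : I * 'I_N) (c q.1)%:E * (f q.1 q.2 w ^+ p.+1)%:E)%E.
  by apply: eq_integral => w _; rewrite /Y -sumEFin; apply: eq_bigr => q _; rewrite EFinM.
rewrite ge0_integral_sum//; last 2 first.
- by move=> q; apply: measurable_funeM; apply/measurable_EFinP; exact: mq.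
- by move=> q w _; rewrite mule_ge0// lee_fin ?c0// exprn_ge0.
apply: (@le_trans _ _ (\sum_(q : I * 'I_N) ((c q.1) * b q.1 ^+ p.+1)%:E)%E).
  apply: lee_sum => q _.
  have mE : measurable_fun setT (fun w => (f q.1 q.2 w ^+ p.+1)%:E) by apply/measurable_EFinP; exact: mq.
  have fE w : setT w -> (0 <= (f q.1 q.2 w ^+ p.+1)%:E)%E by rewrite lee_fin exprn_ge0.
  have cE : (0 <= (c q.1)%:E)%E by rewrite lee_fin.
  rewrite ge0_integralZl; try exact: measurableT; try exact: mE; try exact: fE; try exact: cE.
  have -> : ((c q.1 * b q.1 ^+ p.+1)%:E = (c q.1)%:E * (b q.1 ^+ p.+1)%:E)%E by exact: EFinM.
  by apply: (lee_pmul cE) => //; apply: integral_ge0.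
rewrite sumEFin lee_fin.
rewrite -(pair_bigA _ (fun e (i : 'I_N) => c e * b e ^+ p.+1))/=.
rewrite (eq_bigr (fun e => N%:R / B0 * (#|I|%:R^-1 * b e))) => [|e _]; last first.
  rewrite sumr_const card_ord -[LHS]mulr_natl /c; have := exprn_gt0 p.+1 (b0 e).
  move: (b e ^+ _) => x x0; have c1 := lt0r_neq0 x0; have B0' := lt0r_neq0 B0_gt0.
  have c2 : #|I|%:R != 0 :> R by rewrite pnatr_eq0 -lt0n.
  by field; rewrite ?B0' ?c1 ?c2.
rewrite -mulr_sumr -mulr_sumr -/(mean b) -/B0 divfK ?gt_eqF//.
Qed.

(** Jensen's inequality under the probability with weights [b e / (#|I| B0)], for the ratio of the
    maximum to [b e]; the maximum is then bounded by a sum. *)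
Lemma mean_max_exprn_le w :
  (mean (fun e => \big[Num.max/0]_i f e i w) / B0) ^+ p.+1 <= Y w.
Proof.
pose m e := \big[Num.max/0]_i f e i w.
have m0 e : 0 <= m e by exact: bigmax_ge_id.
pose M := mean m / B0; have M0 : 0 <= M by rewrite divr_ge0 ?(ltW B0_gt0)// mean_ge0.
have key e : b e / B0 * (M ^+ p.+1 + p.+1%:R * M ^+ p * (m e / b e - M)) <=
    b e / B0 * (m e / b e) ^+ p.+1.
  apply: ler_wpM2l; first by rewrite divr_ge0 ?(ltW (b0 e)) ?(ltW B0_gt0).
  by apply: tangent_exprn => //; rewrite divr_ge0// ltW.
have := ler_mean key.
have -> : mean (fun e => b e / B0 * (M ^+ p.+1 + p.+1%:R * M ^+ p * (m e / b e - M))) = M ^+ p.+1.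
  rewrite (@eq_mean _ _ _ (fun e => (M ^+ p.+1 - p.+1%:R * M ^+ p * M) / B0 * b e +
      p.+1%:R * M ^+ p / B0 * m e)) => [|e]; last first.
    have be := lt0r_neq0 (b0 e); have B0' := lt0r_neq0 B0_gt0.
    by move: (M ^+ p.+1) (M ^+ p) => x y; field; rewrite be B0'.
  rewrite meanD !meanZ -/B0 (_ : mean m = M * B0); last by rewrite /M divfK// gt_eqF.
  have B0' := lt0r_neq0 B0_gt0; move: (M ^+ p.+1) (M ^+ p) => x y; by field.
move=> /le_trans; apply; rewrite /Y -(pair_bigA _ (fun e i => c e * f e i w ^+ p.+1))/= /mean mulr_sumr.
apply: ler_sum => e _; rewrite -mulr_sumr /c -[leRHS]mulrA; apply: ler_wpM2l; first by rewrite invr_ge0.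
have h := bigmax_exprn_le (index_enum 'I_N) p (fun i => f0 e i w).
have q0 : 0 <= b e / B0 / b e ^+ p.+1.
  by rewrite !divr_ge0 ?exprn_ge0 ?(ltW (b0 e)) ?(ltW B0_gt0).
by rewrite expr_div_n [leLHS]mulrA [leLHS]mulrAC; exact: (ler_wpM2l q0 h).
Qed.

(** Markov's inequality for the single variable [Y], which controls the mean over all [e] at once.
    The good event is a sublevel set of [Y], hence measurable. *)
Lemma tail_mean_max : exists2 A : set T, measurable A /\ ((1 - N%:R / al ^+ p.+1)%:E <= P A)%E &
  forall w, A w -> mean (fun e => \big[Num.max/0]_i f e i w) <= al * B0.
Proof.
have mY : measurable_fun setT Y.
  by apply: measurable_sum => q; apply: measurable_funM => //; exact: measurable_funX.
have Y0 w : 0 <= Y w by apply: sumr_ge0 => q _; rewrite mulr_ge0// exprn_ge0.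
have a0 : 0 < al ^+ p.+1 by exact: exprn_gt0.
exists [set w | Y w < al ^+ p.+1]; last first.
  move=> w /= hw; have := le_lt_trans (mean_max_exprn_le w) hw.
  move E : (mean _) => l h; rewrite -ler_pdivrMr//; apply: ltW; move: h.
  rewrite ltr_pXn2r// nnegrE ?(ltW al0)// divr_ge0 ?(ltW B0_gt0)// -E mean_ge0// => e.
  exact: bigmax_ge_id.
have mA : measurable [set w | Y w < al ^+ p.+1].
  have -> : [set w | Y w < al ^+ p.+1] = setT `&` Y @^-1` `]-oo, al ^+ p.+1[%classic.
    by rewrite setTI; apply/seteqP; split => w /=; rewrite in_itv.
  exact: mY.
split=> //; rewrite -(setCK [set w | _]) probability_setC; last exact: measurableC.
have mE : measurable_fun setT (EFin \o Y) by apply/measurable_EFinP.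
have := le_integral_abse P measurableT mE a0.
have -> : (\int[P]_x `|(EFin \o Y) x| = \int[P]_w (Y w)%:E)%E.
  by apply: eq_integral => w _ /=; rewrite ger0_norm.
have -> : setT `&` [set x | ((al ^+ p.+1)%:E <= `|(EFin \o Y) x|)%E] = ~` [set w | Y w < al ^+ p.+1].
  by rewrite setTI; apply/seteqP; split=> w /=; rewrite ger0_norm// lee_fin => /=; rewrite leNgt => /negP.
move=> h0; have h : ((al ^+ p.+1)%:E * P (~` [set w | (Y w < al ^+ p.+1)%R]) <= N%:R%:E)%E.
  exact: le_trans h0 weighted_moment_le.
have [q hq] : exists q : R, P (~` [set w | Y w < al ^+ p.+1]) = q%:E%E.
  by exists (fine (P (~` [set w | Y w < al ^+ p.+1]))); rewrite fineK//; apply: fin_num_measure; exact: measurableC.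
move: h; rewrite hq -EFinM -EFinB !lee_fin => h.
by rewrite lerD2l lerN2 ler_pdivlMr// mulrC.
Qed.

End TailOfMeanMax.

Lemma ln2_ge (R : realType) : 2^-1 <= ln 2 :> R.
Proof.
have h : -1 < - 2^-1 :> R by lra.
have := le_ln1Dx h; rewrite (_ : 1 + - 2^-1 = 2^-1 :> R); last by lra.
by rewrite lnV ?posrE//; lra.
Qed.

(** As [L >= sqrt n >= sqrt 2], the number [ln L] is at least [ln 2 / 2], which lets a multiple of
    [ln L] absorb the additive constants [1 + ln 2]. *)
Lemma ln_scale (R : realType) (n : nat) (L : R) : (1 < n)%N -> Num.sqrt n%:R <= L <= n%:R ->
  exists p : nat, [/\ L <= p.+1%:R, (p <= n)%N, p.+1%:R <= 2 * L,
    0 < ln L & 1 + ln p.+1%:R <= 8 * ln L].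
Proof.
move=> n1 /andP[L1 L2].
have s1 : Num.sqrt 2 <= Num.sqrt n%:R :> R by rewrite ler_sqrt ?ler0n// ler_nat.
have s2 : 1 <= Num.sqrt 2 :> R by rewrite -[leLHS]sqrtr1 ler_sqrt ?ler0n//; lra.
have sL : 1 <= L by exact: le_trans s2 (le_trans s1 L1).
have L0 : 0 < L by lra.
have y1 : ln 2 / 2 <= ln L.
  have h : Num.sqrt 2 <= L by exact: le_trans s1 L1.
  have h2 : 2 <= L ^+ 2.
    rewrite -[leLHS](@sqr_sqrtr R 2) ?ler0n// lerXn2r ?nnegrE ?sqrtr_ge0//; exact: ltW.
  have h3 : ln 2 <= ln (L ^+ 2) by rewrite ler_ln ?posrE ?exprn_gt0.
  by move: h3; rewrite expr2 lnM ?posrE// => h3; lra.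
have l2 := ln2_ge R.
have /andP[p1 p2] := truncn_itv (ltW L0).
exists (Num.trunc L); split.
- exact: ltW.
- by rewrite -(ler_nat R); exact: le_trans p1 L2.
- rewrite -natr1; move: p1; lra.
- by apply: lt_le_trans y1; rewrite divr_gt0//; lra.
have h : ln (Num.trunc L).+1%:R <= ln (2 * L).
  by rewrite ler_ln ?posrE ?mulr_gt0// -natr1; move: p1; lra.
have e : ln (2 * L) = ln 2 + ln L by rewrite lnM ?posrE.
by move: h; rewrite e; move: y1 l2; lra.
Qed.

Section Tail.
Variables (R : realType) (n' N : nat) (mu : probability (borel_rV R n'.+1) R).
Local Notation n := n'.+1.
Hypotheses (hlc : log_concave mu) (hiso : isotropic mu).
Variables (d : measure_display) (T : measurableType d) (P : probability T R).
Variable X : 'I_N -> {RV P >-> borel_rV R n}.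
Hypothesis hlaw : forall i, has_law (X i) mu.
Local Notation mean := (@mean R).

Lemma abs_dot_measurable i (u : 'rV[R]_n) : measurable_fun setT (fun w => `|dot (X i w) u|).
Proof.
have mX := @measurable_funPT _ _ _ _ (X i).
have mf : measurable_fun setT (fun x : borel_rV R n => `|dot (x : 'rV[R]_n) u|).
  apply: (@continuous_measurable_rV R n (fun x => `|dot x u|)); apply: continuous_absr.
  by under eq_fun do rewrite dotC; exact: continuous_dot.
exact: (measurableT_comp mf mX).
Qed.

Lemma integral_law i (u : 'rV[R]_n) p : (0 < p)%N ->
  (\int[P]_w (`|dot (X i w) u| ^+ p)%:E = (hp mu p u ^+ p)%:E)%E.
Proof.
move=> p0; rewrite (hpX hiso hlc p0).
have mf : measurable_fun setT (fun x : borel_rV R n => (`|dot u (x : 'rV[R]_n)| ^+ p)%:E).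
  by apply/measurable_EFinP; exact: abs_dot_pow_measurable.
have f0 (x : borel_rV R n) : (0 <= (`|dot u (x : 'rV[R]_n)| ^+ p)%:E)%E by rewrite lee_fin exprn_ge0.
transitivity (\int[distribution P (X i)]_x (`|dot u (x : 'rV[R]_n)| ^+ p)%:E)%E; last first.
  by apply: eq_measure_integral => A mA _; exact: hlaw.
rewrite (ge0_integral_distribution (X i) mf f0).
by apply: eq_integral => w _ /=; rewrite dotC.
Qed.

Lemma tail_ell (p : nat) (al : R) : 0 < al ->
  let B := ('I_p.+1 * 'I_(2 * n))%type in
  exists2 A : set T, measurable A /\ ((1 - N%:R / al ^+ p.+1)%:E <= P A)%E &
  forall w, A w -> mean (fun e : signs ('I_n * B) => hK (fun i => X i w) (gv R e)) <=
    al * (expR 97 * Num.sqrt p.+1%:R * Num.sqrt (n + p.+1)%:R * (1 + ln p.+1%:R) ^+ 2 + 1).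
Proof.
move=> al0 B.
have I0 := card_signs_gt0 ('I_n * B)%type.
have r0 : (0 < 2 * n)%N by [].
(* Adding 1 keeps the normalizing factors positive, since [hp] may vanish at some [gv R e]. *)
pose b (e : signs ('I_n * B)) : R := hp mu p.+1 (gv R e) + 1.
have b0 e : 0 < b e by rewrite ltr_wpDl// hp_ge0.
have mb : mean b <= expR 97 * Num.sqrt p.+1%:R * Num.sqrt (n + p.+1)%:R * (1 + ln p.+1%:R) ^+ 2 + 1.
  rewrite meanD mean_cst// lerD2r; exact: (mean_hp_gv hiso hlc (ltn0Sn p) r0 (ltn0Sn n')).
pose f (e : signs ('I_n * B)) i w := `|dot (X i w) (gv R e)|.
have fb e i : (\int[P]_w (f e i w ^+ p.+1)%:E <= (b e ^+ p.+1)%:E)%E.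
  rewrite /f /b (integral_law i (gv R e) (ltn0Sn p)) lee_fin.
  have := hp_ge0 mu p.+1 (gv R e); move: (hp _ _ _) => h h0.
  by rewrite lerXn2r ?nnegrE ?addr_ge0// lerDl.
have [A mA hA] := tail_mean_max I0 b0 al0 (fun e i => abs_dot_measurable i (gv R e))
  (fun e i w => normr_ge0 _) fb.
exists A => // w Aw; apply: (le_trans (hA w Aw)).
by rewrite ler_pM2l.
Qed.

End Tail.

(** * Choice of the moment order and of the constants *)

Theorem theorem1p4 (R : realType) (s : R) (hs : 1 <= s) :
  exists c : R, 0 < c /\
  forall (n N : nat)
    (nu : nat -> probability (subspaces R n) R)
    (hnu : forall k, (1 <= k <= n)%N -> haar_grassmannian k (nu k))
    (mu : probability (borel_rV R n) R)
    (hlc : log_concave mu) (hiso : isotropic mu)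
    (d : measure_display) (T : measurableType d) (P : probability T R)
    (X : 'I_N -> {RV P >-> borel_rV R n})
    (hindep : independent_RVs X)
    (hlaw : forall i, has_law (X i) mu)
    (hN : expR (Num.sqrt n%:R) <= (N%:R : R) <= expR n%:R),
  let K (w : T) : set 'rV[R]_n := symmetric_polytope (fun i => X i w) in
  let E : set T := [set w | forall k, (1 <= k < n)%N ->
    (quermassintegral k (nu k) (K w) <=
     (c * Num.sqrt (ln N%:R) * ln (ln N%:R) ^+ 2)%:E)%E] in
  measurable E /\ ((1 - N%:R `^ (- s))%:E < P E)%E.
Proof.
(* The factor [exp (s + 2)] is the tail level; 2 absorbs an additive 1; 3 comes from
   [(p + 1) (n + p + 1) <= 9 n ln N]; and 64 is the square of the 8 in [ln_scale]. *)
pose c0 := quermass_cst R * (expR (s + 2) * (2 * expR 97 * 3 * 64)).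
have c0_gt0 : 0 < c0.
  apply: (mulr_gt0 (quermass_cst_gt0 R)); apply: (mulr_gt0 (expR_gt0 _)).
  have e0 := expR_gt0 (97 : R); move: (expR 97) e0 => e e0; lra.
exists c0; split=> // n N nu hnu mu hlc hiso d T P X hindep hlaw /andP[hN1 hN2].
have N0 : 0 < N%:R :> R by apply: lt_le_trans hN1; exact: expR_gt0.
have N0' : (0 < N)%N by rewrite ltr0n in N0.
(* For [n <= 1] no [k] satisfies [1 <= k < n], so the event is the whole space. The logarithmic
   bounds below need [n >= 2]. *)
have [n1|n1] := leqP n 1.
  move=> K E; have -> : E = setT.
    rewrite -subTset => w _ k /andP[k1 kn].
    by have := leq_trans (leq_ltn_trans k1 kn) n1.
  split=> //; have -> : P setT = 1%E by exact: probability_setT.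
  by rewrite lte_fin ltrBlDr ltrDl powR_gt0.
case: n n1 nu hnu mu hlc hiso X hindep hlaw hN1 hN2 => // n' n1 nu hnu mu hlc hiso X hindep hlaw hN1 hN2 K E.
set L := ln N%:R in E *.
have NL : N%:R = expR L by rewrite /L lnK// posrE.
have Lb : Num.sqrt n'.+1%:R <= L <= n'.+1%:R.
  by move: hN1 hN2; rewrite NL !ler_expR => -> ->.
have [p [Lp pn p2L y0 lnp]] := ln_scale n1 Lb.
have sn : 0 < Num.sqrt n'.+1%:R :> R by rewrite sqrtr_gt0 ltr0n.
have L0 : 0 < L by apply: lt_le_trans (andP Lb).1; exact: sn.
have mE : measurable E.
  have -> : E = \bigcap_(k in [set k | (1 <= k < n'.+1)%N])
      [set w | (quermassintegral k (nu k) (K w) <= (c0 * Num.sqrt L * ln L ^+ 2)%:E)%E] by [].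
  apply: bigcap_measurable => [|k /andP[k1 kn]]; first by exists 1%N; rewrite /= n1.
  exact: quermass_measurable.
split=> //.
have [A [mA PA] hA] := tail_ell hlc hiso hlaw p (expR_gt0 (s + 2)).
have AE : A `<=` E.
  move=> w Aw k /andP[k1 kn].
  move: (hA w Aw); set B0 := (X in expR (s + 2) * X) => hl.
  have sp : 1 <= Num.sqrt p.+1%:R :> R by rewrite -[leLHS]sqrtr1 ler_sqrt ?ler0n// ler1n.
  have snp : 1 <= Num.sqrt (n'.+1 + p.+1)%:R :> R by rewrite -[leLHS]sqrtr1 ler_sqrt ?ler0n// ler1n addSn.
  have l1 : 1 <= 1 + ln p.+1%:R :> R by rewrite lerDl ln_ge0// ler1n.
  have e97 : 1 <= expR 97 :> R by rewrite -[leLHS]expR0 ler_expR ler0n.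
  have B0le : B0 <= 2 * (expR 97 * Num.sqrt p.+1%:R * Num.sqrt (n'.+1 + p.+1)%:R * (1 + ln p.+1%:R) ^+ 2).
    rewrite mulr_natl mulr2n lerD2l.
    apply: mulr_ege1; last exact: exprn_ege1.
    by apply: mulr_ege1 => //; exact: mulr_ege1.
  have B00 : 0 < B0.
    have q0 : 0 <= expR 97 * Num.sqrt p.+1%:R * Num.sqrt (n'.+1 + p.+1)%:R * (1 + ln p.+1%:R) ^+ 2 :> R.
      exact: (mulr_ge0 (mulr_ge0 (mulr_ge0 (expR_ge0 _) (sqrtr_ge0 _)) (sqrtr_ge0 _)) (sqr_ge0 _)).
    by rewrite /B0; move: q0; lra.
  have a0 := expR_gt0 (s + 2).
  have cardB : (2 * n'.+1 <= #|{: 'I_p.+1 * 'I_(2 * n'.+1)}|)%N by rewrite card_prod !card_ord leq_pmull.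
  have h1 : haar_grassmannian 1 (nu 1%N) by apply: hnu.
  have hk : haar_grassmannian k (nu k) by apply: hnu; rewrite k1 ltnW.
  apply: (le_trans (quermass_le h1 cardB hk k1 (mulr_gt0 a0 B00) hl)).
  rewrite lee_fin ler_pdivrMr//; clear hl; clearbody B0.
  suff : B0 <= 2 * expR 97 * 3 * 64 * (Num.sqrt L * Num.sqrt n'.+1%:R * ln L ^+ 2).
    move: (quermass_cst_gt0 R) a0; rewrite /c0.
    move: (quermass_cst R) (expR (s + 2)) (expR 97) (Num.sqrt L) (Num.sqrt n'.+1%:R) (ln L ^+ 2).
    move=> q al e x y z q0 al0 key.
    rewrite (_ : q * (al * (2 * e * 3 * 64)) * x * z * y = q * (al * (2 * e * 3 * 64 * (x * y * z)))); last by ring.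
    by rewrite -?mulrA; move: (ler_wpM2l (ltW q0) (ler_wpM2l (ltW al0) key)); rewrite -?mulrA.
  apply: (le_trans B0le); clear B0le B00.
  have hp : Num.sqrt p.+1%:R * Num.sqrt (n'.+1 + p.+1)%:R <= 3 * (Num.sqrt L * Num.sqrt n'.+1%:R) :> R.
    rewrite -(@ler_sqr R) ?nnegrE ?mulr_ge0 ?sqrtr_ge0 ?ler0n// !exprMn !sqr_sqrtr ?ler0n ?(ltW L0)//.
    have np : (n'.+1 + p.+1)%:R <= 3 * n'.+1%:R :> R.
      by rewrite -natrM ler_nat mulSn leq_add2l mul2n -addnn (leq_trans (_ : p < n'.+2)%N)// addSn ltnS leq_addl.
    apply: (le_trans (ler_pM _ _ p2L np)); rewrite ?ler0n//.
    have nn : 0 <= n'.+1%:R :> R by rewrite ler0n.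
    by move: (n'.+1%:R : R) nn L0 => m m0 L00; nra.
  have hy : (1 + ln p.+1%:R) ^+ 2 <= 64 * ln L ^+ 2.
    rewrite (_ : 64 = 8 ^+ 2 :> R); last by rewrite -natrX.
    by rewrite -exprMn lerXn2r ?nnegrE ?mulr_ge0 ?(ltW y0) ?ler0n//; exact: le_trans l1.
  have := ler_pM (mulr_ge0 (sqrtr_ge0 _) (sqrtr_ge0 _)) (sqr_ge0 _) hp hy.
  have e0 := expR_gt0 (97 : R); clear -e0.
  move: (expR 97) e0 (Num.sqrt p.+1%:R) (Num.sqrt (n'.+1 + p.+1)%:R) ((1 + ln p.+1%:R) ^+ 2) (Num.sqrt L) (Num.sqrt n'.+1%:R) (ln L ^+ 2).
  move=> e e0 x1 x2 x3 x4 x5 x6 h; have := ler_wpM2l (ltW e0) h => h2.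
  rewrite (_ : 2 * (e * x1 * x2 * x3) = 2 * (e * (x1 * x2 * x3))); last by ring.
  rewrite (_ : 2 * e * 3 * 64 * (x4 * x5 * x6) = 2 * (e * (3 * (x4 * x5) * (64 * x6)))); last by ring.
  by move: h2; lra.
apply: (@lt_le_trans _ _ (P A)); last by apply: le_measure => //; rewrite inE.
apply: lt_le_trans PA; rewrite lte_fin ltrD2l ltrN2.
(* Since [p + 1 >= ln N], the failure probability [N exp(- (s + 2) (p + 1))] is at most
   [N^(- s - 1)], strictly less than [N^(- s)] as [ln N > 0]. *)
rewrite -expRM_natr /powR gt_eqF// -/L NL -expRN -expRD ltr_expR.
have s2 : 0 < s + 2 by move: hs; lra.
have := ler_wpM2l (ltW s2) Lp; move: L0; lra.
Qed.
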